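(* Let $K_n(t,r(x,y))$ be the heat kernel of the hyperbolic space $\mathbb{H}^n$ and $\kappa_n(t,r(x,y))$ the heat kernel of the unit sphere $\mathbb{S}^n$, where $r(x,y)$ denotes geodesic distance. For $m=1,2,\dots$ set $$c_{m,k}=\begin{cases}1,&k=0,\\ \displaystyle\sum_{1\le i_1<i_2<\cdots<i_k\le m-1} i_1^2i_2^2\cdots i_k^2,&1\le k\le m-1,\\ 0,&k\ge m.\end{cases}$$ Then for every $m=1,2,\dots$: (1) For all $t>0$, $$K_{2m+1}(t,0)=(4\pi t)^{-\frac{2m+1}{2}}e^{-m^2t}\sum_{k=0}^{m-1}\frac{\Gamma(m-k+\frac12)\,c_{m,k}}{\Gamma(m+\frac12)}\,t^k .$$ (2) As $t\to0^+$, $$\begin{aligned}\kappa_{2m+1}(t,0)\sim\;&(4\pi t)^{-\frac{2m+1}{2}}e^{m^2t}\sum_{k=0}^{m-1}(-1)^k\frac{\Gamma(m-k+\frac12)\,c_{m,k}}{\Gamma(m+\frac12)}\,t^k\\ =\;&\frac{1}{\mathrm{Vol}(\mathbb{S}^{2m+1})}\,t^{-\frac{2m+1}{2}}\sum_{k=0}^\infty a_{2m+1,k}\,t^k,\end{aligned}$$ where $$a_{2m+1,k}=\sum_{l=0}^k(-1)^l\,\frac{m^{2k-2l}\,\Gamma\left(m-l+\frac12\right)c_{m,l}}{(2m)!\,(k-l)!},\qquad k=0,1,2,\dots,$$ are the heat trace coefficients of $\mathbb{S}^{2m+1}$.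
   Context: $\mathbb{H}^n$ is the simply connected complete $n$-dimensional space of constant curvature $-1$, and $\mathbb{S}^n$ is the unit $n$-sphere with its round metric of curvature $1$. Heat kernels are the (minimal) fundamental solutions of $\partial_t u=\Delta u$, with $\Delta$ the (nonpositive) Laplace–Beltrami operator, with respect to the Riemannian volume; on these spaces they depend only on $t$ and the distance $r$, so $K_n(t,0)$ and $\kappa_n(t,0)$ are their values on the diagonal. The relation $f(t)\sim g(t)$ as $t\to0^+$ is in the sense of asymptotic expansions, i.e. $f(t)-g(t)=O(t^N)$ for every $N$. The heat trace coefficients $a_{n,k}$ of $\mathbb{S}^n$ are the coefficients in the asymptotic expansion of the heat trace $\mathrm{Vol}(\mathbb{S}^n)\,\kappa_n(t,0)\sim t^{-n/2}\sum_{k\ge0}a_{n,k}t^k$ as $t\to0^+$. *)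

(* Defs.v *)
From HB Require Import structures.
From mathcomp Require Import all_boot all_order all_algebra.
From mathcomp Require Import all_classical all_reals all_analysis.
Set Implicit Arguments.
Unset Strict Implicit.
Unset Printing Implicit Defensive.
Import Order.TTheory GRing.Theory Num.Theory.
Import numFieldNormedType.Exports.

Local Open Scope classical_set_scope.
Local Open Scope ring_scope.

(* n-dimensional Lebesgue measure on n.-tuple R, as the n-fold product of the
   one-dimensional one. *)
Section LebesgueTuple.
Context (R : realType).
Local Notation T n := (n.-tuple (measurableTypeR R)).

Definition tuple_cons n (p : measurableTypeR R * T n) : T n.+1 :=
  [tuple of p.1 :: p.2].

Definition tuple_uncons n (v : T n.+1) : measurableTypeR R * T n :=
  (thead v, [tuple of behead v]).

Lemma tuple_consK n : cancel (@tuple_cons n) (@tuple_uncons n).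
Proof.
by case=> a v; congr pair; apply: val_inj.
Qed.

Lemma tuple_unconsK n : cancel (@tuple_uncons n) (@tuple_cons n).
Proof. by move=> v; rewrite [RHS]tuple_eta; apply: val_inj. Qed.

Lemma measurable_tuple_cons n : measurable_fun [set: _] (@tuple_cons n).
Proof. exact: (measurable_cons measurable_fst measurable_snd). Qed.

Lemma measurable_tuple_uncons n : measurable_fun [set: _] (@tuple_uncons n).
Proof.
apply/measurable_fun_pairP; split; first exact: measurable_tnth.
exact: measurable_behead.
Qed.

Section Step.
Context n (mu : {sigma_finite_measure set (T n) -> \bar R}).

Definition lebesgue_cons : set (T n.+1) -> \bar R :=
  pushforward (@lebesgue_measure R \x mu)%E (@tuple_cons n).

Let pf : {measure set (T n.+1) -> \bar R} :=
  measure_function_pushforward__canonical__measure_function_Measure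
    (@lebesgue_measure R \x mu)%E (@measurable_tuple_cons n).

HB.instance Definition _ := isMeasure.Build _ _ _ lebesgue_cons
  (measure0 pf) (measure_ge0 pf) (@measure_semi_sigma_additive _ _ _ pf).

Let lebesgue_cons_sigma_finite : sigma_finite setT lebesgue_cons.
Proof.
have /sigma_finiteP[F [FT ndF Foo]] := sigma_finiteT (@lebesgue_measure R).
have /sigma_finiteP[G [GT ndG Goo]] := sigma_finiteT mu.
exists (fun i => @tuple_uncons n @^-1` (F i `*` G i)).
  rewrite -preimage_bigcup -[LHS](preimage_setT (@tuple_uncons n)).
  congr (_ @^-1` _); apply/esym; rewrite predeqE => -[x y]; split => // _.
  have [k _ Fx] : (\bigcup_k F k) x by rewrite -FT.
  have [l _ Gy] : (\bigcup_l G l) y by rewrite -GT.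
  exists (maxn k l) => //; split.
  - by move: x Fx; exact/subsetPset/ndF/leq_maxl.
  - by move: y Gy; exact/subsetPset/ndG/leq_maxr.
move=> i; have [mF Fi] := Foo i; have [mG Gi] := Goo i; split.
  rewrite -[X in measurable X]setTI.
  by apply: measurable_tuple_uncons => //; exact: measurableX.
rewrite /lebesgue_cons /pushforward -comp_preimage.
rewrite (_ : _ \o _ = id); last by apply/funext => p /=; exact: tuple_consK.
by rewrite preimage_id product_measure1E// lte_mul_pinfty// ge0_fin_numE.
Qed.

HB.instance Definition _ := Measure_isSigmaFinite.Build _ _ _ lebesgue_cons
  lebesgue_cons_sigma_finite.

End Step.

Fixpoint lebesgue_tuple n : {sigma_finite_measure set (T n) -> \bar R} :=
  match n return {sigma_finite_measure set (T n) -> \bar R} with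
  | 0 => \d_([tuple] : T 0)
  | k.+1 => lebesgue_cons (lebesgue_tuple k)
  end.

End LebesgueTuple.

Section Geometry.
Context (R : realType).

Definition partial n (i : 'I_n) (V : normedModType R) (f : 'rV[R]_n -> V) :
  'rV[R]_n -> V := fun x => 'D_(delta_mx 0 i) f x.

(* An n-dimensional manifold inside R^N whose Riemannian metric is the
   restriction of a constant symmetric bilinear form of R^N; [chart i] ranges
   over global parametrizations R^n -> M whose images cover M.  The image of
   [main_chart] must have a null complement: it is the one used to integrate. *)
Record embedded (N n : nat) := Embedded {
  carrier : set 'rV[R]_N;
  form : 'M[R]_N;
  chart_index : Type;
  chart : chart_index -> 'rV[R]_n -> 'rV[R]_N;
  main_chart : chart_index }.

Section Riemannian.
Context (N n : nat) (M : embedded N n).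

Definition pairing (v w : 'rV[R]_N) : R := (v *m form M *m w^T) 0 0.

Definition metric (c : chart_index M) (x : 'rV[R]_n) : 'M[R]_n :=
  \matrix_(i, j) pairing (partial i (chart c) x) (partial j (chart c) x).

Definition density (c : chart_index M) (x : 'rV[R]_n) : R :=
  Num.sqrt (\det (metric c x)).

Definition laplace_beltrami (c : chart_index M) (u : 'rV[R]_n -> R)
    (x : 'rV[R]_n) : R :=
  (density c x)^-1 * \sum_i partial i (fun y =>
    density c y * \sum_j (invmx (metric c y)) i j * partial j u y) x.

Definition volume_integral (f : 'rV[R]_N -> R) : R :=
  \int[lebesgue_tuple R n]_v
    (let x := \row_i tnth v i in
     f (chart (main_chart M) x) * density (main_chart M) x).

Definition volume : R := volume_integral (fun=> 1).

Definition C1_curve (x y : 'rV[R]_N) (g : R -> 'rV[R]_N) : Prop :=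
  [/\ g 0 = x, g 1 = y, (forall s, 0 <= s <= 1 -> carrier M (g s)),
      (forall s, derivable g s 1) & continuous (derive1 g)].

Definition curve_length (g : R -> 'rV[R]_N) : R :=
  \int[lebesgue_measure]_(s in `[0, 1])
    Num.sqrt (pairing (derive1 g s) (derive1 g s)).

Definition geodesic_distance (x y : 'rV[R]_N) : R :=
  inf [set curve_length g | g in C1_curve x y].

(* C^1 in time and C^2 in space on ]0, +oo[ x R^n, all the derivatives
   involved being jointly continuous. *)
Definition C12 (u : R -> 'rV[R]_n -> R) : Prop :=
  forall t x, 0 < t ->
  [/\ derivable (fun s => u s x) t 1,
      (forall i, derivable (u t) x (delta_mx 0 i)),
      (forall i j, derivable (partial j (u t)) x (delta_mx 0 i)),
      {for (t, x), continuous (fun z : R * 'rV[R]_n => u z.1 z.2)} &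
      [/\ {for (t, x), continuous
             (fun z : R * 'rV[R]_n => derive1 (fun s => u s z.2) z.1)},
          (forall i, {for (t, x), continuous
             (fun z : R * 'rV[R]_n => partial i (u z.1) z.2)}) &
          (forall i j, {for (t, x), continuous
             (fun z : R * 'rV[R]_n => partial i (partial j (u z.1)) z.2)})]].

Definition test_function (f : 'rV[R]_N -> R) : Prop :=
  {within carrier M, continuous f} /\
  exists C : set 'rV[R]_N, [/\ compact C, C `<=` carrier M &
    forall x, carrier M x -> ~ C x -> f x = 0].

(* Nonnegative classical solutions of the heat equation on ]0, +oo[ x M whose
   initial value is the Dirac mass at y. *)
Definition fundamental_solution (y : 'rV[R]_N) (q : R -> 'rV[R]_N -> R) : Prop :=
  [/\ (forall t x, 0 < t -> carrier M x -> 0 <= q t x),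
      (forall c : chart_index M, C12 (fun t x => q t (chart c x))),
      (forall c t x, 0 < t ->
         derive1 (fun s => q s (chart c x)) t =
         laplace_beltrami c (fun x' => q t (chart c x')) x) &
      (forall f, test_function f ->
         (fun t => volume_integral (fun x => q t x * f x)) @ 0^'+ --> f y)].

(* The minimal fundamental solution. *)
Definition heat_kernel (p : R -> 'rV[R]_N -> 'rV[R]_N -> R) : Prop :=
  forall y, carrier M y ->
    fundamental_solution y (fun t x => p t x y) /\
    forall q, fundamental_solution y q ->
      forall t x, 0 < t -> carrier M x -> p t x y <= q t x.

Definition radial_heat_kernel (k : R -> R -> R) : Prop :=
  heat_kernel (fun t x y => k t (geodesic_distance x y)).

End Riemannian.

Section Models.
Context (n : nat).

Definition sqnorm (x : 'rV[R]_n) : R := \sum_i x 0 i ^+ 2.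

(* Hyperboloid model: the sheet x_0 > 0 of <x, x> = -1 in Minkowski space
   R^{1,n}, parametrized as a graph over R^n. *)
Definition minkowski : 'M[R]_(1 + n) := block_mx (- 1%:M) 0 0 1%:M.

Definition hyperboloid_chart (x : 'rV[R]_n) : 'rV[R]_(1 + n) :=
  row_mx (Num.sqrt (1 + sqnorm x))%:M x.

Definition hyperbolic_space : embedded (1 + n) n := {|
  carrier := [set x | (x *m minkowski *m x^T) 0 0 = -1 /\ 0 < x 0 0];
  form := minkowski;
  chart := fun _ : unit => hyperboloid_chart;
  main_chart := tt |}.

(* Unit sphere of Euclidean R^(1 + n), with the inverse stereographic
   projections from (-1, 0) ([b = false]) and from (1, 0) ([b = true]); each of
   them misses a single point of the sphere. *)
Definition stereographic_chart (b : bool) (x : 'rV[R]_n) : 'rV[R]_(1 + n) :=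
  (1 + sqnorm x)^-1 *: row_mx ((-1) ^+ b * (1 - sqnorm x))%:M (2 *: x).

Definition sphere : embedded (1 + n) n := {|
  carrier := [set x | (x *m x^T) 0 0 = 1];
  form := 1%:M;
  chart := stereographic_chart;
  main_chart := false |}.

End Models.

End Geometry.

Section Coefficients.
Context (R : realType).

(* Euler's integral; it is the Gamma function for x > 0 only. *)
Definition Gamma (x : R) : R :=
  \int[lebesgue_measure]_(s in `]0, +oo[) (s `^ (x - 1) * expR (- s)).

(* The increasing tuples i_1 < ... < i_k in {1, ..., m - 1} are encoded as
   the k-element sets A of elements of 'I_m that do not contain 0. *)
Definition c_coef (m k : nat) : R :=
  if (k == 0)%N then 1
  else if (k <= m - 1)%N then
    \sum_(A : {set 'I_m} | (#|A| == k) && [forall i in A, (0 < i)%N])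
      \prod_(i in A) (nat_of_ord i)%:R ^+ 2
  else 0.

(* For l >= m the argument of Gamma may be negative, where the integral above
   is not the Gamma function, but then c_coef m l = 0. *)
Definition a_coef (m k : nat) : R :=
  \sum_(0 <= l < k.+1)
    (-1) ^+ l * (m%:R ^+ (2 * k - 2 * l) * Gamma (m%:R - l%:R + 2^-1) * c_coef m l)
    / ((2 * m)`!%:R * (k - l)`!%:R).

(* Equality of asymptotic expansions as t -> 0+. *)
Definition asymp_eq (f g : R -> R) : Prop :=
  forall N : nat, (fun t => f t - g t) =O_ (0^'+) (fun t => t ^+ N).

(* a is the sequence of coefficients in Tr ~ t^(- n / 2) \sum_k a_k t^k. *)
Definition heat_trace_expansion (n : nat) (Tr : R -> R) (a : nat -> R) : Prop :=
  forall N : nat,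
    (fun t => Tr t - t `^ (- (n%:R / 2)) * \sum_(0 <= k < N) a k * t ^+ k)
      =O_ (0^'+) (fun t => t `^ (N%:R - n%:R / 2)).

Definition is_heat_trace_coefficients (N n : nat) (M : embedded R N n)
    (k : R -> R -> R) (a : nat -> R) : Prop :=
  heat_trace_expansion n (fun t => volume M * k t 0) a.

End Coefficients.

(* Main.v *)
(** Only radial solutions of the heat equation issued from one point matter, so
    everything happens on a half line, and the two spaces are treated separately.

    Hyperbolic space.  Put [s = cosh r].  If [v_0 = t^(-1/2) exp (- r^2 / 4t)], a
    solution of the heat equation on the line up to a factor, then
    [v_m = (- d/ds)^m v_0] multiplied by [exp (- m^2 t)] solves the heat equation in
    dimension [2m + 1].  Up to a constant it is a fundamental solution [p]: integrate
    by parts [m] times against a function of [s].  The minimal solution [K] satisfies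
    [K <= p]; as [p - K] is nonnegative with vanishing initial value, testing it with
    the cutoffs [(1 - s/S)^3], whose Laplacian is [O(s^2 / S^2)], shows [K = p].  On
    the diagonal [s = 1] the equation gives [(2k + 1) v_(k+1) = (k^2 - d/dt) v_k], so
    the coefficients are those of [prod_(i < m) (X + i^2)].

    Sphere.  The derivatives [P_q = T_q^(m)] of the Chebyshev polynomials are zonal
    eigenfunctions of the Laplacian, with eigenvalues [m^2 - q^2], so the moments of
    the kernel against them are explicit; testing with [(1 + cos r)^N], which
    concentrates at the pole, recovers the diagonal value as the series
    [exp (m^2 t) sum_q prod_(i < m) (q^2 - i^2) exp (- q^2 t)] up to a constant.  The
    sums of [q^(2p) exp (- q^2 t)] are lattice sums of a Schwartz function, which differ
    from the integral by [O(t^N)] for every [N]. *)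
Require Import Defs.
From HB Require Import structures.
From mathcomp Require Import all_boot all_order all_algebra.
From mathcomp Require Import all_classical all_reals all_analysis.
From mathcomp Require Import measurable_realfun ring lra zify.
Set Implicit Arguments.
Unset Strict Implicit.
Unset Printing Implicit Defensive.
Import Order.TTheory GRing.Theory Num.Theory.
Import numFieldNormedType.Exports.
Local Open Scope classical_set_scope.
Local Open Scope ring_scope.

(** * Calculus on the real line *)

(** The geodesic distance is an infimum over curves and is never evaluated off the diagonal.
    Reflections fixing the base point show that it depends only on the norm of the chart variable,
    so a kernel is known through its restriction to one coordinate axis, in variables where nothing
    is singular at the origin: [s = sqrt (1 + r^2)] with [r = sinh d] on the hyperboloid, the
    stereographic radius on the sphere. The obstacle at [s = 1], where [arccosh] is not smooth, is
    removed by writing [arccosh s / sinh (arccosh s)] as the integral of a rational function.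

    The initial condition is weak, so both halves rest on Green's formula in time. On the
    hyperboloid the cutoff error is controlled by second moments of [cosh d] that are bounded
    uniformly in the radius. On the sphere the two stereographic charts are cut along the equator
    [r = 1], where the boundary terms cancel because [r -> 1/r] exchanges the charts.

    The factors [Gamma (j + 1/2)] have a single source, the moments of the Gaussian, which also fix
    the area of the Euclidean sphere and hence every normalisation. *)

Section DeriveRules.
Context (R : realType).
Implicit Types (f g : R -> R) (x c df dg : R).

Lemma isd_eq f x (df dg : R) : is_derive x 1 f df -> df = dg -> is_derive x 1 f dg.
Proof. by move=> ? <-. Qed.

Lemma isd_cst c x : is_derive x 1 (fun=> c) 0.
Proof. exact: is_derive_cst. Qed.

Lemma isd_id x : is_derive x 1 (fun y => y) (1 : R).
Proof. exact: is_derive_id. Qed.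

Lemma isdD f g x df dg : is_derive x 1 f df -> is_derive x 1 g dg ->
  is_derive x 1 (fun y => f y + g y) (df + dg).
Proof. by move=> ? ?; exact: is_deriveD. Qed.

Lemma isdN f x df : is_derive x 1 f df -> is_derive x 1 (fun y => - f y) (- df).
Proof. by move=> ?; exact: is_deriveN. Qed.

Lemma isdM f g x df dg : is_derive x 1 f df -> is_derive x 1 g dg ->
  is_derive x 1 (fun y => f y * g y) (f x * dg + g x * df).
Proof. by move=> ? ?; exact: is_deriveM. Qed.

Lemma isd_addl c x : is_derive x 1 ( +%R c) 1.
Proof. by apply: isd_eq (isdD (isd_cst c x) (isd_id x)) _; rewrite add0r. Qed.

Lemma isd_mull c x : is_derive x 1 ( *%R c) c.
Proof. by apply: isd_eq (isdM (isd_cst c x) (isd_id x)) _; rewrite mulr1 mulr0 addr0. Qed.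

Lemma isdX f n x df : is_derive x 1 f df ->
  is_derive x 1 (fun y => f y ^+ n) (n%:R * f x ^+ n.-1 * df).
Proof.
move=> Df; elim: n => [|n IH]; first by rewrite !mul0r; exact: isd_cst.
rewrite (_ : (fun y => _) = fun y => f y * f y ^+ n); last first.
  by apply/funext => y; rewrite exprS.
apply: isd_eq (isdM Df IH) _; case: n {IH} => [|n]; rewrite /= ?expr0 ?exprS.
  by ring.
by rewrite -!natr1; ring.
Qed.

Lemma isd_comp f g x (df dg : R) : is_derive x 1 f df ->
  is_derive (f x) 1 g dg -> is_derive x 1 (fun y => g (f y)) (dg * df).
Proof. by move=> ? ?; exact: is_derive1_comp. Qed.

Lemma isdV f x (df : R) : f x != 0 -> is_derive x 1 f df ->
  is_derive x 1 (fun y => (f y)^-1) (- df / f x ^+ 2).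
Proof.
move=> fx0 Df; apply: isd_eq (is_deriveV fx0 Df) _.
by rewrite /GRing.scale/=; ring.
Qed.

Lemma isd_exp f x (df : R) : is_derive x 1 f df ->
  is_derive x 1 (fun y => expR (f y)) (expR (f x) * df).
Proof. by move=> Df; apply: isd_comp Df (is_derive_expR _). Qed.

Lemma isd_ln f x (df : R) : 0 < f x -> is_derive x 1 f df ->
  is_derive x 1 (fun y => ln (f y)) (df / f x).
Proof.
move=> f0 Df; apply: isd_eq (isd_comp Df (is_derive1_ln f0)) _; exact: mulrC.
Qed.

Lemma isd_sqrt f x (df : R) : 0 < f x -> is_derive x 1 f df ->
  is_derive x 1 (fun y => Num.sqrt (f y)) (df / (2 * Num.sqrt (f x))).
Proof.
move=> f0 Df; apply: isd_eq (isd_comp Df (is_derive1_sqrt f0)) _; exact: mulrC.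
Qed.

Lemma isd_sum (I : Type) (r : seq I) (P : pred I) (F : I -> R -> R) (dF : I -> R) x :
  (forall i, P i -> is_derive x 1 (F i) (dF i)) ->
  is_derive x 1 (fun y => \sum_(i <- r | P i) F i y) (\sum_(i <- r | P i) dF i).
Proof.
move=> DF; elim: r => [|i r IH].
  rewrite big_nil (_ : (fun _ => _) = fun=> 0); first exact: isd_cst.
  by apply/funext => y; rewrite big_nil.
rewrite big_cons (_ : (fun y => _) = fun y => if P i then F i y + \sum_(j <- r | P j) F j y
   else \sum_(j <- r | P j) F j y); last by apply/funext => y; rewrite big_cons.
by case: ifPn => // /DF DFi; exact: isdD.
Qed.

End DeriveRules.

(** Hypotheses are tried first, so a derivative put in the context acts as a new rule. [isd_tac]
    leaves the side conditions of inverses, logarithms and square roots, then the equation between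
    the derivative found and the announced one. *)
Ltac isd_step :=
  match goal with
  | H : is_derive ?x ?v ?f _ |- is_derive ?x ?v ?f _ => exact H
  | |- is_derive _ _ (fun _ => ?c) _ => apply: isd_cst
  | |- is_derive _ _ (fun y => y) _ => apply: isd_id
  | |- is_derive _ _ (fun y => _ + _) _ => eapply isdD
  | |- is_derive _ _ (fun y => - _) _ => eapply isdN
  | |- is_derive _ _ -%R _ => apply: (isdN (isd_id _))
  | |- is_derive _ _ (fun y => _ * _) _ => eapply isdM
  | |- is_derive _ _ ( *%R _) _ => apply: isd_mull
  | |- is_derive _ _ ( +%R _) _ => apply: isd_addl
  | |- is_derive _ _ (fun y => _ ^+ _) _ => eapply isdX
  | |- is_derive _ _ (fun y => _ ^-1) _ => eapply isdV
  | |- is_derive _ _ (fun y => expR _) _ => eapply isd_exp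
  | |- is_derive _ _ (fun y => ln _) _ => eapply isd_ln
  | |- is_derive _ _ (fun y => Num.sqrt _) _ => eapply isd_sqrt
  | |- is_derive _ _ (@Num.sqrt _) _ => eapply isd_sqrt; [ | apply: isd_id]
  | |- is_derive _ _ (@expR _) _ => eapply (isd_exp (isd_id _))
  end.

Ltac isd_tac := eapply isd_eq; [repeat isd_step | cbv beta].

Section ContinuityRules.
Context (R : realType) (T : topologicalType).
Implicit Types (f g : T -> R) (x : T) (c : R).
Local Notation C x f := {for x, continuous f}.

Lemma cont_cst c x : C x (fun=> c).
Proof. exact: cst_continuous. Qed.

Lemma contD f g x : C x f -> C x g -> C x (fun y => f y + g y).
Proof. exact: cvgD. Qed.

Lemma contN f x : C x f -> C x (fun y => - f y).
Proof. exact: cvgN. Qed.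

Lemma contM f g x : C x f -> C x g -> C x (fun y => f y * g y).
Proof. exact: cvgM. Qed.

Lemma cont_comp f (h : R -> R) x : C x f -> C (f x) h -> C x (fun y => h (f y)).
Proof. by move=> cf ch; apply: continuous_comp. Qed.

Lemma cont_mull c (x : R) : {for x, continuous ( *%R c)}.
Proof. exact: mulrl_continuous. Qed.

Lemma cont_addl c (x : R) : {for x, continuous ( +%R c)}.
Proof. by apply: (@cvgD _ _ _ _ _ (cst c) id); [exact: cvg_cst|exact: cvg_id]. Qed.

Lemma contX f n x : C x f -> C x (fun y => f y ^+ n).
Proof. by move=> cf; apply: cont_comp cf (@exprn_continuous _ _ _). Qed.

Lemma contV f x : f x != 0 -> C x f -> C x (fun y => (f y)^-1).
Proof. by move=> f0 cf; exact: cvgV. Qed.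

Lemma cont_exp f x : C x f -> C x (fun y => expR (f y)).
Proof. by move=> cf; apply: cont_comp cf _; exact: continuous_expR. Qed.

Lemma cont_sqrt f x : C x f -> C x (fun y => Num.sqrt (f y)).
Proof. by move=> cf; apply: cont_comp cf _; exact: sqrt_continuous. Qed.

Lemma cont_abs f x : C x f -> C x (fun y => `|f y|).
Proof. by move=> cf; apply: cont_comp cf _; exact: norm_continuous. Qed.

Lemma cont_sum (I : Type) (r : seq I) (P : pred I) (F : I -> T -> R) x :
  (forall i, P i -> C x (F i)) -> C x (fun y => \sum_(i <- r | P i) F i y).
Proof.
move=> cF; elim: r => [|i r IH].
  rewrite (_ : (fun _ => _) = fun=> 0); first exact: cont_cst.
  by apply/funext => y; rewrite big_nil.
rewrite (_ : (fun y => _) = fun y => if P i then F i y + \sum_(j <- r | P j) F j y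
   else \sum_(j <- r | P j) F j y); last by apply/funext => y; rewrite big_cons.
by case E : (P i) => //; apply: contD => //; exact: cF.
Qed.

End ContinuityRules.

Ltac cont_step :=
  match goal with
  | H : {for _, continuous ?f} |- {for _, continuous ?f} => exact H
  | H : continuous ?f |- {for _, continuous ?f} => exact: H
  | |- {for _, continuous (fun _ => ?c)} => apply: cont_cst
  | |- {for _, continuous (fun y => y)} => apply: cvg_id
  | |- {for _, continuous (fun y => fst y)} => apply: cvg_fst
  | |- {for _, continuous (fun y => snd y)} => apply: cvg_snd
  | |- {for _, continuous (fun y => _ + _)} => eapply contD
  | |- {for _, continuous (fun y => - _)} => eapply contN
  | |- {for _, continuous -%R} => apply: opp_continuous
  | |- {for _, continuous fst} => apply: cvg_fst
  | |- {for _, continuous snd} => apply: cvg_snd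
  | |- {for _, continuous (fun y => _ * _)} => eapply contM
  | |- {for _, continuous ( *%R _)} => apply: cont_mull
  | |- {for _, continuous ( +%R _)} => apply: cont_addl
  | |- {for _, continuous (fun y => _ ^+ _)} => eapply contX
  | |- {for _, continuous (fun y => _ ^-1)} => eapply contV
  | |- {for _, continuous (fun y => expR _)} => eapply cont_exp
  | |- {for _, continuous (fun y => Num.sqrt _)} => eapply cont_sqrt
  | |- {for _, continuous (fun y => `|_|)} => eapply cont_abs
  | |- {for _, continuous (@Num.sqrt _)} => apply: sqrt_continuous
  | |- {for _, continuous (@expR _)} => apply: continuous_expR
  | H : continuous ?h |- {for _, continuous (fun y => ?h _)} => eapply (cont_comp (h := h)); [ | exact: H]
  end.
Ltac cont_tac :=
  try match goal with
  | |- continuous_at ?x ?f => change ({for x, continuous f})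
  end; repeat cont_step.

Section Calculus.
Context (R : realType).
Implicit Types (f g F : R -> R) (a b c t x : R).

(** For [b < a] the segment is empty and the value is [0], not [- integ b a f]: this is why
    additivity asks for ordered bounds. *)
Definition integ a b f : R := \int[lebesgue_measure]_(x in `[a, b]) f x.

Lemma cont_integrable a b f : continuous f ->
  lebesgue_measure.-integrable `[a, b] (EFin \o f).
Proof.
move=> cf; apply: continuous_compact_integrable; first exact: segment_compact.
exact: continuous_subspaceT.
Qed.

Lemma eq_integ a b f g : (forall x, a <= x <= b -> f x = g x) ->
  integ a b f = integ a b g.
Proof.
by move=> fg; apply: eq_Rintegral => x; rewrite inE/= in_itv/= => /fg.
Qed.

Lemma integD a b f g : continuous f -> continuous g ->
  integ a b (fun x => f x + g x) = integ a b f + integ a b g.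
Proof. by move=> cf cg; apply: RintegralD => //; exact: cont_integrable. Qed.

Lemma integB a b f g : continuous f -> continuous g ->
  integ a b (fun x => f x - g x) = integ a b f - integ a b g.
Proof. by move=> cf cg; apply: RintegralB => //; exact: cont_integrable. Qed.

Lemma integZ a b c f : continuous f ->
  integ a b (fun x => c * f x) = c * integ a b f.
Proof. by move=> cf; apply: RintegralZl => //; exact: cont_integrable. Qed.

Lemma le_integ a b f g : continuous f -> continuous g ->
  (forall x, a <= x <= b -> f x <= g x) -> integ a b f <= integ a b g.
Proof.
move=> cf cg fg; by apply: le_Rintegral => //; exact: cont_integrable.
Qed.

Lemma integ_ge0 a b f : (forall x, a <= x <= b -> 0 <= f x) ->
  0 <= integ a b f.
Proof.
by move=> f0; apply: Rintegral_ge0 => x /=; rewrite in_itv/= => /f0.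
Qed.

Lemma le_norm_integ a b f : continuous f ->
  `|integ a b f| <= integ a b (fun x => `|f x|).
Proof. by move=> cf; apply: le_normr_Rintegral => //; exact: cont_integrable. Qed.

Lemma integ_cst a b c : a <= b -> integ a b (fun=> c) = c * (b - a).
Proof.
rewrite le_eqVlt => /predU1P[->|ab].
  by rewrite /integ set_itv1 Rintegral_set1 subrr mulr0.
by rewrite /integ Rintegral_cst//= lebesgue_measure_itv/= lte_fin ab -EFinD.
Qed.

Lemma integ_cat a b c f : continuous f -> a <= b -> b <= c ->
  integ a c f = integ a b f + integ b c f.
Proof.
move=> cf ab bc.
have := @Rintegral_itvB R f (BLeft a) (BRight c) b (cont_integrable _ _ cf).
rewrite !bnd_simp => /(_ ab bc) E; apply/eqP; rewrite -subr_eq0 opprD addrA.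
rewrite /integ E Rintegral_itv_obnd_cbnd ?subrr//.
by apply: integrableS (cont_integrable b c cf) => //;
  apply: subset_itvr; rewrite bnd_simp.
Qed.

Lemma integ_FTC a b f F : a <= b -> continuous f -> continuous F ->
  (forall x, a < x < b -> is_derive x 1 F (f x)) ->
  integ a b f = F b - F a.
Proof.
rewrite le_eqVlt => /predU1P[->|ab] cf cF dF.
  by rewrite /integ set_itv1 Rintegral_set1 subrr.
rewrite /integ /Rintegral (@continuous_FTC2 _ f F a b)//.
- exact: continuous_subspaceT.
- split.
  + by move=> x; rewrite in_itv/= => /dF[].
  + by apply: cvg_at_right_filter; exact: cF.
  + by apply: cvg_at_left_filter; exact: cF.
- by move=> x; rewrite in_itv/= => /dF; rewrite derive1E => -[_ ->].
Qed.

(** The derivative is two-sided, which forces [a < x]. A primitive needed up to the end of a segment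
    is therefore based further to the left. *)
Lemma integ_deriv a x f : a < x -> continuous f ->
  is_derive x 1 (fun y => integ a y f) (f x).
Proof.
move=> ax cf.
have xx1 : x < x + 1 by rewrite ltrDl.
have [d e] := continuous_FTC1_closed xx1 (cont_integrable a (x + 1) cf) ax (cf x).
by rewrite -e derive1E; apply: derivableP; exact: d.
Qed.

(** The primitive of [f] from [a] is squeezed between [0] and the total integral, so it vanishes
    identically, and so does its derivative. *)
Lemma integ_gt0_eq0 a b f : continuous f -> a < b ->
  (forall x, a <= x <= b -> 0 <= f x) -> integ a b f = 0 ->
  forall x, a < x < b -> f x = 0.
Proof.
move=> cf ab f0 if0 x /andP[ax xb].
have G0 y : a <= y -> y <= b -> integ a y f = 0.
  move=> ay yb; apply/eqP; rewrite eq_le; apply/andP; split.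
    rewrite -if0 (@integ_cat a y b)// lerDl integ_ge0// => z /andP[yz zb].
    by apply: f0; rewrite zb (le_trans ay).
  by apply: integ_ge0 => z /andP[az zy]; rewrite f0// az (le_trans zy).
have [_ <-] := integ_deriv ax cf.
rewrite (@near_eq_derive _ _ _ _ (cst 0)) ?derive_val//.
near=> y; apply: G0; apply/ltW; near: y.
- exact: lt_nbhsr.
- exact: lt_nbhsl.
Unshelve. all: by end_near. Qed.

Lemma continuous2_bounded (f : R -> R -> R) (c d a b : R) :
  (forall t x, c <= t <= d ->
    {for (t, x), continuous (fun z : R * R => f z.1 z.2)}) ->
  exists2 M : R, 0 <= M & forall t x, c <= t <= d -> a <= x <= b -> `|f t x| <= M.
Proof.
move=> cf; pose B := `[c, d]%classic `*` `[a, b]%classic.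
have cB : compact B by apply: compact_setX; exact: segment_compact.
have : compact ((fun z : R * R => f z.1 z.2) @` B).
  apply: (@continuous_compact (R * R)%type R) => //.
  by apply: continuous_in_subspaceT; apply/in_setP => -[t x] [/= + _];
    rewrite in_itv/=; exact: cf.
move=> /compact_bounded [M [_ MP]].
exists (`|M| + 1) => [|t x ct ax]; first by rewrite addr_ge0.
apply: (MP (`|M| + 1)); first by rewrite ltr_pwDr// ler_norm.
by exists (t, x) => //; split; rewrite /= in_itv.
Qed.

Lemma is_derive_under_integ (f df : R -> R -> R) (u v a b t : R) :
  u < t < v ->
  (forall s, u < s < v -> continuous (f s)) ->
  (forall s x, u < s < v -> is_derive s 1 (f ^~ x) (df s x)) ->
  (forall s x, u < s < v ->
    {for (s, x), continuous (fun z : R * R => df z.1 z.2)}) ->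
  is_derive t 1 (fun s => integ a b (f s)) (integ a b (df t)).
Proof.
move=> /andP[ut tv] cf Df cdf.
(* A compact time interval inside []u, v[]: on [[c, d] x [a, b]] the continuous [df] is bounded, and
   that constant is the dominating function. *)
pose c := (u + t) / 2; pose d := (t + v) / 2.
have uc : u < c by rewrite /c; lra.
have ct : c < t by rewrite /c; lra.
have td : t < d by rewrite /d; lra.
have dv : d < v by rewrite /d; lra.
have sub s : c <= s <= d -> u < s < v.
  by move=> /andP[cs sd]; rewrite (lt_le_trans uc)//= (le_lt_trans sd).
have [M M0 MP] := @continuous2_bounded df c d a b (fun s x h => cdf s x (sub s h)).
have It : `]c, d[%classic t by rewrite /= in_itv/= ct td.
have sub' s : `]c, d[%classic s -> c <= s <= d.
  by rewrite /= in_itv/= => /andP[/ltW-> /ltW->].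
have intf s : `]c, d[%classic s ->
    lebesgue_measure.-integrable `[a, b] (EFin \o f s).
  by move=> /sub' /sub /cf; exact: cont_integrable.
have derf s x : `]c, d[%classic s -> `[a, b]%classic x -> derivable (f ^~ x) s 1.
  by move=> /sub' /sub /Df - /(_ x)[].
have ub s x : `]c, d[%classic s -> `[a, b]%classic x ->
    `|partial1of2 f s x| <= cst M x.
  move=> /sub' cs; rewrite /= in_itv/= => ax.
  by rewrite partial1of2E; have [_ ->] := Df _ x (sub _ cs); exact: MP.
have intM : lebesgue_measure.-integrable `[a, b] (EFin \o (cst M : R -> R)).
  by apply: cont_integrable; exact: cst_continuous.
have mab : measurable (`[a, b]%classic : set (measurableTypeR R)) by [].
have D := @derivable_under_integral R _ _ lebesgue_measure f _ mab t c d It intf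
  derf (cst M) (fun=> M0) intM ub.
have E := @differentiation_under_integral R _ _ lebesgue_measure f _ mab t c d It
  intf derf (cst M) (fun=> M0) intM ub.
apply: DeriveDef; first exact: D.
rewrite -derive1E E; apply: eq_Rintegral => x _.
have utv : u < t < v by rewrite ut.
by rewrite partial1of2E; have [_ ->] := Df t x utv.
Qed.

(** Form of the derivative suited to [ball_integral], whose increments are only known through an
    inequality. *)
Lemma is_derive_eps (f : R -> R) (x l : R) :
  (forall e, 0 < e -> \forall y \near x, `|f y - f x - l * (y - x)| <= e * `|y - x|) ->
  is_derive x 1 f l.
Proof.
move=> H; suff cv : (fun h => h^-1 *: (f (h + x) - f x)) @ 0^' --> l.
  apply: DeriveDef.
    apply/cvg_ex; exists l; apply: cvg_trans cv; apply: near_eq_cvg.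
    by near=> h; rewrite /= scaler1.
  rewrite /derive; apply: cvg_lim => //; apply: cvg_trans cv; apply: near_eq_cvg.
  by near=> h; rewrite /= scaler1.
apply/cvgrPdist_le => /= e e0.
have /nbhs_ballP[d /= d0 Hd] := H _ e0.
near=> h.
have h0 : h != 0 by near: h; exact: nbhs_dnbhs_neq.
have hd : `|h| < d by near: h; exact: dnbhs0_lt.
have : `|f (h + x) - f x - l * (h + x - x)| <= e * `|h + x - x|.
  by apply: Hd; rewrite /ball/= opprD addrCA subrr addr0 normrN.
rewrite addrK => hh; rewrite -(ler_pM2r (_ : 0 < `|h|)) ?normr_gt0//.
apply: le_trans hh; rewrite -normrM distrC mulrBl /GRing.scale/=.
by rewrite mulrAC mulVf// mul1r.
Unshelve. all: by end_near. Qed.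

Lemma continuous_bounded (g : R -> R) a b : continuous g ->
  exists2 M : R, 0 <= M & forall x, a <= x <= b -> `|g x| <= M.
Proof.
move=> cg.
have [|M M0 gM] := @continuous2_bounded (fun _ => g) 0 0 a b.
  by move=> t x _; apply: continuous_comp; [exact: cvg_snd|exact: cg].
by exists M => // x; apply: (gM 0); rewrite lexx.
Qed.

Lemma is_derive_near_lip (f : R -> R) (x l C : R) : `|l| < C ->
  is_derive x 1 f l -> \forall y \near x, `|f y - f x| <= C * `|y - x|.
Proof.
move=> lC [df fl].
have cv : (fun h => h^-1 *: (f (h *: 1 + x) - f x)) @ 0^' --> l.
  by rewrite -fl; exact: df.
have [d /= d0 Hd] := cvgr_lt `|l| (cvg_norm cv) C lC.
exists d => //= y xy.
have [->|yx] := eqVneq y x; first by rewrite !subrr normr0 mulr0.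
have yx0 : y - x != 0 by rewrite subr_eq0.
have := Hd (y - x); rewrite /ball_/= sub0r normrN distrC => /(_ xy yx0)/ltW.
by rewrite scaler1 subrK normrM normfV mulrC ler_pdivrMr ?normr_gt0// (distrC x).
Qed.

End Calculus.

(** * Lebesgue measure in polar coordinates *)

Section Measure.
Context (R : realType).
Local Notation T n := (n.-tuple (measurableTypeR R)).
Local Notation leb := (@lebesgue_measure R).
Local Open Scope ereal_scope.

Lemma ge0_integral_cons n (f : T n.+1 -> \bar R) :
  measurable_fun [set: T n.+1] f -> (forall v, 0 <= f v) ->
  \int[lebesgue_tuple R n.+1]_v f v =
  \int[leb]_x \int[lebesgue_tuple R n]_v f [tuple of x :: v].
Proof.
move=> mf f0; rewrite /= /lebesgue_cons.
rewrite (ge0_integral_pushforward (@measurable_tuple_cons R n) _ measurableT mf)//.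
rewrite preimage_setT fubini_tonelli1//; last first.
  by move=> ?; exact: f0.
exact: measurableT_comp mf (@measurable_tuple_cons R n).
Qed.

Lemma measurable_integral_cons n (f : T n.+1 -> \bar R) :
  measurable_fun [set: T n.+1] f -> (forall v, 0 <= f v) ->
  measurable_fun setT
    (fun x => \int[lebesgue_tuple R n]_v f [tuple of x :: v]).
Proof.
move=> mf f0.
have mg : measurable_fun setT (f \o @tuple_cons R n).
  exact: measurableT_comp mf (@measurable_tuple_cons R n).
have g0 z : 0 <= (f \o @tuple_cons R n) z by exact: f0.
exact: (@measurable_fun_fubini_tonelli_F _ _ _ _ R (lebesgue_tuple R n) _ mg g0).
Qed.

(** The image of Lebesgue measure under [x -> a x], multiplied by [a], gives every open interval its
    length, hence is Lebesgue measure by uniqueness. *)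
Lemma ge0_integral_scale (a : R) (f : R -> \bar R) : (0 < a)%R ->
  measurable_fun [set: measurableTypeR R] f -> (forall x, 0 <= f x) ->
  \int[leb]_x f x = a%:E * \int[leb]_x f (a * x)%R.
Proof.
move=> a0 mf f0.
have mphi : measurable_fun setT (( *%R a) : measurableTypeR R -> measurableTypeR R).
  exact: measurable_funM.
have := ge0_integral_pushforward mphi leb measurableT mf.
rewrite preimage_setT /= => <-//.
have a0' : (0 <= a)%R by exact: ltW.
pose pf : {measure set (measurableTypeR R) -> \bar R} :=
  measure_function_pushforward__canonical__measure_function_Measure leb mphi.
rewrite -[RHS]/((NngNum a0')%:num%:E * \int[pf]_x f x).
rewrite -(ge0_integral_mscale pf measurableT (NngNum a0') mf)//.
apply: eq_measure_integral => //= A mA _.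
apply: lebesgue_measure_unique => //= _ [[u v]] _ <-.
rewrite /mscale/= /pushforward.
rewrite (_ : _ @^-1` _ = `]u / a, v / a]%classic)%R; last first.
  apply/seteqP; split => x /=; rewrite !in_itv/=;
  by rewrite ltr_pdivrMr// ler_pdivlMr// ![(x * a)%R]mulrC.
rewrite !lebesgue_measure_itv/= !lte_fin ltr_pM2r ?invr_gt0//.
case: ifPn => _; last by rewrite mule0.
by rewrite -!EFinD -EFinM mulrBr ![(a * (_ / _))%R]mulrCA divff ?gt_eqF// !mulr1.
Qed.

Definition tscale n (a : R) (v : T n) : T n := [tuple of map ( *%R a) v].

Lemma measurable_tscale n a : measurable_fun setT (@tscale n a).
Proof.
apply/measurable_fun_tnthP => i /=.
rewrite (_ : _ \o _ = fun v : T n => a * tnth v i)%R; last first.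
  by apply/funext => v; rewrite /= tnth_map.
by apply: measurable_funM => //; exact: measurable_tnth.
Qed.

Lemma ge0_integral_tscale n (a : R) (f : T n -> \bar R) : (0 < a)%R ->
  measurable_fun [set: T n] f -> (forall v, 0 <= f v) ->
  \int[lebesgue_tuple R n]_v f v =
  (a ^+ n)%:E * \int[lebesgue_tuple R n]_v f (tscale a v).
Proof.
move=> a0; elim: n f => [|n IH] f mf f0.
  rewrite expr0 mul1e; apply: eq_integral => v _.
  by rewrite [tscale a v]tuple0 [v in LHS]tuple0.
have mft : measurable_fun setT (f \o tscale a).
  exact: measurableT_comp mf (measurable_tscale a).
rewrite ge0_integral_cons// ge0_integral_cons//.
have mfx x : measurable_fun setT (fun v : T n => f [tuple of x :: v]).
  have mc : measurable_fun setT (fun v : T n => [tuple of x :: v]).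
    by apply: measurable_cons => //; exact: measurable_cst.
  exact: measurableT_comp mf mc.
rewrite (ge0_integral_scale a0); last 2 first.
- exact: measurable_integral_cons.
- by move=> x; apply: integral_ge0.
rewrite exprS EFinM -muleA; congr (_ * _).
rewrite -ge0_integralZl//; last 3 first.
- exact: (measurable_integral_cons mft (fun v => f0 (tscale a v))).
- by move=> x _; apply: integral_ge0.
- by rewrite lee_fin exprn_ge0 // ltW.
apply: eq_integral => x _; rewrite IH//; congr (_ * _).
by apply: eq_integral => v _; congr (f _); apply: val_inj.
Qed.

Definition tsq n (v : T n) : R := (\sum_i tnth v i ^+ 2)%R.

Lemma tsq_cons n x (v : T n) : tsq [tuple of x :: v] = (x ^+ 2 + tsq v)%R.
Proof.
rewrite /tsq big_ord_recl tnth0; congr (_ + _)%R.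
by apply: eq_bigr => i _; rewrite tnthS.
Qed.

Lemma tsq_ge0 n (v : T n) : (0 <= tsq v)%R.
Proof. by apply: sumr_ge0 => i _; exact: sqr_ge0. Qed.

Lemma tsq_scale n a (v : T n) : tsq (tscale a v) = (a ^+ 2 * tsq v)%R.
Proof.
by rewrite /tsq mulr_sumr; apply: eq_bigr => i _; rewrite tnth_map exprMn.
Qed.

Lemma measurable_tsq n : measurable_fun [set: T n] (@tsq n).
Proof.
apply: measurable_sum => i; apply: measurable_funX; exact: measurable_tnth.
Qed.

Lemma measurable_comp_tsq (h : R -> R) n : continuous h ->
  measurable_fun [set: T n] (fun v => (h (tsq v))%:E).
Proof.
move=> ch; apply/measurable_EFinP; apply: measurableT_comp.
  exact: continuous_measurable_fun.
exact: measurable_tsq.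
Qed.

Lemma measurable_exp_tsq n :
  measurable_fun [set: T n] (fun v => (expR (- tsq v))%:E).
Proof.
apply: (@measurable_comp_tsq (fun x => expR (- x)))%R => x.
by apply: continuous_comp; [exact: opp_continuous|exact: continuous_expR].
Qed.

Lemma integral_gauss_tuple n :
  \int[lebesgue_tuple R n]_v (expR (- tsq v))%:E = (Num.sqrt pi ^+ n)%:E.
Proof.
elim: n => [|n IH].
  rewrite /= integral_dirac//; last exact: measurable_exp_tsq.
  by rewrite diracT mul1e /tsq big_ord0 oppr0 expR0 expr0.
rewrite ge0_integral_cons; last 2 first.
- exact: measurable_exp_tsq.
- by move=> v; rewrite lee_fin expR_ge0.
under eq_integral => x _.
  under eq_integral => v _ do rewrite tsq_cons opprD expRD EFinM.
  rewrite ge0_integralZl; last 4 first.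
  - exact: measurableT.
  - exact: measurable_exp_tsq.
  - by move=> v _; rewrite lee_fin expR_ge0.
  - by rewrite lee_fin expR_ge0.
  rewrite IH muleC; over.
rewrite ge0_integralZl; last 4 first.
- exact: measurableT.
- apply/measurable_EFinP; exact: measurable_gauss_fun.
- by move=> v _; rewrite lee_fin expR_ge0.
- by rewrite lee_fin exprn_ge0// sqrtr_ge0.
by rewrite integralT_gauss -EFinM -exprSr.
Qed.

(** The clause [0 <= r] empties the balls of negative radius, so that membership is [trad v <= r]
    for every real [r]. *)
Definition tball n (r : R) : set (T n) :=
  [set v | (0 <= r)%R /\ (tsq v <= r ^+ 2)%R].

Lemma measurable_tball n r : measurable (@tball n r).
Proof.
have [r0|r0] := leP 0%R r; last first.
  have -> : @tball n r = set0.
    by apply/seteqP; split => // v [] /=; rewrite leNgt r0.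
  exact: measurable0.
have -> : @tball n r = @tsq n @^-1` `]-oo, (r ^+ 2)%R]%classic.
  by apply/seteqP; split => v; rewrite /tball /= in_itv/=; [case|split].
by rewrite -[X in measurable X]setTI; apply: measurable_tsq.
Qed.

Definition ball_vol n : R := fine (lebesgue_tuple R n (@tball n 1)).

(** On the unit ball [1 <= e * exp (- |v|^2)], and the Gaussian has a finite integral. *)
Lemma tball1_fin n : lebesgue_tuple R n (@tball n 1) < +oo.
Proof.
apply: (@le_lt_trans _ _ (expR 1 * Num.sqrt pi ^+ n)%:E); last exact: ltry.
rewrite EFinM -integral_gauss_tuple.
rewrite -ge0_integralZl; last 4 first.
- exact: measurableT.
- exact: measurable_exp_tsq.
- by move=> v _; rewrite lee_fin expR_ge0.
- by rewrite lee_fin expR_ge0.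
rewrite -[leLHS]mul1e -integral_cst//; last exact: measurable_tball.
rewrite integral_mkcond; apply: ge0_le_integral => //.
- by move=> v _; rewrite patchE; case: ifP.
- apply/(measurable_restrictT _ _).1 => //; exact: measurable_tball.
- by apply: measurable_funeM; exact: measurable_exp_tsq.
move=> v _; rewrite patchE; case: ifPn => [|_].
  rewrite inE => -[_]; rewrite expr1n => v1.
  rewrite -EFinM lee_fin -expRD -[leLHS]expR0 ler_expR; lra.
by rewrite -EFinM lee_fin mulr_ge0 ?expR_ge0.
Qed.

Lemma tball_vol n r : (0 < r)%R ->
  lebesgue_tuple R n (@tball n r) = (ball_vol n * r ^+ n)%:E.
Proof.
move=> r0.
rewrite -[LHS]mul1e -integral_cst//; last exact: measurable_tball.
rewrite integral_mkcond (ge0_integral_tscale r0); last 2 first.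
- by apply/(measurable_restrictT _ _).1 => //; exact: measurable_tball.
- by move=> v; rewrite patchE; case: ifP.
rewrite mulrC EFinM /ball_vol fineK ?ge0_fin_numE ?tball1_fin//.
congr (_ * _); rewrite -[RHS]mul1e -integral_cst//; last exact: measurable_tball.
rewrite [RHS]integral_mkcond; apply: eq_integral => v _.
rewrite !patchE; congr (if _ then _ else _).
apply/idP/idP; rewrite !inE /tball/= tsq_scale expr1n.
  by move=> [_]; rewrite ger_pMr ?exprn_gt0.
by move=> [_ ?]; split; [exact: ltW|rewrite ger_pMr ?exprn_gt0].
Qed.

Lemma tball0 n : (0 < n)%N -> lebesgue_tuple R n (@tball n 0) = 0.
Proof.
move=> n0; apply/eqP; rewrite eq_le measure_ge0 andbT.
apply/lee_addgt0Pr => /= e e0; rewrite add0e.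
pose c := (ball_vol n + 1)%R.
have c0 : (0 < c)%R by rewrite ltr_wpDl// fine_ge0.
pose r := (Num.min 1 (e / c))%R.
have r0 : (0 < r)%R by rewrite lt_min ltr01 divr_gt0.
apply: (@le_trans _ _ (lebesgue_tuple R n (@tball n r))).
  apply: le_measure; rewrite ?inE; try exact: measurable_tball.
  move=> v [_]; rewrite expr0n/= => v0; split; first exact: ltW.
  by rewrite (le_trans v0)// exprn_ge0// ltW.
rewrite tball_vol// lee_fin (@le_trans _ _ (c * r)%R)//.
  apply: ler_pM; rewrite ?fine_ge0 ?exprn_ge0 ?lerDl//; first exact: ltW.
  case: n n0 @c {c0} @r r0 => // n _ c r r0; rewrite exprSr ler_piMl//.
    exact: ltW.
  by rewrite exprn_ile1//; [exact: ltW|rewrite ge_min lexx].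
by rewrite mulrC -ler_pdivlMr// ge_min lexx orbT.
Qed.

End Measure.

(** * Polar coordinates, obtained by differentiating integrals over balls *)

Section Polar.
Context (R : realType).
Local Notation T n := (n.-tuple (measurableTypeR R)).
Local Notation leb := (@lebesgue_measure R).
Local Notation lebt n := (lebesgue_tuple R n).

Definition trad n (v : T n) : R := Num.sqrt (tsq v).

Lemma trad_ge0 n (v : T n) : 0 <= trad v.
Proof. exact: sqrtr_ge0. Qed.

Lemma measurable_trad n : measurable_fun [set: T n] (@trad n).
Proof.
apply: (@measurableT_comp _ _ _ _ _ _ (@Num.sqrt R) _ (@tsq R n)).
  by apply: continuous_measurable_fun; exact: sqrt_continuous.
exact: measurable_tsq.
Qed.

Lemma tballE n r (v : T n) : tball r v <-> trad v <= r.
Proof.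
split=> [[r0 vr]|vr].
  by rewrite -(ler_pXn2r (n := 2)) ?nnegrE ?sqrtr_ge0// sqr_sqrtr// tsq_ge0.
have r0 : 0 <= r by exact: le_trans (sqrtr_ge0 _) vr.
split=> //; rewrite -[tsq v]sqr_sqrtr ?tsq_ge0//.
by rewrite ler_pXn2r// nnegrE sqrtr_ge0.
Qed.

Definition ball_growth k (r : R) : R := ball_vol R k.+1 * Num.max 0 r ^+ k.+1.

Lemma tball_volS k r :
  lebt k.+1 (@tball R k.+1 r) = (ball_growth k r)%:E.
Proof.
rewrite /ball_growth; case: (ltgtP 0 r) => [r0|r0|<-].
- exact: tball_vol.
- rewrite expr0n mulr0.
  have -> : @tball R k.+1 r = set0.
    by apply/seteqP; split => // v [] /=; rewrite leNgt r0.
  by rewrite measure0.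
- by rewrite tball0// expr0n mulr0.
Qed.

Lemma tball_lty k r : (lebt k.+1 (@tball R k.+1 r) < +oo)%E.
Proof. by rewrite tball_volS ltry. Qed.

Lemma ball_vol_ge0 n : 0 <= ball_vol R n.
Proof. exact: fine_ge0. Qed.

Section ball.
Context (k : nat) (g : R -> R) (cg : continuous g).
Local Notation n := k.+1.

Lemma integrable_tball r : (lebt n).-integrable (@tball R n r) (EFin \o (g \o @trad n)).
Proof.
apply: measurable_bounded_integrable.
- exact: measurable_tball.
- exact: tball_lty.
- apply: measurable_funTS; apply: measurableT_comp; last exact: measurable_trad.
  exact: continuous_measurable_fun.
- have [M M0 gM] := continuous_bounded 0 r cg.
  exists M; split => [|M' MM' v /= /tballE vr]; first exact: num_real.
  by rewrite (le_trans (gM _ _) (ltW MM'))// ?trad_ge0.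
Qed.

Definition ball_integral r := \int[lebt n]_(v in @tball R n r) g (trad v).

(** The increment is the integral over the shell [x < |v| <= y], on which [g] is within [e] of [c].
    The choice [c = 0] yields continuity in the radius, and [c = g x] the derivative. *)
Lemma ball_integral_diff (x y c e : R) : x <= y ->
  (forall z, 0 <= z -> x <= z <= y -> `|g z - c| <= e) ->
  `|ball_integral y - ball_integral x - c * (ball_growth k y - ball_growth k x)|
  <= e * (ball_growth k y - ball_growth k x).
Proof.
move=> xy ge.
pose D := @tball R n y `\` @tball R n x.
have mD : measurable D by apply: measurableD; exact: measurable_tball.
have sub : @tball R n x `<=` @tball R n y.
  by move=> v /tballE vx; apply/tballE; exact: le_trans xy.
have volD : lebt n D = (ball_growth k y - ball_growth k x)%:E.
  transitivity (lebt n (@tball R n y) - lebt n (@tball R n y `&` @tball R n x))%E.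
    by apply: measureD; [exact: measurable_tball|exact: measurable_tball|exact: tball_lty].
  by rewrite (setIidr sub) !tball_volS.
have intD : (lebt n).-integrable D (EFin \o (g \o @trad n)).
  apply: integrableS (integrable_tball y) => //; first exact: measurable_tball.
  exact: subDsetl.
have intDc (a : R) : (lebt n).-integrable D (EFin \o cst a).
  apply: measurable_bounded_integrable => //.
    have vD : (lebt n D < +oo)%E by rewrite volD ltry.
    exact: vD.
  exists `|a|; split=> [|M aM z _]; [exact: num_real|exact: ltW].
have -> : ball_integral y - ball_integral x = \int[lebt n]_(v in D) g (trad v).
  rewrite /ball_integral -[X in Rintegral _ X](setDKU sub) setUC.
  rewrite Rintegral_setU//.
  - by rewrite addrC addKr.
  - exact: measurable_tball.
  - by rewrite setUC setDKU//; exact: integrable_tball.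
  - by apply/disj_setPS => v [vx [_]].
have V : fine (lebt n D) = ball_growth k y - ball_growth k x.
  by rewrite volD.
rewrite -V -Rintegral_cst// -RintegralB//; last exact: intDc.
rewrite -Rintegral_cst//; apply: le_trans (le_normr_Rintegral mD _) _.
  by have := integrableB mD intD (intDc c); apply: eq_integrable.
apply: le_Rintegral => //.
- have := integrable_abse (integrableB mD intD (intDc c)).
  by apply: eq_integrable.
- exact: intDc.
- move=> v [/tballE vy vx]; apply: ge; rewrite ?trad_ge0// vy andbT ltW// ltNge.
  by apply/negP => /tballE.
Qed.

Lemma ball_growth_nd (x y : R) : x <= y -> ball_growth k x <= ball_growth k y.
Proof.
move=> xy; apply: ler_wpM2l; first exact: ball_vol_ge0.
have m0 z : 0 <= Num.max 0 z :> R by rewrite le_max lexx.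
apply: lerXn2r; rewrite ?nnegrE ?m0//.
by rewrite ge_max m0/= le_max xy orbT.
Qed.

Lemma is_derive_ball_growth (x : R) : 0 < x ->
  is_derive x 1 (ball_growth k) (ball_vol R n * (n%:R * x ^+ k)).
Proof.
move=> x0.
have D : is_derive x 1 (fun y => ball_vol R n * y ^+ n) (ball_vol R n * (n%:R * x ^+ k)).
  by isd_tac; rewrite /=; ring.
apply: near_eq_is_derive D; near=> y; rewrite /ball_growth max_r//.
by apply/ltW; near: y; exact: lt_nbhsr.
Unshelve. all: by end_near. Qed.

Lemma continuous_ball_growth : continuous (ball_growth k).
Proof.
have c0 : continuous (Num.max 0 : R -> R).
  by move=> y; apply: continuous_max; [exact: cst_continuous|exact: cvg_id].
by move=> x; rewrite /ball_growth; cont_tac.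
Qed.

Lemma continuous_ball_integral : continuous ball_integral.
Proof.
move=> x; have [M M0 gM] := continuous_bounded 0 (x + 1) cg.
have F y z : y <= z -> z <= x + 1 ->
    `|ball_integral z - ball_integral y| <= M * `|ball_growth k z - ball_growth k y|.
  move=> yz zx; have := @ball_integral_diff y z 0 M yz.
  rewrite mul0r subr0 => H; rewrite [X in _ <= _ * X]ger0_norm ?subr_ge0 ?ball_growth_nd//.
  by apply: H => u u0 /andP[_ uz]; rewrite subr0 gM// u0 (le_trans uz).
have F' y z : y <= x + 1 -> z <= x + 1 ->
    `|ball_integral z - ball_integral y| <= M * `|ball_growth k z - ball_growth k y|.
  move=> yx zx; have [yz|/ltW zy] := leP y z; first exact: F.
  by rewrite distrC (distrC (ball_growth _ _)); exact: F.
apply/cvgrPdist_le => e e0.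
have e0' : 0 < e / (M + 1) by rewrite divr_gt0// ltr_wpDl.
have /cvgrPdist_le/(_ _ e0') H := @continuous_ball_growth x.
near=> y; have yx : y <= x + 1.
  by apply/ltW; near: y; apply: lt_nbhsl; rewrite ltrDl.
apply: le_trans (F' _ _ yx _) _; first by rewrite lerDl.
apply: (@le_trans _ _ ((M + 1) * (e / (M + 1)))).
  apply: ler_pM => //; first by rewrite lerDl.
  by near: y.
by rewrite mulrCA divff ?mulr1// gt_eqF// ltr_wpDl.
Unshelve. all: by end_near. Qed.

(** By the shell estimate, [ball_integral - g x * ball_growth] has increments small compared with
    those of the volume; the volume being Lipschitz near [x], its derivative there is [0]. No
    measure on spheres is involved. *)
Lemma is_derive_ball_integral (x : R) : 0 < x ->
  is_derive x 1 ball_integral (ball_vol R n * (n%:R * x ^+ k) * g x).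
Proof.
move=> x0; set V' := ball_vol R n * _; have DV := is_derive_ball_growth x0.
rewrite -/V' in DV.
have DG : is_derive x 1 (fun y => ball_integral y - g x * ball_growth k y) 0.
  apply: is_derive_eps => e e0.
  have C0 : 0 < `|V'| + 1 by rewrite ltr_wpDl.
  have VC : `|V'| < `|V'| + 1 by rewrite ltrDl.
  have lip := is_derive_near_lip VC DV.
  have e0' : 0 < e / (`|V'| + 1) by rewrite divr_gt0.
  have /cvgrPdist_le/(_ _ e0') [d /= d0 Hd] := @cg x.
  near=> y; rewrite mul0r subr0.
  have xyd : `|x - y| < d by near: y; exists d.
  have -> : ball_integral y - g x * ball_growth k y
      - (ball_integral x - g x * ball_growth k x) =
    ball_integral y - ball_integral x - g x * (ball_growth k y - ball_growth k x).
    by ring.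
  apply: (@le_trans _ _ (e / (`|V'| + 1) * `|ball_growth k y - ball_growth k x|)).
    have [xy|/ltW yx] := leP x y.
      rewrite [X in _ <= _ * X]ger0_norm ?subr_ge0 ?ball_growth_nd//.
      apply: ball_integral_diff => // z _ /andP[xz zy].
      rewrite distrC; apply: Hd; rewrite /ball_/=; apply: le_lt_trans xyd.
      by rewrite !ler0_norm ?subr_le0// !opprB lerD2r.
    rewrite [X in _ <= _ * X]distrC [X in _ <= _ * X]ger0_norm ?subr_ge0 ?ball_growth_nd//.
    have -> (a b c d' h : R) : `|a - b - h * (c - d')| = `|b - a - h * (d' - c)|.
      by rewrite -normrN; congr (`|_|); ring.
    apply: ball_integral_diff => // z _ /andP[yz zx].
    rewrite distrC; apply: Hd; rewrite /ball_/=; apply: le_lt_trans xyd.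
    by rewrite !ger0_norm ?subr_ge0// lerD2l lerN2.
  rewrite mulrAC ler_pdivrMr// -mulrA ler_pM2l// mulrC.
  by near: y; exact: lip.
have := is_deriveD DG (is_deriveZ (g x) DV).
rewrite add0r => D; apply: isd_eq; last exact: mulrC.
apply: near_eq_is_derive D; near=> y => /=.
by rewrite /GRing.scale /= subrK.
Unshelve. all: by end_near. Qed.

Lemma ball_integralE (r : R) : 0 <= r ->
  ball_integral r = n%:R * ball_vol R n * integ 0 r (fun x => g x * x ^+ k).
Proof.
move=> r0.
have cgk : continuous (fun x => g x * x ^+ k).
  by move=> x; cont_tac.
rewrite -integZ//.
have B0 : ball_integral 0 = 0.
  rewrite /ball_integral /Rintegral.
  have -> : (\int[lebt n]_(v in @tball R n 0) (g (trad v))%:E = 0)%E; last by [].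
  apply: null_set_integral; first exact: measurable_tball.
  - exact: measurable_int (integrable_tball 0).
  - by have := tball_volS k 0; rewrite /ball_growth maxxx expr0n mulr0.
rewrite -[LHS]subr0 -[X in _ - X = _]B0; apply/esym; apply: integ_FTC => //.
- by move=> x; cont_tac.
- exact: continuous_ball_integral.
- move=> x /andP[x0 _]; have D := is_derive_ball_integral x0.
  by apply: isd_eq D _; ring.
Qed.

End ball.
End Polar.

Section Polar2.
Context (R : realType).
Local Notation T n := (n.-tuple (measurableTypeR R)).
Local Notation lebt n := (lebesgue_tuple R n).

Lemma integral_truncated k (g : R -> R) b (F : T k.+1 -> R) : continuous g ->
  (forall v, trad v <= b -> F v = g (trad v)) -> (forall v, b < trad v -> F v = 0) ->
  (lebt k.+1).-integrable setT (EFin \o F) /\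
  \int[lebt k.+1]_v F v = ball_integral k g b.
Proof.
move=> cg Fin Fout.
have FE : F = (g \o @trad R k.+1) \_ (@tball R k.+1 b).
  apply/funext => v; rewrite patchE; case: ifPn => [/set_mem/tballE|/negP vb].
    exact: Fin.
  by apply: Fout; rewrite ltNge; apply/negP => /tballE ?; apply: vb; rewrite inE.
split; last by rewrite FE -Rintegral_mkcond.
rewrite FE -restrict_EFin; apply/integrable_restrict => //.
  exact: measurable_tball.
by rewrite setTI; exact: integrable_tball.
Qed.

Lemma measurable_comp_trad (g : R -> R) n : continuous g ->
  measurable_fun [set: T n] (g \o @trad R n).
Proof.
move=> cg; apply: measurableT_comp; last exact: measurable_trad.
exact: continuous_measurable_fun.
Qed.

Lemma bigcup_tball n : \bigcup_i @tball R n i%:R = setT.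
Proof.
apply/seteqP; split => // v _; exists (Num.truncn (trad v)).+1 => //.
by apply/tballE/ltW/truncnS_gt.
Qed.

Lemma nondecreasing_tball n : nondecreasing_seq (fun i => @tball R n i%:R).
Proof.
move=> i j ij; apply/subsetPset => v /tballE vi; apply/tballE.
by rewrite (le_trans vi)// ler_nat.
Qed.

Lemma ge0_ball_integral_lim k (g : R -> R) : continuous g -> (forall x, 0 <= g x) ->
  ((ball_integral k g i%:R)%:E @[i --> \oo] -->
   \int[lebt k.+1]_v (g (trad v))%:E)%E.
Proof.
move=> cg g0.
have mf (i : nat) : measurable_fun (@tball R k.+1 i%:R) (fun v => (g (trad v))%:E).
  apply: measurable_funTS; apply/measurable_EFinP.
  exact: measurable_comp_trad.
have f0 (i : nat) v : @tball R k.+1 i%:R v -> (0 <= (g (trad v))%:E)%E.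
  by move=> _; rewrite lee_fin.
have := ge0_nondecreasing_set_cvg_integral (mu := lebt k.+1) (@nondecreasing_tball _)
  (fun i => @measurable_tball R k.+1 i%:R) mf f0.
rewrite bigcup_tball => H; apply: cvg_trans H.
apply: near_eq_cvg; near=> i => /=.
rewrite /ball_integral /Rintegral fineK//; apply: integrable_fin_num.
  exact: measurable_tball.
exact: integrable_tball.
Unshelve. all: by end_near. Qed.

(** Monotone convergence along the balls of integer radius makes the majorant [h] integrable;
    dominated convergence then applies to [g]. *)
Lemma dom_ball_integral_lim k (g h : R -> R) C : continuous g -> continuous h ->
  (forall x, `|g x| <= h x) -> (forall i : nat, ball_integral k h i%:R <= C) ->
  (lebt k.+1).-integrable setT (EFin \o (g \o @trad R k.+1)) /\
  ball_integral k g i%:R @[i --> \oo] --> \int[lebt k.+1]_v g (trad v).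
Proof.
move=> cg ch gh hC.
have h0 x : 0 <= h x by exact: le_trans (gh x).
have ih : (lebt k.+1).-integrable setT (EFin \o (h \o @trad R k.+1)).
  apply/integrableP; split.
    by apply/measurable_EFinP; exact: measurable_comp_trad.
  under eq_integral => v _ do rewrite /= ger0_norm//.
  apply: (@le_lt_trans _ _ C%:E); last exact: ltry.
  have cv := ge0_ball_integral_lim (k := k) ch h0.
  rewrite -(cvg_lim _ cv)//; apply: lime_le; first by apply/cvg_ex; eexists; exact: cv.
  by near=> i; rewrite lee_fin.
have ig : (lebt k.+1).-integrable setT (EFin \o (g \o @trad R k.+1)).
  apply: le_integrable ih => //.
    by apply/measurable_EFinP; exact: measurable_comp_trad.
  by move=> v _; rewrite lee_fin /= [leRHS]ger0_norm.
split=> //.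
apply: fine_cvg; rewrite /Rintegral fineK; last exact: integrable_fin_num.
have -> : (fun i : nat => (\int[lebt k.+1]_(v in @tball R k.+1 i%:R) (g (trad v))%:E)%E) =
  (fun i : nat => (\int[lebt k.+1]_v (((g \o @trad R k.+1) \_ (@tball R k.+1 i%:R)) v)%:E)%E).
  apply/funext => i; rewrite integral_mkcond; apply: eq_integral => v _.
  by rewrite restrict_EFin.
apply: (@dominated_cvg _ _ R (lebt k.+1) setT measurableT _ _
   (EFin \o (h \o @trad R k.+1))) => //.
- move=> i; apply/measurable_EFinP/(measurable_restrictT _ _).1.
    exact: measurable_tball.
  by apply: measurable_funTS; exact: measurable_comp_trad.
- move=> v _; apply: cvg_near_cst.
  exists (Num.truncn (trad v)).+1 => // i /= vi.
  rewrite patchE ifT// inE; apply/tballE/ltW.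
  by rewrite (lt_le_trans (truncnS_gt _))// ler_nat.
- move=> i v _; rewrite lee_fin /= patchE; case: ifP => _; first exact: gh.
  by rewrite normr0.
Unshelve. all: by end_near. Qed.

(** Continuity refers to the topology of row vectors, measurability to the product sigma-algebra of
    tuples. They meet because every open set is a union of boxes with rational centre and size, of
    which there are countably many. *)
Lemma measurable_cont_row n (F : 'rV[R]_n -> R) : continuous F ->
  measurable_fun [set: T n] (fun v => F (\row_i tnth v i)).
Proof.
move=> cF.
have mopen (U : set 'rV[R]_n) : open U ->
    measurable [set v : T n | U (\row_i tnth v i)].
  move=> oU.
  pose box (q : 'rV[rat]_n * rat) := [set v : T n | forall i, `|tnth v i - ratr (q.1 0 i)| < ratr q.2].
  have mbox q : measurable (box q).
    have -> : box q = \bigcap_(i in [set: 'I_n])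
        [set v : T n | `|tnth v i - ratr (q.1 0 i)| < ratr q.2].
      by apply/seteqP; split => [v vq i _|v vq i]; apply: vq.
    apply: fin_bigcap_measurable; first exact: finite_finset.
    move=> i _.
    have mf : measurable_fun setT (fun v : T n => `|tnth v i - ratr (q.1 0 i)|).
      apply: measurableT_comp; first exact: normr_measurable.
      by apply: measurable_funB => //; exact: measurable_tnth.
    have := mf measurableT `]-oo, (ratr q.2 : R)[%classic (measurable_itv _).
    by rewrite setTI; congr measurable; apply/seteqP; split => v; rewrite /= in_itv.
  pose good := [set q | box q `<=` [set v : T n | U (\row_i tnth v i)]].
  have -> : [set v : T n | U (\row_i tnth v i)] =
      \bigcup_q (if q \in good then box q else set0).
    apply/seteqP; split => [v Uv|v [q _]]; last first.
      by case: ifPn => // /set_mem gq; exact: gq.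
    have /nbhs_ballP[e /= e0 eU] := oU _ Uv.
    have e2 : 0 < e / 2 by rewrite divr_gt0.
    have /rat_in_itvoo[r] := e2; rewrite inE/= => /itvP h.
    have r0 : 0 < ratr r :> R by rewrite h.
    have re : ratr r < e / 2 by rewrite h.
    have /choice [c cP] : forall i : 'I_n, exists p : rat, `|tnth v i - ratr p| < ratr r.
      move=> i; have : tnth v i - ratr r < tnth v i + ratr r by lra.
      move=> /rat_in_itvoo[p]; rewrite inE/= => /itvP h'.
      by exists p; rewrite ltr_distlC h' h'.
    exists (\row_i c i, r) => //; rewrite ifT; last first.
      rewrite inE => w wq; apply: eU; split=> // i j; rewrite !mxE /ball/=.
      have := wq j; have := cP j; rewrite mxE !ltr_norml => /andP[? ?] /andP[? ?].
      by apply/andP; split; lra.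
    by move=> i /=; rewrite mxE.
  apply: countable_bigcupT_measurable; first exact: countableP.
  by move=> q; case: ifP => // _; exact: measurable0.
apply: (measurability _ (RGenOInfty.measurableE R)) => // _ [_ [a ->] <-].
rewrite setTI; apply: (mopen (F @^-1` `]a, +oo[)).
by apply: open_comp => // x _; exact: cF.
Qed.

End Polar2.

(** * The hyperboloid and the stereographic charts *)

Section Isometries.
Context (R : realType).

Lemma cont_rV (T : topologicalType) n (F : T -> 'rV[R]_n) (x : T) :
  (forall i, {for x, continuous (fun y => F y 0 i)}) -> {for x, continuous F}.
Proof.
move=> cF; apply/cvg_ballP => e e0.
have : forall i, \forall y \near x, ball (F x 0 i) e (F y 0 i).
  by move=> i; have /cvg_ballP := cF i; apply.
move=> /filter_forall; apply: filterS => y Fy.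
by split=> // i j; rewrite ord1; exact: Fy.
Qed.

Lemma is_derive_mulmx N n (g : R -> 'rV[R]_N) (B : 'M[R]_(N, n)) s :
  derivable g s 1 ->
  derivable (fun u => g u *m B) s 1 /\
  derive1 (fun u => g u *m B) s = derive1 g s *m B.
Proof.
move=> dg.
have D i j : is_derive s 1 (fun u => (g u *m B) i j)
    (\sum_k (derive1 g s) i k * B k j).
  rewrite (_ : (fun u => _) = fun u => \sum_k g u i k * B k j); last first.
    by apply/funext => u; rewrite mxE.
  apply: isd_sum => k _.
  have Dg : is_derive s 1 (fun u => g u i k) ((derive1 g s) i k).
    rewrite derive1E derive_mx// mxE; apply: DeriveDef => //.
    by move/derivable_mxP : dg; apply.
  by isd_tac; ring.
have dgB : derivable (fun u => g u *m B) s 1.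
  by apply/derivable_mxP => i j; case: (D i j).
split=> //; rewrite derive1E derive_mx//; apply/matrixP => i j.
by rewrite !mxE; case: (D i j).
Qed.

Lemma continuous_mulmxr N n (B : 'M[R]_(N, n)) : continuous (fun v : 'rV[R]_N => v *m B).
Proof.
move=> v; apply: cont_rV => j.
rewrite (_ : (fun u => _) = fun u : 'rV[R]_N => \sum_k u 0 k * B k j); last first.
  by apply/funext => u; rewrite mxE.
apply: cont_sum => k _; apply: contM; last exact: cont_cst.
exact: coord_continuous.
Qed.

Section embedded.
Context (N n : nat) (M : embedded R N n).

Lemma geodesic_distance_xx x : carrier M x -> geodesic_distance M x x = 0.
Proof.
move=> Mx; apply/eqP; rewrite eq_le; apply/andP; split; last first.
  apply: lb_le_inf.
    exists (curve_length M (fun=> x)), (fun=> x) => //; split=> //.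
    by move=> s; rewrite (_ : derive1 _ = fun=> 0)//; [exact: cst_continuous|
      apply/funext => u; rewrite derive1_cst].
  by move=> _ [g _ <-]; apply: Rintegral_ge0 => s _; exact: sqrtr_ge0.
apply: ge_inf.
  by exists 0 => _ [g _ <-]; apply: Rintegral_ge0 => s _; exact: sqrtr_ge0.
exists (fun=> x); first split=> //.
  by move=> s; rewrite (_ : derive1 _ = fun=> 0)//; [exact: cst_continuous|
    apply/funext => u; rewrite derive1_cst].
rewrite /curve_length (@eq_Rintegral _ _ _ _ _ (fun=> 0)).
  by rewrite Rintegral_cst// mul0r.
by move=> s _; rewrite derive1_cst /pairing !mul0mx mxE sqrtr0.
Qed.

(** [B] carries curves to curves of the same length, which gives one inclusion between the sets of
    lengths. As [B] is an involution, the same inclusion at the image points is the converse. *)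
Lemma geodesic_distance_isometry (B : 'M[R]_N) :
  B *m Defs.form M *m B^T = Defs.form M -> B *m B = 1%:M ->
  (forall x, carrier M x -> carrier M (x *m B)) ->
  forall x y, geodesic_distance M (x *m B) (y *m B) = geodesic_distance M x y.
Proof.
move=> BM BB MB x y.
have sub u v : [set curve_length M g | g in C1_curve M u v] `<=`
    [set curve_length M g | g in C1_curve M (u *m B) (v *m B)].
  move=> _ [g [g0 g1 gM dg cg] <-]; exists (fun s => g s *m B).
    split; [by rewrite g0|by rewrite g1|by move=> s s01; apply/MB/gM| |].
      by move=> s; have [] := is_derive_mulmx B (dg s).
    have -> : derive1 (fun s => g s *m B) = (fun v => v *m B) \o derive1 g.
      by apply/funext => s /=; have [] := is_derive_mulmx B (dg s).
    move=> s; apply: continuous_comp; first exact: cg.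
    exact: continuous_mulmxr.
  apply: eq_Rintegral => s _; congr Num.sqrt.
  have [_ ->] := is_derive_mulmx B (dg s).
  by rewrite /pairing trmx_mul !mulmxA -(mulmxA _ B) -(mulmxA _ (B *m _)) BM.
congr inf; apply/seteqP; split; last exact: sub.
by have := sub (x *m B) (y *m B); rewrite -!mulmxA BB !mulmx1.
Qed.

End embedded.

Lemma sqnormE n (x : 'rV[R]_n) : sqnorm x = (x *m x^T) 0 0.
Proof. by rewrite mxE; apply: eq_bigr => i _; rewrite mxE expr2. Qed.

Lemma sqnorm_ge0 n (x : 'rV[R]_n) : 0 <= sqnorm x.
Proof. by apply: sumr_ge0 => i _; exact: sqr_ge0. Qed.

Lemma sqnormZ n a (x : 'rV[R]_n) : sqnorm (a *: x) = a ^+ 2 * sqnorm x.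
Proof. by rewrite mulr_sumr; apply: eq_bigr => i _; rewrite mxE exprMn. Qed.

Lemma sqnorm_delta n (i : 'I_n) : sqnorm (delta_mx 0 i : 'rV[R]_n) = 1.
Proof.
rewrite /sqnorm (bigD1 i)//= big1 ?mxE ?eqxx ?expr1n ?addr0// => j ji.
by rewrite mxE (negbTE ji) andbF expr0n.
Qed.

(** The reflection in the hyperplane orthogonal to [x - |x| e_0]; when that vector is zero, the
    identity. *)
Lemma householder k (x : 'rV[R]_k.+1) : exists O : 'M[R]_k.+1,
  [/\ O^T = O, O *m O = 1%:M & x *m O = Num.sqrt (sqnorm x) *: delta_mx 0 0].
Proof.
set r := Num.sqrt _; pose e := delta_mx 0 0 : 'rV[R]_k.+1.
pose v := x - r *: e; pose q := sqnorm v.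
have [v0|v0] := eqVneq q 0.
  exists 1%:M; rewrite trmx1 !mulmx1; split=> //.
  apply/eqP; rewrite -subr_eq0 -/v; apply/eqP/rowP => i; rewrite [RHS]mxE.
  apply/eqP; rewrite -sqrf_eq0 eq_le sqr_ge0 andbT -v0 /q /sqnorm.
  by rewrite (bigD1 i)//= lerDl sumr_ge0// => j _; exact: sqr_ge0.
have vvT : v *m v^T = q%:M by apply/matrixP => i j; rewrite !ord1 /q sqnormE [in RHS]mxE.
exists (1%:M - (2 / q) *: (v^T *m v)); split.
- by rewrite linearB/= linearZ/= trmx1 trmx_mul trmxK.
- set W := v^T *m v; have WW : W *m W = q *: W.
    by rewrite /W mulmxA -(mulmxA _ v) vvT mul_mx_scalar -scalemxAl.
  rewrite mulmxBl !mulmxBr !mul1mx mulmx1 -!scalemxAl -!scalemxAr WW !scalerA.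
  rewrite (_ : 2 / q * (2 / q) * q = 2 / q + 2 / q); last by field.
  by rewrite scalerDl opprB addrK subrK.
rewrite mulmxBr mulmx1 -scalemxAr mulmxA.
have xvT : x *m v^T = (q / 2)%:M.
  apply/matrixP => i j; rewrite !ord1 [RHS]mxE eqxx mulr1n.
  have rr : r ^+ 2 = sqnorm x by rewrite sqr_sqrtr// sqnorm_ge0.
  (* [|v|^2 - 2 <x, v> = |v - x|^2 - |x|^2] with [v - x = - r e]; it vanishes because [r = |x|],
     hence [<x, v> = q / 2]. *)
  have E : q - 2 * (x *m v^T) 0 0 = r ^+ 2 * sqnorm e - sqnorm x.
    rewrite /q /sqnorm mxE !mulr_sumr -!sumrB; apply: eq_bigr => l _.
    by rewrite !mxE; ring.
  rewrite sqnorm_delta mulr1 rr subrr in E.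
  by apply: (mulfI (_ : 2 != 0 :> R)); rewrite ?pnatr_eq0// mulrCA divff ?pnatr_eq0// mulr1;
    apply/esym/eqP; rewrite -subr_eq0 E.
by rewrite xvT mul_scalar_mx scalerA mulrA divfK// divff ?pnatr_eq0// scale1r /v opprB addrCA subrr addr0.
Qed.

(** [B] is the reflection above extended by [1] on the coordinate [x_0]; it therefore preserves both
    the Minkowski and the Euclidean form and fixes the base point. *)
Lemma radial_point k (x : 'rV[R]_k.+1) : exists B : 'M[R]_(1 + k.+1),
  [/\ B *m B = 1%:M, B *m B^T = 1%:M, B *m Defs.minkowski R k.+1 *m B^T = Defs.minkowski R k.+1,
      forall a (y : 'rV[R]_k.+1), exists z, row_mx a%:M y *m B = row_mx a%:M z &
      forall a b, row_mx a%:M (b *: x) *m B =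
        row_mx a%:M (b *: (Num.sqrt (sqnorm x) *: delta_mx 0 0))].
Proof.
have [Q [OT OO xO]] := householder x.
exists (block_mx 1%:M 0 0 Q); split.
- by rewrite mulmx_block !(mul0mx, mulmx0, mul1mx, addr0, add0r) OO -scalar_mx_block.
- rewrite tr_block_mx !trmx0 trmx1 OT.
  by rewrite mulmx_block !(mul0mx, mulmx0, mul1mx, addr0, add0r) OO -scalar_mx_block.
- rewrite tr_block_mx !trmx0 trmx1 OT /Defs.minkowski.
  by rewrite !mulmx_block !(mul0mx, mulmx0, mul1mx, mulmx1, addr0, add0r) OO.
- by move=> a y; exists (y *m Q); rewrite mul_row_block !mulmx0 mulmx1 addr0 add0r.
- by move=> a b; rewrite mul_row_block !mulmx0 mulmx1 addr0 add0r -scalemxAl xO.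
Qed.

Definition base_point n : 'rV[R]_(1 + n) := row_mx 1%:M 0.

Lemma hyperboloid_chart0 n : hyperboloid_chart (0 : 'rV[R]_n) = base_point n.
Proof.
rewrite /hyperboloid_chart /base_point /sqnorm big1 ?addr0 ?sqrtr1// => i _.
by rewrite mxE expr0n.
Qed.

Lemma stereographic_chart0 n : stereographic_chart false (0 : 'rV[R]_n) = base_point n.
Proof.
rewrite /stereographic_chart /base_point /sqnorm big1 ?addr0 ?subr0 => [|i _]; last first.
  by rewrite mxE expr0n.
by rewrite invr1 scale1r expr0 mulr1 scaler0.
Qed.

Lemma hyperboloid_chart_carrier n (x : 'rV[R]_n) :
  carrier (hyperbolic_space R n) (hyperboloid_chart x).
Proof.
have s0 : 0 < 1 + sqnorm x by rewrite ltr_pwDl// sqnorm_ge0.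
rewrite /=; split; last by rewrite /hyperboloid_chart -(lshift0 n 0) row_mxEl mxE mulr1n sqrtr_gt0.
rewrite /hyperboloid_chart /Defs.minkowski tr_row_mx mul_row_block mul_row_col.
rewrite !mulmx0 addr0 add0r mulmx1 [LHS]mxE -sqnormE.
rewrite mulmxN mulmx1 mulNmx !mxE big_ord1 !mxE eqxx !mulr1n.
by rewrite -expr2 sqr_sqrtr ?ltW//; ring.
Qed.

Lemma stereographic_chart_carrier n b (x : 'rV[R]_n) :
  carrier (sphere R n) (stereographic_chart b x).
Proof.
have s0 : 1 + sqnorm x != 0 by rewrite gt_eqF// ltr_pwDl// sqnorm_ge0.
rewrite /= /stereographic_chart -scalemxAl linearZ/= -scalemxAr scalerA.
rewrite tr_row_mx mul_row_col [LHS]mxE [X in _ * X]mxE -[((2 *: x) *m _) 0 0]sqnormE sqnormZ.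
rewrite !mxE big_ord1 !mxE eqxx !mulr1n.
have -> : (-1) ^+ b * (1 - sqnorm x) * ((-1) ^+ b * (1 - sqnorm x)) = (1 - sqnorm x) ^+ 2.
  by rewrite mulrACA -expr2 sqrr_sign mul1r expr2.
have -> : (1 - sqnorm x) ^+ 2 + 2 ^+ 2 * sqnorm x = (1 + sqnorm x) ^+ 2 by ring.
by rewrite expr2; field.
Qed.

Lemma hyperboloid_dist_radial k (x : 'rV[R]_k.+1) :
  geodesic_distance (hyperbolic_space R k.+1) (hyperboloid_chart x) (base_point _) =
  geodesic_distance (hyperbolic_space R k.+1)
    (hyperboloid_chart (Num.sqrt (sqnorm x) *: delta_mx 0 0)) (base_point _).
Proof.
have [B [BB BBT BM By Bx]] := radial_point x.
rewrite -(geodesic_distance_isometry (B := B))//.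
  rewrite /hyperboloid_chart sqnormZ sqnorm_delta mulr1 sqr_sqrtr ?sqnorm_ge0//.
  congr (geodesic_distance _ _ _).
    by rewrite -{2}[x]scale1r Bx scale1r.
  by have := Bx 1 0; rewrite !scale0r.
move=> /= z [zM z0]; split.
  by rewrite trmx_mul !mulmxA -(mulmxA _ B) -(mulmxA _ (B *m _)) BM.
have [a [y zE]] : exists a (y : 'rV_k.+1), z = row_mx a%:M y.
  by exists (lsubmx z 0 0), (rsubmx z); rewrite -mx11_scalar hsubmxK.
have [w] := By a y; rewrite -zE => ->; move: z0; rewrite zE.
by rewrite -(lshift0 k.+1 0) !row_mxEl.
Qed.

Lemma stereographic_dist_radial k b (x : 'rV[R]_k.+1) :
  geodesic_distance (sphere R k.+1) (stereographic_chart b x) (base_point _) =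
  geodesic_distance (sphere R k.+1)
    (stereographic_chart b (Num.sqrt (sqnorm x) *: delta_mx 0 0)) (base_point _).
Proof.
have [B [BB BBT BM By Bx]] := radial_point x.
rewrite -(geodesic_distance_isometry (B := B))//.
- rewrite /stereographic_chart sqnormZ sqnorm_delta mulr1 sqr_sqrtr ?sqnorm_ge0//.
  congr (geodesic_distance _ _ _).
    by rewrite -scalemxAl Bx.
  by have := Bx 1 0; rewrite !scale0r.
- by rewrite /= mulmx1.
- by move=> /= z zM; rewrite trmx_mul !mulmxA -(mulmxA _ B) BBT mulmx1.
Qed.

End Isometries.

(** * The Laplace-Beltrami operator on radial functions *)

Section Partials.
Context (R : realType).
Local Notation e_ i := (delta_mx 0 i).

Lemma is_derive_line n (i : 'I_n) (f : 'rV[R]_n -> R) (x : 'rV[R]_n) (l : R) :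
  is_derive (0 : R) (1 : R) (fun h : R => f (h *: e_ i + x)) l <-> is_derive x (e_ i) f l.
Proof.
have E : (fun h : R => h^-1 *: ((fun h : R => f (h *: e_ i + x)) (h *: 1 + 0) -
    (fun h : R => f (h *: e_ i + x)) 0)) = (fun h : R => h^-1 *: (f (h *: e_ i + x) - f x)).
  by apply/funext => h /=; rewrite addr0 scale0r add0r /GRing.scale/= mulr1.
by split=> -[D <-]; (apply: DeriveDef; [move: D; rewrite /derivable E //| rewrite /derive E//]).
Qed.

Lemma partialE n (i : 'I_n) (f : 'rV[R]_n -> R) x (l : R) :
  is_derive x (e_ i) f l -> partial i f x = l.
Proof. by case. Qed.

Lemma sqnorm_line n (i : 'I_n) (x : 'rV[R]_n) h :
  sqnorm (h *: e_ i + x) = sqnorm x + 2 * h * x 0 i + h ^+ 2.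
Proof.
rewrite /sqnorm (bigD1 i)//= [in RHS](bigD1 i)//= !mxE !eqxx mulr1.
rewrite (eq_bigr (fun j => x 0 j ^+ 2)); first by ring.
by move=> j /negbTE ji; rewrite !mxE ji andbF mulr0 add0r.
Qed.

Lemma is_partial_radial n (i : 'I_n) (B : R -> R) (dB : R) (x : 'rV[R]_n) :
  is_derive (sqnorm x) 1 B dB ->
  is_derive x (e_ i) (fun y => B (sqnorm y)) (2 * x 0 i * dB).
Proof.
move=> DB; apply/is_derive_line.
rewrite (_ : (fun h => _) = fun h => B (sqnorm x + 2 * h * x 0 i + h ^+ 2)); last first.
  by apply/funext => h; rewrite sqnorm_line.
have D : is_derive (0 : R) 1 (fun h : R => sqnorm x + 2 * h * x 0 i + h ^+ 2) (2 * x 0 i).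
  by isd_tac; ring.
have DB' : is_derive (sqnorm x + 2 * 0 * x 0 i + 0 ^+ 2) 1 B dB.
  by rewrite mulr0 mul0r expr0n !addr0.
by apply: isd_eq (isd_comp D DB') _; rewrite mulrC.
Qed.

Lemma is_partial_coord n (i j : 'I_n) (x : 'rV[R]_n) :
  is_derive x (e_ i) (fun y : 'rV[R]_n => y 0 j) ((i == j)%:R).
Proof.
apply/is_derive_line.
rewrite (_ : (fun h => _) = fun h : R => h * (i == j)%:R + x 0 j); last first.
  by apply/funext => h; rewrite !mxE eqxx eq_sym.
by isd_tac; ring.
Qed.

Lemma is_partialM n (i : 'I_n) (f g : 'rV[R]_n -> R) x (df dg : R) :
  is_derive x (e_ i) f df -> is_derive x (e_ i) g dg ->
  is_derive x (e_ i) (fun y => f y * g y) (f x * dg + g x * df).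
Proof.
move=> /is_derive_line Df /is_derive_line Dg; apply/is_derive_line.
by have := isdM Df Dg; rewrite !scale0r !add0r.
Qed.

Lemma near_sqnorm n (x : 'rV[R]_n) (P : R -> Prop) :
  (\forall s \near sqnorm x, P s) -> \forall y \near x, P (sqnorm y).
Proof.
have : {for x, continuous (@sqnorm R n)}.
  rewrite /sqnorm; apply: cont_sum => i _; apply: contX; exact: coord_continuous.
by apply.
Qed.

Lemma continuous_sqnorm n : continuous (@sqnorm R n).
Proof.
move=> x; rewrite /sqnorm; apply: (@cont_sum R _ _ _ _ (fun i (y : 'rV[R]_n) => y 0 i ^+ 2)) => i _.
by apply: contX; exact: coord_continuous.
Qed.

Lemma near_is_partial n (i : 'I_n) (f g : 'rV[R]_n -> R) x (l : R) :
  (\forall y \near x, f y = g y) -> is_derive x (e_ i) f l -> is_derive x (e_ i) g l.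
Proof. by move=> fg; exact: near_eq_is_derive. Qed.

Section LaplaceRadial.
Context (N n : nat) (M : embedded R N n) (c : chart_index M).
Variables (dens alpha beta : R -> R).
Hypothesis densE : forall x, density c x = dens (sqnorm x).
Hypothesis invE : forall x i j, (invmx (metric c x)) i j =
  alpha (sqnorm x) * (i == j)%:R + beta (sqnorm x) * (x 0 i * x 0 j).

(** With [s = |x|^2], the gradient of [B s] is [2 B' x], and the inverse metric [alpha + beta x^T x]
    multiplies [x] by [alpha + beta s]. The flux is thus [F s] times [x], of Euclidean divergence
    [n F + 2 s F']. *)
Lemma laplace_radial (B B1 : R -> R) (dPhi : R) (F : R -> R) (u : 'rV[R]_n -> R)
    (x : 'rV[R]_n) :
  (\forall y \near x, u y = B (sqnorm y)) ->
  (\forall s \near sqnorm x, is_derive (s : R) 1 B (B1 s)) ->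
  (\forall s \near sqnorm x, F s = 2 * dens s * (alpha s + beta s * s) * B1 s) ->
  is_derive (sqnorm x) 1 F dPhi ->
  laplace_beltrami c u x =
    (dens (sqnorm x))^-1 * (n%:R * F (sqnorm x) + 2 * sqnorm x * dPhi).
Proof.
move=> uB DB FE DF; rewrite /laplace_beltrami densE; congr (_ * _).
have flux (i : 'I_n) : \forall y \near x, (y : 'rV[R]_n) 0 i * F (sqnorm y) =
    density c y * \sum_j (invmx (metric c y)) i j * partial j u y.
  have uBn := near_join uB; have DBn := near_sqnorm DB; have FEn := near_sqnorm FE.
  near=> y.
  have -> : F (sqnorm y) = 2 * dens (sqnorm y) * (alpha (sqnorm y) + beta (sqnorm y) * sqnorm y) * B1 (sqnorm y).
    by near: y.
  have pE j : partial j u y = 2 * y 0 j * B1 (sqnorm y).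
    apply: partialE; apply: (@near_is_partial _ _ (fun z => B (sqnorm z))).
      have : \forall z \near y, u z = B (sqnorm z) by near: y.
      by apply: filterS => z ->.
    by apply: is_partial_radial; near: y.
  rewrite densE (eq_bigr (fun j => alpha (sqnorm y) * 2 * B1 (sqnorm y) * (y 0 j * (i == j)%:R) +
      beta (sqnorm y) * 2 * B1 (sqnorm y) * y 0 i * (y 0 j ^+ 2))); last first.
    by move=> j _; rewrite invE pE; ring.
  rewrite big_split/= -!mulr_sumr -/(sqnorm y).
  rewrite (bigD1 i)//= eqxx mulr1 big1 ?addr0; last first.
    by move=> j; rewrite eq_sym => /negbTE ->; rewrite mulr0.
  by ring.
rewrite (eq_bigr (fun i => F (sqnorm x) + 2 * dPhi * x 0 i ^+ 2)); last first.
  move=> i _; apply: partialE; apply: near_is_partial (flux i) _.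
  have D := is_partialM (is_partial_coord i i x) (is_partial_radial i DF).
  by move: D; rewrite eqxx mulr1n => -[D E]; apply: DeriveDef => //; rewrite E; ring.
rewrite big_split/= -mulr_sumr sumr_const card_ord -/(sqnorm x) mulr_natl.
by congr (_ + _); ring.
Unshelve. all: by end_near. Qed.

End LaplaceRadial.
End Partials.

Section Metrics.
Context (R : realType).
Local Notation e_ i := (delta_mx 0 i).

Lemma is_derive_rV (V : normedModType R) n (F : V -> 'rV[R]_n) (x v : V) (l : 'rV[R]_n) :
  (forall j, is_derive x v (fun y => F y 0 j) (l 0 j)) -> is_derive x v F l.
Proof.
move=> H; have D : derivable F x v.
  by apply/derivable_mxP => i j; rewrite ord1; case: (H j).
apply: DeriveDef => //; rewrite derive_mx//; apply/rowP => j.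
by rewrite mxE; case: (H j).
Qed.

(** One block matrix is factored through the Schur complement of either diagonal block. *)
Lemma det_rank1 n (u v : 'rV[R]_n) : \det (1%:M + u^T *m v) = 1 + (v *m u^T) 0 0.
Proof.
pose A := block_mx (1%:M : 'M[R]_1) (- v) u^T 1%:M.
have E1 : A = block_mx 1%:M 0 u^T 1%:M *m block_mx 1%:M (- v) 0 (1%:M + u^T *m v).
  rewrite mulmx_block !(mul1mx, mul0mx, mulmx1, mulmx0, addr0, add0r).
  by rewrite mulmxN addrCA addNr addr0.
have E2 : A = block_mx (1%:M + v *m u^T) (- v) 0 1%:M *m block_mx 1%:M 0 u^T 1%:M.
  rewrite mulmx_block !(mul1mx, mul0mx, mulmx1, mulmx0, addr0, add0r).
  by rewrite mulNmx addrK.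
have := congr1 (fun M => \det M) E1; rewrite E2 !det_mulmx !det_ublock !det_lblock !det1 !mulr1 !mul1r.
by move=> <-; rewrite det_mx11 !mxE.
Qed.

Lemma invmx_eq n (A B : 'M[R]_n) : A *m B = 1%:M -> invmx A = B.
Proof.
by move=> AB; have [uA _] := mulmx1_unit AB; rewrite -[RHS](mulKmx uA) AB mulmx1.
Qed.

Lemma pairing_minkowski n (v w : 'rV[R]_(1 + n)) :
  (v *m Defs.minkowski R n *m w^T) 0 0 =
  - (v 0 0 * w 0 0) + \sum_(k < n) v 0 (rshift 1 k) * w 0 (rshift 1 k).
Proof.
rewrite -[v]hsubmxK -[w]hsubmxK /Defs.minkowski mul_row_block tr_row_mx mul_row_col.
rewrite !mulmx0 addr0 add0r mulmxN !mulmx1 mulNmx 3!mxE big_ord1 [X in _ + X]mxE.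
rewrite -(lshift0 n 0) !row_mxEl !mxE; congr (_ + _).
by apply: eq_bigr => k _; rewrite !row_mxEr !mxE.
Qed.

Lemma pairing_euclid n (v w : 'rV[R]_(1 + n)) :
  (v *m 1%:M *m w^T) 0 0 =
  v 0 0 * w 0 0 + \sum_(k < n) v 0 (rshift 1 k) * w 0 (rshift 1 k).
Proof.
by rewrite mulmx1 mxE big_split_ord big_ord1 /= !mxE (lshift0 n 0);
  congr (_ + _); apply: eq_bigr => k _; rewrite mxE.
Qed.

Lemma split_1n n (P : 'I_(1 + n) -> Prop) :
  P 0 -> (forall k, P (rshift 1 k)) -> forall j, P j.
Proof.
move=> P0 PS j; rewrite -(splitK j); case: (fintype.split j) => k //=.
by rewrite ord1 (_ : lshift n 0 = 0)//; apply: val_inj.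
Qed.

Lemma sum_delta n (i : 'I_n) (f : 'I_n -> R) : \sum_k (i == k)%:R * f k = f i.
Proof.
rewrite (bigD1 i)//= eqxx mul1r big1 ?addr0// => k.
by rewrite eq_sym => /negbTE ->; rewrite mul0r.
Qed.

Section hyperbolic.
Variable n : nat.
Implicit Type x : 'rV[R]_n.

Lemma sqnorm1_gt0 x : 0 < 1 + sqnorm x.
Proof. by rewrite ltr_pwDl// sqnorm_ge0. Qed.

Lemma hyperboloid_partial x i :
  partial i (@hyperboloid_chart R n) x =
  row_mx (x 0 i / Num.sqrt (1 + sqnorm x))%:M (e_ i).
Proof.
suff : is_derive x (e_ i) (@hyperboloid_chart R n)
  (row_mx (x 0 i / Num.sqrt (1 + sqnorm x))%:M (e_ i)) by case.
apply: is_derive_rV; apply: split_1n => [|k].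
- rewrite -(lshift0 n 0) row_mxEl mxE mulr1n.
  rewrite (_ : (fun y => _) = fun y => Num.sqrt (1 + sqnorm y)); last first.
    by apply/funext => y; rewrite /hyperboloid_chart row_mxEl mxE mulr1n.
  have D : is_derive (sqnorm x) 1 (fun s : R => Num.sqrt (1 + s)) (1 / (2 * Num.sqrt (1 + sqnorm x))).
    by isd_tac; [exact: sqnorm1_gt0|by []].
  have [D1 D2] := is_partial_radial i D; apply: DeriveDef => //; rewrite D2.
  field; rewrite gt_eqF ?sqrtr_gt0 ?sqnorm1_gt0//.
- rewrite row_mxEr mxE eqxx /=.
  rewrite (_ : (fun y => _) = fun y : 'rV[R]_n => y 0 k); last first.
    by apply/funext => y; rewrite /hyperboloid_chart row_mxEr.
  by rewrite (eq_sym k); exact: is_partial_coord.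
Qed.

Lemma hyperboloid_metric x : metric (M := hyperbolic_space R n) tt x =
  1%:M + (- (1 + sqnorm x)^-1 *: x)^T *m x.
Proof.
apply/matrixP => i j; rewrite mxE /pairing /= !hyperboloid_partial pairing_minkowski.
rewrite -(lshift0 n 0) !row_mxEl !mxE !mulr1n big_ord1 !mxE.
rewrite (eq_bigr (fun k => (i == k)%:R * (j == k)%:R)); last first.
  by move=> k _; rewrite !row_mxEr !mxE /= (eq_sym k) (eq_sym k).
rewrite sum_delta (eq_sym j).
have /sqr_sqrtr E : 0 <= 1 + sqnorm x by rewrite ltW// sqnorm1_gt0.
rewrite -[in RHS]E; set s := Num.sqrt _.
by have s0 : s != 0; [rewrite gt_eqF// sqrtr_gt0 sqnorm1_gt0|field].
Qed.

Lemma hyperboloid_density x :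
  density (M := hyperbolic_space R n) tt x = (Num.sqrt (1 + sqnorm x))^-1.
Proof.
rewrite /density hyperboloid_metric det_rank1 linearZ/= -scalemxAr mxE -sqnormE.
rewrite (_ : 1 + _ = (1 + sqnorm x)^-1) ?sqrtrV ?ltW ?sqnorm1_gt0//.
by have := lt0r_neq0 (sqnorm1_gt0 x) => s0; field.
Qed.

Lemma hyperboloid_inv x i j : (invmx (metric (M := hyperbolic_space R n) tt x)) i j =
  1 * (i == j)%:R + 1 * (x 0 i * x 0 j).
Proof.
(* The inverse of the rank-one perturbation [1 - x^T x / (1 + |x|^2)], found by the Sherman-Morrison
   formula. *)
rewrite (@invmx_eq _ _ (1%:M + x^T *m x)); last first.
  rewrite hyperboloid_metric linearZ/= -scalemxAl; set W := x^T *m x.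
  have WW : W *m W = sqnorm x *: W.
    rewrite /W mulmxA -(mulmxA _ x).
    have -> : x *m x^T = (sqnorm x)%:M.
      by apply/matrixP => a b; rewrite !ord1 sqnormE [RHS]mxE.
    by rewrite mul_mx_scalar -scalemxAl.
  rewrite mulmxDl mul1mx mulmxDr mulmx1 -scalemxAl WW scalerA -addrA -scalerDl.
  have s0 := lt0r_neq0 (sqnorm1_gt0 x).
  have -> : - (1 + sqnorm x)^-1 + - (1 + sqnorm x)^-1 * sqnorm x = -1 by field.
  by rewrite scaleN1r subrr addr0.
by rewrite !mxE big_ord1 !mxE !mul1r.
Qed.

End hyperbolic.

Section spherical.
Variable n : nat.
Implicit Type x : 'rV[R]_n.

Lemma stereographic_partial b x i :
  partial i (@stereographic_chart R n b) x =
  row_mx (- ((-1) ^+ b * 4 * x 0 i / (1 + sqnorm x) ^+ 2))%:M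
   ((2 / (1 + sqnorm x)) *: e_ i - (4 * x 0 i / (1 + sqnorm x) ^+ 2) *: x).
Proof.
have s0 := lt0r_neq0 (sqnorm1_gt0 x).
set L := row_mx _ _.
suff : is_derive x (e_ i) (@stereographic_chart R n b) L by case.
apply: is_derive_rV; apply: split_1n => [|k].
- rewrite /L -(lshift0 n 0) row_mxEl mxE mulr1n.
  rewrite (_ : (fun y => _) = fun y => (-1) ^+ b * (1 - sqnorm y) / (1 + sqnorm y)); last first.
    apply/funext => y; rewrite /stereographic_chart mxE row_mxEl mxE mulr1n.
    by rewrite mulrC.
  have D : is_derive (sqnorm x) 1 (fun s : R => (-1) ^+ b * (1 - s) / (1 + s)) (- ((-1) ^+ b * 2) / (1 + sqnorm x) ^+ 2).
    by isd_tac; [exact: s0|field].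
  have [D1 D2] := is_partial_radial i D; apply: DeriveDef => //; rewrite D2.
  by field.
- rewrite /L row_mxEr !mxE eqxx /=.
  rewrite (_ : (fun y => _) = fun y : 'rV[R]_n => y 0 k * (2 / (1 + sqnorm y))); last first.
    by apply/funext => y; rewrite /stereographic_chart mxE row_mxEr mxE; ring.
  have D : is_derive (sqnorm x) 1 (fun s : R => 2 / (1 + s)) (- 2 / (1 + sqnorm x) ^+ 2).
    by isd_tac; [exact: s0|field].
  have [D1 D2] := is_partialM (is_partial_coord i k x) (is_partial_radial i D).
  apply: DeriveDef => //; rewrite D2 (eq_sym k).
  by field.
Qed.

Lemma stereographic_metric b x : metric (M := sphere R n) b x =
  ((2 / (1 + sqnorm x)) ^+ 2)%:M.
Proof.
have s0 := lt0r_neq0 (sqnorm1_gt0 x).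
apply/matrixP => i j; rewrite mxE /pairing /= !stereographic_partial pairing_euclid.
rewrite -(lshift0 n 0) !row_mxEl !mxE !mulr1n.
set q := 1 + sqnorm x in s0 *.
rewrite (eq_bigr (fun k => (2 / q) ^+ 2 * ((i == k)%:R * (j == k)%:R)
   - (8 * x 0 j / q ^+ 3) * ((i == k)%:R * x 0 k) - (8 * x 0 i / q ^+ 3) * ((j == k)%:R * x 0 k)
   + (16 * x 0 i * x 0 j / q ^+ 4) * x 0 k ^+ 2)); last first.
  move=> k _; rewrite !row_mxEr !mxE /= (eq_sym k) (eq_sym k).
  by field.
rewrite !big_split/= !sumrN -!mulr_sumr !sum_delta -/(sqnorm x).
have -> : sqnorm x = q - 1 by rewrite /q addrC addKr.
have -> : - ((-1) ^+ b * 4 * x 0 i / q ^+ 2) * - ((-1) ^+ b * 4 * x 0 j / q ^+ 2) =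
  ((-1) ^+ b * (-1) ^+ b) * (16 * x 0 i * x 0 j / q ^+ 4) by field.
rewrite -expr2 sqrr_sign (eq_sym j) -mulr_natr.
by field.
Qed.

Lemma stereographic_density b x :
  density (M := sphere R n) b x = (2 / (1 + sqnorm x)) ^+ n.
Proof.
rewrite /density stereographic_metric det_scalar -exprM mulnC exprM sqrtr_sqr ger0_norm//.
by rewrite exprn_ge0// divr_ge0// ltW// sqnorm1_gt0.
Qed.

Lemma stereographic_inv b x i j : (invmx (metric (M := sphere R n) b x)) i j =
  ((1 + sqnorm x) ^+ 2 / 4) * (i == j)%:R + 0 * (x 0 i * x 0 j).
Proof.
have s0 := lt0r_neq0 (sqnorm1_gt0 x).
rewrite (@invmx_eq _ _ ((1 + sqnorm x) ^+ 2 / 4)%:M).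
  by rewrite mxE mul0r addr0 mulr_natr.
rewrite stereographic_metric -scalar_mxM; congr (_%:M); by field.
Qed.

End spherical.
End Metrics.

(** * The radial heat kernel of odd-dimensional hyperbolic space *)

Section HeatTower.
Context (R : realType).
Implicit Types (s t u : R).

Lemma cont_isd (f : R -> R) (x df : R) : is_derive x 1 f df -> {for x, continuous f}.
Proof.
by move=> [D _]; apply: differentiable_continuous; exact/derivable1_diffP.
Qed.

Let Q u s : R := 1 + 2 * u ^+ 2 * s + u ^+ 4.

Let Q_gt0 u s : 0 <= s -> 0 < Q u s.
Proof.
move=> s0; have u4 : 0 <= u ^+ 4.
  by rewrite (_ : u ^+ 4 = (u ^+ 2) ^+ 2) ?sqr_ge0// -exprM.
have u2 := sqr_ge0 u; rewrite /Q -addrA ltr_pwDl//.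
by apply: addr_ge0 => //; apply: mulr_ge0 => //; apply: mulr_ge0.
Qed.

(** For [k = 0] the substitution [w = u^2] gives the integral of [2 / (1 + 2 s w + w^2)] over
    [[0, 1]], which is [d / sinh d] when [s = cosh d]. The other cases are its derivatives in [s]
    under the integral sign, without the sign [(-1)^k]. *)
Let phi_int k s u : R := 4 * u * k`!%:R * (2 * u ^+ 2) ^+ k / Q u s ^+ k.+1.

(* For [s > 1], [phi k s] is the [k]-th derivative of [arccosh s / sqrt (s^2 - 1)]
   up to the sign [(-1)^k]; the integral is smooth, and positive, across [s = 1]. *)
Definition phi k s : R := integ 0 1 (phi_int k s).

Let phi_int_cont k s : 0 <= s -> continuous (phi_int k s).
Proof.
move=> s0 u; rewrite /phi_int /Q; cont_tac.
by rewrite expf_neq0// gt_eqF// Q_gt0.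
Qed.

Lemma is_derive_phi k s : 0 < s -> is_derive s 1 (phi k) (- phi k.+1 s).
Proof.
move=> s0.
have -> : - phi k.+1 s = integ 0 1 (fun u => - 1 * phi_int k.+1 s u).
  by rewrite integZ ?mulN1r//; apply: phi_int_cont; exact: ltW.
apply: (@is_derive_under_integ R (phi_int k) (fun s u => -1 * phi_int k.+1 s u) 0 (s + 1) 0 1).
- by rewrite s0 ltrDl/=.
- by move=> r /andP[r0 _]; apply: phi_int_cont; exact: ltW.
- move=> r u /andP[r0 _]; have Q0 : Q u r != 0 by rewrite gt_eqF// Q_gt0// ltW.
  rewrite /phi_int /Q.
  isd_tac; first by rewrite -/(Q u r) expf_neq0.
  rewrite -/(Q u r) factS natrM !exprS /=.
  have := expf_neq0 k Q0; set q := Q u r ^+ k => q0.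
  by field; rewrite q0.
- move=> r u /andP[r0 _]; rewrite /phi_int /Q; cont_tac.
  by rewrite -/(Q u r) expf_neq0// gt_eqF// Q_gt0// ltW.
Qed.

Lemma phi_cont k s : 0 < s -> {for s, continuous (phi k)}.
Proof. by move=> s0; exact: cont_isd (is_derive_phi k s0). Qed.

Lemma phi_ge0 k s : 0 <= s -> 0 <= phi k s.
Proof.
move=> s0; apply: integ_ge0 => u /andP[u0 _]; rewrite /phi_int.
by rewrite divr_ge0 ?mulr_ge0 ?exprn_ge0 ?mulr_ge0// ltW// Q_gt0.
Qed.

(* The antiderivative is [- 2 (s u^2 + 1) / (1 + 2 s u^2 + u^4)]. *)
Lemma phi_ode s : 0 < s -> s * phi 0 s - (s ^+ 2 - 1) * phi 1 s = 1.
Proof.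
move=> s0; have c k : continuous (phi_int k s) by apply: phi_int_cont; exact: ltW.
have c0 := c 0%N; have c1 := c 1%N.
rewrite /phi -!integZ// -integB; [|by move=> u; cont_tac|by move=> u; cont_tac].
pose F u := - 2 * (s * u ^+ 2 + 1) / Q u s.
transitivity (F 1 - F 0); last first.
  rewrite /F /Q !expr1n !expr0n/= !mulr0 !mul0r !addr0 !mulr1.
  have s1 : s + 1 != 0 by rewrite gt_eqF// ltr_wpDl// ltW.
  have s2 : 1 + 2 * s + 1 != 0 by apply: contra_neq s1; lra.
  by field; rewrite ?s1 ?s2.
apply: integ_FTC => //.
- by move=> u; cont_tac.
- by move=> u; rewrite /F /Q; cont_tac; rewrite -/(Q u s) gt_eqF// Q_gt0// ltW.
- move=> u _; have Q0 : Q u s != 0 by rewrite gt_eqF// Q_gt0// ltW.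
  rewrite /phi_int /F fact0 (_ : 1`! = 1%N)// !expr1 !expr0; move: Q0; rewrite /Q => Q0.
  by isd_tac; [exact: Q0|field].
Qed.

Lemma phi0_gt0 s : 1 <= s -> 0 < phi 0 s.
Proof.
move=> s1; have s0 : 0 < s by lra.
rewrite lt_neqAle phi_ge0 ?ltW// andbT eq_sym; apply/eqP => p0.
have := phi_ode s0; rewrite p0 mulr0 sub0r => E.
have : 0 <= (s ^+ 2 - 1) * phi 1 s.
  have s2 : 0 <= s ^+ 2 - 1 by rewrite subr_ge0 exprn_ege1.
  by rewrite mulr_ge0// phi_ge0// ltW.
by rewrite -oppr_le0 E ler10.
Qed.

(** The squared distance [d^2] when [s = cosh d], as [phi 0 s = d / sinh d]; written this way it is
    smooth across [s = 1]. *)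
Definition acosh2 s : R := (s ^+ 2 - 1) * phi 0 s ^+ 2.

Lemma is_derive_acosh2 s : 0 < s -> is_derive s 1 acosh2 (2 * phi 0 s).
Proof.
move=> s0; have D := is_derive_phi 0 s0.
rewrite /acosh2; isd_tac.
rewrite -[RHS]mulr1 -[X in _ = _ * X](phi_ode s0); ring.
Qed.

(* [v k t] is [(- d/ds)^k] applied to [t^(-1/2) exp (- arccosh^2 s / 4t)]. *)
Definition v0 t s : R := (Num.sqrt t)^-1 * expR (- acosh2 s / (4 * t)).

(* [vtab k] tabulates [v 0, ..., v k], so that the recursion, which refers to
   all the previous values, is structural. *)
Fixpoint vtab t s (k : nat) : nat -> R :=
  if k is k'.+1 then fun i => if (i <= k')%N then vtab t s k' i else
    (2 * t)^-1 * \sum_(j < k'.+1) 'C(k', j)%:R * phi j s * vtab t s k' (k' - j)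
  else fun=> v0 t s.

Definition v k t s : R := vtab t s k k.

Lemma vtabE t s k i : (i <= k)%N -> vtab t s k i = v i t s.
Proof.
elim: k => [|k IH]; first by rewrite leqn0 => /eqP ->.
by rewrite leq_eqVlt => /predU1P[->//|]; rewrite ltnS => ik; rewrite /= ik IH.
Qed.

(** The recursion is Leibniz's rule for [(- d/ds)^k] applied to the product
    [v 1 = phi 0 * v 0 / (2 t)]; no signs appear since they are built into [phi] and [v]. *)
Lemma vS k t s : v k.+1 t s =
  (2 * t)^-1 * \sum_(j < k.+1) 'C(k, j)%:R * (phi j s * v (k - j) t s).
Proof.
rewrite {1}/v /= ltnn; congr (_ * _); apply: eq_bigr => j _.
by rewrite vtabE ?leq_subr// mulrA.
Qed.

Lemma leibniz_pascal (a b : nat -> R) k :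
  \sum_(j < k.+1) 'C(k, j)%:R * (a j.+1 * b (k - j)%N + a j * b (k - j).+1) =
  \sum_(j < k.+2) 'C(k.+1, j)%:R * (a j * b (k.+1 - j)%N).
Proof.
rewrite [RHS]big_ord_recl /= bin0 subn0 mul1r.
under [in RHS]eq_bigr => j _ do rewrite /bump /= add1n binS natrD mulrDl subSS.
rewrite big_split /=; under eq_bigr => j _ do rewrite mulrDr.
rewrite big_split /= addrC [RHS]addrA; congr (_ + _).
rewrite big_ord_recl /= bin0 mul1r subn0; congr (_ + _).
rewrite [RHS]big_ord_recr /= bin_small// mul0r addr0.
by apply: eq_bigr => j _; rewrite /bump /= add1n subnSK.
Qed.

Lemma is_derive_leibniz (a b : nat -> R -> R) k s :
  (forall j, is_derive s 1 (a j) (- a j.+1 s)) ->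
  (forall j, (j <= k)%N -> is_derive s 1 (b j) (- b j.+1 s)) ->
  is_derive s 1 (fun s => \sum_(j < k.+1) 'C(k, j)%:R * (a j s * b (k - j)%N s))
   (- \sum_(j < k.+2) 'C(k.+1, j)%:R * (a j s * b (k.+1 - j)%N s)).
Proof.
move=> Da Db; rewrite -(leibniz_pascal (a^~ s) (b^~ s)) -sumrN.
apply: isd_sum => j _; have Daj := Da j; have Dbj := Db _ (leq_subr j k).
by isd_tac; ring.
Qed.

Lemma is_derive_v k t s : 0 < t -> 0 < s -> is_derive s 1 (v k t) (- v k.+1 t s).
Proof.
move=> t0; elim/ltn_ind: k s => -[|k] IH s s0.
  rewrite vS big_ord1 bin0 mul1r subn0 /v /= /v0.
  have DA := is_derive_acosh2 s0; isd_tac.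
  have tn0 : t != 0 by rewrite gt_eqF.
  have qn0 : Num.sqrt t != 0 by rewrite gt_eqF// sqrtr_gt0.
  by field; rewrite ?tn0 ?qn0.
rewrite (_ : v k.+1 t = fun s => (2 * t)^-1 *
   \sum_(j < k.+1) 'C(k, j)%:R * (phi j s * v (k - j) t s)); last first.
  by apply/funext => r; rewrite vS.
have D : is_derive s 1 (fun s => \sum_(j < k.+1) 'C(k, j)%:R * (phi j s * v (k - j) t s))
   (- \sum_(j < k.+2) 'C(k.+1, j)%:R * (phi j s * v (k.+1 - j) t s)).
  apply: (@is_derive_leibniz phi (fun j => v j t)) => j; first exact: is_derive_phi.
  by move=> jk; apply: IH => //; rewrite ltnS.
by rewrite vS; isd_tac; ring.
Qed.

Lemma v_ge0 k t s : 0 < t -> 0 <= s -> 0 <= v k t s.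
Proof.
move=> t0 s0; elim/ltn_ind: k => -[|k] IH.
  by rewrite /v /= /v0 mulr_ge0 ?invr_ge0 ?sqrtr_ge0 ?expR_ge0.
rewrite vS; apply: mulr_ge0; first by rewrite invr_ge0 mulr_ge0// ltW.
apply: sumr_ge0 => j _.
by rewrite !mulr_ge0 ?phi_ge0// IH// ltnS leq_subr.
Qed.

Lemma v_cont k t s : 0 < t -> 0 < s ->
  {for (t, s), continuous (fun z : R * R => v k z.1 z.2)}.
Proof.
move=> t0 s0; elim/ltn_ind: k => -[|k] IH.
  rewrite /v /= /v0.
  have ca : {for s, continuous acosh2} by exact: cont_isd (is_derive_acosh2 s0).
  cont_tac.
  - by rewrite /= gt_eqF// sqrtr_gt0.
  - by apply: (cont_comp (h := acosh2)); [exact: cvg_snd|exact: ca].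
  - by rewrite /= mulf_neq0// ?pnatr_eq0// gt_eqF.
rewrite (_ : (fun z => _) = fun z : R * R => (2 * z.1)^-1 *
   \sum_(j < k.+1) 'C(k, j)%:R * (phi j z.2 * v (k - j) z.1 z.2)); last first.
  by apply/funext => r; rewrite vS.
apply: contM; first by cont_tac; rewrite /= mulf_neq0// ?pnatr_eq0// gt_eqF.
apply: cont_sum => j _; apply: contM; first exact: cont_cst.
apply: contM; last by apply: IH; rewrite ltnS leq_subr.
by apply: (cont_comp (h := phi j)); [exact: cvg_snd|exact: phi_cont].
Qed.

(** The time derivative that [v k] should have. For functions of [s = cosh d] the Laplacian of the
    hyperbolic space of dimension [2 k + 1] is [(s^2 - 1) f'' + (2 k + 1) s f']; with [f = v k] this
    is [vt k] without its last term, and [k^2] is what the factor [exp (- k^2 t)] compensates. *)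
Definition vt k t s : R :=
  (s ^+ 2 - 1) * v k.+2 t s - (2 * k%:R + 1) * s * v k.+1 t s + k%:R ^+ 2 * v k t s.

(** The reason for the tower: [- d/ds] intertwines the radial heat operators of dimensions [2 k + 1]
    and [2 k + 3]. *)
Lemma is_derive_vt k t s : 0 < t -> 0 < s -> is_derive s 1 (vt k t) (- vt k.+1 t s).
Proof.
move=> t0 s0; rewrite /vt.
have D0 := is_derive_v k t0 s0; have D1 := is_derive_v k.+1 t0 s0.
have D2 := is_derive_v k.+2 t0 s0.
by isd_tac; rewrite -!natr1; ring.
Qed.

Lemma v1E t s : v 1 t s = (2 * t)^-1 * (phi 0 s * v 0 t s).
Proof. by rewrite vS big_ord1 bin0 mul1r subn0. Qed.

Lemma vt0E t s : 0 < t -> 0 < s ->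
  vt 0 t s = (acosh2 s / (4 * t ^+ 2) - (2 * t)^-1) * v 0 t s.
Proof.
move=> t0 s0; rewrite /vt vS !big_ord_recl big_ord0 /= /bump /= bin0 bin1 !mul1r addr0.
rewrite subn0 subnn mulr0 expr0n mul0r addr0 add0r mul1r v1E.
have -> : (acosh2 s / (4 * t ^+ 2) - (2 * t)^-1) = acosh2 s / (4 * t ^+ 2) -
    (2 * t)^-1 * (s * phi 0 s - (s ^+ 2 - 1) * phi 1 s) by rewrite phi_ode// mulr1.
rewrite /acosh2.
by field; rewrite gt_eqF.
Qed.

Lemma near_is_derive_eq (f g : R -> R) (s df dg : R) : (\forall y \near s, f y = g y) ->
  is_derive s 1 f df -> is_derive s 1 g dg -> df = dg.
Proof.
move=> fg [_ <-] [_ <-]; exact: near_eq_derive.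
Qed.

(** What the recursion [vS] becomes when differentiated in time, with [vt] in place of the time
    derivatives. It is propagated in [k] by differentiating both sides in [s], starting from the
    derivative of the explicit formula [vt0E]. *)
Lemma vt_leibniz k t s : 0 < t -> 0 < s ->
  (2 * t)^-1 * (\sum_(j < k.+1) 'C(k, j)%:R * (phi j s * vt (k - j) t s)) - v k.+1 t s / t =
  vt k.+1 t s.
Proof.
move=> t0; elim: k s => [|k IH] s s0.
  rewrite big_ord1 bin0 mul1r subn0 vt0E//.
  have D1 := is_derive_vt 0 t0 s0; have DA := is_derive_acosh2 s0.
  have Dv := is_derive_v 0 t0 s0.
  have D2 : is_derive s 1 (fun s => (acosh2 s / (4 * t ^+ 2) - (2 * t)^-1) * v 0 t s)
     ((acosh2 s / (4 * t ^+ 2) - (2 * t)^-1) * (- v 1 t s) + 2 * phi 0 s / (4 * t ^+ 2) * v 0 t s).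
    by isd_tac; ring.
  have fg : \forall y \near s, vt 0 t y = (acosh2 y / (4 * t ^+ 2) - (2 * t)^-1) * v 0 t y.
    by near=> y; apply: vt0E => //; near: y; exact: lt_nbhsr.
  have E := near_is_derive_eq fg D1 D2.
  rewrite -[RHS]opprK E v1E; by field; rewrite gt_eqF.
have Dl : is_derive s 1 (fun s => (2 * t)^-1 * (\sum_(j < k.+1) 'C(k, j)%:R * (phi j s * vt (k - j) t s)) - v k.+1 t s / t)
  ((2 * t)^-1 * (- \sum_(j < k.+2) 'C(k.+1, j)%:R * (phi j s * vt (k.+1 - j) t s)) + v k.+2 t s / t).
  have D := @is_derive_leibniz phi (fun j => vt j t) k s (fun j => is_derive_phi j s0)
    (fun j _ => is_derive_vt j t0 s0).
  have Dv := is_derive_v k.+1 t0 s0.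
  by isd_tac; ring.
have Dr := is_derive_vt k.+1 t0 s0.
have fg : \forall y \near s, (2 * t)^-1 * (\sum_(j < k.+1) 'C(k, j)%:R *
    (phi j y * vt (k - j) t y)) - v k.+1 t y / t = vt k.+1 t y.
  by near=> r; apply: IH; near: r; exact: lt_nbhsr.
by rewrite -[RHS]opprK -(near_is_derive_eq fg Dl Dr); ring.
Unshelve. all: by end_near. Qed.

Lemma is_derive_v_time k t s : 0 < t -> 0 < s -> is_derive t 1 (v k ^~ s) (vt k t s).
Proof.
move=> t0 s0; elim/ltn_ind: k => -[|k] IH.
  rewrite vt0E// /v /= /v0; isd_tac.
  - by rewrite gt_eqF// sqrtr_gt0.
  - by [].
  - by rewrite mulf_neq0// ?pnatr_eq0// gt_eqF.
  have tE : t = Num.sqrt t ^+ 2 by rewrite sqr_sqrtr// ltW.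
  have : Num.sqrt t != 0 by rewrite gt_eqF// sqrtr_gt0.
  move: tE; set e := expR _; clearbody e; generalize (Num.sqrt t) => q tE q0.
  by rewrite tE; field.
rewrite -vt_leibniz//.
rewrite (_ : (fun t => _) = fun t => (2 * t)^-1 *
   \sum_(j < k.+1) 'C(k, j)%:R * (phi j s * v (k - j) t s)); last first.
  by apply/funext => r; rewrite vS.
have D : is_derive t 1 (fun t => \sum_(j < k.+1) 'C(k, j)%:R * (phi j s * v (k - j) t s))
   (\sum_(j < k.+1) 'C(k, j)%:R * (phi j s * vt (k - j) t s)).
  apply: isd_sum => j _.
  have Dj : is_derive t 1 (v (k - j) ^~ s) (vt (k - j) t s).
    by apply: IH; rewrite ltnS leq_subr.
  by isd_tac; ring.
rewrite vS; isd_tac; first by rewrite mulf_neq0// ?pnatr_eq0// gt_eqF.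
by field; rewrite gt_eqF.
Qed.

End HeatTower.

Section C12Radial.
Context (R : realType).
Local Notation e_ i := (delta_mx 0 i).
Implicit Types (s t : R).

(** Profiles in the squared norm are handled on the open half-line [-1 < s], where [sqrt (1 + s)] is
    smooth, so that the origin [s = 0] is an interior point with two-sided derivatives. *)
Lemma sqnorm_gtN1 n (x : 'rV[R]_n) : -1 < sqnorm x.
Proof. by rewrite (lt_le_trans _ (sqnorm_ge0 x))// ltrN10. Qed.

Lemma cont_near (T : topologicalType) (f g : T -> R) x :
  (\forall z \near x, f z = g z) -> {for x, continuous f} -> {for x, continuous g}.
Proof.
move=> fg cf; rewrite /prop_for /continuous_at -(nbhs_singleton fg).
by apply: cvg_trans cf; exact: near_eq_cvg.
Qed.

Lemma cont_comp2 (T : topologicalType) (F : R -> R -> R) (a b : T -> R) x :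
  {for x, continuous a} -> {for x, continuous b} ->
  {for (a x, b x), continuous (fun w : R * R => F w.1 w.2)} ->
  {for x, continuous (fun z => F (a z) (b z))}.
Proof.
move=> ca cb cF.
have cab : {for x, continuous (fun z => (a z, b z))} by exact: (cvg_pair ca cb).
exact: (continuous_comp cab cF).
Qed.

Lemma near_fst_gt0 (T : topologicalType) (t : R) (x : T) : 0 < t ->
  \forall z \near (t, x), 0 < z.1.
Proof.
move=> t0; have : {for (t, x), continuous (@fst R T)} by exact: cvg_fst.
by move=> /(_ _ (lt_nbhsr t0)).
Qed.

Section radial.
Variables (n : nat) (B0 Bt B1 B2 : R -> R -> R).
Hypothesis D0 : forall t s, 0 < t -> -1 < s -> is_derive t 1 (B0 ^~ s) (Bt t s).
Hypothesis D1 : forall t s, 0 < t -> -1 < s -> is_derive s 1 (B0 t) (B1 t s).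
Hypothesis D2 : forall t s, 0 < t -> -1 < s -> is_derive s 1 (B1 t) (B2 t s).
Let cont2 (F : R -> R -> R) := forall t s, 0 < t -> -1 < s ->
  {for (t, s), continuous (fun w : R * R => F w.1 w.2)}.
Hypotheses (c0 : cont2 B0) (ct : cont2 Bt) (c1 : cont2 B1) (c2 : cont2 B2).

Let u t (x : 'rV[R]_n) := B0 t (sqnorm x).

Let is_partial1 t x i : 0 < t -> is_derive x (e_ i) (u t) (2 * x 0 i * B1 t (sqnorm x)).
Proof.
by move=> t0; apply: is_partial_radial; apply: D1 => //; exact: sqnorm_gtN1.
Qed.

Let partial1E t x j : 0 < t -> partial j (u t) x = 2 * x 0 j * B1 t (sqnorm x).
Proof. by move=> t0; apply: partialE; exact: is_partial1. Qed.

Let partial1_ext t j : 0 < t ->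
  partial j (u t) = fun x : 'rV[R]_n => x 0 j * (2 * B1 t (sqnorm x)).
Proof. by move=> t0; apply/funext => x; rewrite partial1E//; ring. Qed.

Let is_partial2 t x i j : 0 < t -> is_derive x (e_ i) (partial j (u t))
  (2 * (i == j)%:R * B1 t (sqnorm x) + 4 * x 0 i * x 0 j * B2 t (sqnorm x)).
Proof.
move=> t0; rewrite partial1_ext//.
have DB := D2 t0 (sqnorm_gtN1 x).
have DB' : is_derive (sqnorm x) 1 (fun s => 2 * B1 t s) (2 * B2 t (sqnorm x)).
  by isd_tac; ring.
have [P1 P2] := is_partialM (is_partial_coord i j x) (is_partial_radial i DB').
by apply: DeriveDef => //; rewrite P2; ring.
Qed.

Let cont_lift F (t : R) (x : 'rV[R]_n) : cont2 F -> 0 < t ->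
  {for (t, x), continuous (fun z : R * 'rV[R]_n => F z.1 (sqnorm z.2))}.
Proof.
move=> cF t0; apply: (@cont_comp2 _ F fst (fun z : R * 'rV[R]_n => sqnorm z.2)).
- exact: cvg_fst.
- by apply: (@continuous_comp _ _ _ snd (@sqnorm R n)); [exact: cvg_snd|exact: continuous_sqnorm].
- by apply: cF => //; exact: sqnorm_gtN1.
Qed.

Let cont_coord2 (z : R * 'rV[R]_n) i :
  {for z, continuous (fun z : R * 'rV[R]_n => z.2 0 i)}.
Proof.
by apply: (@continuous_comp _ _ _ snd (fun x : 'rV[R]_n => x 0 i));
  [exact: cvg_snd|exact: coord_continuous].
Qed.

Lemma C12_radial : C12 u.
Proof.
move=> t x t0; split.
- by have [] := D0 t0 (sqnorm_gtN1 x).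
- by move=> i; case: (is_partial1 x i t0).
- by move=> i j; case: (is_partial2 x i j t0).
- exact: cont_lift.
split.
- apply: (@cont_near _ (fun z : R * 'rV[R]_n => Bt z.1 (sqnorm z.2))); last first.
    exact: cont_lift.
  near=> z.
  have z0 : 0 < z.1 by near: z; exact: near_fst_gt0.
  by rewrite derive1E; have [_ ->] := D0 z0 (sqnorm_gtN1 z.2).
- move=> i; apply: (@cont_near _ (fun z : R * 'rV[R]_n => 2 * z.2 0 i * B1 z.1 (sqnorm z.2))).
    near=> z; have z0 : 0 < z.1 by near: z; exact: near_fst_gt0.
    by rewrite partial1E.
  have cc := @cont_coord2 (t, x) i; have cl := @cont_lift B1 t x c1 t0.
  by cont_tac.
- move=> i j; apply: (@cont_near _ (fun z : R * 'rV[R]_n =>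
    2 * (i == j)%:R * B1 z.1 (sqnorm z.2) + 4 * z.2 0 i * z.2 0 j * B2 z.1 (sqnorm z.2))).
    near=> z; have z0 : 0 < z.1 by near: z; exact: near_fst_gt0.
    by rewrite (partialE (is_partial2 z.2 i j z0)).
  have ci := @cont_coord2 (t, x) i; have cj := @cont_coord2 (t, x) j.
  have cl1 := @cont_lift B1 t x c1 t0; have cl2 := @cont_lift B2 t x c2 t0.
  by cont_tac.
Unshelve. all: by end_near. Qed.

End radial.

Section HyperbolicKernel.
Variables (C : R) (m : nat).
Local Notation n := (2 * m).+1.
Local Notation w s := (Num.sqrt (1 + s)).

Definition hker t (z : 'rV[R]_(1 + n)) : R := C * expR (- (m%:R ^+ 2 * t)) * v m t (z 0 0).

Let E t := C * expR (- (m%:R ^+ 2 * t)).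
Let B0 t s := E t * v m t (w s).
Let Bt t s := E t * (vt m t (w s) - m%:R ^+ 2 * v m t (w s)).
Let B1 t s := - (E t * v m.+1 t (w s) / (2 * w s)).
Let B2 t s := E t * (v m.+2 t (w s) / (4 * w s ^+ 2) + v m.+1 t (w s) / (4 * w s ^+ 3)).

Let w_gt0 s : -1 < s -> 0 < w s.
Proof. by move=> s0; rewrite sqrtr_gt0; lra. Qed.

Let is_derive_vw k t s : 0 < t -> -1 < s ->
  is_derive s 1 (fun s => v k t (w s)) (- v k.+1 t (w s) / (2 * w s)).
Proof.
move=> t0 s0.
have Dw : is_derive s 1 (fun s : R => w s) (1 / (2 * w s)).
  by isd_tac; rewrite ?mul1r//; lra.
by apply: isd_eq (isd_comp Dw (is_derive_v k t0 (w_gt0 s0))) _; rewrite mulrA mulr1.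
Qed.

Let D0 t s : 0 < t -> -1 < s -> is_derive t 1 (B0 ^~ s) (Bt t s).
Proof.
move=> t0 s0; have D := is_derive_v_time m t0 (w_gt0 s0).
by rewrite /B0 /Bt /E; isd_tac; ring.
Qed.

Let D1 t s : 0 < t -> -1 < s -> is_derive s 1 (B0 t) (B1 t s).
Proof.
move=> t0 s0; have D := is_derive_vw m t0 s0.
by rewrite /B0 /B1; isd_tac; ring.
Qed.

Let D2 t s : 0 < t -> -1 < s -> is_derive s 1 (B1 t) (B2 t s).
Proof.
move=> t0 s0; have D := is_derive_vw m.+1 t0 s0.
have w0 := w_gt0 s0; have wn0 : w s != 0 by rewrite gt_eqF.
have w20 : 2 * w s != 0 by rewrite mulf_neq0// pnatr_eq0.
rewrite /B1 /B2; isd_tac => //; first lra.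
by field.
Qed.

Let cont2 (F : R -> R -> R) := forall t s, 0 < t -> -1 < s ->
  {for (t, s), continuous (fun w : R * R => F w.1 w.2)}.

Let cont_vw k t s : 0 < t -> -1 < s ->
  {for (t, s), continuous (fun z : R * R => v k z.1 (w z.2))}.
Proof.
move=> t0 s0; apply: (@cont_comp2 _ (v k) fst (fun z : R * R => w z.2)).
- exact: cvg_fst.
- by cont_tac.
- by apply: v_cont => //; exact: w_gt0.
Qed.

Let c0 : cont2 B0.
Proof.
move=> t s t0 s0; have c := @cont_vw m t s t0 s0; rewrite /B0 /E; by cont_tac.
Qed.

Let ct : cont2 Bt.
Proof.
move=> t s t0 s0; have cm := @cont_vw m t s t0 s0; have cm1 := @cont_vw m.+1 t s t0 s0.
have cm2 := @cont_vw m.+2 t s t0 s0; rewrite /Bt /E /vt; by cont_tac.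
Qed.

Let c1 : cont2 B1.
Proof.
move=> t s t0 s0; have cm1 := @cont_vw m.+1 t s t0 s0; rewrite /B1 /E; cont_tac.
by rewrite /= mulf_neq0// ?pnatr_eq0// gt_eqF// w_gt0.
Qed.

Let c2 : cont2 B2.
Proof.
move=> t s t0 s0; have cm1 := @cont_vw m.+1 t s t0 s0; have cm2 := @cont_vw m.+2 t s t0 s0.
rewrite /B2 /E; cont_tac.
all: by rewrite /= mulf_neq0// ?pnatr_eq0// expf_neq0// gt_eqF// w_gt0.
Qed.

Let hker_chart t x : hker t (hyperboloid_chart x) = B0 t (sqnorm x).
Proof.
by rewrite /hker /B0 /hyperboloid_chart -(lshift0 n 0) row_mxEl mxE mulr1n.
Qed.

Lemma hker_C12 : C12 (fun t x => hker t (@hyperboloid_chart R n x)).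
Proof.
have -> : (fun t x => hker t (@hyperboloid_chart R n x)) = fun t x => B0 t (sqnorm x).
  by apply/funext => t; apply/funext => x; exact: hker_chart.
exact: (@C12_radial n B0 Bt B1 B2 D0 D1 D2 c0 ct c1 c2).
Qed.

Lemma hker_heat (c : chart_index (hyperbolic_space R n)) t x : 0 < t ->
  derive1 (fun s => hker s (hyperboloid_chart x)) t =
  laplace_beltrami c (fun x' => hker t (hyperboloid_chart x')) x.
Proof.
case: c => t0.
have -> : (fun s => hker s (@hyperboloid_chart R n x)) = B0 ^~ (sqnorm x).
  by apply/funext => s; exact: hker_chart.
rewrite derive1E; have [_ ->] := D0 t0 (sqnorm_gtN1 x).
have x0 := sqnorm_gtN1 x.
(* Here [dens s * (1 + s) = w s], and the factor [2 w] cancels the denominator of [B1]. *)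
pose F s := - (E t * v m.+1 t (w s)).
have DF : is_derive (sqnorm x) 1 F (E t * v m.+2 t (w (sqnorm x)) / (2 * w (sqnorm x))).
  by have D := is_derive_vw m.+1 t0 x0; rewrite /F; isd_tac; ring.
have FE : \forall s \near sqnorm x,
    F s = 2 * (w s)^-1 * (cst 1 s + cst 1 s * s) * B1 t s.
  near=> s; have s1 : -1 < s by near: s; exact: lt_nbhsr.
  have wn0 : w s != 0 by rewrite gt_eqF// w_gt0.
  have ws : 1 + s = w s ^+ 2 by rewrite sqr_sqrtr//; lra.
  move: ws wn0; rewrite /F /B1 /=; set W := Num.sqrt _ => ws wn0.
  by rewrite mul1r ws; field.
have DB : \forall s \near sqnorm x, is_derive (s : R) 1 (B0 t) (B1 t s).
  by near=> s; apply: D1 => //; near: s; exact: lt_nbhsr.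
have uB : \forall y \near x, hker t (@hyperboloid_chart R n y) = B0 t (sqnorm y).
  by near=> y; exact: hker_chart.
rewrite (laplace_radial (M := hyperbolic_space R n) (c := tt)
  (dens := fun s => (w s)^-1) (alpha := cst 1) (beta := cst 1)
  (@hyperboloid_density R n) (@hyperboloid_inv R n) uB DB FE DF).
have wn0 : w (sqnorm x) != 0 by rewrite gt_eqF// w_gt0.
have ws : sqnorm x = w (sqnorm x) ^+ 2 - 1 by rewrite sqr_sqrtr; lra.
have nE : n%:R = 2 * m%:R + 1 :> R by rewrite -natr1 natrM.
rewrite /Bt /vt /F nE; move: wn0 ws; set W := Num.sqrt _ => wn0 ws.
by rewrite [in RHS]ws; field.
Unshelve. all: by end_near. Qed.

Lemma hker_ge0 t z : 0 <= C -> 0 < t -> carrier (hyperbolic_space R n) z -> 0 <= hker t z.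
Proof.
move=> C0 t0 [_ z0]; rewrite /hker mulr_ge0 ?mulr_ge0 ?expR_ge0//.
by rewrite v_ge0// ltW.
Qed.

End HyperbolicKernel.
End C12Radial.

(** * Moments of the functions [v k] over hyperbolic balls *)

Section HyperbolicIntegrals.
Context (R : realType).
Implicit Types (s t b x r : R) (h : {poly R}).

Lemma integ_FTC_closed a b (f F : R -> R) : a <= b -> continuous f ->
  (forall x, a <= x <= b -> is_derive x 1 F (f x)) ->
  integ a b f = F b - F a.
Proof.
rewrite le_eqVlt => /predU1P[->|ab] cf dF.
  by rewrite /integ set_itv1 Rintegral_set1 subrr.
have cF x : a <= x <= b -> {for x, continuous F} by move=> /dF; exact: cont_isd.
rewrite /integ /Rintegral (@continuous_FTC2 _ f F a b)//.
- exact: continuous_subspaceT.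
- split.
  + by move=> x; rewrite in_itv/= => /andP[/ltW ax /ltW xb]; have [] := dF x; rewrite ?ax.
  + by apply: cvg_at_right_filter; apply: cF; rewrite lexx ltW.
  + by apply: cvg_at_left_filter; apply: cF; rewrite lexx ltW.
- move=> x; rewrite in_itv/= => /andP[/ltW ax /ltW xb]; rewrite derive1E.
  by have [|_ ->] := dF x; rewrite ?ax.
Qed.

Lemma is_derive_nd (F f : R -> R) a b : a <= b ->
  (forall x, a <= x <= b -> is_derive x 1 F (f x)) ->
  (forall x, a <= x <= b -> 0 <= f x) -> F a <= F b.
Proof.
move=> ab dF f0.
have [| |c cab E] := @MVT_segment R F f a b ab.
- by move=> x; rewrite in_itv/= => /andP[/ltW ax /ltW xb]; apply: dF; rewrite ax.
- apply: continuous_in_subspaceT; apply/in_setP => x /=; rewrite in_itv/= => xab.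
  exact: cont_isd (dF x xab).
- rewrite -subr_ge0 E mulr_ge0 ?subr_ge0// f0//; move: cab; by rewrite in_itv.
Qed.

Definition sr r : R := Num.sqrt (1 + r ^+ 2).

Lemma sr_ge1 r : 1 <= sr r.
Proof. by rewrite -[X in X <= _]sqrtr1 ler_wsqrtr// lerDl sqr_ge0. Qed.

Lemma sr_gt0 r : 0 < sr r.
Proof. exact: lt_le_trans (sr_ge1 r). Qed.

Lemma sr_neq0 r : sr r != 0. Proof. by rewrite gt_eqF// sr_gt0. Qed.

Lemma sqr_sr r : sr r ^+ 2 = 1 + r ^+ 2.
Proof. by rewrite sqr_sqrtr// addr_ge0// sqr_ge0. Qed.

Lemma continuous_sr : continuous sr.
Proof. by move=> x; rewrite /sr; cont_tac. Qed.

Lemma is_derive_sr r : is_derive r 1 sr (r / sr r).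
Proof.
have p : 0 < 1 + r ^+ 2 by rewrite ltr_pwDl// sqr_ge0.
rewrite /sr; isd_tac => //; have := sr_neq0 r; rewrite /sr; set q := Num.sqrt _ => q0.
by field.
Qed.

Lemma sr_le r b : 0 <= r -> r <= b -> sr r <= sr b.
Proof.
move=> r0 rb; rewrite ler_wsqrtr// lerD2l lerXn2r// nnegrE//.
exact: le_trans rb.
Qed.

Lemma continuous_v_sr k t : 0 < t -> continuous (fun r => v k t (sr r)).
Proof.
move=> t0 r; apply: (cont_comp (h := v k t)); first exact: continuous_sr.
exact: cont_isd (is_derive_v k t0 (sr_gt0 r)).
Qed.

(* Here [s = sr r = cosh d] and [r = sinh d], [d] being the distance to the base
   point; [hint] integrates against the volume of the ball [r <= b]. *)
Definition hint k b h t : R :=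
  integ 0 b (fun r => v k t (sr r) * h.[sr r] * r ^+ (2 * k) / sr r).

Lemma continuous_horner_sr h : continuous (fun r => h.[sr r]).
Proof.
move=> r; apply: (cont_comp (h := horner h)); first exact: continuous_sr.
exact: continuous_horner.
Qed.

Lemma continuous_hint k h t : 0 < t ->
  continuous (fun r => v k t (sr r) * h.[sr r] * r ^+ (2 * k) / sr r).
Proof.
move=> t0 r; have cv := @continuous_v_sr k t t0; have ch := @continuous_horner_sr h.
by have cs := continuous_sr; cont_tac; exact: sr_neq0.
Qed.

(* Integration by parts in [s] trades [v k.+1] for [v k] and [h] for [hop k h]. *)
Definition hop k h : {poly R} := ('X^2 - 1) * h^`() + (2 * k%:R + 1) *: ('X * h).

Lemma is_derive_horner h x : is_derive x 1 (horner h) h^`().[x].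
Proof.
apply: DeriveDef; first exact: derivable_horner.
by rewrite -derive1E -derivE.
Qed.

(** The fundamental theorem for [v k * h * r^(2 k + 1)], which vanishes at [r = 0]; only the
    boundary term at [b] survives. *)
Lemma hint_rec k b h t : 0 < t -> 0 <= b ->
  hint k.+1 b h t = hint k b (hop k h) t - v k t (sr b) * h.[sr b] * b ^+ (2 * k).+1.
Proof.
move=> t0 b0.
have c1 := @continuous_hint k.+1 h t t0; have c2 := @continuous_hint k (hop k h) t t0.
pose F r := v k t (sr r) * h.[sr r] * r ^+ (2 * k).+1.
have E : hint k b (hop k h) t - hint k.+1 b h t = F b - F 0.
  rewrite /hint -integB//.
  apply: integ_FTC_closed => //; first by move=> r; cont_tac.
  move=> r _; have Ds := is_derive_sr r.
  have Dv := isd_comp Ds (is_derive_v k t0 (sr_gt0 r)).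
  have Dh := isd_comp Ds (is_derive_horner h (sr r)).
  rewrite /F /hop; isd_tac.
  rewrite !hornerE /= sqr_sr mulnS !exprS.
  have kE : (2 * k).+1%:R = 2 * k%:R + 1 :> R by rewrite -natr1 natrM.
  rewrite kE; have S0 := sr_neq0 r; set a := v k t _; set a' := v k.+1 t _; set q := r ^+ (2 * k).
  by field.
have F0 : F 0 = 0 by rewrite /F exprS mul0r mulr0.
by rewrite -/(F b) -[F b]subr0 -F0 -E; ring.
Qed.

(** Each integration by parts costs one order of vanishing at [S]. A zero of order [k] thus kills
    all boundary terms of [k] successive integrations. *)
Lemma hop_dvd k j S h g : h = ('X - S%:P) ^+ j.+1 * g ->
  exists g', hop k h = ('X - S%:P) ^+ j * g'.
Proof.
move=> ->; rewrite /hop derivM deriv_exp derivXsubC mul1r /= -mul_polyC.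
exists (('X^2 - 1) * (j.+1%:R * g + ('X - S%:P) * g^`()) +
   (2 * k%:R + 1)%:P * ('X * (('X - S%:P) * g))).
rewrite -mulr_natl !exprS; set E := 'X - _; set c := (_)%:P; set D := g^`().
by clearbody E c D; move: (E ^+ j) => Ej; ring.
Qed.

Lemma hop_at1 k h : (hop k h).[1] = (2 * k%:R + 1) * h.[1].
Proof. by rewrite /hop !hornerE/=; ring. Qed.

Lemma hint_reduce k b h g : 0 <= b -> h = ('X - (sr b)%:P) ^+ k * g ->
  exists2 H : {poly R}, H.[1] = (\prod_(i < k) (2 * i%:R + 1)) * h.[1] &
    forall t, 0 < t -> hint k b h t = hint 0 b H t.
Proof.
move=> b0; elim: k h g => [|k IH] h g hE.
  by exists h => //; rewrite big_ord0 mul1r.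
have [g' g'E] := hop_dvd k hE.
have [H H1 HE] := IH _ _ g'E.
exists H => [|t t0]; first by rewrite H1 hop_at1 big_ord_recr /= mulrA.
rewrite hint_rec// HE// (_ : h.[sr b] = 0) ?mulr0 ?mul0r ?subr0//.
by rewrite hE hornerM horner_exp hornerXsubC subrr exprS !mul0r.
Qed.

Lemma hop_Xn_le k j (S : R) : 1 <= S ->
  (hop k 'X^j).[S] <= (j%:R + 2 * k%:R + 1) * S ^+ j.+1.
Proof.
move=> S1; have S0 : 0 <= S by lra.
have -> : (hop k 'X^j).[S] = (S ^+ 2 - 1) * (j%:R * S ^+ j.-1) + (2 * k%:R + 1) * S ^+ j.+1.
  rewrite /hop derivXn !hornerE /= ?hornerMn ?hornerXn -mulr_natl !exprS; ring.
have -> : (j%:R + 2 * k%:R + 1) * S ^+ j.+1 = j%:R * S ^+ j.+1 + (2 * k%:R + 1) * S ^+ j.+1.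
  by ring.
rewrite lerD2r; case: j => [|j] /=; first by rewrite !mul0r mulr0.
have -> : j.+1%:R * S ^+ j.+2 = S ^+ 2 * (j.+1%:R * S ^+ j) by rewrite !exprS; ring.
by rewrite ler_wpM2r ?mulr_ge0 ?exprn_ge0// gerBl.
Qed.

(** The boundary term has a favourable sign and is dropped, so the estimate is uniform in [b]. *)
Lemma hint_le_rec k b j t : 0 < t -> 0 <= b ->
  hint k.+1 b 'X^j t <= (j%:R + 2 * k%:R + 1) * hint k b 'X^(j.+1) t.
Proof.
move=> t0 b0; rewrite hint_rec//.
have c1 := @continuous_hint k (hop k 'X^j) t t0; have c2 := @continuous_hint k 'X^(j.+1) t t0.
apply: (@le_trans _ _ (hint k b (hop k 'X^j) t)).
  have S0 := ltW (sr_gt0 b); rewrite lerBlDr lerDl hornerXn.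
  by apply: mulr_ge0; [apply: mulr_ge0; [exact: v_ge0|exact: exprn_ge0]|exact: exprn_ge0].
rewrite /hint -integZ//; apply: le_integ => //; first by move=> r; cont_tac.
move=> r /andP[r0 _].
have S1 := sr_ge1 r; have S0 := sr_gt0 r; set S := sr r in S1 S0 *.
have hle := @hop_Xn_le k j S S1.
have a0 : 0 <= v k t S by rewrite v_ge0// ltW.
have q0 : 0 <= r ^+ (2 * k) / S by rewrite divr_ge0 ?exprn_ge0// ltW.
have -> : v k t S * (hop k 'X^j).[S] * r ^+ (2 * k) / S = (v k t S * (r ^+ (2 * k) / S)) * (hop k 'X^j).[S] by ring.
have -> : (j%:R + 2 * k%:R + 1) * (v k t S * ('X^(j.+1)).[S] * r ^+ (2 * k) / S) =
  (v k t S * (r ^+ (2 * k) / S)) * ((j%:R + 2 * k%:R + 1) * S ^+ j.+1) by rewrite hornerXn; ring.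
by rewrite ler_wpM2l// mulr_ge0.
Qed.

(* [rr] is the inverse of [sinh]. *)
Definition rr r : R := r * phi 0 (sr r).

Lemma rr_ge0 r : 0 <= r -> 0 <= rr r.
Proof. by move=> r0; rewrite mulr_ge0// phi_ge0// ltW// sr_gt0. Qed.

Lemma is_derive_rr r : is_derive r 1 rr (sr r)^-1.
Proof.
have Ds := is_derive_sr r.
have Dp := isd_comp Ds (is_derive_phi 0 (sr_gt0 r)).
rewrite /rr; isd_tac.
have S0 := sr_neq0 r; have := phi_ode (sr_gt0 r); rewrite sqr_sr => E.
have r2 : 1 + r ^+ 2 - 1 = r ^+ 2 by ring.
rewrite r2 in E; rewrite -[RHS]mul1r -[X in _ = X / _]E.
by field.
Qed.

Lemma acosh2_sr r : acosh2 (sr r) = rr r ^+ 2.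
Proof. by rewrite /acosh2 sqr_sr /rr exprMn; congr (_ * _); ring. Qed.

(** The inequality [tanh d <= d], read off [phi_ode]. *)
Lemma rr_lb r : 0 <= r -> r / sr r <= rr r.
Proof.
move=> r0; rewrite /rr ler_wpM2l// -div1r ler_pdivrMr ?sr_gt0//.
rewrite -[X in X <= _](phi_ode (sr_gt0 r)) mulrC gerBl mulr_ge0//.
  by rewrite sqr_sr addrAC subrr add0r sqr_ge0.
by rewrite phi_ge0// ltW// sr_gt0.
Qed.

Lemma sr_le_exp r : 0 <= r -> sr r <= expR (rr r).
Proof.
move=> r0; rewrite -ler_ln ?posrE ?sr_gt0 ?expR_gt0// expRK -subr_ge0.
have -> : 0 = rr 0 - ln (sr 0) by rewrite /rr /sr mul0r expr0n addr0 sqrtr1 ln1 subrr.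
apply: (@is_derive_nd (fun r => rr r - ln (sr r)) (fun r => (sr r)^-1 - (r / sr r) / sr r)) => //.
- move=> x _; have Ds := is_derive_sr x; have Dr := is_derive_rr x.
  by isd_tac => //; exact: sr_gt0.
- move=> x /andP[x0 _]; rewrite subr_ge0 ler_piMl ?invr_ge0 ?(ltW (sr_gt0 _))//.
  rewrite ler_pdivrMr ?sr_gt0// mul1r.
  have : x ^+ 2 <= sr x ^+ 2 by rewrite sqr_sr lerDr.
  by rewrite ler_pXn2r// nnegrE// ltW// sr_gt0.
Qed.

Definition gaussI x : R := integ 0 x (fun y => expR (- y ^+ 2)).

Let cgauss : continuous (fun y : R => expR (- y ^+ 2)).
Proof. by move=> y; cont_tac. Qed.

Lemma gaussI_cvg : gaussI x @[x --> +oo%R] --> Num.sqrt pi / 2.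
Proof.
have := cvg_comp _ _ (@gauss_integral_proof.cvg_integral0_gauss_sqr R) (@sqrt_continuous R (pi / 4)).
have -> : Num.sqrt (pi / 4) = Num.sqrt pi / 2 :> R.
  rewrite sqrtrM ?pi_ge0// sqrtrV//; congr (_ / _).
  by rewrite (_ : 4 = 2 ^+ 2) ?sqrtr_sqr ?ger0_norm//; ring.
apply: cvg_trans; apply: near_eq_cvg; near=> x => /=.
by rewrite sqrtr_sqr ger0_norm ?gauss_integral_proof.integral0_gauss_ge0.
Unshelve. all: by end_near. Qed.

Lemma gaussI_nd x y : 0 <= x -> x <= y -> gaussI x <= gaussI y.
Proof.
move=> x0 xy; rewrite /gaussI (@integ_cat _ 0 x y)// lerDl.
apply: integ_ge0 => z _; exact: expR_ge0.
Qed.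

Lemma gaussI_le x : 0 <= x -> gaussI x <= Num.sqrt pi / 2.
Proof.
move=> x0; rewrite -(cvg_lim _ gaussI_cvg)//; apply: limr_ge.
  by apply/cvg_ex; eexists; exact: gaussI_cvg.
by near=> y; apply: gaussI_nd => //; near: y; exact: nbhs_pinfty_ge.
Unshelve. all: by end_near. Qed.

Lemma hint0_gauss b t : 0 < t -> 0 <= b -> hint 0 b 1 t = 2 * gaussI (rr b / (2 * Num.sqrt t)).
Proof.
move=> t0 b0; have q0 : 0 < Num.sqrt t by rewrite sqrtr_gt0.
have qn0 : Num.sqrt t != 0 by rewrite gt_eqF.
(* The primitive is based at [-1] so as to be differentiable at [0] too; the substitution is
   [y = d / (2 sqrt t)]. *)
pose g1 x := integ (-1) x (fun y => expR (- y ^+ 2)).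
pose F r := 2 * g1 (rr r / (2 * Num.sqrt t)).
have a0 : 0 <= rr b / (2 * Num.sqrt t) by rewrite divr_ge0 ?rr_ge0// mulr_ge0// ltW.
transitivity (F b - F 0); last first.
  rewrite /F {2}/rr !mul0r -mulrBr /gaussI; congr (_ * _).
  by rewrite /g1 (integ_cat (b := 0) cgauss (lerN10 R) a0) addrAC subrr add0r.
apply: integ_FTC_closed => //; first exact: continuous_hint.
move=> r /andP[r0 _].
have x1 : -1 < rr r / (2 * Num.sqrt t).
  by rewrite (lt_le_trans (ltrN10 _))// divr_ge0 ?rr_ge0// mulr_ge0// ltW.
have Dr := is_derive_rr r.
have Dx : is_derive r 1 (fun r => rr r / (2 * Num.sqrt t)) ((sr r)^-1 / (2 * Num.sqrt t)).
  by isd_tac; ring.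
have Dg := isd_comp Dx (integ_deriv x1 cgauss).
rewrite /F; isd_tac; rewrite hornerC muln0 expr0 !mulr1 /v /= /v0 acosh2_sr.
have -> : - rr r ^+ 2 / (4 * t) = - (rr r / (2 * Num.sqrt t)) ^+ 2.
  by rewrite !exprMn exprVn exprMn sqr_sqrtr ?ltW//; field; rewrite gt_eqF.
by have S0 := sr_neq0 r; field; rewrite ?qn0 ?S0.
Qed.

Lemma hint0_1_le b t : 0 < t -> 0 <= b -> hint 0 b 1 t <= Num.sqrt pi.
Proof.
move=> t0 b0; rewrite hint0_gauss// mulrC -ler_pdivlMr//; apply: gaussI_le.
by rewrite divr_ge0 ?rr_ge0// mulr_ge0// sqrtr_ge0.
Qed.

Lemma hint0_1_cvg b : 0 < b -> hint 0 b 1 t @[t --> 0^'+] --> Num.sqrt pi.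
Proof.
move=> b0; have rb : 0 < rr b.
  by rewrite mulr_gt0// phi0_gt0// sr_ge1.
have -> : Num.sqrt pi = 2 * (Num.sqrt pi / 2) :> R by rewrite mulrCA divff ?mulr1.
have cy : rr b / (2 * Num.sqrt t) @[t --> 0^'+] --> +oo%R.
  apply/cvgryPge => A.
  have A1 : 0 < `|A| + 1 by rewrite ltr_wpDl.
  near=> t; have t0 : 0 < t by [].
  have q0 : 0 < Num.sqrt t by rewrite sqrtr_gt0.
  apply: (@le_trans _ _ (`|A| + 1)).
    by rewrite (le_trans (ler_norm _))// lerDl.
  have tl : t <= (rr b / (2 * (`|A| + 1))) ^+ 2.
    near: t; apply: nbhs_right_le; rewrite exprn_gt0// divr_gt0// mulr_gt0//.
  have := ler_wsqrtr tl; rewrite sqrtr_sqr ger0_norm; last first.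
    by rewrite divr_ge0 ?ltW// mulr_gt0.
  rewrite ler_pdivlMr ?mulr_gt0// => ql; rewrite ler_pdivlMr ?mulr_gt0//.
  have -> : (`|A| + 1) * (2 * Num.sqrt t) = Num.sqrt t * (2 * (`|A| + 1)) by ring.
  exact: ql.
have c : 2 * gaussI (rr b / (2 * Num.sqrt t)) @[t --> 0^'+] --> 2 * (Num.sqrt pi / 2 : R).
  by apply: cvgM; [exact: cvg_cst|exact: (cvg_comp _ _ cy gaussI_cvg)].
apply: cvg_trans c; apply: near_eq_cvg; near=> t.
by rewrite hint0_gauss// ltW.
Unshelve. all: by end_near. Qed.

(** Laplace's method with an explicit error: [H s - H 1] is divisible by [s - 1], which is at most a
    constant times [d^2], and [d^2] against the Gaussian of time [t] is [O(t)] times the Gaussian of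
    time [2 t]. *)
Lemma hint0_H b (H : {poly R}) : 0 < b ->
  hint 0 b H t @[t --> 0^'+] --> Num.sqrt pi * H.[1].
Proof.
move=> b0; set S := sr b.
have [q qE] : exists q, H = q * ('X - 1%:P) + H.[1]%:P.
  exists (H %/ ('X - 1%:P)); have := divp_eq H ('X - 1%:P).
  by rewrite modp_XsubC.
have [M M0 qM] : exists2 M : R, 0 <= M & forall s, 1 <= s <= S -> `|q.[s]| <= M.
  by apply: continuous_bounded; exact: continuous_horner.
(* [M] bounds the quotient [q], [S^2] comes from [s - 1 <= S^2 d^2], [8] from [y exp (- y) <= 1] at
   [y = d^2 / 8t], [sqrt 2] from the prefactor at time [2 t], and [sqrt pi] bounds the remaining
   integral. *)
pose K := M * S ^+ 2 * 8 * Num.sqrt 2 * Num.sqrt pi.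
have key t : 0 < t -> `|hint 0 b H t - H.[1] * hint 0 b 1 t| <= K * t.
  move=> t0; have t20 : 0 < 2 * t by rewrite mulr_gt0.
  have cH := @continuous_hint 0 H t t0; have c1 := @continuous_hint 0 1 t t0.
  have c12 := @continuous_hint 0 1 (2 * t) t20.
  have cd : continuous (fun r => v 0 t (sr r) * H.[sr r] * r ^+ (2 * 0) / sr r -
      H.[1] * (v 0 t (sr r) * (1 : {poly R}).[sr r] * r ^+ (2 * 0) / sr r)).
    by move=> r; cont_tac.
  rewrite /hint -integZ// -integB//; last by move=> r; cont_tac.
  apply: le_trans (le_norm_integ _ _ cd) _.
  pose L := M * S ^+ 2 * (8 * Num.sqrt 2 * t).
  apply: (@le_trans _ _ (L * hint 0 b 1 (2 * t))); last first.
    apply: (@le_trans _ _ (L * Num.sqrt pi)).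
      have L0 : 0 <= L.
        by rewrite /L; apply: mulr_ge0; apply: mulr_ge0; rewrite ?sqr_ge0 ?mulr_ge0 ?sqrtr_ge0// ltW.
      by apply: ler_wpM2l => //; apply: hint0_1_le => //; exact: ltW.
    by rewrite /L /K le_eqVlt; apply/orP; left; apply/eqP; ring.
  rewrite /hint -integZ//; apply: le_integ.
  - by move=> r; cont_tac.
  - by move=> r; cont_tac.
  move=> r /andP[r0 rb]; have s1 := sr_ge1 r; have s0 := sr_gt0 r.
  have sS : sr r <= S by exact: sr_le.
  rewrite muln0 expr0 hornerC !mulr1.
  have -> : v 0 t (sr r) * H.[sr r] / sr r - H.[1] * (v 0 t (sr r) / sr r) =
     v 0 t (sr r) / sr r * (H.[sr r] - H.[1]) by ring.
  have -> : H.[sr r] - H.[1] = q.[sr r] * (sr r - 1).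
    by rewrite {1}qE !hornerE /=; ring.
  have vs0 : 0 <= v 0 t (sr r) / sr r by rewrite divr_ge0 ?v_ge0// ltW.
  rewrite normrM (ger0_norm vs0) normrM (@ger0_norm _ (sr r - 1)) ?subr_ge0//.
  have srr : sr r - 1 <= S ^+ 2 * rr r ^+ 2.
    apply: (@le_trans _ _ (r ^+ 2)).
      have : sr r * 1 <= sr r * sr r by rewrite ler_wpM2l// ltW.
      rewrite mulr1 -expr2 sqr_sr => ?; lra.
    have Srr0 : 0 <= S * rr r by rewrite mulr_ge0 ?rr_ge0// ltW// sr_gt0.
    rewrite -exprMn; apply: lerXn2r; rewrite ?nnegrE//.
    have := rr_lb r0; rewrite ler_pdivrMr// => h1.
    by apply: (le_trans h1); rewrite mulrC ler_wpM2r// rr_ge0.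
  apply: (@le_trans _ _ (v 0 t (sr r) / sr r * (M * (S ^+ 2 * rr r ^+ 2)))).
    rewrite ler_wpM2l//; apply: ler_pM; rewrite ?normr_ge0 ?subr_ge0//.
    by apply: qM; rewrite s1.
  have -> : v 0 t (sr r) / sr r * (M * (S ^+ 2 * rr r ^+ 2)) =
    M * S ^+ 2 * (v 0 t (sr r) * rr r ^+ 2 / sr r) by ring.
  rewrite /L -[X in _ <= X]mulrA; apply: ler_wpM2l; first by rewrite mulr_ge0 ?sqr_ge0.
  rewrite mulrA ler_wpM2r ?invr_ge0 ?(ltW s0)//.
  rewrite /v /= /v0 acosh2_sr; set x := rr r.
  have -> : - x ^+ 2 / (4 * t) = - x ^+ 2 / (4 * (2 * t)) + - (x ^+ 2 / (8 * t)).
    by field; rewrite gt_eqF.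
  rewrite expRD; set e1 := expR _; set y := x ^+ 2 / (8 * t).
  have y0 : 0 <= y by rewrite divr_ge0 ?sqr_ge0// mulr_ge0// ltW.
  have ye : y * expR (- y) <= 1.
    have := expR_ge1Dx y; rewrite expRN ler_pdivrMr ?expR_gt0// mul1r; lra.
  have -> : x ^+ 2 = y * (8 * t) by rewrite /y divfK// mulf_neq0// ?pnatr_eq0// gt_eqF.
  have q2 : Num.sqrt 2 != 0 :> R by rewrite gt_eqF// sqrtr_gt0.
  have qt : Num.sqrt t != 0 by rewrite gt_eqF// sqrtr_gt0.
  have -> : 8 * Num.sqrt 2 * t * ((Num.sqrt (2 * t))^-1 * e1) = (Num.sqrt t)^-1 * e1 * (8 * t) * 1.
    by rewrite sqrtrM//; field; rewrite q2 qt.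
  have -> : (Num.sqrt t)^-1 * (e1 * expR (- y)) * (y * (8 * t)) =
    (Num.sqrt t)^-1 * e1 * (8 * t) * (y * expR (- y)) by ring.
  by rewrite ler_wpM2l// !mulr_ge0 ?invr_ge0 ?sqrtr_ge0 ?expR_ge0// ltW.
have c0 : (K * t) @[t --> 0^'+] --> K * 0.
  by apply: cvgM; [exact: cvg_cst|exact: cvg_within].
rewrite mulr0 in c0.
have cd : (hint 0 b H t - H.[1] * hint 0 b 1 t) @[t --> 0^'+] --> (0 : R).
  apply/norm_cvg0P; apply: (@squeeze_cvgr _ _ _ _ (fun=> 0) (fun t => K * t)) => //.
  - by near=> t; rewrite normr_ge0/= key.
  - exact: cvg_cst.
have c1 : H.[1] * hint 0 b 1 t @[t --> 0^'+] --> H.[1] * Num.sqrt pi.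
  by apply: cvgM; [exact: cvg_cst|exact: hint0_1_cvg].
rewrite [X in _ --> X]mulrC -[X in _ --> X]add0r.
have c2 : (hint 0 b H t - H.[1] * hint 0 b 1 t) + H.[1] * hint 0 b 1 t @[t --> 0^'+] -->
    0 + H.[1] * Num.sqrt pi by exact: cvgD.
have E : \forall t \near 0^'+,
    (hint 0 b H t - H.[1] * hint 0 b 1 t) + H.[1] * hint 0 b 1 t = hint 0 b H t.
  by near=> t; rewrite subrK.
exact: (cvg_trans (near_eq_cvg E) c2).
Unshelve. all: by end_near. Qed.

Lemma hint_cvg k b h g : 0 < b -> h = ('X - (sr b)%:P) ^+ k * g ->
  hint k b h t @[t --> 0^'+] --> Num.sqrt pi * (\prod_(i < k) (2 * i%:R + 1)) * h.[1].
Proof.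
move=> b0 hE; have [H H1 HE] := hint_reduce (ltW b0) hE.
have := @hint0_H b H b0; rewrite H1 mulrA; apply: cvg_trans; apply: near_eq_cvg.
by near=> t; rewrite HE.
Unshelve. all: by end_near. Qed.

(** [cosh^j d <= exp (j d)], and completing the square gives [j d - d^2 / 8t <= 2 j^2 t]; the other
    half of the Gaussian exponent is kept for convergence. *)
Lemma hint0_Xn_le j t b : 0 < t -> 0 <= b ->
  hint 0 b 'X^j t <= Num.sqrt 2 * expR (2 * j%:R ^+ 2 * t) * Num.sqrt pi.
Proof.
move=> t0 b0; have t20 : 0 < 2 * t by rewrite mulr_gt0.
have cj := @continuous_hint 0 'X^j t t0; have c12 := @continuous_hint 0 1 (2 * t) t20.
apply: (@le_trans _ _ (Num.sqrt 2 * expR (2 * j%:R ^+ 2 * t) * hint 0 b 1 (2 * t))); last first.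
  by rewrite ler_wpM2l ?hint0_1_le// mulr_ge0 ?sqrtr_ge0 ?expR_ge0.
rewrite /hint -integZ//; apply: le_integ => //; first by move=> r; cont_tac.
move=> r /andP[r0 _]; rewrite muln0 expr0 hornerXn hornerC !mulr1.
have s0 := sr_gt0 r; rewrite mulrA ler_wpM2r ?invr_ge0 ?(ltW s0)//.
have sj : sr r ^+ j <= expR (j%:R * rr r).
  rewrite expRM_natl; apply: lerXn2r; rewrite ?nnegrE ?expR_ge0 ?(ltW s0)//.
  exact: sr_le_exp.
rewrite /v /= /v0 acosh2_sr; set x := rr r in sj *.
apply: (@le_trans _ _ ((Num.sqrt t)^-1 * expR (- x ^+ 2 / (4 * t)) * expR (j%:R * x))).
  by rewrite ler_wpM2l// mulr_ge0 ?invr_ge0 ?sqrtr_ge0 ?expR_ge0.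
have q2 : Num.sqrt 2 != 0 :> R by rewrite gt_eqF// sqrtr_gt0.
have qt : Num.sqrt t != 0 by rewrite gt_eqF// sqrtr_gt0.
have -> : Num.sqrt 2 * expR (2 * j%:R ^+ 2 * t) * ((Num.sqrt (2 * t))^-1 * expR (- x ^+ 2 / (4 * (2 * t)))) =
   (Num.sqrt t)^-1 * (expR (2 * j%:R ^+ 2 * t) * expR (- x ^+ 2 / (4 * (2 * t)))).
  by rewrite sqrtrM//; set e1 := expR _; set e2 := expR _; field; rewrite q2 qt.
rewrite -mulrA -!expRD ler_wpM2l ?invr_ge0 ?sqrtr_ge0// ler_expR -subr_ge0.
have -> : 2 * j%:R ^+ 2 * t + - x ^+ 2 / (4 * (2 * t)) - (- x ^+ 2 / (4 * t) + j%:R * x) =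
  (x - 4 * j%:R * t) ^+ 2 / (8 * t) by field; rewrite gt_eqF.
by rewrite divr_ge0 ?sqr_ge0// mulr_ge0// ltW.
Qed.

Lemma hint_Xn_le k j (t0 : R) : exists C : R, forall b t, 0 <= b -> 0 < t <= t0 ->
  hint k b 'X^j t <= C.
Proof.
elim: k j => [|k IH] j.
  exists (Num.sqrt 2 * expR (2 * j%:R ^+ 2 * t0) * Num.sqrt pi) => b t b0 /andP[t_gt0 tt0].
  apply: (le_trans (hint0_Xn_le j t_gt0 b0)).
  by rewrite ler_wpM2r ?sqrtr_ge0// ler_wpM2l ?sqrtr_ge0// ler_expR ler_wpM2l// mulr_ge0 ?sqr_ge0.
have [C CP] := IH j.+1; exists ((j%:R + 2 * k%:R + 1) * C) => b t b0 /andP[t_gt0 tt0].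
apply: (le_trans (hint_le_rec k j t_gt0 b0)); apply: ler_wpM2l.
  by rewrite !addr_ge0 ?mulr_ge0.
by apply: CP => //; rewrite t_gt0.
Qed.

End HyperbolicIntegrals.

(** * Radial solutions of the heat equation *)

Section RadialSolutions.
Context (R : realType).
Implicit Types (r s t b : R).

Lemma cont_pair (T U V : topologicalType) (a : T -> U) (b : T -> V) x :
  {for x, continuous a} -> {for x, continuous b} ->
  {for x, continuous (fun z => (a z, b z))}.
Proof. by move=> ca cb; exact: (cvg_pair ca cb). Qed.

Section profile.
Variables (m : nat).
Local Notation n := (2 * m).+1.
Local Notation e0 := (delta_mx 0 0 : 'rV[R]_n).
Variables (N : nat) (M : embedded R N n) (c : chart_index M).
Variables (dens alpha beta dg ddg : R -> R).
Hypothesis densE : forall x, density c x = dens (sqnorm x).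
Hypothesis dens_neq0 : forall s, 0 <= s -> dens s != 0.
Hypothesis invE : forall x i j, (invmx (metric c x)) i j =
  alpha (sqnorm x) * (i == j)%:R + beta (sqnorm x) * (x 0 i * x 0 j).
Hypothesis dgE : forall s, 0 < s -> dg s = dens s * (alpha s + beta s * s).
Hypothesis Ddg : forall s, 0 < s -> is_derive s 1 dg (ddg s).
Variable u : R -> 'rV[R]_n -> R.
Hypothesis u_C12 : C12 u.
Hypothesis u_heat : forall t x, 0 < t ->
  derive1 (fun s => u s x) t = laplace_beltrami c (u t) x.
Hypothesis u_radial : forall t x, u t x = u t (Num.sqrt (sqnorm x) *: e0).

Definition prof t r : R := u t (r *: e0).
Definition prof1 t r : R := partial 0 (u t) (r *: e0).
Definition prof2 t r : R := partial 0 (partial 0 (u t)) (r *: e0).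
Definition proft t r : R := derive1 (fun s => u s (r *: e0)) t.

Let is_derive_axis (f : 'rV[R]_n -> R) r : derivable f (r *: e0) e0 ->
  is_derive r 1 (fun r => f (r *: e0)) (partial 0 f (r *: e0)).
Proof.
move=> D; have /is_derive_line D0 : is_derive (r *: e0) e0 f (partial 0 f (r *: e0)).
  by apply: DeriveDef.
have Ds : is_derive r 1 (fun r' => r' - r) 1 by isd_tac; ring.
have D1 : is_derive (r - r) 1 (fun h : R => f (h *: e0 + r *: e0)) (partial 0 f (r *: e0)).
  by rewrite subrr.
have := isd_comp Ds D1; rewrite mulr1.
rewrite (_ : (fun y => _) = fun r => f (r *: e0))//.
by apply/funext => y; rewrite -scalerDl subrK.
Qed.

Lemma is_derive_prof t r : 0 < t -> is_derive r 1 (prof t) (prof1 t r).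
Proof. by move=> t0; apply: is_derive_axis; have [] := u_C12 (r *: e0) t0. Qed.

Lemma is_derive_prof1 t r : 0 < t -> is_derive r 1 (prof1 t) (prof2 t r).
Proof. by move=> t0; apply: is_derive_axis; have [] := u_C12 (r *: e0) t0. Qed.

Lemma is_derive_proft t r : 0 < t -> is_derive t 1 (prof ^~ r) (proft t r).
Proof.
move=> t0; rewrite /proft derive1E; have [D _ _ _ _] := u_C12 (r *: e0) t0.
by apply: DeriveDef.
Qed.

Let cont_axis (F : R * 'rV[R]_n -> R) t r : {for (t, r *: e0), continuous F} ->
  {for (t, r), continuous (fun z : R * R => F (z.1, z.2 *: e0))}.
Proof.
move=> cF; have c2 : {for (t, r), continuous (fun z : R * R => (z.1, z.2 *: e0))}.
  apply: cont_pair; first exact: cvg_fst.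
  apply: (@continuous_comp _ _ _ snd (fun r : R => r *: e0)); first exact: cvg_snd.
  exact: scalel_continuous.
exact: (continuous_comp c2 cF).
Qed.

Lemma prof_cont t r : 0 < t -> {for (t, r), continuous (fun z : R * R => prof z.1 z.2)}.
Proof. by move=> t0; have [_ _ _ H _] := u_C12 (r *: e0) t0; exact: (cont_axis H). Qed.

Lemma proft_cont t r : 0 < t -> {for (t, r), continuous (fun z : R * R => proft z.1 z.2)}.
Proof. by move=> t0; have [_ _ _ _ [H _ _]] := u_C12 (r *: e0) t0; exact: (cont_axis H). Qed.

Lemma prof1_cont t r : 0 < t -> {for (t, r), continuous (fun z : R * R => prof1 z.1 z.2)}.
Proof. by move=> t0; have [_ _ _ _ [_ H _]] := u_C12 (r *: e0) t0; exact: (cont_axis (H _)). Qed.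

Lemma cont_section (F : R -> R -> R) t r :
  {for (t, r), continuous (fun z : R * R => F z.1 z.2)} -> {for r, continuous (F t)}.
Proof.
move=> cF; have c2 : {for r, continuous (fun y : R => (t, y))}.
  by apply: cont_pair; [exact: cvg_cst|exact: cvg_id].
exact: (continuous_comp c2 cF).
Qed.

(** The radial heat equation in divergence form. [laplace_radial] works in [s = r^2], so the profile
    is composed with a square root, legitimate for [0 < r] only; Green's formula needs no more. *)
Lemma radial_flux t r : 0 < t -> 0 < r ->
  is_derive r 1 (fun r => r ^+ (2 * m) * dg (r ^+ 2) * prof1 t r)
    (r ^+ (2 * m) * dens (r ^+ 2) * proft t r).
Proof.
move=> t0 r0; set x := r *: e0.
have sx : sqnorm x = r ^+ 2 by rewrite /x sqnormZ sqnorm_delta mulr1.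
have r20 : 0 < r ^+ 2 by rewrite exprn_gt0.
have sr2 : Num.sqrt (r ^+ 2) = r by rewrite sqrtr_sqr ger0_norm// ltW.
pose B s := prof t (Num.sqrt s).
pose B1 s := prof1 t (Num.sqrt s) / (2 * Num.sqrt s).
pose F s := dg s * (prof1 t (Num.sqrt s) / Num.sqrt s).
have q0 s : 0 < s -> Num.sqrt s != 0 by move=> s0; rewrite gt_eqF// sqrtr_gt0.
have DB s : 0 < s -> is_derive s 1 B (B1 s).
  move=> s0; have D := isd_comp (isd_sqrt s0 (isd_id s)) (is_derive_prof (Num.sqrt s) t0).
  by apply: isd_eq D _; rewrite /B1; field; exact: q0.
have D1 s : 0 < s -> is_derive s 1 (fun s => prof1 t (Num.sqrt s)) (prof2 t (Num.sqrt s) / (2 * Num.sqrt s)).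
  move=> s0; have D := isd_comp (isd_sqrt s0 (isd_id s)) (is_derive_prof1 (Num.sqrt s) t0).
  by apply: isd_eq D _; field; exact: q0.
pose dF := dg (r ^+ 2) * (prof2 t r / (2 * r) / r - prof1 t r / (2 * r ^+ 3)) +
  prof1 t r / r * ddg (r ^+ 2).
have rn0 : r != 0 by rewrite gt_eqF.
have DF : is_derive (sqnorm x) 1 F dF.
  rewrite sx; have Dg := Ddg r20; have D1' := D1 _ r20.
  rewrite /F; isd_tac; first exact: q0.
    by [].
  by rewrite sr2 /dF; field.
have nearp : \forall s \near sqnorm x, 0 < s by apply: lt_nbhsr; rewrite sx.
have uB : \forall y \near x, u t y = B (sqnorm y) by near=> y; exact: u_radial.
have DBn : \forall s \near sqnorm x, is_derive (s : R) 1 B (B1 s).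
  by apply: filterS nearp => s s0; exact: DB.
have FE : \forall s \near sqnorm x, F s = 2 * dens s * (alpha s + beta s * s) * B1 s.
  apply: filterS nearp => s s0; rewrite /F dgE// /B1; have := q0 _ s0 => ?.
  by field.
have heat := u_heat x t0.
rewrite (laplace_radial densE invE uB DBn FE DF) sx in heat.
have DFr : is_derive r 1 (fun r => F (r ^+ 2)) (dF * (2 * r)).
  have D2 : is_derive r 1 (fun r : R => r ^+ 2) (2 * r) by isd_tac; rewrite /=; ring.
  by apply: isd_comp D2 _; rewrite -sx.
have D : is_derive r 1 (fun r => r ^+ n * F (r ^+ 2)) (r ^+ (2 * m) * dens (r ^+ 2) * proft t r).
  isd_tac; rewrite /proft -/x heat /=.
  rewrite exprS; have := dens_neq0 (ltW r20); set d := dens _ => d0.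
  set q := r ^+ (2 * m); by field.
apply: near_eq_is_derive D; near=> y.
have y0 : 0 < y by near: y; exact: lt_nbhsr.
rewrite /F sqrtr_sqr (ger0_norm (ltW y0)) exprS; have yn0 : y != 0 by rewrite gt_eqF.
by field.
Unshelve. all: by end_near. Qed.

Section moment.
Variables (P P1 Q : R -> R).
Hypotheses (cP : continuous P) (cP1 : continuous P1) (cQ : continuous Q).
Hypothesis (cW : continuous (fun r => r ^+ (2 * m) * dens (r ^+ 2))).
Hypothesis (cG : continuous (fun r => r ^+ (2 * m) * dg (r ^+ 2))).
Hypothesis DP : forall r, 0 < r -> is_derive r 1 P (P1 r).
Hypothesis DGP : forall r, 0 < r ->
  is_derive r 1 (fun r => r ^+ (2 * m) * dg (r ^+ 2) * P1 r) (r ^+ (2 * m) * dens (r ^+ 2) * Q r).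

Lemma prof_continuous t : 0 < t -> continuous (prof t).
Proof. by move=> t0 r; exact: (cont_section (@prof_cont t r t0)). Qed.

Lemma proft_continuous t : 0 < t -> continuous (proft t).
Proof. by move=> t0 r; exact: (cont_section (@proft_cont t r t0)). Qed.

Lemma prof1_continuous t : 0 < t -> continuous (prof1 t).
Proof. by move=> t0 r; exact: (cont_section (@prof1_cont t r t0)). Qed.

Lemma radial_green t b : (0 < m)%N -> 0 < t -> 0 <= b ->
  integ 0 b (fun r => r ^+ (2 * m) * dens (r ^+ 2) * (proft t r * P r)) =
  integ 0 b (fun r => r ^+ (2 * m) * dens (r ^+ 2) * (prof t r * Q r)) +
  b ^+ (2 * m) * dg (b ^+ 2) * (prof1 t b * P b - prof t b * P1 b).
Proof.
move=> m0 t0 b0; apply/eqP; rewrite addrC -subr_eq; apply/eqP.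
have c0 := @prof_continuous t t0; have ct := @proft_continuous t t0.
have c1 := @prof1_continuous t t0.
rewrite -integB; [|by move=> r; cont_tac|by move=> r; cont_tac].
pose F r := r ^+ (2 * m) * dg (r ^+ 2) * (prof1 t r * P r - prof t r * P1 r).
(* The weight [r^(2 m)] vanishes at the origin because [0 < m]. *)
transitivity (F b - F 0); last by rewrite /F expr0n muln_eq0 /= (gtn_eqF m0) !mul0r subr0.
apply: integ_FTC => //.
- by move=> r; cont_tac.
- by move=> r; rewrite /F; cont_tac.
move=> r /andP[r0 _]; rewrite /F.
rewrite (_ : (fun r => _) = fun r => (r ^+ (2 * m) * dg (r ^+ 2) * prof1 t r) * P r -
  prof t r * (r ^+ (2 * m) * dg (r ^+ 2) * P1 r)); last by apply/funext => y; ring.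
have D1 := radial_flux t0 r0; have D2 := DGP r0; have D3 := DP r0.
have D4 := is_derive_prof r t0.
by isd_tac; ring.
Qed.

Lemma is_derive_moment t b : 0 < t ->
  is_derive t 1 (fun t => integ 0 b (fun r => r ^+ (2 * m) * dens (r ^+ 2) * (prof t r * P r)))
   (integ 0 b (fun r => r ^+ (2 * m) * dens (r ^+ 2) * (proft t r * P r))).
Proof.
move=> t0.
apply: (@is_derive_under_integ R (fun t r => r ^+ (2 * m) * dens (r ^+ 2) * (prof t r * P r))
   (fun t r => r ^+ (2 * m) * dens (r ^+ 2) * (proft t r * P r)) 0 (t + 1) 0 b).
- by rewrite t0 ltrDl/=.
- move=> s /andP[s0 _]; have c0 := @prof_continuous s s0.
  by move=> r; cont_tac.
- move=> s r /andP[s0 _]; have D := is_derive_proft r s0.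
  by isd_tac; ring.
- move=> s r /andP[s0 _]; have ct := @proft_cont s r s0.
  have cW' : {for (s, r), continuous (fun z : R * R => z.2 ^+ (2 * m) * dens (z.2 ^+ 2))}.
    by apply: (cont_comp (h := fun r => r ^+ (2 * m) * dens (r ^+ 2))); [exact: cvg_snd|exact: cW].
  have cP' : {for (s, r), continuous (fun z : R * R => P z.2)}.
    by apply: (cont_comp (h := P)); [exact: cvg_snd|exact: cP].
  by cont_tac.
Qed.

End moment.
End profile.
End RadialSolutions.

(** * Moments of the Gaussian and the constant of polar coordinates *)

Section GaussMoments.
Context (R : realType).
Implicit Types (x X : R).

Lemma expR_ge_pow x n : 0 <= x -> x ^+ n / n`!%:R <= expR x.
Proof.
move=> x0; case: n => [|n]; first by rewrite expr0 divr1 -[X in X <= _]expR0 ler_expR.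
by apply: le_trans (expR_ge1Dxn n x0); rewrite lerDr.
Qed.

Lemma pow_gauss_cvg0 k : X ^+ k * expR (- X ^+ 2) @[X --> +oo%R] --> (0 : R).
Proof.
have c0 : k.+1`!%:R * X^-1 @[X --> +oo%R] --> (k.+1`!%:R * 0 : R).
  apply: cvgM; first exact: cvg_cst.
  apply/cvgrPdist_le => [e e0]; near=> X.
  have eX : e^-1 <= X by near: X; apply: nbhs_pinfty_ge; apply: num_real.
  have X0 : 0 < X by rewrite (lt_le_trans _ eX)// invr_gt0.
  rewrite sub0r normrN ger0_norm ?invr_ge0 ?(ltW X0)// -[e]invrK lef_pV2 ?posrE ?invr_gt0//.
rewrite mulr0 in c0.
apply: (@squeeze_cvgr _ _ _ _ (fun=> 0) (fun X => k.+1`!%:R * X^-1)) => //; last exact: cvg_cst.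
near=> X; have X1 : 1 <= X by near: X; exact: nbhs_pinfty_ge.
have X0 : 0 < X by lra.
rewrite mulr_ge0 ?expR_ge0 ?exprn_ge0 ?(ltW X0)//=.
rewrite expRN ler_pdivrMr ?expR_gt0// mulrAC ler_pdivlMr// -exprSr mulrC -ler_pdivrMr; last first.
  by rewrite ltr0n fact_gt0.
apply: le_trans (expR_ge_pow k.+1 (sqr_ge0 X)).
rewrite ler_wpM2r ?invr_ge0 ?ler0n//.
by apply: lerXn2r; rewrite ?nnegrE ?sqr_ge0 ?(ltW X0)// expr2 ler_peMr// ltW.
Unshelve. all: by end_near. Qed.

Definition gaussM p X : R := integ 0 X (fun x => x ^+ (2 * p) * expR (- x ^+ 2)).

Lemma gaussM0 X : gaussM 0 X = gaussI X.
Proof. by apply: eq_integ => x _; rewrite muln0 expr0 mul1r. Qed.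

Lemma gaussM_rec p X : 0 <= X ->
  gaussM p.+1 X = (p%:R + 2^-1) * gaussM p X - 2^-1 * (X ^+ (2 * p).+1 * expR (- X ^+ 2)).
Proof.
move=> X0; pose F x : R := 2^-1 * (x ^+ (2 * p).+1 * expR (- x ^+ 2)).
have E : (p%:R + 2^-1) * gaussM p X - gaussM p.+1 X = F X - F 0; last first.
  have F0 : F 0 = 0 by rewrite /F exprS !mul0r mulr0.
  by rewrite -/(F X) -[F X]subr0 -F0 -E; ring.
rewrite /gaussM -integZ; last by move=> x; cont_tac.
rewrite -integB; [|by move=> x; cont_tac|by move=> x; cont_tac].
apply: integ_FTC_closed => //; first by move=> x; cont_tac.
move=> x _; rewrite /F; isd_tac.
have kE : (2 * p).+1%:R = 2 * p%:R + 1 :> R by rewrite -natr1 natrM.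
rewrite kE mulnS !exprS /=; set q := x ^+ (2 * p); set e := expR _.
by field.
Qed.

(** This is [Gamma (p + 1/2) / 2]; the product comes from the recursion [gaussM_rec]. *)
Definition gauss_moment p : R := Num.sqrt pi / 2 * \prod_(i < p) (i%:R + 2^-1).

Lemma gaussM_cvg p : gaussM p X @[X --> +oo%R] --> gauss_moment p.
Proof.
elim: p => [|p IH].
  rewrite /gauss_moment big_ord0 mulr1; have := @gaussI_cvg R.
  by under eq_fun do rewrite -gaussM0.
have E : \forall X \near +oo%R, (p%:R + 2^-1) * gaussM p X - 2^-1 * (X ^+ (2 * p).+1 * expR (- X ^+ 2)) = gaussM p.+1 X.
  near=> X; rewrite gaussM_rec//; near: X; exact: nbhs_pinfty_ge.
have c : (p%:R + 2^-1) * gaussM p X - 2^-1 * (X ^+ (2 * p).+1 * expR (- X ^+ 2)) @[X --> +oo%R] -->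
    (p%:R + 2^-1) * gauss_moment p - 2^-1 * 0.
  apply: cvgB; apply: cvgM; [exact: cvg_cst|exact: IH|exact: cvg_cst|exact: pow_gauss_cvg0].
rewrite mulr0 subr0 in c.
have -> : gauss_moment p.+1 = (p%:R + 2^-1) * gauss_moment p.
  by rewrite /gauss_moment big_ord_recr /=; ring.
exact: (cvg_trans (near_eq_cvg E) c).
Unshelve. all: by end_near. Qed.

Lemma gauss_moment_gt0 p : 0 < gauss_moment p.
Proof.
rewrite /gauss_moment mulr_gt0 ?divr_gt0 ?sqrtr_gt0 ?pi_gt0// prodr_gt0//.
Qed.

Lemma cvgn_of_cvgy (f : R -> R) (l : R) : f x @[x --> +oo%R] --> l -> f i%:R @[i --> \oo] --> l.
Proof. by move=> cf; apply: (cvg_comp _ _ _ cf); exact: cvgr_idn. Qed.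

(* The constant in polar coordinates, found by integrating the Gaussian. *)
Lemma polar_constant k m : k = (2 * m)%N ->
  k.+1%:R * ball_vol R k.+1 * gauss_moment m = Num.sqrt pi ^+ k.+1.
Proof.
move=> kE; pose g x : R := expR (- x ^+ 2).
have cg : continuous g by move=> x; rewrite /g; cont_tac.
have g0 x : 0 <= g x by exact: expR_ge0.
have := ge0_ball_integral_lim (k := k) cg g0.
have -> : (\int[lebesgue_tuple R k.+1]_v (g (trad v))%:E)%E = (Num.sqrt pi ^+ k.+1)%:E.
  rewrite -integral_gauss_tuple; apply: eq_integral => v _.
  by rewrite /g /trad sqr_sqrtr// tsq_ge0.
move=> /fine_cvgP[_] /= H.
have c2 : (k.+1%:R * ball_vol R k.+1) * gaussM m i%:R @[i --> \oo] -->
    (k.+1%:R * ball_vol R k.+1) * gauss_moment m.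
  by apply: cvgM; [exact: cvg_cst|exact: (@cvgn_of_cvgy (gaussM m) _ (@gaussM_cvg m))].
apply: (cvg_unique _ c2); first exact: Rhausdorff.
apply: cvg_trans H; apply: near_eq_cvg; near=> i => /=.
rewrite ball_integralE//; congr (_ * _); apply: eq_integ => x _.
by rewrite /g kE mulrC.
Unshelve. all: by end_near. Qed.

End GaussMoments.

(** * Initial condition and minimality in hyperbolic space *)

Section TestFunctions.
Context (R : realType).
Local Notation T n := (n.-tuple (measurableTypeR R)).

Lemma sqnorm_row n (v : T n) : sqnorm (\row_i (tnth v i : R)) = tsq v.
Proof. by apply: eq_bigr => i _; rewrite mxE. Qed.

Lemma compact_sqnorm_ball n (b : R) : compact [set x : 'rV[R]_n | sqnorm x <= b].
Proof.
apply: bounded_closed_compact; last first.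
  rewrite (_ : [set x | _] = @sqnorm R n @^-1` [set y | y <= b])//.
  by apply: preimage_closed; [move=> x _; exact: continuous_sqnorm|exact: closed_le].
exists (1 + `|b|); split; first exact: num_real.
move=> M bM x /= xb.
have b0 : 0 <= b by exact: le_trans (sqnorm_ge0 x) xb.
have M0 : 0 < M by rewrite (lt_trans _ bM)// ltr_pwDl.
rewrite /Num.norm/= mx_normrE (bigmax_le _ (ltW M0))// => -[i j] _ /=; rewrite ord1.
rewrite -(ler_pXn2r (n := 2)) ?nnegrE ?(ltW M0)// real_normK ?num_real//.
apply: (@le_trans _ _ b).
  by apply: le_trans xb; rewrite /sqnorm (bigD1 j)//= lerDl sumr_ge0// => k _; exact: sqr_ge0.
rewrite ger0_norm// in bM; rewrite expr2.
have M1 : 1 <= M by lra.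
by rewrite (@le_trans _ _ M)//; [lra|rewrite ler_peMr// ltW].
Qed.

Lemma sphere_compact n : compact (carrier (sphere R n)).
Proof.
apply: (subclosed_compact _ (@compact_sqnorm_ball (1 + n) 1)); last first.
  by move=> x /= xc; rewrite /= sqnormE xc.
rewrite (_ : carrier _ = @sqnorm R (1 + n) @^-1` [set y | y = 1]).
  by apply: preimage_closed; [move=> x _; exact: continuous_sqnorm|exact: closed_eq].
by apply/seteqP; split=> x /=; rewrite sqnormE.
Qed.

Lemma hyperboloid_chart_surj n z : carrier (hyperbolic_space R n) z ->
  z = hyperboloid_chart (rsubmx z).
Proof.
case; rewrite pairing_minkowski => zz z0.
have z0E : z 0 0 = Num.sqrt (1 + sqnorm (rsubmx z)).
  have <- : (z 0 0) ^+ 2 = 1 + sqnorm (rsubmx z).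
    rewrite /sqnorm (eq_bigr (fun k => z 0 (rshift 1 k) * z 0 (rshift 1 k))); last first.
      by move=> k _; rewrite mxE expr2.
    by rewrite expr2; lra.
  by rewrite sqrtr_sqr ger0_norm// ltW.
rewrite /hyperboloid_chart -z0E -[LHS](hsubmxK z); congr row_mx.
apply/rowP => i; rewrite !ord1 !mxE eqxx mulr1n; congr (z _ _); exact: val_inj.
Qed.

Lemma hyperboloid_chart00 n (x : 'rV[R]_n) : hyperboloid_chart x 0 0 = sr (Num.sqrt (sqnorm x)).
Proof.
rewrite /hyperboloid_chart /sr sqr_sqrtr ?sqnorm_ge0//.
rewrite (_ : 0 = lshift n 0 :> 'I_(1 + n)); last exact: val_inj.
by rewrite row_mxEl mxE eqxx.
Qed.

Lemma continuous_hyperboloid_chart n : continuous (@hyperboloid_chart R n).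
Proof.
move=> x; apply: cont_rV; apply: split_1n => [|k].
  rewrite (_ : (fun y => _) = fun y => sr (Num.sqrt (sqnorm y))); last first.
    by apply/funext => y; exact: hyperboloid_chart00.
  change {for x, continuous (fun y : 'rV[R]_n => sr (Num.sqrt (sqnorm y)))}.
  apply: (cont_comp (h := @sr R)); last exact: continuous_sr.
  by apply: cont_sqrt; exact: continuous_sqnorm.
rewrite (_ : (fun y => _) = fun y : 'rV[R]_n => y 0 k); first exact: coord_continuous.
by apply/funext => y; rewrite /hyperboloid_chart row_mxEr.
Qed.

Lemma compact_hyperboloid n b :
  compact [set z | carrier (hyperbolic_space R n) z /\ z 0 0 <= sr b].
Proof.
rewrite (_ : mkset _ = @hyperboloid_chart R n @` [set x | sqnorm x <= b ^+ 2]).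
  apply: continuous_compact; last exact: compact_sqnorm_ball.
  exact/continuous_subspaceT/continuous_hyperboloid_chart.
have srE (x : 'rV[R]_n) : (sr (Num.sqrt (sqnorm x)) <= sr b) = (sqnorm x <= b ^+ 2).
  rewrite -(ler_pXn2r (n := 2)) ?nnegrE ?(ltW (sr_gt0 _))// !sqr_sr.
  by rewrite sqr_sqrtr ?sqnorm_ge0// lerD2l.
apply/seteqP; split=> [z [zc zb]|_ [x xb <-]] /=.
  exists (rsubmx z); last by rewrite -hyperboloid_chart_surj.
  by rewrite /= -srE -hyperboloid_chart00 -hyperboloid_chart_surj.
split; first exact: hyperboloid_chart_carrier.
by rewrite hyperboloid_chart00 srE.
Qed.

Section volume.
Variable m : nat.
Local Notation n := (2 * m).+1.
Local Notation H := (hyperbolic_space R n).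

(** The area of the unit sphere of [R^n], of dimension [2 m]. *)
Definition polar_cst : R := n%:R * ball_vol R n.

Lemma polar_cst_gt0 : 0 < polar_cst.
Proof.
have := polar_constant R (erefl (2 * m)%N); rewrite -/polar_cst => E.
by rewrite -(pmulr_lgt0 _ (gauss_moment_gt0 R m)) E exprn_gt0// sqrtr_gt0 pi_gt0.
Qed.

Definition hyp_integrand (F : 'rV[R]_(1 + n) -> R) (v : T n) : R :=
  let x := \row_i (tnth v i : R) in F (hyperboloid_chart x) / sr (trad v).

Lemma hyp_volume_integralE F :
  volume_integral H F = \int[lebesgue_tuple R n]_v hyp_integrand F v.
Proof.
apply: eq_Rintegral => v _; rewrite /= /hyp_integrand hyperboloid_density sqnorm_row.
by rewrite /sr /trad sqr_sqrtr ?tsq_ge0.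
Qed.

Lemma hyp_integral_truncated (g : R -> R) b F : continuous g -> 0 <= b ->
  (forall x, Num.sqrt (sqnorm x) <= b -> F (hyperboloid_chart x) = g (Num.sqrt (sqnorm x))) ->
  (forall x, b < Num.sqrt (sqnorm x) -> F (hyperboloid_chart x) = 0) ->
  (lebesgue_tuple R n).-integrable setT (EFin \o hyp_integrand F) /\
  \int[lebesgue_tuple R n]_v hyp_integrand F v =
    polar_cst * integ 0 b (fun r => r ^+ (2 * m) * (sr r)^-1 * g r).
Proof.
move=> cg b0 Fin Fout.
have cg' : continuous (fun r => g r / sr r).
  by have cs := @continuous_sr R; move=> r; cont_tac; exact: sr_neq0.
have [||i e] := @integral_truncated R (2 * m) _ b (hyp_integrand F) cg'.
- move=> v vb; rewrite /hyp_integrand Fin ?sqnorm_row//.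
- by move=> v vb; rewrite /hyp_integrand Fout ?mul0r ?sqnorm_row.
split=> //; rewrite e ball_integralE//; congr (_ * _); apply: eq_integ => r _; ring.
Qed.

End volume.
End TestFunctions.

Section InitialCondition.
Context (R : realType).
Local Notation T n := (n.-tuple (measurableTypeR R)).

(** The pointwise bound also supplies the integrability of [F], without which its integral would
    carry no information. *)
Lemma Rintegral_dist_le d (X : measurableType d) (mu : {measure set X -> \bar R})
    (F T0 T1 : X -> R) (c e C : R) :
  measurable_fun setT F -> mu.-integrable setT (EFin \o T0) ->
  mu.-integrable setT (EFin \o T1) ->
  (forall v, `|F v - c * T0 v| <= e * T0 v + C * T1 v) ->
  `|\int[mu]_v F v - c * \int[mu]_v T0 v| <= e * \int[mu]_v T0 v + C * \int[mu]_v T1 v.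
Proof.
move=> mF i0 i1 bF.
have iZ k (f : X -> R) : mu.-integrable setT (EFin \o f) ->
    mu.-integrable setT (EFin \o (fun v => k * f v)).
  by move=> jf; exact: (integrableZl measurableT k jf).
have iU : mu.-integrable setT (EFin \o (fun v => e * T0 v + C * T1 v)).
  exact: (integrableD measurableT (iZ e _ i0) (iZ C _ i1)).
have mT0 : measurable_fun setT T0.
  by have /measurable_int := i0; move/measurable_EFinP.
have iB : mu.-integrable setT (EFin \o (fun v => F v - c * T0 v)).
  apply: (le_integrable measurableT _ _ iU).
    apply/measurable_EFinP; apply: measurable_funB => //.
    by apply: measurable_funM => //; exact: measurable_cst.
  by move=> v _ /=; rewrite lee_fin; apply: (le_trans (bF v)); exact: ler_norm.
have iF : mu.-integrable setT (EFin \o F).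
  have := integrableD measurableT iB (iZ c _ i0).
  by congr (integrable _ _ _); apply/funext => v /=; rewrite -EFinD subrK.
rewrite -(RintegralZl c measurableT i0) -(RintegralB measurableT iF (iZ c _ i0)).
apply: (le_trans (le_normr_Rintegral measurableT iB)).
rewrite -(RintegralZl e measurableT i0) -(RintegralZl C measurableT i1).
rewrite -(RintegralD measurableT (iZ e _ i0) (iZ C _ i1)).
by apply: le_Rintegral => //; exact: (integrable_abse iB).
Qed.

Lemma near_sqnorm0 n (P : set 'rV[R]_n) : (\forall x \near (0 : 'rV[R]_n), P x) ->
  exists2 r : R, 0 < r & forall x, sqnorm x < r -> P x.
Proof.
move=> /nbhs_ballP[r /= r0 rP]; exists (r ^+ 2); first exact: exprn_gt0.
move=> x xr; apply: rP; split=> // i j; rewrite ord1 /ball /= mxE sub0r normrN.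
rewrite -(ltr_pXn2r (n := 2)) ?nnegrE ?(ltW r0)// real_normK ?num_real//.
apply: le_lt_trans xr.
by rewrite /sqnorm (bigD1 j)//= lerDl sumr_ge0// => k _; exact: sqr_ge0.
Qed.

Lemma continuous_bounded_compact (X : topologicalType) (A : set X) (f : X -> R) : compact A ->
  {within A, continuous f} -> exists M, forall x, A x -> `|f x| <= M.
Proof.
move=> cA cf; have /compact_bounded[M [_ bM]] := continuous_compact cf cA.
exists (M + 1) => x Ax; apply: (bM (M + 1)); first by rewrite ltrDl.
by exists x.
Qed.

Section hyperbolic.
Variable m : nat.
Local Notation n := (2 * m).+1.
Local Notation H := (hyperbolic_space R n).
Local Notation nrm x := (Num.sqrt (sqnorm x)).

Lemma hker_chartE C t (x : 'rV[R]_n) :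
  hker C t (hyperboloid_chart x) = C * expR (- (m%:R ^+ 2 * t)) * v m t (sr (nrm x)).
Proof. by rewrite /hker hyperboloid_chart00. Qed.

Lemma test_function_chart f : test_function H f ->
  continuous (fun x : 'rV[R]_n => f (hyperboloid_chart x)).
Proof.
move=> [/subspace_continuousP cf _] x U /= Uf.
have nx : \forall y \near x, (fun z => carrier H z -> U (f z)) (hyperboloid_chart y).
  exact: (@continuous_hyperboloid_chart R n x _ (cf _ (hyperboloid_chart_carrier x) U Uf)).
by apply: filterS nx => y /=; apply; exact: hyperboloid_chart_carrier.
Qed.

Lemma test_function_support f : test_function H f -> exists2 S : R, 1 <= S &
  forall x : 'rV[R]_n, S < sr (nrm x) -> f (hyperboloid_chart x) = 0.
Proof.
move=> [_ [K [cK KH K0]]].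
have [M bM] : exists M, forall z, K z -> `|z 0 0| <= M.
  by apply: (continuous_bounded_compact cK); apply: continuous_subspaceT => z; exact: coord_continuous.
exists (Num.max 1 M); first by rewrite le_max lexx.
move=> x; rewrite gt_max => /andP[_ Mx]; apply: K0; first exact: hyperboloid_chart_carrier.
move=> /bM; rewrite hyperboloid_chart00 leNgt ger0_norm ?Mx//.
exact/ltW/sr_gt0.
Qed.

(** [h] is normalised by [h 1 = 1] and has a zero of order [m] at [S], as the integrations by parts
    require. Near the base point continuity gives the error [e h]; elsewhere [s - 1] is bounded
    below and [f] is at most a multiple of [h], since [f] vanishes beyond [S0 < S]. *)
Lemma test_function_estimate f (S S0 : R) : test_function H f -> 1 <= S0 -> S0 < S ->
  (forall x : 'rV[R]_n, S0 < sr (nrm x) -> f (hyperboloid_chart x) = 0) ->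
  let h s := ((S - s) / (S - 1)) ^+ m in
  forall e : R, 0 < e -> exists2 C : R, 0 <= C &
  forall x : 'rV[R]_n, let s := sr (nrm x) in s <= S ->
    `|f (hyperboloid_chart x) - f (hyperboloid_chart 0) * h s| <= e * h s + C * ((s - 1) * h s).
Proof.
move=> tf S01 S0S supp h e e0.
have cf := test_function_chart tf; set phi := fun x : 'rV[R]_n => _ in cf.
have S1 : 0 < S - 1 by lra.
have h0 s : s <= S -> 0 <= h s by move=> sS; rewrite exprn_ge0// divr_ge0//; lra.
have srn (x : 'rV[R]_n) : sr (nrm x) = Num.sqrt (1 + sqnorm x) by rewrite /sr sqr_sqrtr// sqnorm_ge0.
have [M bM] : exists M, forall x, [set x | sqnorm x <= S ^+ 2] x -> `|phi x| <= M.
  by apply: continuous_bounded_compact; [exact: compact_sqnorm_ball|exact: continuous_subspaceT].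
pose hm := h S0; have hm0 : 0 < hm by rewrite exprn_gt0// divr_gt0//; lra.
pose M' := `|M| / hm; have M'0 : 0 <= M' by rewrite divr_ge0// ltW.
have bphi x : sr (nrm x) <= S -> `|phi x| <= M' * h (sr (nrm x)).
  move=> sS; have [sS0|sS0] := leP (sr (nrm x)) S0; last first.
    by rewrite /phi supp// normr0 mulr_ge0// h0.
  apply: (@le_trans _ _ `|M|).
    apply: le_trans (ler_norm M); apply: bM => /=.
    rewrite (_ : sqnorm x = sr (nrm x) ^+ 2 - 1); last first.
      by rewrite sqr_sr sqr_sqrtr ?sqnorm_ge0//; ring.
    rewrite lerBlDr (@le_trans _ _ (S ^+ 2))//; last by rewrite lerDl.
    by rewrite ler_pXn2r ?nnegrE ?(ltW (sr_gt0 _))//; lra.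
  rewrite /M' mulrAC ler_pdivlMr// ler_wpM2l// /hm lerXn2r ?nnegrE ?divr_ge0//; try lra.
  by rewrite ler_pM2r ?invr_gt0//; lra.
have csr : continuous (fun x : 'rV[R]_n => sr (nrm x)).
  move=> x; change {for x, continuous (fun x : 'rV[R]_n => sr (nrm x))}.
  apply: (cont_comp (h := @sr R)); last exact: continuous_sr.
  by apply: cont_sqrt; exact: continuous_sqnorm.
have ch : continuous (fun x : 'rV[R]_n => h (sr (nrm x))) by move=> x; rewrite /h; cont_tac.
have s0 : sr (nrm (0 : 'rV[R]_n)) = 1.
  by rewrite srn (_ : sqnorm 0 = 0) ?addr0 ?sqrtr1// /sqnorm big1// => i _; rewrite mxE expr0n.
have h1 : h 1 = 1 by rewrite /h divff ?expr1n// gt_eqF.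
pose D x := phi x - phi 0 * h (sr (nrm x)).
have cD : continuous D by move=> x; rewrite /D; cont_tac.
have D0 : D 0 = 0 by rewrite /D s0 h1 mulr1 subrr.
have [r r0 rP] : exists2 r : R, 0 < r & forall x, sqnorm x < r ->
    `|D x| <= e / 2 /\ 2^-1 <= h (sr (nrm x)).
  apply: near_sqnorm0; near=> x; split.
    near: x; have /cvgrPdist_le /(_ (e / 2)) := cD 0; rewrite D0.
    under eq_near do rewrite sub0r normrN; apply; exact: divr_gt0.
  near: x; apply: (cvgr_ge (h (sr (nrm (0 : 'rV[R]_n))))); first exact: ch.
  by rewrite s0 h1; lra.
(* Since [|x|^2 = (s - 1)(s + 1)] and [s <= S], [s - 1 < d] forces [|x|^2 < r]. *)
pose d := r / (S + 1); have Sp : 0 < S + 1 by lra.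
have d0 : 0 < d by rewrite divr_gt0.
exists ((M' + `|phi 0|) / d); first by rewrite divr_ge0 ?addr_ge0// ltW.
move=> x s sS; have hs0 := h0 _ sS; have s1 : 1 <= s by exact: sr_ge1.
change (`|D x| <= e * h s + (M' + `|phi 0|) / d * ((s - 1) * h s)).
have [ds|sd] := leP d (s - 1).
  apply: (@le_trans _ _ ((M' + `|phi 0|) * h s)).
    rewrite mulrDl (le_trans (ler_normB _ _))// lerD ?bphi// normrM ler_wpM2l//.
    by rewrite ger0_norm.
  apply: (@le_trans _ _ ((M' + `|phi 0|) / d * ((s - 1) * h s))); last by rewrite lerDr mulr_ge0// ltW.
  rewrite -mulrA ler_wpM2l ?addr_ge0// mulrA ler_peMl// mulrC ler_pdivlMr// mul1r//.
apply: (@le_trans _ _ (e * h s)); last first.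
  rewrite lerDl; apply: mulr_ge0; first by apply: divr_ge0; [exact: addr_ge0|exact: ltW].
  by apply: mulr_ge0 => //; rewrite subr_ge0.
have [|Dx hx] := rP x.
  have sE : s ^+ 2 = 1 + sqnorm x by rewrite /s sqr_sr sqr_sqrtr// sqnorm_ge0.
  have -> : sqnorm x = (s - 1) * (s + 1).
    by rewrite -[LHS](addrK 1) [sqnorm x + 1]addrC -sE; ring.
  rewrite -ltr_pdivlMr; last by lra.
  apply: lt_le_trans sd _; rewrite /d ler_pM2l// lef_pV2 ?posrE; lra.
by apply: (le_trans Dx); rewrite ler_pM2l.
Unshelve. all: by end_near. Qed.

(** The inverse of the limit of the unnormalised total mass, as given by [hint_cvg] for a test
    polynomial equal to [1] at [s = 1]. *)
Definition hyp_cst : R :=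
  (polar_cst R m * (Num.sqrt pi * \prod_(i < m) (2 * i%:R + 1)))^-1.

Lemma hyp_prod_gt0 : 0 < Num.sqrt pi * \prod_(i < m) (2 * i%:R + 1) :> R.
Proof.
by rewrite mulr_gt0 ?sqrtr_gt0 ?pi_gt0// prodr_gt0// => i _; rewrite -natrM natr1.
Qed.

Lemma hyp_cst_gt0 : 0 < hyp_cst.
Proof. by rewrite invr_gt0 mulr_gt0 ?polar_cst_gt0// hyp_prod_gt0. Qed.

(** A test function need not be radial, but it is compared with the radial [f(base) h]. The kernel
    integrates [h] to a limit [1] and [(s - 1) h] to a limit [0], so the error is at most [e / 2] in
    the limit. *)
Lemma hker_init f : test_function H f ->
  volume_integral H (fun x => hker hyp_cst t x * f x) @[t --> 0^'+] --> f (base_point R n).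
Proof.
move=> tf; have cphi := test_function_chart tf.
have [S0 S01 supp] := test_function_support tf.
set phi := fun x : 'rV[R]_n => _ in cphi.
have b0 : 0 < S0 by lra.
(* [S0] bounds [cosh d] on the support and is reused as the radius [r = sinh d] of a ball. As [cosh]
   exceeds [sinh], that ball, where [s <= S], contains the support with a margin. *)
pose S := sr S0; have S0S : S0 < S.
  by rewrite -(ltr_pXn2r (n := 2)) ?nnegrE ?(ltW b0) ?(ltW (sr_gt0 _))// sqr_sr ltrDr.
have S1n : S - 1 != 0 by rewrite gt_eqF//; lra.
pose h s : R := ((S - s) / (S - 1)) ^+ m.
have est (e : R) (e0 : 0 < e) : exists2 C : R, 0 <= C & forall x : 'rV[R]_n, sr (nrm x) <= S ->
    `|phi x - phi 0 * h (sr (nrm x))| <= e * h (sr (nrm x)) + C * ((sr (nrm x) - 1) * h (sr (nrm x))).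
  exact: (test_function_estimate tf S01 S0S supp e0).
pose E t : R := expR (- (m%:R ^+ 2 * t)).
pose g0 : {poly R} := ((- (S - 1)^-1) ^+ m)%:P.
pose h0 : {poly R} := ('X - S%:P) ^+ m * g0.
pose h1 : {poly R} := ('X - S%:P) ^+ m * (g0 * ('X - 1%:P)).
have h0E s : h0.[s] = h s.
  rewrite /h0 /g0 /h !hornerE -exprMn; congr (_ ^+ m); by field.
have h1E s : h1.[s] = (s - 1) * h s.
  by rewrite /h1 mulrA -/h0 hornerM h0E !hornerE mulrC.
pose trunc (q : {poly R}) t (z : 'rV[R]_(1 + n)) : R :=
  if z 0 0 <= S then hker hyp_cst t z * q.[z 0 0] else 0.
have srS (x : 'rV[R]_n) : (sr (nrm x) <= S) = (nrm x <= S0).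
  rewrite /S -[LHS](ler_pXn2r (n := 2)) ?nnegrE ?(ltW (sr_gt0 _))// !sqr_sr lerD2l.
  by rewrite ler_pXn2r ?nnegrE ?sqrtr_ge0// ltW.
have truncI q t : 0 < t ->
    (lebesgue_tuple R n).-integrable setT (EFin \o hyp_integrand (trunc q t)) /\
    \int[lebesgue_tuple R n]_v hyp_integrand (trunc q t) v =
      polar_cst R m * (hyp_cst * E t * hint m S0 q t).
  move=> t0; have cv := @continuous_v_sr R m t t0; have cq := @continuous_horner_sr R q.
  have cs := @continuous_sr R.
  have cg : continuous (fun r => hyp_cst * E t * v m t (sr r) * q.[sr r]) by move=> r; cont_tac.
  have [|||i ->] := @hyp_integral_truncated R m _ S0 (trunc q t) cg.
  - exact: ltW.
  - by move=> x xS; rewrite /trunc hyperboloid_chart00 srS xS hker_chartE.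
  - by move=> x xS; rewrite /trunc hyperboloid_chart00 srS leNgt xS.
  split=> //; congr (_ * _); rewrite /hint -integZ; last exact: (@continuous_hint R m q t t0).
  by apply: eq_integ => r _; ring.
pose V q t := polar_cst R m * (hyp_cst * E t * hint m S0 q t).
have Ecvg : E t @[t --> 0^'+] --> (1 : R).
  have cE : {for (0 : R), continuous E} by rewrite /E; cont_tac.
  have E0 : E 0 = 1 by rewrite /E mulr0 oppr0 expR0.
  by rewrite -E0; exact: cvg_at_right_filter cE.
have Vcvg q g : q = ('X - S%:P) ^+ m * g -> V q t @[t --> 0^'+] --> q.[1].
  move=> qE; have c := hint_cvg b0 qE.
  have -> : q.[1] = polar_cst R m * (hyp_cst * 1 *
      (Num.sqrt pi * (\prod_(i < m) (2 * i%:R + 1)) * q.[1])).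
    rewrite /hyp_cst; have := hyp_prod_gt0; have := polar_cst_gt0 R m.
    set X := polar_cst _ _; set Y := _ * \prod_(_ < _) _ => X0 Y0.
    by field; rewrite !gt_eqF.
  apply: cvgM; first exact: cvg_cst.
  by apply: cvgM; [apply: cvgM; [exact: cvg_cst|exact: Ecvg]|exact: c].
have V0 : V h0 t @[t --> 0^'+] --> (1 : R).
  by have := Vcvg h0 g0 erefl; rewrite h0E /h divff// expr1n.
have V1 : V h1 t @[t --> 0^'+] --> (0 : R).
  by have := Vcvg h1 _ erefl; rewrite h1E subrr mul0r.
have phi0 : f (base_point R n) = phi 0 by rewrite /phi hyperboloid_chart0.
rewrite phi0; apply/cvgrPdist_lt => e e0.
have [C C0 est'] := est (e / 2) (divr_gt0 e0 (ltr0Sn _ 1)).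
have key t : 0 < t -> `|volume_integral H (fun x => hker hyp_cst t x * f x) - phi 0 * V h0 t|
    <= e / 2 * V h0 t + C * V h1 t.
  move=> t0; have [i0 I0] := truncI h0 t t0; have [i1 I1] := truncI h1 t t0.
  rewrite hyp_volume_integralE /V -I0 -I1; apply: Rintegral_dist_le => //.
    have cF : continuous (fun x : 'rV[R]_n =>
        hyp_cst * expR (- (m%:R ^+ 2 * t)) * v m t (sr (nrm x)) * phi x / sr (nrm x)).
      have cv : continuous (fun x : 'rV[R]_n => v m t (sr (nrm x))).
        move=> x; change {for x, continuous (fun x : 'rV[R]_n => v m t (sr (nrm x)))}.
        apply: (cont_comp (h := fun r => v m t (sr r))); last exact: continuous_v_sr.
        by apply: cont_sqrt; exact: continuous_sqnorm.
      have cs : continuous (fun x : 'rV[R]_n => sr (nrm x)).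
        move=> x; change {for x, continuous (fun x : 'rV[R]_n => sr (nrm x))}.
        apply: (cont_comp (h := @sr R)); last exact: continuous_sr.
        by apply: cont_sqrt; exact: continuous_sqnorm.
      by move=> x; cont_tac; exact: sr_neq0.
    have := measurable_cont_row cF; congr (measurable_fun _ _); apply/funext => v.
    by rewrite /hyp_integrand -hker_chartE sqnorm_row.
  move=> v; rewrite /hyp_integrand; set x := \row_i _.
  have <- : nrm x = trad v by rewrite /x sqnorm_row.
  rewrite /trunc hyperboloid_chart00 -/(phi x) h0E h1E.
  have s0 := sr_gt0 (nrm x); set s := sr (nrm x) in s0 *.
  have kge : 0 <= hker hyp_cst t (hyperboloid_chart x).
    by apply: hker_ge0 => //; [exact/ltW/hyp_cst_gt0|exact: hyperboloid_chart_carrier].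
  set k := hker _ _ _ in kge *.
  case: ifPn => sS; last first.
    by rewrite /phi supp ?(lt_trans S0S) ?ltNge// !(mulr0, mul0r) subr0 normr0 addr0.
  have -> : k * phi x / s - phi 0 * (k * h s / s) = k / s * (phi x - phi 0 * h s) by ring.
  have -> : e / 2 * (k * h s / s) + C * (k * ((s - 1) * h s) / s) =
    k / s * (e / 2 * h s + C * ((s - 1) * h s)) by ring.
  rewrite normrM ger0_norm ?divr_ge0// ?(ltW s0)// ler_wpM2l ?divr_ge0 ?(ltW s0)//.
  exact: est'.
have Ucvg : `|phi 0| * `|V h0 t - 1| + (e / 2 * V h0 t + C * V h1 t) @[t --> 0^'+] -->
    `|phi 0| * `|1 - 1| + (e / 2 * 1 + C * 0).
  apply: cvgD; apply: cvgM || apply: cvgD; try exact: cvg_cst.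
  - apply: cvg_norm; apply: cvgB => //; exact: cvg_cst.
  - by apply: cvgM => //; exact: cvg_cst.
  - by apply: cvgM => //; exact: cvg_cst.
have Ue : `|phi 0| * `|1 - 1| + (e / 2 * 1 + C * 0) < e by rewrite subrr normr0; lra.
near=> t; have t0 : 0 < t by near: t; exact: nbhs_right_gt.
rewrite distrC.
have Ut : `|phi 0| * `|V h0 t - 1| + (e / 2 * V h0 t + C * V h1 t) < e.
  by near: t; exact: cvgr_lt Ucvg _ Ue.
apply: le_lt_trans Ut; rewrite -normrM mulrBr mulr1.
set I := volume_integral _ _.
have -> : I - phi 0 = (phi 0 * V h0 t - phi 0) + (I - phi 0 * V h0 t) by ring.
by apply: (le_trans (ler_normD _ _)); rewrite lerD2l; exact: key.
Unshelve. all: by end_near. Qed.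

Lemma hker_fundamental : fundamental_solution H (base_point R n) (@hker R hyp_cst m).
Proof.
split.
- by move=> t x t0 xc; apply: hker_ge0 => //; exact/ltW/hyp_cst_gt0.
- by move=> c; exact: hker_C12.
- by move=> c t x t0; exact: hker_heat.
- exact: hker_init.
Qed.

End hyperbolic.
End InitialCondition.

(** * The minimal kernel equals the explicit solution at the base point *)

Section Minimality.
Context (R : realType).
Variable m : nat.
Local Notation n := (2 * m).+1.
Local Notation H := (hyperbolic_space R n).
Local Notation nrm x := (Num.sqrt (sqnorm x)).
Local Notation e0 := (delta_mx 0 0 : 'rV[R]_n).

Lemma nrm_axis (r : R) : 0 <= r -> nrm (r *: e0) = r.
Proof. by move=> r0; rewrite sqnormZ sqnorm_delta mulr1 sqrtr_sqr ger0_norm. Qed.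

Lemma base_point00 k : base_point R k 0 0 = 1.
Proof.
rewrite /base_point (_ : 0 = lshift k 0 :> 'I_(1 + k)); last exact: val_inj.
by rewrite row_mxEl mxE eqxx.
Qed.

Section cutoff.
Variable b : R.
Hypothesis b0 : 0 < b.
Local Notation S := (sr b).

(** The triple zero at [r = b] removes both boundary terms from Green's formula. [cutoff1] is the
    derivative in [r], and [cutoff2] the hyperbolic Laplacian. *)
Definition cutoff r : R := ((S - sr r) / S) ^+ 3.
Definition cutoff1 r : R := - (3 * r * (S - sr r) ^+ 2 / (sr r * S ^+ 3)).
Definition cutoff2 r : R :=
  (6 * r ^+ 2 * (S - sr r) - 3 * n%:R * sr r * (S - sr r) ^+ 2) / S ^+ 3.

Let cs := @continuous_sr R.

Lemma continuous_cutoff : continuous cutoff.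
Proof. by move=> r; rewrite /cutoff; cont_tac. Qed.

Lemma continuous_cutoff1 : continuous cutoff1.
Proof. by move=> r; rewrite /cutoff1; cont_tac; rewrite mulf_neq0 ?expf_neq0// sr_neq0. Qed.

Lemma continuous_cutoff2 : continuous cutoff2.
Proof. by move=> r; rewrite /cutoff2; cont_tac. Qed.

Lemma is_derive_cutoff (r : R) : is_derive r 1 cutoff (cutoff1 r).
Proof.
have D := is_derive_sr r; rewrite /cutoff; isd_tac; rewrite /cutoff1 /=.
by field; rewrite !sr_neq0.
Qed.

Lemma is_derive_cutoff_flux (r : R) :
  is_derive r 1 (fun r => r ^+ (2 * m) * sr r * cutoff1 r) (r ^+ (2 * m) * (sr r)^-1 * cutoff2 r).
Proof.
have D := is_derive_sr r.
rewrite (_ : (fun _ => _) = fun r => - 3 * r ^+ n * (S - sr r) ^+ 2 / S ^+ 3); last first.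
  apply/funext => y; rewrite /cutoff1 [y ^+ n]exprS; set q := y ^+ (2 * m); field; by rewrite !sr_neq0.
isd_tac; rewrite /cutoff2 [r ^+ n]exprS/=; set q := r ^+ (2 * m).
by field; rewrite !sr_neq0.
Qed.

Lemma cutoff_b : cutoff b = 0. Proof. by rewrite /cutoff subrr mul0r expr0n. Qed.

Lemma cutoff1_b : cutoff1 b = 0.
Proof. by rewrite /cutoff1 subrr expr0n /= mulr0 mul0r oppr0. Qed.

Lemma cutoff_ge0 r : 0 <= r <= b -> 0 <= cutoff r.
Proof.
move=> /andP[r0 rb]; have := sr_le r0 rb => ?.
by rewrite exprn_ge0// divr_ge0 ?subr_ge0// ltW// sr_gt0.
Qed.

(** Only an upper bound is needed: the first-order term of the Laplacian is negative and is dropped,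
    and [r^2 (S - s) <= s^2 S]. *)
Lemma cutoff2_le r : 0 <= r <= b -> cutoff2 r <= 6 / S ^+ 2 * sr r ^+ 2.
Proof.
move=> /andP[r0 rb]; have sS := sr_le r0 rb; have S0 := sr_gt0 b; have s0 := sr_gt0 r.
rewrite /cutoff2 ler_pdivrMr ?exprn_gt0//.
have -> : 6 / S ^+ 2 * sr r ^+ 2 * S ^+ 3 = 6 * sr r ^+ 2 * S by field; rewrite sr_neq0.
apply: (@le_trans _ _ (6 * r ^+ 2 * (S - sr r))).
  rewrite gerBl; apply: mulr_ge0; last exact: sqr_ge0.
  by apply: mulr_ge0; [exact: mulr_ge0|exact: ltW].
apply: ler_pM; rewrite ?subr_ge0 ?gerBl ?(ltW S0) ?(ltW s0)//.
  by rewrite mulr_ge0 ?sqr_ge0.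
by rewrite sqr_sr; lra.
Qed.

Definition cutoff_test (z : 'rV[R]_(1 + n)) : R := (Num.max 0 ((S - z 0 0) / S)) ^+ 3.

Lemma cutoff_test_function : test_function H cutoff_test.
Proof.
split.
  apply: continuous_subspaceT => z.
  change {for z, continuous (fun z : 'rV[R]_(1 + n) => (Num.max 0 ((S - z 0 0) / S)) ^+ 3)}.
  apply: contX; apply: continuous_max; first exact: cst_continuous.
  have cz : {for z, continuous (fun z : 'rV[R]_(1 + n) => z 0 0)} by exact: coord_continuous.
  by change {for z, continuous (fun z : 'rV[R]_(1 + n) => ((S - z 0 0) / S))}; cont_tac.
exists [set z | carrier H z /\ z 0 0 <= S]; split; first exact: compact_hyperboloid.
  by move=> z [].
move=> z zc nz; have Sz : S < z 0 0 by rewrite ltNge; apply/negP => ?; exact: nz.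
rewrite /cutoff_test max_l ?expr0n// pmulr_lle0 ?invr_gt0 ?sr_gt0//.
by rewrite subr_le0 ltW.
Qed.

Section solution.
Variable q : R -> 'rV[R]_(1 + n) -> R.
Hypothesis fq : fundamental_solution H (base_point R n) q.
Hypothesis rq : forall t (x : 'rV[R]_n),
  q t (hyperboloid_chart x) = q t (hyperboloid_chart (nrm x *: e0)).

Let u t (x : 'rV[R]_n) := q t (hyperboloid_chart x).
Let dens (s : R) := (Num.sqrt (1 + s))^-1.

Lemma hyp_cutoff_moment (t : R) : (0 < m)%N -> 0 < t -> is_derive t 1
  (fun t => integ 0 b (fun r => r ^+ (2 * m) * (sr r)^-1 * (prof u t r * cutoff r)))
  (integ 0 b (fun r => r ^+ (2 * m) * (sr r)^-1 * (prof u t r * cutoff2 r))).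
Proof.
move=> m0 t0; have [_ C _ _] := fq.
have cu : C12 u by exact: C tt.
have cW : continuous (fun r : R => r ^+ (2 * m) * dens (r ^+ 2)).
  by move=> r; rewrite /dens; cont_tac; exact: sr_neq0.
apply: isd_eq (is_derive_moment cu continuous_cutoff cW b t0) _.
have := @radial_green R m (1 + n) H tt dens (cst 1) (cst 1) (fun s => Num.sqrt (1 + s))
  (fun s => (2 * Num.sqrt (1 + s))^-1) (@hyperboloid_density R n) _ (@hyperboloid_inv R n) _ _ u cu _ rq
  cutoff cutoff1 cutoff2 continuous_cutoff continuous_cutoff1 continuous_cutoff2 cW _
  (fun r _ => is_derive_cutoff r) (fun r _ => is_derive_cutoff_flux r) t b m0 t0 (ltW b0).
rewrite cutoff_b cutoff1_b !mulr0 subr0 mulr0 addr0; apply.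
- by move=> s s0; rewrite invr_neq0// gt_eqF// sqrtr_gt0; lra.
- move=> s s0; rewrite /dens /= mul1r.
  have -> : 1 + s = Num.sqrt (1 + s) ^+ 2 by rewrite sqr_sqrtr//; lra.
  rewrite sqrtr_sqr ger0_norm ?sqrtr_ge0//; field.
  by rewrite gt_eqF// sqrtr_gt0; lra.
- move=> s s0; isd_tac; first by lra.
  by rewrite ?add0r ?mul1r.
- by move=> t' x t'0; have [_ _ h _] := fq; exact: h.
- by move=> r; cont_tac.
Qed.

Lemma hyp_cutoff_init :
  integ 0 b (fun r => r ^+ (2 * m) * (sr r)^-1 * (prof u t r * cutoff r)) @[t --> 0^'+] -->
  (polar_cst R m)^-1 * cutoff 0.
Proof.
have w0 := polar_cst_gt0 R m.
have [_ C _ I] := fq; have := I _ cutoff_test_function.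
have -> : cutoff_test (base_point R n) = cutoff 0.
  rewrite /cutoff_test base_point00 /cutoff (_ : sr 0 = 1) ?max_r//.
    by rewrite divr_ge0 ?subr_ge0 ?sr_ge1// ltW// sr_gt0.
  by rewrite /sr expr0n addr0 sqrtr1.
move=> c.
have {}c : (polar_cst R m)^-1 * volume_integral H (fun x => q t x * cutoff_test x) @[t --> 0^'+] -->
    (polar_cst R m)^-1 * cutoff 0.
  by apply: cvgM => //; exact: cvg_cst.
have E : \forall t \near 0^'+, (polar_cst R m)^-1 * volume_integral H (fun x => q t x * cutoff_test x) =
    integ 0 b (fun r => r ^+ (2 * m) * (sr r)^-1 * (prof u t r * cutoff r)).
  near=> t; have t0 : 0 < t by near: t; exact: nbhs_right_gt.
  have cu : C12 u by exact: C tt.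
  have cp := @prof_continuous R m u cu t t0; have cc := continuous_cutoff.
  have cg : continuous (fun r => prof u t r * cutoff r) by move=> r; cont_tac.
  have srS (x : 'rV[R]_n) : (sr (nrm x) <= S) = (nrm x <= b).
    rewrite -[LHS](ler_pXn2r (n := 2)) ?nnegrE ?(ltW (sr_gt0 _))// !sqr_sr lerD2l.
    by rewrite ler_pXn2r ?nnegrE ?sqrtr_ge0// ltW.
  rewrite hyp_volume_integralE.
  have [|||i ->] := @hyp_integral_truncated R m _ b (fun x => q t x * cutoff_test x) cg.
  - exact: ltW.
  - move=> x xb; rewrite rq; congr (_ * _).
    rewrite /cutoff_test hyperboloid_chart00 max_r// divr_ge0 ?subr_ge0 ?srS//.
    by rewrite ltW// sr_gt0.
  - move=> x xb; rewrite /cutoff_test hyperboloid_chart00 max_l ?expr0n ?mulr0//.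
    rewrite pmulr_lle0 ?invr_gt0 ?sr_gt0// subr_le0 ltW//.
    by rewrite ltNge srS -ltNge.
  - by rewrite mulrA mulVf ?mul1r// gt_eqF.
exact: (cvg_trans (near_eq_cvg E) c).
Unshelve. all: by end_near. Qed.

End solution.
End cutoff.

Lemma le0_of_derive_le0 (f df : R -> R) (t : R) : 0 < t -> (forall s : R, 0 < s -> is_derive s 1 f (df s)) ->
  (forall s, 0 < s <= t -> df s <= 0) -> f s @[s --> 0^'+] --> (0 : R) -> f t <= 0.
Proof.
move=> t0 Df df0 f0; apply/ler_addgt0Pr => e e0; rewrite add0r.
near (0 : R)^'+ => s.
have s0 : 0 < s by near: s; exact: nbhs_right_gt.
have st : s <= t by near: s; exact: nbhs_right_le.
apply: (@le_trans _ _ (f s)); last first.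
  by apply: ltW; near: s; apply: cvgr_lt f0 _ _; exact: e0.
have := @is_derive_nd R (fun s => - f s) (fun s => - df s) s t st.
rewrite lerN2; apply=> x /andP[sx xt].
  have D := Df x (lt_le_trans s0 sx); by isd_tac.
by rewrite oppr_ge0 df0// xt (lt_le_trans s0 sx).
Unshelve. all: by end_near. Qed.

Variable K : R -> R -> R.
Hypothesis rK : radial_heat_kernel H K.
Hypothesis m_gt0 : (0 < m)%N.

Let q t (x : 'rV[R]_(1 + n)) := K t (geodesic_distance H x (base_point R n)).
Let p t (x : 'rV[R]_(1 + n)) := hker (hyp_cst R m) t x.

Let base_carrier : carrier H (base_point R n).
Proof. by rewrite -hyperboloid_chart0; exact: hyperboloid_chart_carrier. Qed.

Let fq : fundamental_solution H (base_point R n) q.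
Proof. by have [] := rK base_carrier. Qed.

Let fp : fundamental_solution H (base_point R n) p.
Proof. exact: hker_fundamental. Qed.

Let rq t (x : 'rV[R]_n) : q t (hyperboloid_chart x) = q t (hyperboloid_chart (nrm x *: e0)).
Proof. by rewrite /q hyperboloid_dist_radial. Qed.

Let rp t (x : 'rV[R]_n) : p t (hyperboloid_chart x) = p t (hyperboloid_chart (nrm x *: e0)).
Proof. by rewrite /p !hker_chartE nrm_axis// sqrtr_ge0. Qed.

Let U t r : R := prof (fun t (x : 'rV[R]_n) => q t (hyperboloid_chart x)) t r.
Let V t r : R := prof (fun t (x : 'rV[R]_n) => p t (hyperboloid_chart x)) t r.

Let VE t r : 0 <= r -> V t r = hyp_cst R m * expR (- (m%:R ^+ 2 * t)) * v m t (sr r).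
Proof. by move=> r0; rewrite /V /prof /p hker_chartE nrm_axis. Qed.

Let U_ge0 t r : 0 < t -> 0 <= U t r.
Proof. by move=> t0; have [h _ _ _] := fq; apply: h => //; exact: hyperboloid_chart_carrier. Qed.

Let UV t r : 0 < t -> U t r <= V t r.
Proof.
move=> t0; have [_ h] := rK base_carrier; apply: (h _ fp) => //.
exact: hyperboloid_chart_carrier.
Qed.

Let cU t : 0 < t -> continuous (U t).
Proof. by move=> t0; have [_ c _ _] := fq; exact: (@prof_continuous R m _ (c tt) t t0). Qed.

Let cV t : 0 < t -> continuous (V t).
Proof. by move=> t0; have [_ c _ _] := fp; exact: (@prof_continuous R m _ (c tt) t t0). Qed.

Let W r : R := r ^+ (2 * m) * (sr r)^-1.

Let cW : continuous W.
Proof. by have cs := @continuous_sr R; move=> r; rewrite /W; cont_tac; exact: sr_neq0. Qed.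

Let W_ge0 r : 0 <= r -> 0 <= W r.
Proof. by move=> r0; rewrite mulr_ge0 ?exprn_ge0// invr_ge0 ltW// sr_gt0. Qed.

Let gap t b : R := integ 0 b (fun r => W r * (V t r * cutoff b r)) -
  integ 0 b (fun r => W r * (U t r * cutoff b r)).

Let gap_cvg b : 0 < b -> gap t b @[t --> 0^'+] --> (0 : R).
Proof.
move=> b0; rewrite -[X in _ --> X](subrr ((polar_cst R m)^-1 * cutoff b 0)).
by apply: cvgB; apply: hyp_cutoff_init.
Qed.

(** By Green's formula the time derivative of [gap] is the integral of [(V - U) cutoff2]. Since
    [0 <= U <= V], this is at most [6 / S^2] times the second moment of [V], bounded uniformly in
    [b]; integrate from time [0], where [gap] tends to [0]. *)
Let gap_le t : 0 < t -> exists D, forall b, 0 < b -> gap t b <= D / sr b ^+ 2.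
Proof.
move=> t0; have [C HC] := hint_Xn_le m 2 t.
exists (6 * hyp_cst R m * C * t) => b b0.
have S0 := sr_gt0 b.
pose D := 6 * hyp_cst R m * C / sr b ^+ 2.
suff : gap t b - D * t <= 0 by rewrite subr_le0 /D => h; apply: (le_trans h); rewrite mulrAC.
pose dgap s := integ 0 b (fun r => W r * (V s r * cutoff2 b r)) -
  integ 0 b (fun r => W r * (U s r * cutoff2 b r)) - D.
apply: (@le0_of_derive_le0 (fun s => gap s b - D * s) dgap t t0).
- move=> s s0; have D1 := hyp_cutoff_moment b0 fp rp m_gt0 s0.
  have D2 := hyp_cutoff_moment b0 fq rq m_gt0 s0.
  have D3 : is_derive s 1 (gap ^~ b) (integ 0 b (fun r => W r * (V s r * cutoff2 b r)) -
    integ 0 b (fun r => W r * (U s r * cutoff2 b r))) by exact: (isdD D1 (isdN D2)).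
  by isd_tac; rewrite /dgap; ring.
- move=> s /andP[s0 st]; rewrite subr_le0.
  have cu := cU s0; have cv := cV s0; have c2 := @continuous_cutoff2 b.
  have cs := @continuous_sr R; have ch := @continuous_hint R m 'X^2 s s0.
  have hc := ltW (hyp_cst_gt0 R m).
  rewrite -integB; [|by move=> r; cont_tac|by move=> r; cont_tac].
  apply: (@le_trans _ _ (integ 0 b (fun r => 6 / sr b ^+ 2 * hyp_cst R m *
     (v m s (sr r) * ('X^2).[sr r] * r ^+ (2 * m) / sr r)))).
    apply: le_integ; [by move=> r; cont_tac|by move=> r; cont_tac|].
    move=> r /andP[r0 rb].
    have Vle : V s r <= hyp_cst R m * v m s (sr r).
      rewrite VE// -mulrA ler_wpM2l// ler_piMl ?v_ge0 ?(ltW (sr_gt0 _))//.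
      by rewrite -[leRHS](@expR0 R) ler_expR oppr_le0 mulr_ge0 ?sqr_ge0 ?ltW.
    have rbb : 0 <= r <= b by rewrite r0.
    apply: (@le_trans _ _ (W r * ((V s r - U s r) * cutoff2 b r))); first by rewrite le_eqVlt; apply/orP; left; apply/eqP; ring.
    apply: (@le_trans _ _ (W r * ((V s r - U s r) * (6 / sr b ^+ 2 * sr r ^+ 2)))).
      by rewrite ler_wpM2l ?W_ge0// ler_wpM2l ?subr_ge0 ?UV// cutoff2_le.
    have -> : 6 / sr b ^+ 2 * hyp_cst R m * (v m s (sr r) * ('X^2).[sr r] * r ^+ (2 * m) / sr r) =
      W r * ((hyp_cst R m * v m s (sr r)) * (6 / sr b ^+ 2 * sr r ^+ 2)).
      by rewrite hornerXn /W; ring.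
    rewrite ler_wpM2l ?W_ge0// ler_wpM2r//; last by apply: le_trans Vle; rewrite gerBl U_ge0.
    by rewrite mulr_ge0 ?sqr_ge0// divr_ge0 ?sqr_ge0.
  rewrite integZ// /D -[X in X <= _]/(_ * hint m b 'X^2 s).
  have -> : 6 * hyp_cst R m * C / sr b ^+ 2 = 6 / sr b ^+ 2 * hyp_cst R m * C by ring.
  apply: ler_wpM2l; first by rewrite mulr_ge0// divr_ge0 ?sqr_ge0.
  by apply: HC; rewrite ?(ltW b0)// s0.
have c : gap s b - D * s @[s --> 0^'+] --> 0 - D * 0.
  apply: cvgB; first exact: gap_cvg.
  apply: cvgM; first exact: cvg_cst.
  by apply: cvg_at_right_filter; exact: cvg_id.
by rewrite mulr0 subrr in c.
Qed.

Let UV0 t : 0 < t -> U t 0 = V t 0.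
Proof.
move=> t0; have cu := cU t0; have cv := cV t0; have cw := cW.
have cF : continuous (fun r => W r * (V t r - U t r)) by move=> r; cont_tac.
have F0 r : 0 <= r <= 1 -> 0 <= W r * (V t r - U t r).
  by move=> /andP[r0 _]; rewrite mulr_ge0 ?W_ge0 ?subr_ge0 ?UV.
have I0 : integ 0 1 (fun r => W r * (V t r - U t r)) = 0.
  apply/le_anti; rewrite integ_ge0// andbT.
  have [D HD] := gap_le t0; apply/ler_addgt0Pr => e e0; rewrite add0r.
  (* For [r <= 1] the first condition gives [1 - s/S >= 1/2], so [8 * cutoff >= 1] there: the
     integral over [[0, 1]] is at most [8 * gap], and the second condition makes that small. *)
  have [b b1 [bb be]] : exists2 b : R, 1 <= b & 2 * sr 1 <= sr b /\ 8 * (D / sr b ^+ 2) <= e.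
    pose b := 1 + 2 * sr 1 + 8 * `|D| / e.
    have s1 := sr_gt0 (1 : R); have D0 : 0 <= 8 * `|D| / e by rewrite divr_ge0 ?mulr_ge0 ?(ltW e0).
    have b0 : 0 <= b by rewrite /b; lra.
    have bs : b <= sr b.
      by rewrite -(ler_pXn2r (n := 2)) ?nnegrE// ?(ltW (sr_gt0 _))// sqr_sr lerDr.
    exists b; first by rewrite /b; lra.
    split; first by apply: le_trans bs; rewrite /b; lra.
    have S1 := sr_ge1 b; have S0 := sr_gt0 b.
    rewrite mulrA ler_pdivrMr ?exprn_gt0//.
    apply: (@le_trans _ _ (8 * `|D|)); first by rewrite ler_pM2l// ler_norm.
    rewrite -ler_pdivrMl// [e^-1 * _]mulrC.
    apply: (@le_trans _ _ (sr b)); last by rewrite expr2 ler_peMr// ltW.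
    by apply: le_trans bs; rewrite /b; lra.
  have b0 : 0 < b by lra.
  have cc := @continuous_cutoff b.
  apply: le_trans be; apply: (@le_trans _ _ (8 * gap t b)); last by rewrite ler_pM2l// HD.
  rewrite /gap -integB; [|by move=> r; cont_tac|by move=> r; cont_tac].
  rewrite -integZ; last by move=> r; cont_tac.
  rewrite (@integ_cat R 0 1 b)//; last by move=> r; cont_tac.
  rewrite -[X in X <= _]addr0; apply: lerD.
    apply: le_integ => //; first by move=> r; cont_tac.
    move=> r /andP[r0 r1].
    have -> : 8 * (W r * (V t r * cutoff b r) - W r * (U t r * cutoff b r)) =
      W r * (V t r - U t r) * (8 * cutoff b r) by ring.
    rewrite ler_peMr ?F0 ?r0//.
    have -> : 8 * cutoff b r = (2 * ((sr b - sr r) / sr b)) ^+ 3 by rewrite /cutoff; ring.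
    rewrite exprn_ege1// mulrA ler_pdivlMr ?sr_gt0// mul1r.
    have := sr_le r0 r1; lra.
  apply: integ_ge0 => r /andP[r1 rb]; have r0 : 0 <= r by lra.
  have -> : 8 * (W r * (V t r * cutoff b r) - W r * (U t r * cutoff b r)) =
      W r * (V t r - U t r) * (8 * cutoff b r) by ring.
  have rbb : 0 <= r <= b by rewrite r0.
  apply: mulr_ge0; first by rewrite mulr_ge0 ?W_ge0 ?subr_ge0 ?UV.
  by rewrite mulr_ge0 ?cutoff_ge0.
have Z := integ_gt0_eq0 cF ltr01 F0 I0.
(* The weight [W] vanishes at [0], so equality is obtained for [0 < r < 1] and passes to [r = 0] by
   continuity. *)
have E : \forall r \near 0^'+, V t r = U t r.
  near=> r; have r0 : 0 < r by near: r; exact: nbhs_right_gt.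
  have r1 : r < 1 by near: r; exact: nbhs_right_lt.
  have /eqP : W r * (V t r - U t r) = 0 by apply: Z; rewrite r0.
  rewrite mulf_eq0 subr_eq0 => /orP[|/eqP//].
  by rewrite /W mulf_eq0 expf_eq0 invr_eq0 (gt_eqF (sr_gt0 r)) (gt_eqF r0) andbF.
have c1 : V t r @[r --> 0^'+] --> V t 0 by apply: cvg_at_right_filter; exact: cv.
have c2 : U t r @[r --> 0^'+] --> U t 0 by apply: cvg_at_right_filter; exact: cu.
have c3 : U t r @[r --> 0^'+] --> V t 0 by exact: (cvg_trans (near_eq_cvg E) c1).
by apply: (cvg_unique _ c2 c3); exact: Rhausdorff.
Unshelve. all: by end_near. Qed.

Lemma hyperbolic_kernel_diag t : 0 < t ->
  K t 0 = hyp_cst R m * expR (- (m%:R ^+ 2 * t)) * v m t 1.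
Proof.
move=> t0; have := UV0 t0; rewrite VE// (_ : sr 0 = 1); last by rewrite /sr expr0n addr0 sqrtr1.
by rewrite /U /prof scale0r hyperboloid_chart0 /q geodesic_distance_xx.
Qed.

End Minimality.

(** * Gamma at half-integers and the diagonal value *)

Section Values.
Context (R : realType).
Implicit Types (s t x : R).

Lemma sqrt_cvgy : Num.sqrt x @[x --> +oo%R] --> (+oo%R : set_system R).
Proof.
apply/cvgryPge => A; near=> x.
have xA : A ^+ 2 <= x by near: x; apply: nbhs_pinfty_ge; exact: num_real.
have x0 : 0 <= x by exact: le_trans (sqr_ge0 A) xA.
by apply: le_trans (ler_norm A) _; rewrite -sqrtr_sqr ler_sqrt.
Unshelve. all: by end_near. Qed.

(** The substitution [s = x^2]. For [0 < j] the integrand extends continuously to [s = 0], so the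
    fundamental theorem on a closed half-line applies. *)
Lemma Gamma_half j : (0 < j)%N -> Gamma (j%:R + 2^-1 : R) = 2 * gauss_moment R j.
Proof.
case: j => // j _.
pose f s : R := s ^+ j * Num.sqrt s * expR (- s).
have -> : Gamma (j.+1%:R + 2^-1 : R) = \int[lebesgue_measure]_(s in `]0, +oo[) f s.
  apply: eq_Rintegral => s; rewrite inE/= in_itv/= andbT => s0; rewrite /f; congr (_ * _).
  rewrite -natr1 addrAC addrK powRD ?gt_eqF ?implybT//.
  by rewrite powR_mulrn ?(ltW s0)// powR12_sqrt// ltW.
pose F s : R := 2 * gaussM j.+1 (Num.sqrt s).
have cg : continuous (fun x : R => x ^+ (2 * j.+1) * expR (- x ^+ 2)) by move=> x; cont_tac.
have DF s : 0 < s -> is_derive s 1 F (f s).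
  move=> s0; have q0 : 0 < Num.sqrt s by rewrite sqrtr_gt0.
  have D := isd_comp (isd_sqrt s0 (isd_id s)) (integ_deriv q0 cg).
  rewrite /F /gaussM; isd_tac; rewrite /f exprM sqr_sqrtr ?ltW//.
  have qq : s = Num.sqrt s ^+ 2 by rewrite sqr_sqrtr// ltW.
  rewrite mulr0 addr0 mul1r exprS; move: (Num.sqrt s) q0 qq => q q0 qq.
  set a := s ^+ j; rewrite {1}qq; field; by rewrite gt_eqF.
have cf : continuous f by move=> s; rewrite /f; cont_tac.
rewrite /Rintegral integral_itv_obnd_cbnd; last first.
  by apply/measurable_EFinP; apply: measurable_funTS; exact: continuous_measurable_fun.
have F0 : F 0 = 0 by rewrite /F sqrtr0 /gaussM /integ set_itv1 Rintegral_set1 mulr0.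
rewrite (@ge0_continuous_FTC2y R f F 0 (2 * gauss_moment R j.+1)).
- by rewrite F0 sube0.
- by move=> s s0; rewrite !mulr_ge0 ?exprn_ge0 ?sqrtr_ge0 ?expR_ge0.
- exact: continuous_subspaceT.
- apply: cvgM; first exact: cvg_cst.
  by apply: (cvg_comp _ _ sqrt_cvgy); exact: gaussM_cvg.
- by move=> s s0; case: (DF s s0).
- have := @continuous_bounded R _ 0 1 cg => -[M M0 HM].
  rewrite F0; apply: (@squeeze_cvgr _ _ _ _ (fun=> 0) (fun s => 2 * (M * Num.sqrt s))).
  + near=> s; have s0 : 0 < s by near: s; exact: nbhs_right_gt.
    have s1 : s <= 1 by near: s; exact: nbhs_right_le.
    have q1 : Num.sqrt s <= 1 by rewrite -sqrtr1 ler_sqrt.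
    apply/andP; split.
      rewrite mulr_ge0// integ_ge0// => x /andP[x0 _].
      by rewrite mulr_ge0 ?exprn_ge0 ?expR_ge0.
    rewrite ler_pM2l// /gaussM -[X in M * X]subr0 -integ_cst ?sqrtr_ge0//.
    apply: le_integ => //; first by move=> x; exact: cst_continuous.
    move=> x /andP[x0 xs]; apply: le_trans (ler_norm _) (HM _ _).
    by rewrite x0 (le_trans xs).
  + exact: cvg_cst.
  + have cc : {for (0 : R), continuous (fun s : R => 2 * (M * Num.sqrt s))} by cont_tac.
    have := cvg_at_right_filter cc; by rewrite sqrtr0 !mulr0.
- by move=> s; rewrite in_itv/= andbT => s0; rewrite derive1E; have [_ ->] := DF s s0.
Unshelve. all: by end_near. Qed.

(** The [c_coef] are the elementary symmetric functions of the [i^2]. Expanding over subsets, those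
    containing the index [0] contribute the factor [0^2]; the remaining ones have fewer than [m]
    elements and are grouped by cardinality. *)
Lemma prod_c_coef m : (0 < m)%N ->
  \prod_(i < m) ('X + (i%:R ^+ 2)%:P) = \sum_(k < m) (c_coef R m k)%:P * 'X^(m - k) :> {poly R}.
Proof.
move=> m0; under eq_bigr do rewrite addrC.
rewrite bigA_distr.
pose P (J : {set 'I_m}) := [forall i in J, (0 < i)%N].
pose T (J : {set 'I_m}) : {poly R} := (\prod_(i in J) ((i : nat)%:R ^+ 2))%:P * 'X^(m - #|J|).
have TE (J : {set 'I_m}) : \prod_i (if i \in J then (i%:R ^+ 2)%:P else 'X) = T J.
  rewrite (bigID (mem J))/= /T rmorph_prod; congr (_ * _).
    by apply: eq_bigr => i ->.
  rewrite (eq_bigr (fun=> 'X)) => [|i /negPf ->//]; rewrite prodr_const.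
  have -> : (m - #|J| = #|~: J|)%N by rewrite [RHS]cardsCs finset.setCK card_ord.
  by congr (_ ^+ _); apply: eq_card => i; rewrite !inE.
under eq_bigr do rewrite TE.
rewrite (bigID P)/= [X in _ + X]big1 ?addr0; last first.
  move=> J; rewrite negb_forall => /existsP[i]; rewrite negb_imply -eqn0Ngt => /andP[iJ /eqP i0].
  by rewrite /T (bigD1 i)//= i0 expr0n /= mul0r polyC0 mul0r.
have cardP J : P J -> (#|J| < m)%N.
  move=> /forallP PJ; rewrite -[X in (_ < X)%N]card_ord ltn_neqAle max_card andbT.
  apply/negP => /eqP cJ; have := PJ (Ordinal m0).
  have -> : J = finset.setTfor 'I_m by apply/eqP; rewrite eqEcard finset.subsetT cardsT cJ leqnn.
  by rewrite finset.in_setT.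
rewrite (partition_big (fun J : {set 'I_m} => inord #|J| : 'I_m.-1.+1) predT)//=.
rewrite -[in RHS](prednK m0); apply: eq_bigr => k _.
have kE J : P J -> (inord #|J| == k :> 'I_m.-1.+1) = (#|J| == k).
  by move=> PJ; rewrite -val_eqE /= inordK// prednK// cardP.
under eq_bigl => J do rewrite (andb_id2l (kE J)).
rewrite [X in _ = (c_coef _ X _)%:P * 'X^(X - _)](prednK m0).
transitivity ((\sum_(J : {set 'I_m} | P J && (#|J| == k)) \prod_(i in J) ((i : nat)%:R ^+ 2))%:P * 'X^(m - k) : {poly R}).
  rewrite rmorph_sum /= big_distrl /=; apply: eq_bigr => J /andP[_ /eqP JE].
  by rewrite /T JE.
congr (_%:P * _); rewrite /c_coef; case: eqP => [k0|k0].
  rewrite (big_pred1 finset.set0) ?big_set0// => J; rewrite /= k0 cards_eq0 andbC.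
  by case: eqP => //= ->; apply/forallP => i; rewrite inE.
have -> : (k <= m - 1)%N by rewrite subn1 -ltnS ltn_ord.
by apply: eq_bigl => J; rewrite andbC.
Qed.

End Values.

(** * The hyperbolic diagonal value in closed form *)

Section DiagonalValue.
Context (R : realType).
Implicit Types (s t x : R).

Definition half_fact j : R := \prod_(i < j) (i%:R + 2^-1).

Lemma half_fact_gt0 j : 0 < half_fact j.
Proof. by apply: prodr_gt0. Qed.

Lemma half_factS j : half_fact j.+1 = half_fact j * (j%:R + 2^-1).
Proof. by rewrite /half_fact big_ord_recr. Qed.

Lemma Gamma_half_fact j : (0 < j)%N -> Gamma (j%:R + 2^-1) = Num.sqrt pi * half_fact j.
Proof. by move=> j0; rewrite Gamma_half// /gauss_moment -/(half_fact j); field. Qed.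

Lemma prod_odd j : \prod_(i < j) (2 * i%:R + 1) = 2 ^+ j * half_fact j.
Proof.
elim: j => [|j IH]; first by rewrite /half_fact !big_ord0 expr0 mul1r.
by rewrite big_ord_recr/= IH half_factS exprS; field.
Qed.

Lemma powR_half x n : 0 <= x -> x `^ (- (n%:R / 2)) = (Num.sqrt x ^+ n)^-1.
Proof.
by move=> x0; rewrite powRN mulrC powRrM powR12_sqrt// powR_mulrn// sqrtr_ge0.
Qed.

(** This is [(- d/dt)^j] applied to [t^(-1/2)]. *)
Definition time_pow j t : R := half_fact j * (t ^+ j)^-1 * (Num.sqrt t)^-1.

Lemma is_derive_time_pow j t : 0 < t -> is_derive t 1 (time_pow j) (- time_pow j.+1 t).
Proof.
move=> t0; rewrite /time_pow; isd_tac.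
- by rewrite expf_neq0// gt_eqF.
- by rewrite gt_eqF// sqrtr_gt0.
- exact: t0.
rewrite half_factS; have q0 : 0 < Num.sqrt t by rewrite sqrtr_gt0.
have qq : t = Num.sqrt t ^+ 2 by rewrite sqr_sqrtr// ltW.
move: (Num.sqrt t) q0 qq => q q0 qq.
case: j => [|j] /=; first by rewrite expr0 expr1 qq; field; rewrite gt_eqF.
rewrite !exprS qq -exprM -natr1; set p := q ^+ (2 * j).
by field; rewrite gt_eqF//= expf_neq0// gt_eqF.
Qed.

(** At [s = 1] the second-order term of [vt] disappears, leaving a first-order recursion. In the
    polynomial, [X] stands for [- d/dt] acting on [v 0 t 1 = t^(-1/2)]. *)
Lemma v_at1_poly k t : 0 < t ->
  \prod_(i < k) (2 * i%:R + 1) * v k t 1 =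
  \sum_(j < k.+1) (\prod_(i < k) ('X + (i%:R ^+ 2)%:P))`_j * time_pow j t.
Proof.
elim: k t => [|k IH] t t0.
  rewrite !big_ord0 big_ord1 coef1 mul1r mul1r /time_pow /half_fact big_ord0 invr1 !mul1r.
  by rewrite /v /= /v0 /acosh2 expr1n subrr mul0r oppr0 mul0r expR0 mulr1.
set P := \prod_(i < k) (2 * i%:R + 1) in IH; set p := \prod_(i < k) ('X + _) in IH.
have D1 : is_derive t 1 (fun t => P * v k t 1) (P * vt k t 1).
  by have D := is_derive_v_time k t0 (@ltr01 R); isd_tac; ring.
have D2 : is_derive t 1 (fun t => \sum_(j < k.+1) p`_j * time_pow j t)
    (\sum_(j < k.+1) p`_j * (- time_pow j.+1 t)).
  apply: isd_sum => j _; have D := is_derive_time_pow j t0; isd_tac; ring.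
have near_t : \forall t' \near t, P * v k t' 1 = \sum_(j < k.+1) p`_j * time_pow j t'.
  by near=> t'; apply: IH; near: t'; exact: lt_nbhsr.
have := near_is_derive_eq near_t D1 D2.
rewrite /vt expr1n subrr mul0r add0r mulr1 => E.
have -> : \prod_(i < k.+1) (2 * i%:R + 1) * v k.+1 t 1 =
    k%:R ^+ 2 * (P * v k t 1) + \sum_(j < k.+1) p`_j * time_pow j.+1 t.
  rewrite big_ord_recr/= -/P.
  have -> : \sum_(j < k.+1) p`_j * time_pow j.+1 t = - \sum_(j < k.+1) p`_j * (- time_pow j.+1 t).
    by rewrite -sumrN; apply: eq_bigr => j _; ring.
  rewrite -E; ring.
rewrite IH//.
have -> : \prod_(i < k.+1) ('X + (i%:R ^+ 2)%:P) = p * ('X + (k%:R ^+ 2)%:P) by rewrite big_ord_recr.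
under [in RHS]eq_bigr do rewrite mulrDr coefD coefMX coefMC mulrDl.
rewrite big_split /= [in RHS]addrC; congr (_ + _).
  rewrite [in RHS]big_ord_recr/= (_ : p`_k.+1 = 0) ?mul0r ?addr0; last first.
    apply: nth_default; rewrite /p.
    apply: (leq_trans (size_prod_leq _ _)).
    rewrite (eq_bigr (fun=> 2%N)) => [|i _]; last by rewrite size_XaddC.
    by rewrite sum_nat_const cardE size_enum_ord muln2 -addnn -addSn addnK.
  by rewrite mulr_sumr; apply: eq_bigr => j _; ring.
rewrite [in RHS]big_ord_recl /= mul0r add0r; apply: eq_bigr => j _.
by rewrite /bump leq0n.
Unshelve. all: by end_near. Qed.

Lemma v_at1 m t : (0 < m)%N -> 0 < t ->
  \prod_(i < m) (2 * i%:R + 1) * v m t 1 =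
  \sum_(k < m) c_coef R m k * time_pow (m - k) t.
Proof.
move=> m0 t0; rewrite v_at1_poly// prod_c_coef//.
under eq_bigr do rewrite coef_sum mulr_suml.
rewrite exchange_big/=; apply: eq_bigr => k _.
have km : (m - k < m.+1)%N by rewrite ltnS leq_subr.
rewrite (bigD1 (Ordinal km))//= coefCM coefXn eqxx mulr1 big1 ?addr0// => j jk.
by rewrite coefCM coefXn -val_eqE /= in jk *; rewrite (negPf jk) mulr0 mul0r.
Qed.

Lemma powR_4pi m t : 0 < t -> (4 * pi * t) `^ (- ((2 * m).+1%:R / 2)) =
  (2 * (2 ^+ m) ^+ 2 * Num.sqrt pi ^+ (2 * m).+1 * (t ^+ m * Num.sqrt t))^-1.
Proof.
move=> t0; rewrite powR_half ?mulr_ge0 ?pi_ge0 ?(ltW t0)//; congr (_^-1).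
have -> : Num.sqrt (4 * pi * t) = 2 * Num.sqrt pi * Num.sqrt t.
  rewrite !sqrtrM ?mulr_ge0 ?pi_ge0//; congr (_ * _ * _).
  by rewrite (_ : 4 = 2 ^+ 2) ?sqrtr_sqr ?ger0_norm//; ring.
have E1 : 2 ^+ (2 * m).+1 = 2 * (2 ^+ m) ^+ 2 :> R by rewrite exprS mulnC exprM.
have E2 : Num.sqrt t ^+ (2 * m).+1 = t ^+ m * Num.sqrt t by rewrite exprSr exprM sqr_sqrtr// ltW.
by rewrite !exprMn E1 E2.
Qed.

Lemma polar_cstE m : polar_cst R m = Num.sqrt pi ^+ (2 * m).+1 / (Num.sqrt pi / 2 * half_fact m).
Proof.
have := polar_constant R (erefl (2 * m)%N); rewrite -/(polar_cst R m) => <-.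
have p0 : 0 < Num.sqrt pi :> R by rewrite sqrtr_gt0 pi_gt0.
have G0 := half_fact_gt0 m.
by rewrite /gauss_moment -/(half_fact m); field; rewrite !gt_eqF.
Qed.

Lemma hyperbolic_part m (K : R -> R -> R) t : (0 < m)%N ->
  radial_heat_kernel (hyperbolic_space R (2 * m).+1) K -> 0 < t ->
  K t 0 = (4 * pi * t) `^ (- ((2 * m).+1%:R / 2)) * expR (- (m%:R ^+ 2 * t))
          * \sum_(0 <= k < m)
              Gamma (m%:R - k%:R + 2^-1) * c_coef R m k
              / Gamma (m%:R + 2^-1) * t ^+ k.
Proof.
move=> m0 rK t0; rewrite (hyperbolic_kernel_diag rK m0 t0).
have vE := v_at1 m0 t0; rewrite prod_odd in vE.
set w := 2 ^+ m in vE; have w0 : 0 < w :> R by rewrite exprn_gt0.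
have G0 := half_fact_gt0 m; set G := half_fact m in vE G0.
have {}vE : v m t 1 = (w * G)^-1 * \sum_(k < m) c_coef R m k * time_pow (m - k) t.
  by rewrite -vE; field; rewrite !gt_eqF.
have p0 : 0 < Num.sqrt pi :> R by rewrite sqrtr_gt0 pi_gt0.
have q0 : 0 < Num.sqrt t by rewrite sqrtr_gt0.
rewrite powR_4pi// -/w.
rewrite vE big_mkord /hyp_cst.
rewrite polar_cstE -/G.
rewrite prod_odd -/w -/G !mulr_sumr; apply: eq_bigr => k _.
rewrite -natrB; last exact/ltnW/ltn_ord.
rewrite !Gamma_half_fact ?subn_gt0 ?ltn_ord// -/G /time_pow.
have -> : t ^+ m = t ^+ (m - k) * t ^+ k by rewrite -exprD subnK// ltnW.
have T1 : 0 < t ^+ (m - k) by rewrite exprn_gt0.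
have T2 : 0 < t ^+ k by rewrite exprn_gt0.
have A0 : 0 < Num.sqrt pi ^+ (2 * m).+1 :> R by rewrite exprn_gt0.
move: (Num.sqrt pi ^+ (2 * m).+1) A0 (Num.sqrt pi) p0 (Num.sqrt t) q0 => A A0 a a0 b b0.
move: (t ^+ (m - k)) T1 (t ^+ k) T2 => T1 T10 T2 T20.
by field; rewrite ?gt_eqF ?exprn_gt0.
Qed.

End DiagonalValue.

(** * Chebyshev polynomials and zonal integrals *)

Section Chebyshev.
Context (R : realType).
Implicit Types (p : {poly R}) (c : R).

(* The Chebyshev polynomials [cos (q x)] and [sin (q x) / sin x] in [cos x]; the
   second one has degree [q - 1]. The [i]-th derivative of the first one is, up to
   a factor, a Gegenbauer polynomial, hence zonal harmonic on the sphere of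
   dimension [2 * i + 1]. *)
Fixpoint cheb q : {poly R} * {poly R} :=
  if q is q'.+1 then
    ('X * (cheb q').1 - (1 - 'X^2) * (cheb q').2, 'X * (cheb q').2 + (cheb q').1)
  else (1, 0).

Definition chebT q : {poly R} := (cheb q).1.
Definition chebU q : {poly R} := (cheb q).2.
Local Notation T := chebT.
Local Notation U := chebU.

Lemma chebTS q : T q.+1 = 'X * T q - (1 - 'X^2) * U q. Proof. by []. Qed.
Lemma chebUS q : U q.+1 = 'X * U q + T q. Proof. by []. Qed.

Lemma deriv_nat k : (k%:R : {poly R})^`() = 0.
Proof. by rewrite -polyC_natr derivC. Qed.

Lemma cheb_deriv q : (T q)^`() = q%:R * U q /\ (1 - 'X^2) * (U q)^`() = 'X * U q - q%:R * T q.
Proof.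
elim: q => [|q [IT IU]].
  by rewrite /T /U /= derivC deriv0 !mul0r !mulr0 subrr.
have d1 : (1 - 'X^2 : {poly R})^`() = - (2 * 'X).
  by rewrite derivB derivXn (deriv_nat 1) sub0r expr1 mulr_natl.
split.
  rewrite chebTS chebUS derivB !derivM derivX d1 IT IU -natr1; ring.
rewrite chebUS derivD derivM derivX IT mulrDr mulrDr [_ * ('X * _)]mulrCA IU chebTS -natr1; ring.
Qed.

Lemma cheb_pyth q : T q ^+ 2 + (1 - 'X^2) * U q ^+ 2 = 1.
Proof.
elim: q => [|q IH]; first by rewrite /T /U /= expr0n mulr0 addr0 expr1n.
rewrite chebTS chebUS -[RHS]IH; ring.
Qed.

(** Chebyshev's equation differentiated [i] times. In the height [c], the Laplacian on the sphere of
    dimension [2 i + 1] is [(1 - c^2) f'' - (2 i + 1) c f'], so this is an eigenvalue equation. *)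
Lemma cheb_ode q i : (1 - 'X^2) * (T q)^`(i.+2) - (2 * i%:R + 1) * 'X * (T q)^`(i.+1)
  + (q%:R ^+ 2 - i%:R ^+ 2) * (T q)^`(i) = 0.
Proof.
have [IT IU] := cheb_deriv q.
elim: i => [|i IH].
  rewrite derivn0 derivn1 derivnS derivn1 IT derivM deriv_nat mul0r add0r mulrCA IU; ring.
have := congr1 (@deriv R) IH; rewrite deriv0 => E; rewrite -[RHS]E.
have d1 : (1 : {poly R})^`() = 0 by exact: (deriv_nat 1).
have dX2 : ('X^2 : {poly R})^`() = 2 * 'X by rewrite derivXn expr1 mulr_natl.
have dsq k : ((k%:R : {poly R}) ^+ 2)^`() = 0.
  by rewrite expr2 derivM deriv_nat !(mul0r, mulr0) addr0.
rewrite !(d1, dX2, dsq, deriv_nat, derivX, derivN, derivD, derivM) -!derivnS.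
rewrite -[i.+1%:R]natr1; ring.
Qed.

Lemma horner_nat k c : (k%:R : {poly R}).[c] = k%:R.
Proof. by rewrite -polyC_natr hornerC. Qed.

Lemma cheb_odeE q i c : (1 - c ^+ 2) * ((T q)^`(i.+2)).[c] - (2 * i%:R + 1) * c * ((T q)^`(i.+1)).[c]
  + (q%:R ^+ 2 - i%:R ^+ 2) * ((T q)^`(i)).[c] = 0.
Proof.
have := congr1 (horner^~ c) (cheb_ode q i).
by rewrite !(hornerXn, horner_exp, hornerD, hornerN, hornerM, horner_nat, hornerX, hornerC, horner0).
Qed.

Lemma chebT_1 q : (T q).[1] = 1.
Proof.
elim: q => [|q IH]; first by rewrite hornerC.
rewrite chebTS !(hornerXn, hornerD, hornerN, hornerM, hornerX, hornerC) IH expr1n; ring.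
Qed.

Lemma cheb_derivn_1S q i :
  ((T q)^`(i.+1)).[1] = (q%:R ^+ 2 - i%:R ^+ 2) / (2 * i%:R + 1) * ((T q)^`(i)).[1].
Proof.
have := cheb_odeE q i 1; rewrite expr1n subrr mul0r mulr1 sub0r => E.
have n0 : 2 * i%:R + 1 != 0 :> R by rewrite -natrM natr1 pnatr_eq0.
apply: (mulfI n0); apply/eqP; rewrite -subr_eq0 -oppr_eq0; apply/eqP; rewrite -[RHS]E.
by field.
Qed.

Lemma cheb_derivn_1 q i : ((T q)^`(i)).[1] =
  (\prod_(j < i) (q%:R ^+ 2 - j%:R ^+ 2)) / \prod_(j < i) (2 * j%:R + 1).
Proof.
elim: i => [|i IH]; first by rewrite derivn0 chebT_1 !big_ord0 divr1.
rewrite cheb_derivn_1S IH !big_ord_recr/= invfM; ring.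
Qed.

Lemma chebT_le1 q c : `|c| <= 1 -> `|(T q).[c]| <= 1.
Proof.
move=> c1; rewrite -(ler_pXn2r (n := 2)) ?nnegrE// expr1n real_normK ?num_real//.
have := congr1 (horner^~ c) (cheb_pyth q).
rewrite !(hornerXn, horner_exp, hornerD, hornerN, hornerM, hornerX, hornerC) => <-.
rewrite lerDl mulr_ge0 ?sqr_ge0// subr_ge0 -real_normK ?num_real//.
by rewrite exprn_ile1.
Qed.

(** On [[-1, 1]] every [T q] is bounded by [1 = T q (1)]. Nonnegative combinations inherit that they
    are largest at [1], and they are stable under derivation: hence all derivatives of the [T q] are
    controlled by their values at [1]. *)
Inductive cheb_cone : {poly R} -> Prop :=
| cheb_cone0 : cheb_cone 0
| cheb_coneD a q p : 0 <= a -> cheb_cone p -> cheb_cone (a%:P * T q + p).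

Lemma cheb_cone_add p1 p2 : cheb_cone p1 -> cheb_cone p2 -> cheb_cone (p1 + p2).
Proof.
elim=> [|a q p a0 _ IH] c2; first by rewrite add0r.
by rewrite -addrA; apply: cheb_coneD => //; exact: IH.
Qed.

Lemma cheb_coneZ a p : 0 <= a -> cheb_cone p -> cheb_cone (a%:P * p).
Proof.
move=> a0; elim=> [|b q p' b0 _ IH]; first by rewrite mulr0; exact: cheb_cone0.
by rewrite mulrDr mulrA -polyCM; apply: cheb_coneD => //; exact: mulr_ge0.
Qed.

Lemma cheb_coneT q : cheb_cone (T q).
Proof.
by have := cheb_coneD q (@ler01 R) cheb_cone0; rewrite mul1r addr0.
Qed.

Lemma cheb_coneU q : cheb_cone (U q) /\ cheb_cone (U q.+1).
Proof.
elim: q => [|q [IH0 IH1]].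
  split; first exact: cheb_cone0.
  by rewrite chebUS /U /= mulr0 add0r; exact: (cheb_coneT 0).
(* A recursion with nonnegative coefficients, of step two: hence the induction on pairs. *)
split=> //; have -> : U q.+2 = 2%:P * T q.+1 + U q.
  by rewrite (chebUS q.+1) (chebUS q) (chebTS q) polyC_natr; ring.
by apply: cheb_coneD.
Qed.

Lemma cheb_cone_deriv p : cheb_cone p -> cheb_cone p^`().
Proof.
elim=> [|a q p' a0 _ IH]; first by rewrite deriv0; exact: cheb_cone0.
rewrite derivD derivM derivC mul0r add0r; apply: cheb_cone_add => //.
apply: cheb_coneZ => //; have [-> _] := cheb_deriv q; rewrite -polyC_natr.
by apply: cheb_coneZ => //; have [] := cheb_coneU q.
Qed.

Lemma cheb_cone_derivn q i : cheb_cone (T q)^`(i).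
Proof.
elim: i => [|i IH]; first by rewrite derivn0; exact: cheb_coneT.
by rewrite derivnS; exact: cheb_cone_deriv.
Qed.

Lemma cheb_cone_le p c : cheb_cone p -> `|c| <= 1 -> `|p.[c]| <= p.[1].
Proof.
move=> Cp c1; elim: Cp => [|a q p' a0 _ IH]; first by rewrite !horner0 normr0.
rewrite !(hornerD, hornerM, hornerC) chebT_1 (le_trans (ler_normD _ _))// lerD//.
by rewrite normrM ger0_norm// ler_wpM2l// chebT_le1.
Qed.

Lemma cheb_cone_lip p c : cheb_cone p -> -1 <= c <= 1 -> `|p.[c] - p.[1]| <= p^`().[1] * (1 - c).
Proof.
move=> Cp /andP[c1 c2].
have cd : continuous (fun x : R => p^`().[x]).
  by move=> x; exact: (cont_isd (is_derive_horner p^`() x)).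
rewrite distrC.
have <- : integ c 1 (fun x => p^`().[x]) = p.[1] - p.[c].
  by apply: (@integ_FTC_closed R c 1 _ (horner p)) => // x _; exact: is_derive_horner.
apply: (le_trans (le_norm_integ _ _ cd)); rewrite -integ_cst//.
apply: le_integ => //; first by move=> x; cont_tac.
  by move=> x; exact: cst_continuous.
move=> x /andP[cx x1]; apply: cheb_cone_le; first exact: cheb_cone_deriv.
by rewrite ler_norml x1 (le_trans c1).
Qed.

Lemma cheb_size q : [/\ (size (T q) <= q.+1)%N, (size (U q) <= q)%N, 0 < (T q)`_q & 0 <= (U q)`_q.-1].
Proof.
elim: q => [|q [sT sU T0 U0]].
  by rewrite /T /U /= size_poly1 size_poly0 coef1 coef0.
have coefXX p k : ('X * p)`_k.+1 = p`_k by rewrite coefXM.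
have coefQ p k : ((1 - 'X^2) * p)`_k = p`_k - (if (k < 2)%N then 0 else p`_(k - 2)).
  by rewrite mulrBl mul1r coefB coefXnM.
have T0' k : (q < k)%N -> (T q)`_k = 0 by move=> qk; rewrite nth_default// (leq_trans sT).
have U0' k : (q <= k)%N -> (U q)`_k = 0 by move=> qk; rewrite nth_default// (leq_trans sU).
split.
- apply/leq_sizeP => j; case: j => // j qj; rewrite chebTS coefB coefXX T0'//.
  rewrite coefQ U0' ?(ltnW (ltnW qj))// !sub0r opprK; case: ltnP => // j2.
  by rewrite U0'//; lia.
- apply/leq_sizeP => j qj; rewrite chebUS coefD T0'// addr0; case: j qj => // j qj.
  by rewrite coefXX U0'.
- rewrite chebTS coefB coefXX coefQ U0'// sub0r opprK.
  case: ltnP => q2; first by rewrite addr0.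
  rewrite (_ : (q.+1 - 2 = q.-1)%N); first exact: ltr_wpDr.
  by rewrite subSS subn1.
- rewrite chebUS coefD addr_ge0 ?(ltW T0)//= coefXM; case: eqP => // _.
Qed.

Lemma cheb_derivn_size q i : (i <= q)%N ->
  (size (T q)^`(i) <= (q - i).+1)%N /\ 0 < ((T q)^`(i))`_(q - i).
Proof.
move=> iq; have [sT _ T0 _] := cheb_size q; split.
  apply/leq_sizeP => j qj; rewrite coef_derivn nth_default ?mul0rn//.
  by apply: (leq_trans sT); lia.
by rewrite coef_derivn subnKC// pmulrn_rgt0// ffact_gt0.
Qed.

End Chebyshev.

(** * Zonal integrals of polynomials in the height *)

Section Gegenbauer.
Context (R : realType).
Implicit Types (p : {poly R}) (r c : R).
Local Notation T q i := ((chebT R q)^`(i)).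

(* [sn] and [cs] are the sine and the cosine of the distance to the base point, and
   [hh] is the conformal factor, at stereographic radius [r]. *)
Definition hh r : R := 2 / (1 + r ^+ 2).
Definition sn r : R := r * hh r.
Definition cs r : R := (1 - r ^+ 2) / (1 + r ^+ 2).

Let den_gt0 r : 0 < 1 + r ^+ 2. Proof. by rewrite ltr_wpDr ?sqr_ge0. Qed.
Let den_neq0 r : 1 + r ^+ 2 != 0. Proof. by rewrite gt_eqF. Qed.

Lemma hh_gt0 r : 0 < hh r. Proof. by rewrite divr_gt0. Qed.
Lemma sn_ge0 r : 0 <= r -> 0 <= sn r. Proof. by move=> r0; rewrite mulr_ge0// ltW// hh_gt0. Qed.
Lemma sqr_sn r : sn r ^+ 2 = 1 - cs r ^+ 2. Proof. by rewrite /sn /hh /cs; field. Qed.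
Lemma cs_le1 r : cs r <= 1.
Proof. by rewrite ler_pdivrMr// mul1r; have := sqr_ge0 r; lra. Qed.
Lemma cs_geN1 r : -1 <= cs r.
Proof. by rewrite ler_pdivlMr// mulN1r; have := sqr_ge0 r; lra. Qed.
Lemma cs_1 : cs 1 = 0. Proof. by rewrite /cs expr1n subrr mul0r. Qed.
Lemma cs_ge0 r : 0 <= r <= 1 -> 0 <= cs r.
Proof. by move=> /andP[r0 r1]; rewrite divr_ge0 ?(ltW (den_gt0 r))// subr_ge0 expr_le1. Qed.

Lemma continuous_hh : continuous hh. Proof. by move=> r; rewrite /hh; cont_tac. Qed.
Lemma continuous_sn : continuous sn. Proof. by move=> r; rewrite /sn /hh; cont_tac. Qed.
Lemma continuous_cs : continuous cs. Proof. by move=> r; rewrite /cs; cont_tac. Qed.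

Lemma is_derive_sn r : is_derive r 1 sn (cs r * hh r).
Proof. by rewrite /sn /hh; isd_tac; [exact: den_neq0|rewrite /cs /hh /=; field]. Qed.

Lemma is_derive_cs r : is_derive r 1 cs (- (sn r * hh r)).
Proof. by rewrite /cs; isd_tac; [exact: den_neq0|rewrite /sn /hh /=; field]. Qed.

Lemma continuous_horner_poly p : continuous (horner p).
Proof. by move=> x; exact: (cont_isd (is_derive_horner p x)). Qed.

Lemma continuous_horner_cs p : continuous (fun r => p.[cs r]).
Proof.
move=> r; change {for r, continuous (fun r => p.[cs r])}.
by apply: (cont_comp (h := horner p)); [exact: continuous_cs|exact: continuous_horner_poly].
Qed.

Lemma continuous_horner_csN p : continuous (fun r => p.[- cs r]).
Proof.
move=> r; change {for r, continuous (fun r => p.[- cs r])}.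
apply: (cont_comp (h := horner p)); last exact: continuous_horner_poly.
by have c := @continuous_cs; cont_tac.
Qed.

(* Integral over the sphere of dimension [2 * i + 1] of a polynomial in the
   height, up to a constant: each hemisphere is seen in its own stereographic
   chart, as the unit ball. *)
Definition sph i p : R := integ 0 1 (fun r => sn r ^+ (2 * i) * hh r * (p.[cs r] + p.[- cs r])).

Lemma continuous_sph i p : continuous (fun r => sn r ^+ (2 * i) * hh r * (p.[cs r] + p.[- cs r])).
Proof.
have c1 := continuous_hh; have c2 := continuous_sn.
have c3 := @continuous_horner_cs p; have c4 := @continuous_horner_csN p.
by move=> r; cont_tac.
Qed.

Lemma sphD i p q : sph i (p + q) = sph i p + sph i q.
Proof.
rewrite -integD; [|exact: continuous_sph|exact: continuous_sph].
by apply: eq_integ => r _; rewrite !hornerD; ring.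
Qed.

Lemma sphZ i a p : sph i (a%:P * p) = a * sph i p.
Proof.
rewrite -integZ; last exact: continuous_sph.
by apply: eq_integ => r _; rewrite !hornerM !hornerC; ring.
Qed.

Lemma sph0 i : sph i 0 = 0.
Proof. by rewrite -[X in sph i X](mul0r 0) -polyC0 sphZ mul0r. Qed.

Lemma sphB i p q : sph i (p - q) = sph i p - sph i q.
Proof. by rewrite sphD -mulN1r -[-1](rmorphN1 polyC) sphZ mulN1r. Qed.

Lemma sph_sum i n (F : 'I_n -> {poly R}) : sph i (\sum_k F k) = \sum_k sph i (F k).
Proof. by apply: (big_morph (sph i)); [exact: sphD|exact: sph0]. Qed.

Lemma sphS i p : sph i.+1 p = sph i ((1 - 'X^2) * p).
Proof.
apply: eq_integ => r _; rewrite !(hornerXn, hornerM, hornerD, hornerN, hornerC).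
by rewrite sqrrN -sqr_sn mulnS !exprS; ring.
Qed.

(** The integrand is the derivative of [sn^(2 i + 1) p] on each hemisphere; at the equator,
    [cs 1 = 0], the two contributions cancel. *)
Lemma sph_parts i p : sph i ((1 - 'X^2) * p^`() - (2 * i%:R + 1) * 'X * p) = 0.
Proof.
pose F r := - (sn r ^+ (2 * i).+1 * (p.[cs r] - p.[- cs r])).
transitivity (F 1 - F 0); last by rewrite /F cs_1 oppr0 subrr mulr0 /sn !mul0r expr0n/= mul0r subrr.
apply: integ_FTC_closed => //; first exact: continuous_sph.
move=> r _; have D1 := is_derive_cs r; have D2 := is_derive_sn r.
have D3 : is_derive r 1 (fun r => p.[cs r]) (p^`().[cs r] * - (sn r * hh r)).
  exact: isd_comp D1 (is_derive_horner p (cs r)).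
have D4 : is_derive r 1 (fun r => p.[- cs r]) (p^`().[- cs r] * (sn r * hh r)).
  have D := isd_comp (isdN D1) (is_derive_horner p (- cs r)).
  by apply: isd_eq D _; rewrite opprK.
rewrite /F; isd_tac; rewrite !(hornerXn, hornerM, hornerD, hornerN, hornerC, hornerX, horner_nat).
rewrite sqrrN -sqr_sn /= -natr1 natrM exprS; ring.
Qed.

Lemma le_sph i p q : (forall c, -1 <= c <= 1 -> p.[c] <= q.[c]) -> sph i p <= sph i q.
Proof.
move=> pq; apply: le_integ => //; [exact: continuous_sph|exact: continuous_sph|].
move=> r /andP[r0 _]; apply: ler_wpM2l.
  by rewrite mulr_ge0 ?(ltW (hh_gt0 r))// exprn_ge0// sn_ge0.
have := cs_le1 r; have := cs_geN1 r => c1 c2.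
by rewrite lerD// pq//; apply/andP; split; lra.
Qed.

Lemma le_norm_sph i p q : (forall c, -1 <= c <= 1 -> `|p.[c]| <= q.[c]) -> `|sph i p| <= sph i q.
Proof.
move=> pq; have pq' c : -1 <= c <= 1 -> - q.[c] <= p.[c] <= q.[c] by move=> /pq; rewrite ler_norml.
rewrite ler_norml le_sph ?andbT; last by move=> c /pq' /andP[].
rewrite -[sph i q]mul1r -mulNr -sphZ; apply: le_sph => c /pq' /andP[h _].
by rewrite hornerM hornerC mulN1r.
Qed.

Lemma sph_cheb_rec i q k : sph i.+1 (T q i.+1 * T k i.+1) = (k%:R ^+ 2 - i%:R ^+ 2) * sph i (T q i * T k i).
Proof.
apply/eqP; rewrite -subr_eq0 sphS -sphZ -sphB; apply/eqP.
rewrite -[RHS](sph_parts i (T q i * T k i.+1)) derivM -!derivnS; congr (sph i _).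
have E := cheb_ode R k i.
apply/eqP; rewrite -subr_eq0; apply/eqP.
transitivity (- (T q i * ((1 - 'X^2) * T k i.+2 - (2 * i%:R + 1) * 'X * T k i.+1
  + (k%:R ^+ 2 - i%:R ^+ 2) * T k i))); last by rewrite E mulr0 oppr0.
rewrite polyCB !polyC_exp !polyC_natr; ring.
Qed.

(** [sph_cheb_rec] can be read with [q] and [k] exchanged, so the difference of the eigenvalues
    times the integral is zero. *)
Lemma sph_cheb_orth i q k : q <> k -> sph i (T q i * T k i) = 0.
Proof.
move=> qk; have := sph_cheb_rec i q k; rewrite [X in sph _ X]mulrC sph_cheb_rec [X in sph _ X]mulrC.
move=> /eqP; rewrite -subr_eq0 -mulrBl mulf_eq0 => /orP[|/eqP//].
have -> : q%:R ^+ 2 - i%:R ^+ 2 - (k%:R ^+ 2 - i%:R ^+ 2) = q%:R ^+ 2 - k%:R ^+ 2 :> R by ring.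
rewrite subr_eq0 eqrXn2// eqr_nat => /eqP; by [].
Qed.

(** For [i = 0] the integrals of [T^2] and [(1 - X^2) U^2] are equal by [sph_cheb_rec] and sum to
    that of [1] by [cheb_pyth]; each further derivative multiplies by an eigenvalue. *)
Lemma sph_cheb_norm i q : (0 < q)%N ->
  sph i (T q i * T q i) = (\prod_(j < i) (q%:R ^+ 2 - j%:R ^+ 2)) * (sph 0 1 / 2).
Proof.
move=> q0; elim: i => [|i IH]; last by rewrite sph_cheb_rec IH big_ord_recr/=; ring.
rewrite big_ord0 mul1r derivn0.
have qn0 : q%:R != 0 :> R by rewrite pnatr_eq0 -lt0n.
have q2 : q%:R ^+ 2 != 0 :> R by rewrite expf_neq0.
have [TU _] := cheb_deriv R q.
have := sph_cheb_rec 0 q q; rewrite derivn0 derivn1 expr0n subr0 sphS TU => E.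
have E2 : sph 0 ((1 - 'X^2) * (chebU R q) ^+ 2) = sph 0 (chebT R q * chebT R q).
  apply: (mulfI q2); rewrite -E -sphZ; congr (sph _ _).
  by rewrite polyC_exp polyC_natr; ring.
have E3 : sph 0 1 = sph 0 (chebT R q * chebT R q) + sph 0 ((1 - 'X^2) * (chebU R q) ^+ 2).
  by rewrite -sphD -expr2 cheb_pyth.
by rewrite E3 E2; field.
Qed.

Lemma sph01 : sph 0 1 = pi.
Proof.
have ca : continuous (fun r : R => 4 / (1 + r ^+ 2)) by move=> r; cont_tac.
transitivity (integ 0 1 (fun r : R => 4 / (1 + r ^+ 2))).
  by apply: eq_integ => r _; rewrite !hornerC /hh muln0 expr0; ring.
transitivity (4 * atan 1 - 4 * atan (0 : R)); last by rewrite atan0 atan1; field.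
apply: (@integ_FTC_closed R 0 1 _ (fun r => 4 * atan r)) => // r _.
Qed.

Lemma sph1_rec i : sph i.+1 1 = (2 * i%:R + 1) / (2 * i%:R + 2) * sph i 1.
Proof.
have := sph_parts i 'X; rewrite derivX sphB -sphS.
have -> : (2 * i%:R + 1) * 'X * 'X = (2 * i%:R + 1)%:P * (1 - (1 - 'X^2) * 1) :> {poly R}.
  by rewrite polyCD polyCM !polyC_natr; ring.
rewrite sphZ sphB -sphS => E; have n0 : 2 * i%:R + 2 != 0 :> R by rewrite -natrM -natrD pnatr_eq0 addn2.
apply: (mulfI n0); apply/eqP; rewrite -subr_eq0; apply/eqP; rewrite -[RHS]E; by field.
Qed.

Lemma sph1 i : sph i 1 = pi * \prod_(j < i) ((2 * j%:R + 1) / (2 * j%:R + 2)).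
Proof.
elim: i => [|i IH]; first by rewrite big_ord0 mulr1 sph01.
by rewrite sph1_rec IH big_ord_recr/=; ring.
Qed.

(** Quantifies the concentration at the pole: under the density [(1 + X)^N] the mean of [1 - X] is
    of order [1 / N]. It is [sph_parts] applied to [(1 + X)^N]. *)
Lemma sph_kernel i N : sph i ((1 - 'X) * (1 + 'X) ^+ N) =
  (2 * i%:R + 1) / (N%:R + 2 * i%:R + 1) * sph i ((1 + 'X) ^+ N).
Proof.
have n0 : N%:R + 2 * i%:R + 1 != 0 :> R by rewrite -natrM -natrD natr1 pnatr_eq0.
have := sph_parts i ((1 + 'X) ^+ N).
have dX : (1 + 'X : {poly R})^`() = 1 by rewrite derivD derivX (deriv_nat R 1) add0r.
have -> : (1 - 'X^2) * ((1 + 'X) ^+ N)^`() = N%:R%:P * ((1 - 'X) * (1 + 'X) ^+ N) :> {poly R}.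
  rewrite deriv_exp dX mul1r polyC_natr; case: N {n0} => [|N]; first by rewrite mulr0n mulr0 mul0r.
  by rewrite -mulr_natl [(1 + 'X) ^+ N.+1]exprS /=; ring.
have -> : (2 * i%:R + 1) * 'X * (1 + 'X) ^+ N =
    (2 * i%:R + 1)%:P * ((1 + 'X) ^+ N - (1 - 'X) * (1 + 'X) ^+ N) :> {poly R}.
  by rewrite polyCD polyCM !polyC_natr; ring.
rewrite sphB !sphZ sphB => E.
apply: (mulfI n0); apply/eqP; rewrite -subr_eq0; apply/eqP; rewrite -[RHS]E; by field.
Qed.

Lemma sph_kernel_gt0 i N : 0 < sph i ((1 + 'X) ^+ N).
Proof.
have ge0 r : 0 <= r <= 1 -> 0 <= sn r ^+ (2 * i) * hh r *
    (((1 + 'X) ^+ N).[cs r] + ((1 + 'X) ^+ N).[- cs r]).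
  move=> /andP[r0 r1]; have := cs_le1 r; have := cs_geN1 r => c1 c2.
  apply: mulr_ge0; first by rewrite mulr_ge0 ?(ltW (hh_gt0 r))// exprn_ge0 ?sn_ge0.
  rewrite !horner_exp !hornerD !hornerX !hornerC addr_ge0// exprn_ge0//; try lra.
rewrite lt_neqAle integ_ge0// andbT; apply/negP => /eqP/esym E.
have := integ_gt0_eq0 (@continuous_sph i ((1 + 'X) ^+ N)) ltr01 ge0 E.
have h0 : 0 < 2^-1 :> R by lra.
have h1 : 2^-1 < 1 :> R by lra.
move=> /(_ 2^-1); rewrite h0 h1 => /(_ isT) /eqP; apply/negP; rewrite gt_eqF//.
have s0 : 0 < sn 2^-1 :> R by rewrite mulr_gt0 ?hh_gt0.
apply: mulr_gt0; first by rewrite mulr_gt0 ?hh_gt0 ?exprn_gt0.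
rewrite !horner_exp !hornerD !hornerX !hornerC.
have c0 : 0 <= cs 2^-1 :> R by apply: cs_ge0; apply/andP; split; lra.
have := cs_le1 2^-1 => c1.
by rewrite ltr_pwDl ?exprn_gt0 ?exprn_ge0//; lra.
Qed.

End Gegenbauer.

(** * The heat kernel of the sphere *)

Section SphereMoments.
Context (R : realType).
Implicit Types (p : {poly R}) (r c t : R).
Local Notation nrm x := (Num.sqrt (sqnorm x)).

(** The change of variable [x -> 1/x] folds the exterior of the unit ball of one chart into the unit
    ball of the other. *)
Lemma integ_inv (f g : R -> R) N : continuous f -> continuous g -> 1 <= N ->
  (forall x, 0 < x -> f x = g x^-1 / x ^+ 2) -> integ 1 N f = integ 0 1 g - integ 0 N^-1 g.
Proof.
move=> cf cg N1 fg; have N0 : 0 < N by lra.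
have D (x : R) : 0 < x -> is_derive x 1 (fun x => - integ 0 x^-1 g) (f x).
  move=> x0; have xn0 : x != 0 by rewrite gt_eqF.
  have ix0 : 0 < x^-1 by rewrite invr_gt0.
  have D0 := isd_comp (isdV xn0 (isd_id x)) (integ_deriv ix0 cg).
  by apply: isd_eq (isdN D0) _; rewrite fg//; field.
transitivity (- integ 0 N^-1 g - - integ 0 1^-1 g); last by rewrite invr1 opprK addrC.
apply: (@integ_FTC_closed R 1 N f (fun x => - integ 0 x^-1 g)) => //.
by move=> x /andP[x1 _]; apply: D; lra.
Qed.

Lemma hh_inv r : 0 < r -> hh r^-1 = r ^+ 2 * hh r.
Proof.
move=> r0; have d0 : 1 + r ^+ 2 != 0 by rewrite gt_eqF// ltr_wpDr ?sqr_ge0.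
rewrite /hh exprVn; field; rewrite d0 gt_eqF//= addrC d0//.
Qed.

Lemma sn_inv r : 0 < r -> sn r^-1 = sn r.
Proof. by move=> r0; rewrite /sn hh_inv//; field; rewrite gt_eqF. Qed.

Lemma cs_inv r : 0 < r -> cs r^-1 = - cs r.
Proof.
move=> r0; have d0 : 1 + r ^+ 2 != 0 by rewrite gt_eqF// ltr_wpDr ?sqr_ge0.
rewrite /cs exprVn; field; rewrite d0 gt_eqF//= addrC d0//.
Qed.

Section volume.
Variable m : nat.
Local Notation n := (2 * m).+1.
Local Notation M := (sphere R n).
Local Notation e0 := (delta_mx 0 0 : 'rV[R]_n).
Local Notation W r := (sn r ^+ (2 * m) * hh r).

Lemma sphere_weight r : W r = r ^+ (2 * m) * hh r ^+ n.
Proof. by rewrite /sn exprMn exprSr; ring. Qed.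

Lemma continuous_sphere_weight : continuous (fun r => W r).
Proof.
have c1 := @continuous_hh R; have c2 := @continuous_sn R.
by move=> r; cont_tac.
Qed.

Lemma stereographic_chart00 b (x : 'rV[R]_n) :
  stereographic_chart b x 0 0 = (-1) ^+ b * cs (nrm x).
Proof.
rewrite /stereographic_chart /cs sqr_sqrtr ?sqnorm_ge0//.
rewrite (_ : 0 = lshift n 0 :> 'I_(1 + n)); last exact: val_inj.
by rewrite mxE row_mxEl mxE eqxx mulr1n; ring.
Qed.

Lemma stereographic_chart_inv r : 0 < r ->
  stereographic_chart true (r *: e0) = stereographic_chart false (r^-1 *: e0).
Proof.
move=> r0; have d0 : 1 + r ^+ 2 != 0 by rewrite gt_eqF// ltr_wpDr ?sqr_ge0.
have s a : sqnorm (a *: e0) = a ^+ 2 by rewrite sqnormZ sqnorm_delta mulr1.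
have rn0 : r != 0 by rewrite gt_eqF.
have d1 : 1 + (r ^- 1) ^+ 2 != 0 by rewrite gt_eqF// ltr_wpDr ?sqr_ge0.
apply/rowP; apply: split_1n => [|k].
  rewrite !stereographic_chart00 !nrm_axis ?invr_ge0 ?(ltW r0)// cs_inv// expr1 expr0; ring.
rewrite /stereographic_chart !s [LHS]mxE [RHS]mxE !row_mxEr !mxE exprVn.
move: (_%:R : R) => d; field.
by rewrite ?rn0 ?d0 ?[r ^+ 2 + 1]addrC ?d0.
Qed.

(** The main chart covers the sphere up to one point. Its unit ball is a hemisphere; its exterior is
    brought back by inversion to the unit ball of the other chart, where [g1] is the profile. A
    multiple of [hh^n] dominates, which justifies the limit of large radius. *)
Lemma sphere_volume_radial (F : 'rV[R]_(1 + n) -> R) (g0 g1 : R -> R) :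
  continuous g0 -> continuous g1 ->
  (forall x : 'rV[R]_n, F (stereographic_chart false x) = g0 (nrm x)) ->
  (forall r, 0 < r -> g0 r = g1 r^-1) ->
  volume_integral M F =
    polar_cst R m * (integ 0 1 (fun r => W r * g0 r) + integ 0 1 (fun r => W r * g1 r)).
Proof.
move=> c0 c1 FE g01; have ch := @continuous_hh R; have cW := continuous_sphere_weight.
have [B0 B00 hB0] := continuous_bounded 0 1 c0.
have [B1 B10 hB1] := continuous_bounded 0 1 c1.
pose g r := g0 `|r| * hh r ^+ n; pose B := B0 + B1; pose h r := B * hh r ^+ n.
have hn0 r : 0 <= hh r ^+ n by rewrite exprn_ge0// ltW// hh_gt0.
have cg : continuous g.
  have ca : continuous (fun r => g0 `|r|).
    move=> r; change {for r, continuous (fun r => g0 `|r|)}.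
    by apply: (cont_comp (h := g0)); [exact: norm_continuous|exact: c0].
  by move=> r; rewrite /g; cont_tac.
have chn : continuous h by move=> r; rewrite /h; cont_tac.
have gB r : 0 <= r -> `|g0 r| <= B.
  move=> r0; have [r1|r1] := leP r 1.
    by apply: (@le_trans _ _ B0); [apply: hB0; rewrite r0|rewrite lerDl].
  have r0' : 0 < r by lra.
  rewrite g01//; apply: (@le_trans _ _ B1); [apply: hB1|by rewrite lerDr].
  by rewrite invr_ge0 r0 invf_le1 ?ltW.
have gh r : `|g r| <= h r by rewrite /g /h normrM (ger0_norm (hn0 _)) ler_wpM2r// gB.
have split_int (f k : R -> R) N : continuous f -> continuous k -> 1 <= N ->
    (forall r, 0 < r -> f r = k r^-1) ->
    integ 0 N (fun r => W r * f r) =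
    integ 0 1 (fun r => W r * f r) + (integ 0 1 (fun r => W r * k r) - integ 0 N^-1 (fun r => W r * k r)).
  move=> cf ck N1 fk.
  rewrite (@integ_cat R 0 1 N)//; last by move=> r; cont_tac.
  congr (_ + _); apply: integ_inv => //; [by move=> r; cont_tac|by move=> r; cont_tac|].
  move=> r r0; rewrite fk// sn_inv// hh_inv//; field; by rewrite gt_eqF.
have W0 r : 0 <= r -> 0 <= W r.
  by move=> r0; rewrite mulr_ge0 ?exprn_ge0 ?sn_ge0// ltW// hh_gt0.
have cB : continuous (fun _ : R => B) by move=> r; exact: cst_continuous.
have hbound (i : nat) : ball_integral (2 * m) h i%:R <=
    polar_cst R m * (integ 0 1 (fun r => W r * B) + integ 0 1 (fun r => W r * B)).
  rewrite ball_integralE// -/(polar_cst R m) ler_pM2l ?polar_cst_gt0//.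
  apply: (@le_trans _ _ (integ 0 i.+1%:R (fun r => W r * B))).
    have ii : i%:R <= i.+1%:R :> R by rewrite ler_nat.
    rewrite [leRHS](@integ_cat R 0 i%:R i.+1%:R)//; last by move=> r; cont_tac.
    rewrite -[leLHS]addr0 lerD//.
      rewrite le_eqVlt; apply/orP; left; apply/eqP; apply: eq_integ => r _.
      by rewrite sphere_weight /h; ring.
    apply: integ_ge0 => r /andP[ri _]; rewrite mulr_ge0 ?addr_ge0// W0//.
    by apply: le_trans ri; exact: ler0n.
  rewrite (split_int (fun=> B) (fun=> B))//; last by rewrite ler1n.
  rewrite lerD2l gerBl integ_ge0// => r /andP[r0 _].
  by rewrite mulr_ge0 ?addr_ge0// W0.
have [_ lim] := dom_ball_integral_lim (k := 2 * m) cg chn gh hbound.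
have -> : volume_integral M F = \int[lebesgue_tuple R n]_v g (trad v).
  apply: eq_Rintegral => v _ /=; rewrite FE stereographic_density sqnorm_row /g ger0_norm ?trad_ge0//.
  by rewrite /hh /trad sqr_sqrtr ?tsq_ge0.
have limS : (fun i : nat => ball_integral (2 * m) g i.+1%:R) @ \oo -->
    \int[lebesgue_tuple R n]_v g (trad v).
  by rewrite (@cvg_shiftS _ (fun i => ball_integral (2 * m) g i%:R)).
apply: (cvg_unique _ limS); first exact: Rhausdorff.
have [B2 B20 hB2] : exists2 B2 : R, 0 <= B2 & forall x, 0 <= x <= 1 -> `|W x * g1 x| <= B2.
  by apply: continuous_bounded => r; cont_tac.
have small : integ 0 i.+1%:R^-1 (fun r => W r * g1 r) @[i --> \oo] --> (0 : R).
  apply/norm_cvg0P; apply: (@squeeze_cvgr _ _ _ _ (fun=> 0) (fun i : nat => B2 * i.+1%:R^-1)).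
  - near=> i; rewrite normr_ge0 /=.
    have i0 : 0 <= i.+1%:R^-1 :> R by rewrite invr_ge0.
    apply: (le_trans (le_norm_integ _ _ _)); first by move=> r; cont_tac.
    rewrite -[X in B2 * X]subr0 -integ_cst//; apply: le_integ.
    + by move=> r; cont_tac.
    + by move=> r; exact: cst_continuous.
    + move=> r /andP[r0 r1]; apply: hB2; rewrite r0 (le_trans r1)// invf_le1// ler1n//.
  - exact: cvg_cst.
  - rewrite -[X in _ --> X](mulr0 B2); apply: cvgM; first exact: cvg_cst.
    exact: cvg_harmonic.
have lim2 : polar_cst R m * (integ 0 1 (fun r => W r * g0 r) +
    (integ 0 1 (fun r => W r * g1 r) - integ 0 i.+1%:R^-1 (fun r => W r * g1 r))) @[i --> \oo] -->
    polar_cst R m * (integ 0 1 (fun r => W r * g0 r) + (integ 0 1 (fun r => W r * g1 r) - 0)).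
  by apply: cvgM; [exact: cvg_cst|apply: cvgD; [exact: cvg_cst|apply: cvgB => //; exact: cvg_cst]].
rewrite subr0 in lim2; apply: cvg_trans lim2; apply: near_eq_cvg.
near=> i; rewrite -split_int//; last by rewrite ler1n.
rewrite ball_integralE//; congr (_ * _); apply: eq_integ => r /andP[r0 _].
by rewrite sphere_weight /g ger0_norm//; ring.
Unshelve. all: by end_near. Qed.

Lemma sphere_volumeE : volume M = polar_cst R m * sph m 1.
Proof.
have c1 : continuous (fun _ : R => 1 : R) by move=> r; exact: cst_continuous.
rewrite /volume (sphere_volume_radial c1 c1)//; congr (_ * _).
rewrite -integD; [|by have := continuous_sphere_weight => cW r; cont_tac..].
by apply: eq_integ => r _; rewrite !hornerC; ring.
Qed.

End volume.
End SphereMoments.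

(** * Moments of the spherical heat kernel *)

Section SphereKernel.
Context (R : realType).
Implicit Types (p : {poly R}) (r c t : R).
Local Notation nrm x := (Num.sqrt (sqnorm x)).

Lemma eq_of_derive0 (f : R -> R) (l t : R) : 0 < t -> (forall s : R, 0 < s -> is_derive s 1 f 0) ->
  f s @[s --> 0^'+] --> l -> f t = l.
Proof.
move=> t0 Df fl; apply/eqP; rewrite eq_le; apply/andP; split.
  rewrite -subr_le0; apply: (@le0_of_derive_le0 R (fun s => f s - l) (fun=> 0) t t0) => //.
    by move=> s s0; have D := Df s s0; isd_tac; ring.
  by rewrite -[X in _ --> X](subrr l); apply: cvgB => //; exact: cvg_cst.
rewrite -subr_le0; apply: (@le0_of_derive_le0 R (fun s => l - f s) (fun=> 0) t t0) => //.
  by move=> s s0; have D := Df s s0; isd_tac; ring.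
by rewrite -[X in _ --> X](subrr l); apply: cvgB => //; exact: cvg_cst.
Qed.

Variable m : nat.
Hypothesis m_gt0 : (0 < m)%N.
Local Notation n := (2 * m).+1.
Local Notation M := (sphere R n).
Local Notation e0 := (delta_mx 0 0 : 'rV[R]_n).
Local Notation W r := (sn r ^+ (2 * m) * hh r).
Local Notation P q := ((chebT R q)^`(m)).
Local Notation eig q := (q%:R ^+ 2 - m%:R ^+ 2 : R).
Variable q : R -> 'rV[R]_(1 + n) -> R.
Hypothesis fq : fundamental_solution M (base_point R n) q.
Hypothesis rq : forall b t (x : 'rV[R]_n),
  q t (stereographic_chart b x) = q t (stereographic_chart b (nrm x *: e0)).

Let uf b t (x : 'rV[R]_n) : R := q t (stereographic_chart b x).
Let U b t r : R := prof (uf b) t r.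
Let dens (s : R) := (2 / (1 + s)) ^+ n.
Let dg (s : R) := dens s * ((1 + s) ^+ 2 / 4).
Let ddg (s : R) := n%:R * (2 / (1 + s)) ^+ (2 * m) * - (2 / (1 + s) ^+ 2) * ((1 + s) ^+ 2 / 4) +
  dens s * ((1 + s) / 2).

Let uC12 b : C12 (uf b). Proof. by have [_ c _ _] := fq; exact: c. Qed.

Let cU b t : 0 < t -> continuous (U b t).
Proof. by move=> t0; exact: (@prof_continuous R m _ (uC12 b) t t0). Qed.

Let cWn : continuous (fun r => r ^+ (2 * m) * dens (r ^+ 2)).
Proof.
rewrite (_ : (fun _ => _) = fun r => W r); first exact: continuous_sphere_weight.
by apply/funext => r; rewrite sphere_weight.
Qed.

Let cGn : continuous (fun r => r ^+ (2 * m) * dg (r ^+ 2)).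
Proof.
move=> r; have c := cWn.
change {for r, continuous (fun r => r ^+ (2 * m) * (dens (r ^+ 2) * ((1 + r ^+ 2) ^+ 2 / 4)))}.
rewrite (_ : (fun _ => _) = fun r => (r ^+ (2 * m) * dens (r ^+ 2)) * ((1 + r ^+ 2) ^+ 2 / 4)).
  by cont_tac.
by apply/funext => y; ring.
Qed.

(* The sign [e] selects the chart: the height is [e * cs r]. *)
Section green.
Variables (b : bool) (p : {poly R}) (lam : R).
Hypothesis pE : forall c, (1 - c ^+ 2) * p^`()^`().[c] - n%:R * c * p^`().[c] = - lam * p.[c].
Local Notation e := ((-1) ^+ b : R).

Let F r := p.[e * cs r].
Let F1 r := p^`().[e * cs r] * (e * - (sn r * hh r)).

Let cF (k : {poly R}) : continuous (fun r => k.[e * cs r]).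
Proof.
move=> r; change {for r, continuous (fun r => k.[e * cs r])}.
apply: (cont_comp (h := horner k)); last exact: continuous_horner_poly.
by have c := @continuous_cs R; cont_tac.
Qed.

Let cF1 : continuous F1.
Proof.
have c0 := @cF p^`(); have c1 := @continuous_sn R; have c2 := @continuous_hh R.
by move=> r; rewrite /F1; cont_tac.
Qed.

Let DF (k : {poly R}) r : is_derive r 1 (fun r => k.[e * cs r]) (k^`().[e * cs r] * (e * - (sn r * hh r))).
Proof.
have D1 : is_derive r 1 (fun r => e * cs r) (e * - (sn r * hh r)).
  by have D := is_derive_cs r; isd_tac; ring.
exact: isd_comp D1 (is_derive_horner k _).
Qed.

Let e2 : e * e = 1. Proof. by rewrite -expr2 sqrr_sign. Qed.

Let DG r : 0 < r -> is_derive r 1 (fun r => r ^+ (2 * m) * dg (r ^+ 2) * F1 r)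
  (r ^+ (2 * m) * dens (r ^+ 2) * (- lam * F r)).
Proof.
move=> r0; have W_E : (fun r => r ^+ (2 * m) * dg (r ^+ 2) * F1 r) =
    fun r => - (e * sn r ^+ n * p^`().[e * cs r]).
  apply/funext => y; rewrite /dg /dens -/(hh y) /F1 /sn [(y * hh y) ^+ n]exprMn.
  have d0 : 1 + y ^+ 2 != 0 by rewrite gt_eqF// ltr_wpDr ?sqr_ge0.
  have h2 : hh y ^+ 2 * ((1 + y ^+ 2) ^+ 2 / 4) = 1 by rewrite /hh; field.
  rewrite [y ^+ n]exprS.
  transitivity (- (y * y ^+ (2 * m) * (hh y ^+ n) * p^`().[e * cs y] * e *
    (hh y ^+ 2 * ((1 + y ^+ 2) ^+ 2 / 4)))); first by ring.
  by rewrite h2; ring.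
rewrite W_E; have D1 := is_derive_sn r; have D2 := DF p^`() r.
isd_tac.
have -> : r ^+ (2 * m) * dens (r ^+ 2) = W r by rewrite sphere_weight.
rewrite /F -[- lam * _]pE [(e * cs r) ^+ 2]exprMn sqrr_sign mul1r -sqr_sn /= [sn r ^+ n]exprS.
set a := p^`()^`().[_]; set d := p^`().[_]; set z := sn r ^+ (2 * m).
transitivity (sn r ^+ 2 * z * hh r * a * (e * e) - e * d * (n%:R * z * (cs r * hh r))); first by ring.
rewrite e2; ring.
Qed.

(** Green's formula on one hemisphere. The boundary terms sit at the equator [r = 1], where the
    weight [dg] equals [1] and the height is [0]. *)
Lemma sphere_green t : 0 < t -> is_derive t 1 (fun t => integ 0 1 (fun r => W r * (U b t r * F r)))
  (- lam * integ 0 1 (fun r => W r * (U b t r * F r)) +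
   (prof1 (uf b) t 1 * p.[0] + U b t 1 * (e * p^`().[0]))).
Proof.
move=> t0; have WE (G : R -> R -> R) s : integ 0 1 (fun r => W r * G s r) =
    integ 0 1 (fun r => r ^+ (2 * m) * dens (r ^+ 2) * G s r).
  by apply: eq_integ => r _; rewrite sphere_weight.
rewrite (_ : (fun t => _) = fun t => integ 0 1 (fun r => r ^+ (2 * m) * dens (r ^+ 2) * (U b t r * F r))); last first.
  by apply/funext => s; exact: (WE (fun s r => U b s r * F r)).
have D := @is_derive_moment R m dens (uf b) (uC12 b) F (@cF p) cWn t 1 t0.
apply: isd_eq D _.
have cQ : continuous (fun r => - lam * F r) by have c := @cF p; move=> r; rewrite /F; cont_tac.
rewrite (@radial_green R m (1 + n) M b dens (fun s => (1 + s) ^+ 2 / 4) (cst 0) dg ddg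
  (@stereographic_density R n b) _ (@stereographic_inv R n b) _ _ (uf b) (uC12 b) _ (rq b)
  F F1 (fun r => - lam * F r) (@cF p) cF1 cQ cWn cGn (fun r _ => DF p r) DG t 1 m_gt0 t0 ler01).
- congr (_ + _).
    rewrite (WE (fun s r => U b s r * F r)) -integZ.
      by apply: eq_integ => r _; rewrite /U; ring.
    by have cu := @cU b t t0; have c := @cF p; move=> r; rewrite /F; cont_tac; exact: cWn.
  rewrite /F /F1 cs_1 mulr0 /dg /dens /sn /hh !expr1n.
  have -> : (1 + 1 : R) = 2 by ring.
  by rewrite divff// !expr1n /U; field.
- by move=> s s0; rewrite expf_neq0// mulf_neq0// invr_neq0// gt_eqF//; lra.
- by move=> s s0 /=; rewrite mul0r addr0.
- move=> s s0; have sn0 : 1 + s != 0 by rewrite gt_eqF//; lra.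
  rewrite /dg /dens; isd_tac; first exact: sn0.
  by rewrite /ddg /dens /=; field.
- by move=> t' x t'0; have [_ _ h _] := fq; exact: h.
Qed.

End green.

(** The integral of the heat kernel against [p] of the height, without the factor [polar_cst], split
    along the equator: in the second chart the height is [- cs r]. *)
Definition kmoment (p : {poly R}) t : R :=
  integ 0 1 (fun r => W r * (U false t r * p.[cs r])) + integ 0 1 (fun r => W r * (U true t r * p.[- cs r])).

Let U_inv t r : 0 < r -> U false t r = U true t r^-1.
Proof.
move=> r0; rewrite /U /prof /uf stereographic_chart_inv ?invr_gt0//.
by rewrite invrK.
Qed.

Lemma kmoment_volume p t : 0 < t ->
  volume_integral M (fun x => q t x * p.[x 0 0]) = polar_cst R m * kmoment p t.
Proof.
move=> t0; have c0 := @cU false t t0; have c1 := @cU true t t0.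
have d0 := @continuous_horner_cs R p; have d1 := @continuous_horner_csN R p.
have E0 : continuous (fun r => U false t r * p.[cs r]) by move=> r; cont_tac.
have E1 : continuous (fun r => U true t r * p.[- cs r]) by move=> r; cont_tac.
apply: (sphere_volume_radial E0 E1).
  by move=> x; rewrite stereographic_chart00 expr0 mul1r rq.
by move=> r r0; rewrite U_inv// cs_inv// opprK.
Qed.

(** The sphere being compact, every polynomial in the height is a test function; the base point has
    height [1]. *)
Lemma kmoment_init p : kmoment p t @[t --> 0^'+] --> p.[1] / polar_cst R m.
Proof.
have w0 := polar_cst_gt0 R m.
have tf : test_function M (fun x => p.[x 0 0]).
  split.
    apply: continuous_subspaceT => z; change {for z, continuous (fun x : 'rV[R]_(1 + n) => p.[x 0 0])}.
    apply: (cont_comp (h := horner p)); first exact: coord_continuous.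
    exact: continuous_horner_poly.
  exists (carrier M); split=> //; exact: sphere_compact.
have [_ _ _ /(_ _ tf)] := fq; rewrite base_point00 => c.
have {}c : volume_integral M (fun x => q t x * p.[x 0 0]) / polar_cst R m @[t --> 0^'+] -->
    p.[1] / polar_cst R m by apply: cvgM => //; exact: cvg_cst.
apply: cvg_trans c; apply: near_eq_cvg; near=> t.
have t0 : 0 < t by near: t; exact: nbhs_right_gt.
by rewrite kmoment_volume// mulrC mulKf// gt_eqF.
Unshelve. all: by end_near. Qed.

Let D_inv (u v : R -> R) (du dv : R) : (forall r, 0 < r -> u r = v r^-1) ->
  is_derive (1 : R) 1 u du -> is_derive (1 : R) 1 v dv -> du = - dv.
Proof.
move=> uv Du Dv.
have Dv' : is_derive (1^-1 : R) 1 v dv by rewrite invr1.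
have D := isd_comp (isdV (oner_neq0 R) (isd_id (1 : R))) Dv'.
have E : \forall r \near (1 : R), u r = v r^-1.
  by near=> r; apply: uv; near: r; apply: lt_nbhsr.
by rewrite (near_is_derive_eq E Du D) expr1n divr1 mulrN1.
Unshelve. all: by end_near. Qed.

(** The eigenvalue equation turns the moment into a solution of a linear differential equation in
    time, so its product with [exp (eig * t)] is constant and equals its initial limit. *)
Lemma kmoment_cheb k t : 0 < t ->
  kmoment (P k) t = expR (- (eig k * t)) * (P k).[1] / polar_cst R m.
Proof.
move=> t0; have pE c : (1 - c ^+ 2) * (P k)^`()^`().[c] - n%:R * c * (P k)^`().[c] = - eig k * (P k).[c].
  have := cheb_odeE k m c; rewrite -natrM natr1 -!derivnS => E.
  by apply/eqP; rewrite -subr_eq0; apply/eqP; rewrite -[RHS]E; ring.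
have D (s : R) : 0 < s -> is_derive s 1 (kmoment (P k)) (- eig k * kmoment (P k) s).
  move=> s0; have D0 := sphere_green false pE s0; have D1 := sphere_green true pE s0.
  have EN (f : R -> R) : (fun r => W r * (f r * (P k).[(-1) ^+ true * cs r])) =
      (fun r => W r * (f r * (P k).[- cs r])) by apply/funext => r; rewrite expr1 mulN1r.
  have EP (f : R -> R) : (fun r => W r * (f r * (P k).[(-1) ^+ false * cs r])) =
      (fun r => W r * (f r * (P k).[cs r])) by apply/funext => r; rewrite expr0 mul1r.
  have KE : kmoment (P k) = fun t => integ 0 1 (fun r => W r * (U false t r * (P k).[(-1) ^+ false * cs r])) +
      integ 0 1 (fun r => W r * (U true t r * (P k).[(-1) ^+ true * cs r])).
    by apply/funext => t'; rewrite (EN (U true t')) (EP (U false t')).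
  rewrite KE; apply: isd_eq (isdD D0 D1) _.
  (* At the equator the two profiles agree and, as [r -> 1/r] has derivative [-1] at [1], their
     slopes are opposite: the boundary terms of the hemispheres cancel. *)
  have U1 : U false s 1 = U true s 1 by rewrite U_inv// invr1.
  have U2 : prof1 (uf false) s 1 = - prof1 (uf true) s 1.
    by apply: (D_inv (@U_inv s)); exact: is_derive_prof.
  by rewrite U1 U2 expr0 expr1; ring.
have E : kmoment (P k) t * expR (eig k * t) = (P k).[1] / polar_cst R m.
  apply: (@eq_of_derive0 (fun t => kmoment (P k) t * expR (eig k * t))) => //.
    by move=> s s0; have D0 := D s s0; isd_tac; ring.
  rewrite -[X in _ --> X]mulr1; apply: cvgM; first exact: kmoment_init.
  have c : {for (0 : R), continuous (fun t => expR (eig k * t))} by cont_tac.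
  by have := cvg_at_right_filter c; rewrite mulr0 expR0.
by rewrite -mulrA -E expRN; field; rewrite gt_eqF ?expR_gt0.
Qed.

End SphereKernel.

Section GaussianSums.
Context (R : realType).

Lemma expRN_le_pow j (x : R) : 0 < x -> expR (- x) <= j`!%:R / x ^+ j.
Proof.
move=> x0; rewrite expRN -[leRHS]invrK lef_pV2 ?posrE ?expR_gt0 ?invr_gt0 ?divr_gt0 ?exprn_gt0 ?ltr0n ?fact_gt0//.
by rewrite invf_div expR_ge_pow// ltW.
Qed.

Lemma sum_inv_sqr_le N : \sum_(k < N.+1) (k.+1%:R ^+ 2)^-1 <= 2 - N.+1%:R^-1 :> R.
Proof.
elim: N => [|N IH]; first by rewrite big_ord1 expr1n invr1; lra.
rewrite big_ord_recr/=; apply: (le_trans (lerD IH (lexx _))).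
have n0 : 0 < N.+1%:R :> R by rewrite ltr0n.
rewrite -[N.+2%:R]natr1; set y := N.+1%:R in n0 *.
have y1 : 0 < y + 1 by lra.
rewrite -subr_ge0.
have -> : 2 - (y + 1)^-1 - (2 - y^-1 + ((y + 1) ^+ 2)^-1) = (y * (y + 1) ^+ 2)^-1.
  by field; rewrite !gt_eqF.
by rewrite invr_ge0 mulr_ge0 ?sqr_ge0// ltW.
Qed.

(** [exp (- x) <= (p + 1)! / x^(p + 1)] bounds the terms with positive index by a multiple of
    [k^(-2)]. *)
Lemma sum_gauss_bounded p (t : R) : 0 < t -> exists L : R, forall N,
  \sum_(k < N) k%:R ^+ (2 * p) * expR (- (k%:R ^+ 2 * t)) <= L.
Proof.
move=> t0; pose C : R := p.+1`!%:R / t ^+ p.+1.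
have C0 : 0 <= C by rewrite divr_ge0 ?exprn_ge0// ltW.
exists (1 + C * 2) => -[|N]; first by rewrite big_ord0 addr_ge0// mulr_ge0.
rewrite big_ord_recl; apply: lerD.
  rewrite -[leRHS]mulr1 ler_pM ?exprn_ge0 ?expR_ge0//; first by rewrite exprn_ile1.
  by rewrite -[leRHS](@expR0 R) ler_expR oppr_le0 mulr_ge0 ?sqr_ge0// ltW.
apply: (@le_trans _ _ (\sum_(k < N) C * (k.+1%:R ^+ 2)^-1)).
  apply: ler_sum => k _ /=; rewrite /bump leq0n add1n.
  have k0 : 0 < k.+1%:R :> R by rewrite ltr0n.
  have k2 : 0 < k.+1%:R ^+ 2 * t by rewrite mulr_gt0 ?exprn_gt0.
  apply: (@le_trans _ _ (k.+1%:R ^+ (2 * p) * (p.+1`!%:R / (k.+1%:R ^+ 2 * t) ^+ p.+1))).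
    by rewrite ler_pM2l ?exprn_gt0// expRN_le_pow.
  rewrite le_eqVlt; apply/orP; left; apply/eqP; rewrite /C exprMn [(_ ^+ 2) ^+ p.+1]exprSr -exprM.
  have a0 : k.+1%:R ^+ (2 * p) != 0 :> R by rewrite expf_neq0// gt_eqF.
  have b0 : k.+1%:R ^+ 2 != 0 :> R by rewrite expf_neq0// gt_eqF.
  have c0 : t ^+ p.+1 != 0 by rewrite expf_neq0// gt_eqF.
  move: (k.+1%:R ^+ (2 * p)) a0 (k.+1%:R ^+ 2) b0 (t ^+ p.+1) c0 => a a0 b b0 c c0.
  by field; rewrite a0 b0 c0.
rewrite -mulr_sumr ler_wpM2l//; case: N => [|N]; first by rewrite big_ord0.
by rewrite (le_trans (sum_inv_sqr_le N))// gerBl invr_ge0.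
Qed.

End GaussianSums.

(** * Recovery of the diagonal value from the moments *)

Section SphereDensity.
Context (R : realType).
Implicit Types (p : {poly R}) (r c t : R).
Local Notation nrm x := (Num.sqrt (sqnorm x)).

Variable m : nat.
Hypothesis m_gt0 : (0 < m)%N.
Local Notation n := (2 * m).+1.
Local Notation M := (sphere R n).
Local Notation e0 := (delta_mx 0 0 : 'rV[R]_n).
Local Notation W r := (sn r ^+ (2 * m) * hh r).
Local Notation P q := ((chebT R q)^`(m)).
Local Notation eig q := (q%:R ^+ 2 - m%:R ^+ 2 : R).
Variable q : R -> 'rV[R]_(1 + n) -> R.
Hypothesis fq : fundamental_solution M (base_point R n) q.
Hypothesis rq : forall b t (x : 'rV[R]_n),
  q t (stereographic_chart b x) = q t (stereographic_chart b (nrm x *: e0)).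
Variable t : R.
Hypothesis t0 : 0 < t.

Let U b r : R := prof (fun t (x : 'rV[R]_n) => q t (stereographic_chart b x)) t r.

Let cU b : continuous (U b).
Proof. by have [_ c _ _] := fq; exact: (@prof_continuous R m _ (c b) t t0). Qed.

Let kmomentE p : kmoment q p t =
  integ 0 1 (fun r => W r * (U false r * p.[cs r] + U true r * p.[- cs r])).
Proof.
have c0 := @cU false; have c1 := @cU true; have cW := @continuous_sphere_weight R m.
have d0 := @continuous_horner_cs R p; have d1 := @continuous_horner_csN R p.
rewrite /kmoment -integD; [|by move=> r; cont_tac|by move=> r; cont_tac].
by apply: eq_integ => r _; rewrite -mulrDr.
Qed.

Let cK p : continuous (fun r => W r * (U false r * p.[cs r] + U true r * p.[- cs r])).
Proof.
have c0 := @cU false; have c1 := @cU true; have cW := @continuous_sphere_weight R m.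
have d0 := @continuous_horner_cs R p; have d1 := @continuous_horner_csN R p.
by move=> r; cont_tac.
Qed.

Let kmoment_lin a p p' : kmoment q (a%:P * p + p') t = a * kmoment q p t + kmoment q p' t.
Proof.
rewrite !kmomentE -integZ; last exact: cK.
rewrite -integD; last exact: cK.
  by apply: eq_integ => r _; rewrite !hornerD !hornerM !hornerC; ring.
by have c := @cK p; move=> r; cont_tac.
Qed.

Let ker N : {poly R} := (1 + 'X) ^+ N.
Let U0 : R := U false 0.

(** [(1 + X)^N] is an approximate identity at the pole: the kernel differs from its value [U0] by at
    most [e + C (1 - height)], whose mean is given by [sph_kernel]. *)
Let kernel_near e : 0 < e -> exists2 C : R, 0 <= C & forall N,
  `|kmoment q (ker N) t - U0 * sph m (ker N)| <=
  (e + C * ((2 * m%:R + 1) / (N%:R + 2 * m%:R + 1))) * sph m (ker N).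
Proof.
move=> e_gt0.
have [B0 B00 hB0] := continuous_bounded 0 1 (@cU false).
have [B1 B10 hB1] := continuous_bounded 0 1 (@cU true).
have [d d0 hd] : exists2 d : R, 0 < d & forall r, `|r| < d -> `|U false r - U0| <= e.
  have /cvgrPdist_le /(_ e e_gt0) := @cU false 0.
  move=> /nbhs_ballP[d /= d0 hd]; exists d => // r rd; rewrite distrC; apply: hd.
  by rewrite /ball /= sub0r normrN.
have U0B : `|U0| <= B0 by apply: hB0; rewrite lexx ler01.
have d20 : 0 < d ^+ 2 by rewrite exprn_gt0.
(* On the near hemisphere [1 - cs r >= r^2 >= d^2] once [r >= d], with oscillation at most [2 B0];
   on the far one [1 - height = 1 + cs r >= 1], with oscillation at most [B1 + B0]. *)
pose C := (2 * B0) / d ^+ 2 + (B1 + B0).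
have C0 : 0 <= C by rewrite addr_ge0 ?divr_ge0 ?addr_ge0 ?mulr_ge0// ltW.
have est0 r : 0 <= r <= 1 -> `|U false r - U0| <= e + C * (1 - cs r).
  move=> /andP[r0 r1]; have c1 := cs_le1 r.
  have [rd|dr] := ltP r d.
    by rewrite (le_trans (hd r _)) ?ger0_norm// lerDl mulr_ge0// subr_ge0.
  apply: (@le_trans _ _ (2 * B0)).
    rewrite (le_trans (ler_normB _ _))// mulr_natl mulr2n lerD//.
    by apply: hB0; rewrite r0.
  apply: (@le_trans _ _ ((2 * B0) / d ^+ 2 * (1 - cs r))).
    rewrite -mulrA ler_peMr ?mulr_ge0// mulrC ler_pdivlMr// mul1r.
    apply: (@le_trans _ _ (r ^+ 2)); first by rewrite ler_pXn2r ?nnegrE ?(ltW d0).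
    have r2 : r ^+ 2 <= 1 by rewrite expr_le1.
    have p0 := sqr_ge0 r.
    rewrite /cs lerBrDr addrC -lerBrDr ler_pdivrMr; last by lra.
    by rewrite -subr_ge0 (_ : _ - _ = r ^+ 2 * (1 - r ^+ 2)) ?mulr_ge0 ?subr_ge0//; ring.
  have -> : e + C * (1 - cs r) = (2 * B0) / d ^+ 2 * (1 - cs r) + (e + (B1 + B0) * (1 - cs r)) by rewrite /C; ring.
  rewrite lerDl; apply: addr_ge0; first exact: ltW.
  by apply: mulr_ge0; [exact: addr_ge0|rewrite subr_ge0].
have est1 r : 0 <= r <= 1 -> `|U true r - U0| <= e + C * (1 + cs r).
  move=> r01; have c0 := cs_ge0 r01.
  apply: (@le_trans _ _ (B1 + B0)); first by rewrite (le_trans (ler_normB _ _))// lerD// hB1.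
  apply: (@le_trans _ _ C); first by rewrite lerDr divr_ge0 ?mulr_ge0// ltW.
  by apply: (@le_trans _ _ (C * (1 + cs r))); [rewrite ler_peMr// lerDl|rewrite lerDr ltW].
exists C => // N.
have -> : (e + C * ((2 * m%:R + 1) / (N%:R + 2 * m%:R + 1))) * sph m (ker N) =
    sph m (e%:P * ker N + C%:P * ((1 - 'X) * ker N)).
  by rewrite sphD !sphZ sph_kernel -/(ker N); ring.
have cD := @cK (ker N); have cS := @continuous_sph R m (ker N).
rewrite kmomentE /sph -integZ// -integB//; last by move=> r; cont_tac.
have cF : continuous (fun r => W r * (U false r * (ker N).[cs r] + U true r * (ker N).[- cs r]) -
    U0 * (W r * ((ker N).[cs r] + (ker N).[- cs r]))) by move=> r; cont_tac.
apply: (le_trans (le_norm_integ _ _ cF)); apply: le_integ.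
- by move=> r; cont_tac.
- exact: continuous_sph.
move=> r r01; have c0 := cs_ge0 r01; have c1 := cs_le1 r.
have W0 : 0 <= W r.
  by case/andP: r01 => r0 _; rewrite mulr_ge0 ?exprn_ge0 ?sn_ge0// ltW// hh_gt0.
have k0 : 0 <= (ker N).[cs r] by rewrite /ker !hornerE exprn_ge0//; lra.
have k1 : 0 <= (ker N).[- cs r] by rewrite /ker !hornerE exprn_ge0//; lra.
rewrite (_ : _ - _ = W r * ((U false r - U0) * (ker N).[cs r] + (U true r - U0) * (ker N).[- cs r])); last by ring.
rewrite normrM (ger0_norm W0) ler_wpM2l//.
rewrite !(hornerD, hornerM, hornerC, hornerN, hornerX).
rewrite (le_trans (ler_normD _ _))// !normrM (ger0_norm k0) (ger0_norm k1).
have -> : e * (ker N).[cs r] + C * ((1 - cs r) * (ker N).[cs r]) = (e + C * (1 - cs r)) * (ker N).[cs r] by ring.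
have -> : e * (ker N).[- cs r] + C * ((1 - - cs r) * (ker N).[- cs r]) =
  (e + C * (1 + cs r)) * (ker N).[- cs r] by ring.
by rewrite lerD// ler_wpM2r// ?est0 ?est1.
Qed.

Let norm_gt0 k : 0 < sph m (P (m + k) * P (m + k)).
Proof.
rewrite sph_cheb_norm ?addn_gt0 ?m_gt0// mulr_gt0 ?divr_gt0 ?sph01 ?pi_gt0//.
apply: prodr_gt0 => j _; rewrite subr_gt0 ltrXn2r// ltr_nat.
by apply: leq_trans (ltn_ord j) _; exact: leq_addr.
Qed.

(** The coefficient, on the orthogonal family [P], of the kernel multiplied by [polar_cst]. The
    indices start at [m] because an [m]-th derivative kills the [T q] of lower degree. *)
Let co k : R := expR (- (eig (m + k)%N * t)) * (P (m + k)).[1] / sph m (P (m + k) * P (m + k)).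

Let part N : {poly R} := \sum_(k < N.+1) (co k)%:P * P (m + k).

Let sph_part N k : (k <= N)%N -> sph m (part N * P (m + k)) = expR (- (eig (m + k)%N * t)) * (P (m + k)).[1].
Proof.
move=> kN; rewrite /part mulr_suml sph_sum (bigD1 (Ordinal (kN : (k < N.+1)%N)))//= big1 ?addr0.
  by rewrite -mulrA sphZ /= /co divfK// gt_eqF.
move=> j jk; rewrite -mulrA sphZ sph_cheb_orth ?mulr0// => /eqP; rewrite eqn_add2l.
by apply/negP; move: jk; rewrite -val_eqE.
Qed.

(** [P m, P (m + 1), ...] have degrees [0, 1, ...]; subtracting the leading term one degree at a
    time reduces the claim to these polynomials, where it is orthogonality. *)
Let part_span N d p : (d <= N.+1)%N -> (size p <= d)%N ->
  polar_cst R m * kmoment q p t = sph m (part N * p).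
Proof.
elim: d p => [|d IH] p dN sp.
  have -> : p = 0 by apply/eqP; rewrite -size_poly_eq0 -leqn0.
  have -> : kmoment q 0 t = 0.
    have := kmoment_lin (-1) 0 0; rewrite mulr0 add0r => E; lra.
  by rewrite !mulr0 sph0.
have [sP lP] := cheb_derivn_size R (leq_addr d m); rewrite addKn in sP lP.
pose a := p`_d / (P (m + d))`_d.
have -> : p = a%:P * P (m + d) + (p - a%:P * P (m + d)) by rewrite addrC subrK.
rewrite kmoment_lin [in LHS]mulrDr [part N * _]mulrDr sphD IH ?(ltnW dN)//.
  congr (_ + _); rewrite mulrCA [part N * _]mulrCA sphZ sph_part// kmoment_cheb//.
  by congr (_ * _); rewrite mulrC divfK// gt_eqF// polar_cst_gt0.
apply/leq_sizeP => j; rewrite leq_eqVlt => /predU1P[<-|dj]; rewrite coefB coefCM.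
  by rewrite /a divfK ?subrr// gt_eqF.
by rewrite !nth_default ?mulr0 ?subr0// (leq_trans _ dj).
Qed.

(** The coefficients are nonnegative and each [P] lies in the Chebyshev cone, so the constant is the
    sum of [co k] times the derivative of [P (m + k)] at [1]; these terms are dominated by a
    convergent Gaussian series independent of [N]. *)
Let part_lip : exists2 L : R, 0 <= L & forall N c, -1 <= c <= 1 ->
  `|(part N).[c] - (part N).[1]| <= L * (1 - c).
Proof.
have co_ge0 k : 0 <= co k.
  rewrite divr_ge0 ?(ltW (norm_gt0 k))// mulr_ge0 ?expR_ge0//.
  have := cheb_cone_le (cheb_cone_derivn R (m + k) m) (c := 1); rewrite normr1 => /(_ (lexx _)).
  exact: le_trans.
have [L HL] := sum_gauss_bounded m.+1 t0.
(* All factors of [co k] times that derivative that do not depend on [j = m + k]; the rest is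
   [(j^2 - m^2)] times the product of the [j^2 - i^2], at most [j^(2 m + 2)]. *)
pose A : R := expR (m%:R ^+ 2 * t) / ((2 * m%:R + 1) * (\prod_(j < m) (2 * j%:R + 1)) ^+ 2 * (pi / 2)).
have A0 : 0 <= A.
  apply: divr_ge0; first exact: expR_ge0.
  apply: mulr_ge0; last by rewrite divr_ge0 ?pi_ge0.
  by apply: mulr_ge0; [rewrite addr_ge0 ?mulr_ge0|exact: sqr_ge0].
have term k : co k * ((P (m + k))^`()).[1] <= A * ((m + k)%:R ^+ (2 * m.+1) * expR (- ((m + k)%:R ^+ 2 * t))).
  set j := (m + k)%N; have mj : (m <= j)%N by exact: leq_addr.
  have prod0 : 0 < \prod_(i < m) (j%:R ^+ 2 - i%:R ^+ 2) :> R.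
    apply: prodr_gt0 => i _; rewrite subr_gt0 ltrXn2r// ltr_nat.
    exact: leq_trans (ltn_ord i) mj.
  have o0 : 0 < \prod_(i < m) (2 * i%:R + 1) :> R by apply: prodr_gt0 => i _; rewrite -natrM natr1.
  rewrite /co -/j -derivnS cheb_derivn_1S cheb_derivn_1 sph_cheb_norm; last first.
    by apply: leq_trans mj.
  rewrite sph01 /A; set X := \prod_(i < m) (j%:R ^+ 2 - _) in prod0 *; set Y := \prod_(_ < m) _ in o0 *.
  have -> : expR (- ((j%:R ^+ 2 - m%:R ^+ 2) * t)) = expR (m%:R ^+ 2 * t) * expR (- (j%:R ^+ 2 * t)).
    by rewrite -expRD; congr expR; ring.
  have q0 : 0 < 2 * m%:R + 1 :> R by rewrite -natrM natr1.
  have p0 := pi_gt0 R.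
  set E1 := expR _; set E2 := expR (- _).
  have -> : E1 * E2 * (X / Y) / (X * (pi / 2)) * ((j%:R ^+ 2 - m%:R ^+ 2) / (2 * m%:R + 1) * (X / Y)) =
    E1 / ((2 * m%:R + 1) * Y ^+ 2 * (pi / 2)) * (((j%:R ^+ 2 - m%:R ^+ 2) * X) * E2).
    by move: (@pi R) p0 => pp p0; field; rewrite !gt_eqF.
  rewrite ler_wpM2l// ler_wpM2r ?expR_ge0//.
  have j20 : 0 <= j%:R ^+ 2 :> R by exact: sqr_ge0.
  rewrite exprM [(_ ^+ 2) ^+ m.+1]exprS; apply: ler_pM.
  - by rewrite subr_ge0 ler_pXn2r ?nnegrE// ler_nat.
  - exact: ltW.
  - by rewrite gerBl sqr_ge0.
  - have -> : (j%:R ^+ 2) ^+ m = \prod_(i < m) (j%:R ^+ 2) :> R by rewrite prodr_const card_ord.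
    apply: ler_prod => i _; rewrite gerBl sqr_ge0 andbT subr_ge0 ler_pXn2r ?nnegrE// ler_nat.
    by apply: leq_trans mj; exact/ltnW/ltn_ord.
have L0 : 0 <= L by have := HL 0%N; rewrite big_ord0.
exists (A * L); first exact: mulr_ge0.
move=> N c c01; have c1 : 0 <= 1 - c by case/andP: c01 => _; rewrite subr_ge0.
rewrite /part !horner_sum -sumrB.
apply: (le_trans (ler_norm_sum _ _ _)).
apply: (@le_trans _ _ (\sum_(k < N.+1) A * ((m + k)%:R ^+ (2 * m.+1) * expR (- ((m + k)%:R ^+ 2 * t))) * (1 - c))).
  apply: ler_sum => k _; rewrite !hornerM !hornerC -mulrBr normrM (ger0_norm (co_ge0 k)).
  apply: (@le_trans _ _ (co k * ((P (m + k))^`()).[1] * (1 - c))); last by rewrite ler_wpM2r.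
  by rewrite -mulrA ler_wpM2l// cheb_cone_lip//; exact: cheb_cone_derivn.
rewrite -mulr_suml ler_wpM2r// -mulr_sumr ler_wpM2l//.
apply: le_trans (HL (m + N.+1)%N); rewrite big_split_ord /= lerDr sumr_ge0//.
Qed.

(** The moment against [(1 + X)^N] is evaluated twice: it is close to the kernel at the pole by
    [kernel_near], and to [part N] at [1] by [part_lip], because a polynomial of degree [N] does not
    distinguish the kernel from [part N]. *)
Lemma sphere_density : (part N).[1] @[N --> \oo] --> polar_cst R m * q t (base_point R n).
Proof.
have U0E : U0 = q t (base_point R n) by rewrite /U0 /U /prof scale0r stereographic_chart0.
rewrite -U0E; have w0 := polar_cst_gt0 R m; set w := polar_cst R m in w0 *.
have [L L0 HL] := part_lip.
pose rat N : R := (2 * m%:R + 1) / (N%:R + 2 * m%:R + 1).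
have rat0 : rat N @[N --> \oo] --> (0 : R).
  rewrite -(mulr0 (2 * m%:R + 1)); apply: cvgM; first exact: cvg_cst.
  apply: (@squeeze_cvgr _ _ _ _ (fun=> 0) (fun N => N.+1%:R^-1)); [|exact: cvg_cst|exact: cvg_harmonic].
  near=> N; have N0 : 0 < N.+1%:R :> R by rewrite ltr0n.
  have m0 : 0 <= 2 * m%:R :> R by rewrite mulr_ge0.
  rewrite invr_ge0 lef_pV2 ?posrE; rewrite -natr1 in N0 *; [|lra|lra].
  by apply/andP; split; lra.
apply/cvgrPdist_lt => e e_gt0.
pose e1 := e / (2 * w); have e10 : 0 < e1 by rewrite divr_gt0// mulr_gt0.
have [C C0 HC] := kernel_near e10.
have key N : `|w * U0 - (part N).[1]| <= w * (e1 + C * rat N) + L * rat N.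
  have Z0 := sph_kernel_gt0 R m N; set Z := sph m _ in Z0.
  have E1 : w * kmoment q (ker N) t = sph m (part N * ker N).
    apply: (@part_span N N.+1) => //.
    have -> : ker N = (1%:P + 'X) ^+ N by [].
    have s2 : size (1%:P + 'X : {poly R}) = 2%N by rewrite addrC size_XaddC.
    by rewrite size_exp_leq_ // || (apply: (leq_trans (size_poly_exp_leq _ _)); rewrite s2 mul1n).
  have E2 : `|sph m (part N * ker N) - (part N).[1] * Z| <= L * rat N * Z.
    have -> : sph m (part N * ker N) - (part N).[1] * Z = sph m (part N * ker N - (part N).[1]%:P * ker N).
      by rewrite sphB sphZ.
    have -> : L * rat N * Z = sph m (L%:P * ((1 - 'X) * ker N)) by rewrite sphZ sph_kernel -/Z /rat; ring.
    apply: le_norm_sph => c c01.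
    have k0 : 0 <= (ker N).[c] by case/andP: c01 => c1 c2; rewrite /ker !hornerE exprn_ge0//; lra.
    rewrite !(hornerD, hornerM, hornerN, hornerC, hornerX) -/(ker N) -mulrBl normrM (ger0_norm k0) mulrA.
    by rewrite ler_wpM2r// HL.
  have E3 := HC N; rewrite -/(rat N) -/Z in E3.
  rewrite -(ler_pM2r Z0).
  rewrite -[X in _ * X <= _](gtr0_norm Z0) -normrM.
  have -> : (w * U0 - (part N).[1]) * Z = (sph m (part N * ker N) - (part N).[1] * Z) -
     w * (kmoment q (ker N) t - U0 * Z) by rewrite -E1; ring.
  rewrite (le_trans (ler_normB _ _))// addrC [leRHS]mulrDl lerD// normrM (gtr0_norm w0).
  by rewrite -[leRHS]mulrA ler_pM2l.
have lim : w * (e1 + C * rat N) + L * rat N @[N --> \oo] --> w * (e1 + C * 0) + L * 0.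
  apply: cvgD; apply: cvgM; [exact: cvg_cst|apply: cvgD; first exact: cvg_cst|exact: cvg_cst|exact: rat0].
  by apply: cvgM; [exact: cvg_cst|exact: rat0].
have le : w * (e1 + C * 0) + L * 0 < e.
  rewrite !mulr0 !addr0 (_ : w * e1 = e / 2); first by lra.
  by rewrite /e1; field; rewrite gt_eqF.
near=> N; apply: (le_lt_trans (key N)); near: N; exact: cvgr_lt lim _ le.
Unshelve. all: by end_near. Qed.

Lemma sphere_kernel_series :
  \sum_(k < N.+1) (expR (- (eig (m + k)%N * t)) * (\prod_(j < m) ((m + k)%:R ^+ 2 - j%:R ^+ 2)) /
    ((\prod_(j < m) (2 * j%:R + 1)) ^+ 2 * (pi / 2))) @[N --> \oo] -->
  polar_cst R m * q t (base_point R n).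
Proof.
apply: cvg_trans sphere_density; apply: near_eq_cvg; near=> N.
rewrite /part horner_sum; apply: eq_bigr => k _; rewrite hornerM hornerC /co.
have prod0 : 0 < \prod_(i < m) ((m + k)%:R ^+ 2 - i%:R ^+ 2) :> R.
  apply: prodr_gt0 => i _; rewrite subr_gt0 ltrXn2r// ltr_nat.
  by apply: (leq_trans (ltn_ord i)); exact: leq_addr.
have o0 : 0 < \prod_(i < m) (2 * i%:R + 1) :> R by apply: prodr_gt0 => i _; rewrite -natrM natr1.
rewrite cheb_derivn_1 sph_cheb_norm ?addn_gt0 ?m_gt0// sph01.
have p0 := pi_gt0 R.
set X := \prod_(i < m) ((m + k)%:R ^+ 2 - _) in prod0 *; set Y := \prod_(_ < m) _ in o0 *.
by move: (@pi R) p0 => pp p0; field; rewrite !gt_eqF.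
Unshelve. all: by end_near. Qed.

End SphereDensity.

(** * Lattice sums of Gaussians *)

Section Theta.
Context (R : realType).
Implicit Types (f F : R -> R) (h a x t : R) (H : {poly R}).

(** The Riemann sum of mesh [h] over the translated points [a + h q], [-M <= q < M]; the second sum
    holds the negative [q]. *)
Definition lattice_sum f h M a : R :=
  h * (\sum_(q < M) f (h * q%:R + a) + \sum_(q < M) f (a - h * q.+1%:R)).

Lemma lattice_sum_tele F h M :
  lattice_sum F h M h - lattice_sum F h M 0 = h * (F (h * M%:R) - F (- (h * M%:R))).
Proof.
rewrite /lattice_sum -mulrBr; congr (_ * _).
elim: M => [|M IH]; first by rewrite !big_ord0 mulr0 oppr0; ring.
rewrite !big_ord_recr/=.
have -> : h * M%:R + h = h * M.+1%:R by rewrite -natr1; ring.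
have -> : h - h * M.+1%:R = - (h * M%:R) by rewrite -natr1; ring.
rewrite [h * M%:R + 0]addr0 [0 - h * M.+1%:R]sub0r.
move: IH; set A := \sum_(_ < M) _; set B := \sum_(_ < M) _; set C := \sum_(_ < M) _; set D := \sum_(_ < M) _.
move=> IH; transitivity ((A + B - (C + D)) + F (h * M.+1%:R) - F (h * M%:R) + F (- (h * M%:R)) - F (- (h * M.+1%:R))).
  by ring.
by rewrite IH; ring.
Qed.

Lemma is_derive_lattice_sum F f h M a : 0 < h -> 0 <= a <= h ->
  (forall x, `|x| <= h * M%:R -> is_derive x 1 F (f x)) ->
  is_derive a 1 (lattice_sum F h M) (lattice_sum f h M a).
Proof.
move=> h0 /andP[a0 ah] D; rewrite /lattice_sum.
have Dp (q : 'I_M) : is_derive a 1 (fun a => F (h * q%:R + a)) (f (h * q%:R + a)).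
  have D1 : is_derive a 1 (fun a => h * q%:R + a) 1 by isd_tac; ring.
  have D2 : is_derive (h * q%:R + a) 1 F (f (h * q%:R + a)).
    apply: D; rewrite ger0_norm ?addr_ge0 ?mulr_ge0 ?(ltW h0)//.
    apply: (@le_trans _ _ (h * q.+1%:R)); first by rewrite -natr1 mulrDr mulr1 lerD2l.
    by rewrite ler_pM2l// ler_nat.
  by apply: isd_eq (isd_comp D1 D2) _; rewrite mulr1.
have Dn (q : 'I_M) : is_derive a 1 (fun a => F (a - h * q.+1%:R)) (f (a - h * q.+1%:R)).
  have D1 : is_derive a 1 (fun a => a - h * q.+1%:R) 1 by isd_tac; ring.
  have D2 : is_derive (a - h * q.+1%:R) 1 F (f (a - h * q.+1%:R)).
    have qM : h * q.+1%:R <= h * M%:R by rewrite ler_pM2l// ler_nat.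
    have hq : h <= h * q.+1%:R by rewrite ler_peMr ?(ltW h0)// ler1n.
    apply: D; rewrite ler0_norm; lra.
  by apply: isd_eq (isd_comp D1 D2) _; rewrite mulr1.
have Ds1 := @isd_sum R _ (index_enum 'I_M) xpredT (fun q a => F (h * (q : nat)%:R + a)) _ a (fun q _ => Dp q).
have Ds2 := @isd_sum R _ (index_enum 'I_M) xpredT (fun q a => F (a - h * (q : nat).+1%:R)) _ a (fun q _ => Dn q).
by isd_tac; ring.
Qed.

(** Translating by a whole mesh telescopes, and differentiating in [a] replaces [F] by [f]. The mean
    value theorem thus finds a translate for which the Riemann sum of [f] is exactly its
    integral. *)
Lemma lattice_sum_mvt F f h M : 0 < h ->
  (forall x, `|x| <= h * M%:R -> is_derive x 1 F (f x)) ->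
  exists2 a, 0 <= a <= h & lattice_sum f h M a = F (h * M%:R) - F (- (h * M%:R)).
Proof.
move=> h0 D.
have DL a : 0 <= a <= h -> is_derive a 1 (lattice_sum F h M) (lattice_sum f h M a).
  by move=> ah; exact: is_derive_lattice_sum.
have [||a ah E] := @MVT_segment R (lattice_sum F h M) (lattice_sum f h M) 0 h (ltW h0).
- by move=> x; rewrite in_itv/= => /andP[x0 xh]; apply: DL; rewrite !ltW.
- apply: continuous_in_subspaceT => x; rewrite inE/= in_itv/= => xh.
  exact: (cont_isd (DL x xh)).
exists a; first by move: ah; rewrite in_itv.
have hn0 : h != 0 by rewrite gt_eqF.
apply: (mulfI hn0); rewrite -lattice_sum_tele E; ring.
Qed.

Lemma lattice_sum_lip F f h M K : 0 < h ->
  (forall x, is_derive (x : R) 1 F (f x)) ->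
  (forall a, 0 <= a <= h -> `|lattice_sum f h M a| <= K) ->
  forall a b, 0 <= a <= h -> 0 <= b <= h -> `|lattice_sum F h M a - lattice_sum F h M b| <= K * h.
Proof.
move=> h0 D HK a b; wlog ab : a b / b <= a.
  by move=> W ah bh; have [|ba] := leP b a; [move=> ?; exact: W|rewrite distrC; apply: W => //; exact: ltW].
move=> /andP[a0 ah] /andP[b0 bh].
have DL x : 0 <= x <= h -> is_derive x 1 (lattice_sum F h M) (lattice_sum f h M x).
  by move=> xh; exact: is_derive_lattice_sum.
have [||c] := @MVT_segment R (lattice_sum F h M) (lattice_sum f h M) b a ab.
- move=> x; rewrite in_itv/= => /andP[bx xa]; apply: DL.
  by rewrite (le_trans b0 (ltW bx)) (le_trans (ltW xa)).
- apply: continuous_in_subspaceT => x; rewrite inE/= in_itv/= => /andP[bx xa].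
  by apply: (cont_isd (DL x _)); rewrite (le_trans b0 bx) (le_trans xa).
rewrite in_itv/= => /andP[bc ca] ->; rewrite normrM (ger0_norm (_ : 0 <= a - b)) ?subr_ge0//.
apply: ler_pM; rewrite ?subr_ge0//; last by lra.
by apply: HK; rewrite (le_trans b0 bc) (le_trans ca).
Qed.

Definition gauss_poly H x : R := H.[x] * expR (- x ^+ 2).
Definition gauss_deriv H : {poly R} := H^`() - 2%:P * 'X * H.

Lemma is_derive_gauss_poly H x : is_derive x 1 (gauss_poly H) (gauss_poly (gauss_deriv H) x).
Proof.
have D := is_derive_horner H x; rewrite /gauss_poly /gauss_deriv; isd_tac.
by rewrite !(hornerD, hornerN, hornerM, hornerC, hornerX) /=; ring.
Qed.

Lemma continuous_gauss_poly H : continuous (gauss_poly H).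
Proof. by move=> x; exact: (cont_isd (is_derive_gauss_poly H x)). Qed.

(** Monomial by monomial, with [z = 1 + x^2]: [|x|^i <= z^i], [(1 + |x|)^2 <= 2 z], and
    [exp (- x^2) = e exp (- z)] is at most [e (i + 1)! / z^(i + 1)]. *)
Lemma gauss_poly_bound H : exists2 B : R, 0 <= B & forall x, `|gauss_poly H x| <= B / (1 + `|x|) ^+ 2.
Proof.
pose Bi i : R := `|H`_i| * (2 * expR 1 * i.+1`!%:R).
exists (\sum_(i < size H) Bi i).
  by apply: sumr_ge0 => i _; rewrite !mulr_ge0 ?expR_ge0.
move=> x; rewrite /gauss_poly horner_coef mulr_suml; set y := `|x|.
have y0 : 0 <= y by exact: normr_ge0.
have p0 : 0 < (1 + y) ^+ 2 by rewrite exprn_gt0//; lra.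
rewrite ler_pdivlMr// (le_trans (ler_wpM2r (ltW p0) (ler_norm_sum _ _ _)))//.
rewrite mulr_suml; apply: ler_sum => i _.
rewrite !normrM normrX -/y (ger0_norm (expR_ge0 _)) -mulrA -mulrA /Bi.
rewrite ler_wpM2l//.
have -> : x ^+ 2 = y ^+ 2 by rewrite real_normK ?num_real.
pose z := 1 + y ^+ 2; have z0 : 0 < z by rewrite ltr_wpDr ?sqr_ge0.
have -> : expR (- y ^+ 2) = expR 1 * expR (- z) by rewrite -expRD; congr expR; rewrite /z; ring.
have E := expRN_le_pow i.+1 z0.
have zi : y ^+ i <= z ^+ i.
  apply: lerXn2r; rewrite ?nnegrE ?(ltW z0)// /z -subr_ge0.
  by rewrite (_ : _ - y = (y - 2^-1) ^+ 2 + 3 / 4) ?addr_ge0 ?sqr_ge0//; field.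
have z2 : (1 + y) ^+ 2 <= 2 * z.
  by rewrite -subr_ge0 (_ : _ - _ = (1 - y) ^+ 2) ?sqr_ge0// /z; ring.
apply: (@le_trans _ _ (z ^+ i * (expR 1 * (i.+1`!%:R / z ^+ i.+1) * (2 * z)))).
  apply: ler_pM => //; first by rewrite exprn_ge0.
    by apply: mulr_ge0; [rewrite mulr_ge0 ?expR_ge0|exact: ltW].
  apply: ler_pM; [by rewrite mulr_ge0 ?expR_ge0|exact: ltW| |exact: z2].
  by rewrite ler_wpM2l ?expR_ge0.
rewrite le_eqVlt; apply/orP; left; apply/eqP; rewrite [z ^+ i.+1]exprS.
have zi0 : z ^+ i != 0 by rewrite expf_neq0// gt_eqF.
move: (z ^+ i) zi0 => Z Z0; field; by rewrite Z0 gt_eqF.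
Qed.

(** Past the first term [h], each term is at most the drop of [1 / (1 + x)] across its cell, and
    these drops telescope. *)
Lemma sum_inv_sqr_lattice h M : 0 < h ->
  \sum_(q < M) h / (1 + h * q%:R) ^+ 2 <= h + 1.
Proof.
move=> h0; case: M => [|M]; first by rewrite big_ord0; lra.
have : \sum_(q < M.+1) h / (1 + h * q%:R) ^+ 2 <= h + 1 - (1 + h * M%:R)^-1.
  elim: M => [|M IH]; first by rewrite big_ord1 mulr0 addr0 expr1n !divr1 invr1; lra.
  rewrite big_ord_recr/=; apply: (le_trans (lerD IH (lexx _))).
  have M0 : 0 <= h * M%:R by rewrite mulr_ge0// ltW.
  rewrite -natr1 mulrDr mulr1; set y := h * M%:R in M0 *.
  have y1 : 0 < 1 + y by lra.
  have y2 : 0 < 1 + (y + h) by lra.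
  rewrite -subr_ge0.
  rewrite (_ : _ - _ = h ^+ 2 / ((1 + y) * (1 + (y + h)) ^+ 2)); last by field; rewrite !gt_eqF.
  by rewrite divr_ge0 ?sqr_ge0 ?mulr_ge0 ?sqr_ge0// ltW.
have : 0 <= (1 + h * M%:R)^-1 by rewrite invr_ge0 addr_ge0// mulr_ge0// ltW.
lra.
Qed.

Lemma lattice_sum_bounded H : exists2 C : R, 0 <= C & forall h M a, 0 < h <= 1 -> 0 <= a <= h ->
  `|lattice_sum (gauss_poly H) h M a| <= C.
Proof.
have [B B0 HB] := gauss_poly_bound H.
exists (B * 4); first by rewrite mulr_ge0.
move=> h M a /andP[h0 h1] /andP[a0 ah].
have S := sum_inv_sqr_lattice M h0.
have term x q : h * (q : nat)%:R <= `|x| -> `|h * gauss_poly H x| <= B * (h / (1 + h * q%:R) ^+ 2).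
  move=> qx; rewrite normrM (gtr0_norm h0) mulrCA ler_pM2l//; apply: (le_trans (HB x)).
  have q0 : 0 <= h * q%:R by rewrite mulr_ge0// ltW.
  apply: ler_wpM2l => //; rewrite lef_pV2 ?posrE; [|apply: exprn_gt0; lra|apply: exprn_gt0; lra].
  apply: lerXn2r; rewrite ?nnegrE; lra.
rewrite /lattice_sum mulrDr !mulr_sumr (le_trans (ler_normD _ _))//.
have S1 : `|\sum_(q < M) h * gauss_poly H (h * q%:R + a)| <= B * 2.
  rewrite (le_trans (ler_norm_sum _ _ _))//.
  apply: (@le_trans _ _ (\sum_(q < M) B * (h / (1 + h * q%:R) ^+ 2))).
    apply: ler_sum => q _; apply: term; rewrite ger0_norm ?lerDl// addr_ge0// mulr_ge0// ltW//.
  by rewrite -mulr_sumr ler_wpM2l//; lra.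
have S2 : `|\sum_(q < M) h * gauss_poly H (a - h * q.+1%:R)| <= B * 2.
  rewrite (le_trans (ler_norm_sum _ _ _))//.
  apply: (@le_trans _ _ (\sum_(q < M) B * (h / (1 + h * q%:R) ^+ 2))).
    apply: ler_sum => q _; apply: term; rewrite distrC (le_trans _ (ler_norm _))//.
    by rewrite -natr1; lra.
  by rewrite -mulr_sumr ler_wpM2l//; lra.
lra.
Qed.

Lemma gauss_poly_cvg0 H h : 0 < h ->
  gauss_poly H (h * M%:R) - gauss_poly H (- (h * M%:R)) @[M --> \oo] --> (0 : R).
Proof.
move=> h0; have [B B0 HB] := gauss_poly_bound H.
apply/norm_cvg0P; apply: (@squeeze_cvgr _ _ _ _ (fun=> 0) (fun M : nat => (2 * B / h ^+ 2) * M%:R^-1)).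
- near=> M; rewrite normr_ge0/=.
  have M1 : (1 <= M)%N by near: M; exact: nbhs_infty_ge.
  have M1r : 1 <= M%:R :> R by rewrite ler1n.
  have hM : 0 < h * M%:R by rewrite mulr_gt0//; lra.
  rewrite (le_trans (ler_normB _ _))//.
  have E1 := HB (h * M%:R); have E2 := HB (- (h * M%:R)); rewrite normrN in E2.
  apply: (le_trans (lerD E1 E2)); rewrite (gtr0_norm hM).
  have -> : B / (1 + h * M%:R) ^+ 2 + B / (1 + h * M%:R) ^+ 2 = 2 * B / (1 + h * M%:R) ^+ 2 by ring.
  have -> : 2 * B / h ^+ 2 / M%:R = (2 * B) / (h ^+ 2 * M%:R) by rewrite [(_ * M%:R)^-1]invfM; ring.
  apply: ler_wpM2l; first by rewrite mulr_ge0.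
  have M0 : 0 < h ^+ 2 * M%:R by rewrite mulr_gt0 ?exprn_gt0//; lra.
  rewrite lef_pV2 ?posrE//; last by apply: exprn_gt0; lra.
  apply: (@le_trans _ _ ((h * M%:R) ^+ 2)).
    by rewrite exprMn ler_pM2l ?exprn_gt0// expr2 ler_peMr//; lra.
  by rewrite lerXn2r ?nnegrE//; lra.
- exact: cvg_cst.
- rewrite -[X in _ --> X](mulr0 (2 * B / h ^+ 2)); apply: cvgM; first exact: cvg_cst.
  rewrite -cvg_shiftS; exact: cvg_harmonic.
Unshelve. all: by end_near. Qed.

(* The lattice sum of a derivative vanishes somewhere up to a boundary term, so
   that each further derivative gains one power of the mesh. *)
Lemma lattice_sum_small N H : exists2 C : R, 0 <= C & forall h, 0 < h <= 1 -> forall e, 0 < e ->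
  \forall M \near \oo, forall a, 0 <= a <= h ->
    `|lattice_sum (gauss_poly (gauss_deriv H)) h M a| <= C * h ^+ N + e.
Proof.
elim: N H => [|N IH] H.
  have [C C0 HC] := lattice_sum_bounded (gauss_deriv H); exists C => // h h01 e e0.
  near=> M => a ah; rewrite expr0 mulr1 (le_trans (HC h M a h01 ah))// lerDl ltW//.
have [C C0 HC] := IH (gauss_deriv H); exists C => // h h01 e e0.
have /andP[h0 h1] := h01; have e20 : 0 < e / 2 by rewrite divr_gt0.
have HM := HC h h01 _ e20.
have Hc := gauss_poly_cvg0 H h0.
near=> M => a ah.
have [b bh E] := @lattice_sum_mvt _ _ h M h0 (fun x _ => is_derive_gauss_poly H x).
have K : forall a, 0 <= a <= h -> `|lattice_sum (gauss_poly (gauss_deriv (gauss_deriv H))) h M a| <= C * h ^+ N + e / 2.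
  by near: M; exact: HM.
have L := lattice_sum_lip h0 (is_derive_gauss_poly (gauss_deriv H)) K ah bh.
have Eb : `|lattice_sum (gauss_poly (gauss_deriv H)) h M b| <= e / 2.
  rewrite E; near: M; have /cvgrPdist_le /(_ (e / 2) e20) := Hc.
  by under eq_near do rewrite sub0r normrN.
set Sa := lattice_sum _ _ _ _ in L *; set Sb := lattice_sum _ _ _ _ in L Eb.
have -> : Sa = (Sa - Sb) + Sb by rewrite subrK.
rewrite (le_trans (ler_normD _ _))// (le_trans (lerD L Eb))//.
rewrite mulrDl exprSr mulrA -addrA lerD2l.
have : e / 2 * h <= e / 2 by rewrite ler_piMr// ltW.
lra.
Unshelve. all: by end_near. Qed.

Lemma even_gauss_integral p b : 0 < b -> exists2 F : R -> R,
  (forall x, `|x| <= b -> is_derive (x : R) 1 F (gauss_poly 'X^(2 * p) x)) &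
  F b - F (- b) = 2 * gaussM p b.
Proof.
move=> b0; pose G := gauss_poly ('X^(2 * p) : {poly R}).
have cG : continuous G by exact: continuous_gauss_poly.
(* Based strictly to the left of [- b], so that the derivative is two-sided on all of [[- b, b]]. *)
pose F x := integ (- (b + 1)) x G.
have DF x : `|x| <= b -> is_derive (x : R) 1 F (G x).
  by rewrite ler_norml => /andP[x1 x2]; apply: integ_deriv => //; lra.
have GN x : G (- x) = G x by rewrite /G /gauss_poly !hornerXn exprM sqrrN -exprM.
have GE : gaussM p b = integ 0 b G by apply: eq_integ => x _; rewrite /G /gauss_poly hornerXn.
exists F => //.
have E1 : integ 0 b G = F b - F 0.
  apply: integ_FTC_closed => //; first exact: ltW.
  by move=> x /andP[x0 xb]; apply: DF; rewrite ger0_norm.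
have E2 : integ 0 b G = - F (- b) - - F (- 0).
  apply: (@integ_FTC_closed R 0 b G (fun x => - F (- x))) => //; first exact: ltW.
  move=> x /andP[x0 xb]; have D : is_derive (- x) 1 F (G (- x)) by apply: DF; rewrite normrN ger0_norm.
  by apply: isd_eq (isdN (isd_comp (isdN (isd_id x)) D)) _; rewrite GN; ring.
rewrite oppr0 in E2; rewrite GE mulr_natl mulr2n {1}E1 E2; ring.
Qed.

(** With mesh [h = sqrt t], the sum is half a lattice sum of [x^(2 p) exp (- x^2)] divided by
    [h^(2 p + 1)]. The translate given by the mean value theorem yields the integral, and moving it
    back to [0] costs an arbitrary power of [h]. *)
Lemma gauss_sum_asymp p N : (0 < p)%N -> exists2 C : R, 0 <= C & forall t theta, 0 < t <= 1 ->
  (\sum_(q < M) q%:R ^+ (2 * p) * expR (- (q%:R ^+ 2 * t)) @[M --> \oo] --> theta) ->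
  `|theta - gauss_moment R p * ((t ^+ p)^-1 * (Num.sqrt t)^-1)| <= C * t ^+ N.
Proof.
(* [h^(2 N) = t^N]; the extra [2 p] powers absorb the division by [h^(2 p)]. *)
move=> p0; pose H : {poly R} := 'X^(2 * p); pose K := (2 * N + 2 * p)%N.
have [C C0 HC] := lattice_sum_small K H.
exists C => // t theta /andP[t0 t1] lim.
pose h := Num.sqrt t; have h0 : 0 < h by rewrite sqrtr_gt0.
have h1 : h <= 1 by rewrite -sqrtr1 ler_sqrt.
have tE : t = h ^+ 2 by rewrite sqr_sqrtr// ltW.
have h01 : 0 < h <= 1 by rewrite h0.
have hM : h * M%:R @[M --> \oo] --> +oo%R.
  apply: (cvg_comp _ _ (@cvgr_idn R)); apply/cvgryPge => A; near=> x.
  rewrite mulrC -ler_pdivrMr//; near: x; apply: nbhs_pinfty_ge; exact: num_real.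
have lim1 : gaussM p (h * M%:R) @[M --> \oo] --> gauss_moment R p.
  by apply: (cvg_comp _ _ hM); exact: gaussM_cvg.
have lim2 : gauss_poly H (h * M%:R) @[M --> \oo] --> (0 : R).
  have -> : gauss_poly H = fun x => x ^+ (2 * p) * expR (- x ^+ 2).
    by apply/funext => x; rewrite /gauss_poly hornerXn.
  exact: (@cvg_comp _ _ _ (fun M : nat => h * M%:R) (fun x => x ^+ (2 * p) * expR (- x ^+ 2)) _ _ _
    hM (@pow_gauss_cvg0 R (2 * p))).
have latE M : lattice_sum (gauss_poly H) h M 0 =
    h * (2 * (h ^+ (2 * p) * \sum_(q < M) q%:R ^+ (2 * p) * expR (- (q%:R ^+ 2 * t))) + gauss_poly H (h * M%:R)).
  have HN x : gauss_poly H (- x) = gauss_poly H x.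
    by rewrite /gauss_poly !hornerXn exprM sqrrN -exprM.
  rewrite /lattice_sum; congr (_ * _).
  have -> : h ^+ (2 * p) * \sum_(q < M) q%:R ^+ (2 * p) * expR (- (q%:R ^+ 2 * t)) =
      \sum_(q < M) gauss_poly H (h * q%:R).
    rewrite mulr_sumr; apply: eq_bigr => q _; rewrite /gauss_poly hornerXn exprMn tE mulrA.
    by congr (_ * expR _); ring.
  under eq_bigr do rewrite addr0.
  under [X in _ + X]eq_bigr do rewrite sub0r HN.
  (* By parity the negative points repeat the positive ones. The point [0] contributes nothing as
     [0 < p], and the extra point at distance [h M] tends to [0]. *)
  have E : \sum_(q < M) gauss_poly H (h * q.+1%:R) = \sum_(q < M) gauss_poly H (h * q%:R) + gauss_poly H (h * M%:R).
    have G0 : gauss_poly H (h * 0%:R) = 0.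
      by rewrite /gauss_poly hornerXn mulr0 expr0n muln_eq0 (gtn_eqF p0) mul0r.
    transitivity (gauss_poly H (h * 0%:R) + \sum_(q < M) gauss_poly H (h * q.+1%:R)).
      by rewrite G0 add0r.
    rewrite -[RHS](@big_ord_recr _ _ _ M (fun q => gauss_poly H (h * q%:R))) [RHS]big_ord_recl.
    by congr (_ + _); apply: eq_bigr => q _; rewrite /bump leq0n.
  by rewrite E; ring.
have lim3 : lattice_sum (gauss_poly H) h M 0 - 2 * gaussM p (h * M%:R) @[M --> \oo] -->
    h * (2 * (h ^+ (2 * p) * theta) + 0) - 2 * gauss_moment R p.
  under eq_fun do rewrite latE.
  apply: cvgB; apply: cvgM; [exact: cvg_cst| |exact: cvg_cst|exact: lim1].
  by apply: cvgD => //; apply: cvgM; [exact: cvg_cst|apply: cvgM => //; exact: cvg_cst].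
have bound e : 0 < e -> `|h * (2 * (h ^+ (2 * p) * theta) + 0) - 2 * gauss_moment R p| <= h * (C * h ^+ K + e).
  move=> e0; have HM := HC h h01 e e0.
  pose D M : R := `|lattice_sum (gauss_poly H) h M 0 - 2 * gaussM p (h * M%:R)|.
  have lim4 : D @ \oo --> `|h * (2 * (h ^+ (2 * p) * theta) + 0) - 2 * gauss_moment R p|.
    by apply: cvg_norm; exact: lim3.
  suff : \forall M \near \oo, D M <= h * (C * h ^+ K + e) by move=> nD; exact: (cvgr_to_le lim4 nD).
  near=> M.
  have M1 : (0 < M)%N by near: M; exact: nbhs_infty_ge.
  have b0 : 0 < h * M%:R by rewrite mulr_gt0// ltr0n.
  have [F DF FE] := even_gauss_integral p b0.
  have [a ah E] := lattice_sum_mvt h0 DF.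
  have Ka : forall a, 0 <= a <= h -> `|lattice_sum (gauss_poly (gauss_deriv H)) h M a| <= C * h ^+ K + e.
    by near: M; exact: HM.
  rewrite /D -FE -E mulrC; apply: (lattice_sum_lip h0 (is_derive_gauss_poly H) Ka) => //.
  by rewrite lexx ltW.
have main : `|h * (2 * (h ^+ (2 * p) * theta) + 0) - 2 * gauss_moment R p| <= h * (C * h ^+ K).
  apply/ler_addgt0Pr => e e0; apply: (le_trans (bound e e0)); rewrite mulrDr lerD2l.
  by rewrite ler_piMl// ltW.
rewrite -/h; have p20 : 0 < h ^+ (2 * p) by rewrite exprn_gt0.
have -> : t ^+ p = h ^+ (2 * p) by rewrite tE exprM.
have -> : t ^+ N = h ^+ (2 * N) by rewrite tE exprM.
rewrite addr0 in main.
have E : h * (2 * (h ^+ (2 * p) * theta)) - 2 * gauss_moment R p =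
  (2 * h * h ^+ (2 * p)) * (theta - gauss_moment R p * ((h ^+ (2 * p))^-1 * h^-1)).
  by move: (h ^+ (2 * p)) p20 => u u0; field; rewrite !gt_eqF.
have d0 : 0 < 2 * h * h ^+ (2 * p) by rewrite !mulr_gt0.
rewrite E normrM (gtr0_norm d0) in main.
rewrite -(ler_pM2l d0); apply: (le_trans main).
rewrite /K exprD -subr_ge0.
have -> : 2 * h * h ^+ (2 * p) * (C * h ^+ (2 * N)) - h * (C * (h ^+ (2 * N) * h ^+ (2 * p))) =
  h * h ^+ (2 * p) * (C * h ^+ (2 * N)) by ring.
by rewrite !mulr_ge0 ?exprn_ge0// ltW.
Unshelve. all: by end_near. Qed.

End Theta.

(** * The expansion on the sphere *)

Section SphereExpansion.
Context (R : realType).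
Variable m : nat.
Hypothesis m_gt0 : (0 < m)%N.
Local Notation n := (2 * m).+1.
Local Notation M := (sphere R n).
Local Notation G := (half_fact R).
Local Notation cc := (c_coef R m).
Implicit Types t : R.

Let Y : R := 2 ^+ m * G m.

Let Y_gt0 : 0 < Y. Proof. by rewrite mulr_gt0 ?exprn_gt0 ?half_fact_gt0. Qed.

Lemma prod_sub_c_coef (x : R) : \prod_(j < m) (x - j%:R ^+ 2) = \sum_(k < m) (-1) ^+ k * cc k * x ^+ (m - k).
Proof.
have := congr1 (horner^~ (- x)) (prod_c_coef R m_gt0); rewrite horner_prod horner_sum => E.
have E1 : \prod_(j < m) (x - j%:R ^+ 2) = (-1) ^+ m * \prod_(j < m) ('X + (j%:R ^+ 2)%:P).[- x].
  have -> : (-1) ^+ m = \prod_(j < m) (-1 : R) by rewrite prodr_const card_ord.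
  rewrite -big_split /=; apply: eq_bigr => j _; rewrite hornerD hornerX hornerC; ring.
rewrite E1 E mulr_sumr; apply: eq_bigr => k _.
rewrite hornerM hornerC hornerXn -[- x]mulN1r exprMn.
have -> : (-1) ^+ m = (-1) ^+ k * (-1) ^+ (m - k) :> R by rewrite -exprD subnKC// ltnW.
have := sqrr_sign R (m - k); rewrite expr2; move: ((-1) ^+ (m - k)) ((-1) ^+ k) => b a s.
by transitivity ((b * b) * (a * cc k * x ^+ (m - k))); [ring|rewrite s mul1r].
Qed.

Lemma cvg_sum_ord K (F : 'I_K -> nat -> R) (l : 'I_K -> R) :
  (forall i, F i @ \oo --> l i) -> \sum_(i < K) F i N @[N --> \oo] --> \sum_(i < K) l i.
Proof.
move=> Fl; elim: (index_enum _) => [|i r IH].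
  by rewrite big_nil; under eq_fun do rewrite big_nil; exact: cvg_cst.
by rewrite big_cons; under eq_fun do rewrite big_cons; apply: cvgD; [exact: Fl|exact: IH].
Qed.

Definition theta p t : R := limn (fun N => \sum_(q < N) q%:R ^+ (2 * p) * expR (- (q%:R ^+ 2 * t))).

Lemma theta_cvg p t : 0 < t ->
  \sum_(q < N) q%:R ^+ (2 * p) * expR (- (q%:R ^+ 2 * t)) @[N --> \oo] --> theta p t.
Proof.
move=> t0; have [L HL] := sum_gauss_bounded p t0.
apply: nondecreasing_is_cvgn.
  apply/nondecreasing_seqP => N; rewrite big_ord_recr/= lerDl.
  by rewrite mulr_ge0 ?exprn_ge0 ?expR_ge0.
by exists L => _ [N _ <-]; exact: HL.
Qed.

Section kernel.
Variable kappa : R -> R -> R.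
Hypothesis rk : radial_heat_kernel M kappa.

(** The product of the [q^2 - j^2] is expanded by [prod_sub_c_coef], which separates the series into
    sums of [q^(2 p) exp (- q^2 t)], each of them over all [q >= 0]. *)
Lemma sphere_kernel_theta t : 0 < t -> kappa t 0 =
  expR (m%:R ^+ 2 * t) / (polar_cst R m * (Y ^+ 2 * (pi / 2))) * \sum_(k < m) (-1) ^+ k * cc k * theta (m - k) t.
Proof.
move=> t0; pose q t (x : 'rV[R]_(1 + n)) := kappa t (geodesic_distance M x (base_point R n)).
have bc : carrier M (base_point R n) by rewrite -stereographic_chart0; exact: stereographic_chart_carrier.
have [fq _] := rk bc.
have rq b s (x : 'rV[R]_n) : q s (stereographic_chart b x) =
    q s (stereographic_chart b (Num.sqrt (sqnorm x) *: delta_mx 0 0)).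
  by rewrite /q stereographic_dist_radial.
have qE : q t (base_point R n) = kappa t 0 by rewrite /q geodesic_distance_xx.
have := sphere_kernel_series m_gt0 fq rq t0; rewrite -/(q t _) qE => lim.
have w0 := polar_cst_gt0 R m; have p0 := pi_gt0 R.
set D := Y ^+ 2 * (pi / 2).
have D0 : 0 < D by rewrite mulr_gt0 ?exprn_gt0 ?divr_gt0.
have lim2 : expR (m%:R ^+ 2 * t) / D * (\sum_(k < m) (-1) ^+ k * cc k *
    \sum_(q < N + m.+1) q%:R ^+ (2 * (m - k)) * expR (- (q%:R ^+ 2 * t))) @[N --> \oo] -->
    expR (m%:R ^+ 2 * t) / D * \sum_(k < m) (-1) ^+ k * cc k * theta (m - k) t.
  apply: cvgM; first exact: cvg_cst.
  apply: cvg_sum_ord => k; apply: cvgM; first exact: cvg_cst.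
  rewrite (@cvg_shiftn m.+1 _ (fun N => \sum_(q < N) q%:R ^+ (2 * (m - k)) * expR (- (q%:R ^+ 2 * t)))).
  exact: theta_cvg.
have E : polar_cst R m * kappa t 0 = expR (m%:R ^+ 2 * t) / D * \sum_(k < m) (-1) ^+ k * cc k * theta (m - k) t.
  apply: (cvg_unique _ lim); first exact: Rhausdorff.
  apply: cvg_trans lim2; apply: near_eq_cvg; near=> N.
  under eq_bigr do rewrite mulr_sumr; rewrite exchange_big /= mulr_sumr.
  have -> : (N + m.+1 = m + N.+1)%N by rewrite addnS addnC addnS.
  (* The terms with [q < m], absent from the spectral series, may be added: the product over [j < m]
     contains the factor [q^2 - q^2]. *)
  rewrite big_split_ord /= big1 ?add0r; last first.
    move=> i _; rewrite -mulrA; apply/eqP; rewrite mulf_eq0; apply/orP; right.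
    have -> : \sum_(k < m) (-1) ^+ k * cc k * (i%:R ^+ (2 * (m - k)) * expR (- (i%:R ^+ 2 * t))) =
        (\prod_(j < m) (i%:R ^+ 2 - j%:R ^+ 2)) * expR (- (i%:R ^+ 2 * t)).
      by rewrite prod_sub_c_coef mulr_suml; apply: eq_bigr => k _; rewrite exprM mulrA.
    by rewrite (bigD1 i)//= subrr !mul0r mulr0.
  apply: eq_bigr => k _.
  have -> : expR (- (((m + k)%N%:R ^+ 2 - m%:R ^+ 2) * t)) =
      expR (m%:R ^+ 2 * t) * expR (- ((m + k)%N%:R ^+ 2 * t)).
    by rewrite -expRD; congr expR; ring.
  rewrite prod_sub_c_coef prod_odd -/Y -/D.
  have -> : \sum_(k0 < m) (-1) ^+ k0 * cc k0 * ((m + k)%:R ^+ (2 * (m - k0)) * expR (- ((m + k)%:R ^+ 2 * t))) =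
    (\sum_(k0 < m) (-1) ^+ k0 * cc k0 * ((m + k)%:R ^+ 2) ^+ (m - k0)) * expR (- ((m + k)%:R ^+ 2 * t)).
    by rewrite mulr_suml; apply: eq_bigr => k0 _; rewrite exprM mulrA.
  ring.
apply: (mulfI (lt0r_neq0 w0)); rewrite E; set S := \sum_(_ < m) _.
by field; rewrite !gt_eqF.
Unshelve. all: by end_near. Qed.

Definition sphere_main t : R :=
  (4 * pi * t) `^ (- (n%:R / 2)) * expR (m%:R ^+ 2 * t)
  * \sum_(0 <= k < m)
      (-1) ^+ k * (Gamma (m%:R - k%:R + 2^-1) * cc k / Gamma (m%:R + 2^-1)) * t ^+ k.

(** Puts the announced expression in the form of [sphere_kernel_theta], each [theta] being replaced
    by its Gaussian integral; the two can then be compared term by term. *)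
Lemma sphere_mainE t : 0 < t -> sphere_main t =
  expR (m%:R ^+ 2 * t) / (polar_cst R m * (Y ^+ 2 * (pi / 2))) *
  \sum_(k < m) (-1) ^+ k * cc k * (gauss_moment R (m - k) * ((t ^+ (m - k))^-1 * (Num.sqrt t)^-1)).
Proof.
move=> t0; rewrite /sphere_main powR_4pi// polar_cstE big_mkord.
have p0 : 0 < Num.sqrt pi :> R by rewrite sqrtr_gt0 pi_gt0.
have q0 : 0 < Num.sqrt t by rewrite sqrtr_gt0.
have G0 := half_fact_gt0 R m.
have w0 : 0 < 2 ^+ m :> R by rewrite exprn_gt0.
have -> : pi = Num.sqrt pi ^+ 2 :> R by rewrite sqr_sqrtr// pi_ge0.
have -> : Num.sqrt (Num.sqrt pi ^+ 2) = Num.sqrt pi :> R by rewrite sqrtr_sqr ger0_norm// ltW.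
rewrite /Y !mulr_sumr; apply: eq_bigr => k _.
rewrite -natrB; last exact/ltnW/ltn_ord.
rewrite !Gamma_half_fact ?subn_gt0 ?ltn_ord// /gauss_moment -/(half_fact R (m - k)).
have -> : t ^+ m = t ^+ (m - k) * t ^+ k by rewrite -exprD subnK// ltnW.
have T1 : 0 < t ^+ (m - k) by rewrite exprn_gt0.
have T2 : 0 < t ^+ k by rewrite exprn_gt0.
have A0 : 0 < Num.sqrt pi ^+ n :> R by rewrite exprn_gt0.
move: (Num.sqrt pi ^+ n) A0 (Num.sqrt pi) p0 (Num.sqrt t) q0 => A A0 a a0 b b0.
move: (t ^+ (m - k)) T1 (t ^+ k) T2 (half_fact R m) G0 (2 ^+ m) w0 => T1 T10 T2 T20 g g0 w w0.
by field; rewrite ?gt_eqF ?exprn_gt0.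
Qed.

Lemma sphere_kernel_bound N : exists2 C : R, 0 <= C & forall t, 0 < t <= 1 ->
  `|kappa t 0 - sphere_main t| <= C * t ^+ N.
Proof.
pose A : R := expR (m%:R ^+ 2) / (polar_cst R m * (Y ^+ 2 * (pi / 2))).
have w0 := polar_cst_gt0 R m; have p0 := pi_gt0 R.
have D0 : 0 < polar_cst R m * (Y ^+ 2 * (pi / 2)).
  by apply: mulr_gt0 => //; apply: mulr_gt0; [exact: exprn_gt0|rewrite divr_gt0].
have A0 : 0 <= A by rewrite divr_ge0 ?expR_ge0// ltW.
have H (k : 'I_m) : exists C : R, 0 <= C /\ forall t, 0 < t <= 1 ->
    `|theta (m - k) t - gauss_moment R (m - k) * ((t ^+ (m - k))^-1 * (Num.sqrt t)^-1)| <= C * t ^+ N.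
  have mk : (0 < m - k)%N by rewrite subn_gt0.
  have [C C0 HC] := gauss_sum_asymp R N mk; exists C; split=> // t t01.
  by apply: HC => //; apply: theta_cvg; case/andP: t01.
have [C HC] := choice H.
exists (A * \sum_(k < m) `|cc k| * C k).
  by rewrite mulr_ge0 ?sumr_ge0// => k _; rewrite mulr_ge0//; case: (HC k).
move=> t /andP[t0 t1]; rewrite sphere_kernel_theta// sphere_mainE// -mulrBr -sumrB normrM.
rewrite -mulrA; apply: ler_pM => //.
  rewrite ger0_norm ?divr_ge0 ?expR_ge0 ?(ltW D0)// ler_pM2r ?invr_gt0// ler_expR.
  by rewrite ler_piMr ?sqr_ge0.
rewrite mulr_suml (le_trans (ler_norm_sum _ _ _))//; apply: ler_sum => k _.
rewrite -mulrBr !normrM normrX normrN1 expr1n mul1r -[leRHS]mulrA ler_wpM2l//.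
by have [_] := HC k; apply; rewrite t0.
Qed.

Lemma sphere_asymp : asymp_eq (kappa ^~ 0) sphere_main.
Proof.
move=> N; have [C C0 HC] := sphere_kernel_bound N.
apply/eqOP; near=> k; near=> t => /=.
have t0 : 0 < t by near: t; exact: nbhs_right_gt.
have t1 : t <= 1 by near: t; exact: nbhs_right_le.
have tN : 0 <= t ^+ N by rewrite exprn_ge0// ltW.
apply: (le_trans (HC t _)); first by rewrite t0.
rewrite (ger0_norm tN) ler_wpM2r//; near: k; apply: nbhs_pinfty_ge; exact: num_real.
Unshelve. all: by end_near. Qed.

End kernel.

(** A partial sum of the exponential series delayed by [l]: multiplied by [t^l] at [x = m^2 t], it
    is the truncation at degree [K] of [t^l exp (m^2 t)]. *)
Definition exp_shift l K (x : R) : R :=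
  \sum_(0 <= k < K) (if (l <= k)%N then x ^+ (k - l) / (k - l)`!%:R else 0).

Lemma exp_shift_cvg l x : exp_shift l K x @[K --> \oo] --> expR x.
Proof.
rewrite -(@cvg_shiftn l _ (fun K => exp_shift l K x)).
have -> : [sequence exp_shift l (K + l) x]_K = series (exp_coeff x).
  apply/funext => K; rewrite /exp_shift /series /= addnC.
  rewrite (big_cat_nat (n := l)) ?leq_addr//= big1_seq ?add0r; last first.
    by move=> k; rewrite mem_index_iota => /andP[_ /andP[_ kl]]; rewrite leqNgt kl.
  rewrite -{1}[l]add0n big_addn addKn; apply: eq_bigr => k _.
  by rewrite leq_addl addnK /exp_coeff /=.
exact: is_cvg_series_exp_coeff.
Qed.

Lemma exp_shift_le l K x : 0 <= x -> exp_shift l K x <= expR x.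
Proof.
move=> x0; have c := @exp_shift_cvg l x.
rewrite -(cvg_lim (@Rhausdorff R) c).
apply: (@nondecreasing_cvgn_le R (fun K => exp_shift l K x)); last by apply/cvg_ex; exists (expR x).
apply/nondecreasing_seqP => k; rewrite /exp_shift big_nat_recr//= lerDl.
by case: ifP => // _; rewrite divr_ge0 ?exprn_ge0.
Qed.

Let bb l : R := (-1) ^+ l * Gamma (m%:R - l%:R + 2^-1) * cc l / (2 * m)`!%:R.

(** The Cauchy product of a polynomial in [t] with [exp (m^2 t)]. The range of [l] is made
    independent of [k]: terms with [l > k] are set to zero, and those with [l >= m] vanish through
    [c_coef]. Sums over [k] and [l] can then be exchanged. *)
Lemma a_coefE k : a_coef R m k = \sum_(l < m) bb l *
  (if (l <= k)%N then (m%:R ^+ 2) ^+ (k - l) / (k - l)`!%:R else 0).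
Proof.
pose F l := bb l * (if (l <= k)%N then (m%:R ^+ 2) ^+ (k - l) / (k - l)`!%:R else 0).
have F0 l : (m <= l)%N || (k < l)%N -> F l = 0.
  case/orP => h; last by rewrite /F leqNgt h mulr0.
  rewrite /F /bb /c_coef (gtn_eqF (leq_trans m_gt0 h)) (_ : (l <= m - 1)%N = false).
    by rewrite mulr0 !mul0r.
  by rewrite subn1; apply/negbTE; rewrite -ltnNge prednK.
transitivity (\sum_(0 <= l < k.+1 + m) F l).
  rewrite (big_cat_nat (n := k.+1)) ?leq_addr//= [X in _ + X]big1_seq ?addr0; last first.
    by move=> l; rewrite mem_index_iota => /andP[_ /andP[kl _]]; apply: F0; rewrite kl orbT.
  rewrite /a_coef; apply: eq_big_nat => l /andP[_ lk].
  have lk' : (l <= k)%N by [].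
  rewrite /F lk' /bb -mulnBr exprM.
  have f1 : (2 * m)`!%:R != 0 :> R by rewrite pnatr_eq0 -lt0n fact_gt0.
  have f2 : (k - l)`!%:R != 0 :> R by rewrite pnatr_eq0 -lt0n fact_gt0.
  move: ((2 * m)`!%:R) f1 ((k - l)`!%:R) f2 => f1 f10 f2 f20.
  by field; rewrite f10 f20.
rewrite addnC (big_cat_nat (n := m)) ?leq_addr//= [X in _ + X]big1_seq ?addr0 ?big_mkord//.
by move=> l; rewrite mem_index_iota => /andP[_ /andP[ml _]]; apply: F0; rewrite ml.
Qed.

Lemma a_series t K : \sum_(0 <= k < K) a_coef R m k * t ^+ k =
  \sum_(l < m) bb l * t ^+ l * exp_shift l K (m%:R ^+ 2 * t).
Proof.
under eq_bigr do rewrite a_coefE mulr_suml.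
rewrite exchange_big /=; apply: eq_bigr => l _; rewrite /exp_shift mulr_sumr.
apply: eq_bigr => k _; case: ifP => lk; last by rewrite !mulr0 mul0r.
have -> : t ^+ k = t ^+ l * t ^+ (k - l) by rewrite -exprD subnKC.
rewrite [(m%:R ^+ 2 * t) ^+ _]exprMn; move: (t ^+ (k - l)) ((m%:R ^+ 2) ^+ (k - l)) => u w; ring.
Qed.

Let heat_sum t : R := \sum_(l < m) bb l * t ^+ l * expR (m%:R ^+ 2 * t).

Lemma a_series_cvg t : series (fun k => a_coef R m k * t ^+ k) @ \oo --> heat_sum t.
Proof.
have -> : series (fun k => a_coef R m k * t ^+ k) =
    (fun K => \sum_(l < m) bb l * t ^+ l * exp_shift l K (m%:R ^+ 2 * t)).
  by apply/funext => K; rewrite /series /= a_series.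
apply: cvg_sum_ord => l; apply: cvgM; first exact: cvg_cst.
exact: exp_shift_cvg.
Qed.

(** The area of the Euclidean sphere times a Wallis product, put in this form by [(2 m)! = 2^m m! *
    (1 * 3 * ... * (2 m - 1))]. *)
Lemma sphere_volume_value :
  volume M = 2 * (2 ^+ m) ^+ 2 * Num.sqrt pi ^+ n * Gamma (m%:R + 2^-1) / (2 * m)`!%:R.
Proof.
rewrite sphere_volumeE polar_cstE sph1 Gamma_half_fact//.
have E k : (2 * k)`!%:R = 2 ^+ k * k`!%:R * \prod_(j < k) (2 * j%:R + 1) :> R.
  elim: k => [|k IH]; first by rewrite big_ord0 !mulr1 muln0.
  rewrite mulnS !factS !natrM IH big_ord_recr/= exprS -!natr1 natrM; ring.
have P k : \prod_(j < k) ((2 * j%:R + 1) / (2 * j%:R + 2)) =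
    \prod_(j < k) (2 * j%:R + 1) / (2 ^+ k * k`!%:R) :> R.
  elim: k => [|k IH]; first by rewrite !big_ord0 mulr1 divr1.
  rewrite !big_ord_recr/= IH factS exprS natrM -natr1.
  have f0 : k`!%:R != 0 :> R by rewrite pnatr_eq0 -lt0n fact_gt0.
  have w0 : 2 ^+ k != 0 :> R by rewrite expf_neq0.
  have k1 : 1 + k%:R != 0 :> R by rewrite addrC natr1.
  have k2 : 2 * k%:R + 2 != 0 :> R by rewrite -natrM -natrD addn2.
  by field; rewrite f0 w0 k1 k2.
rewrite E P prod_odd.
have G0 := half_fact_gt0 R m; have w0 : 0 < 2 ^+ m :> R by rewrite exprn_gt0.
have f0 : 0 < m`!%:R :> R by rewrite ltr0n fact_gt0.
set A := Num.sqrt pi ^+ n; set a := Num.sqrt pi.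
have a0 : 0 < a by rewrite sqrtr_gt0 pi_gt0.
have piE : pi = a ^+ 2 by rewrite sqr_sqrtr// pi_ge0.
rewrite piE; move: A a a0 {piE} => A a a0.
move: (half_fact R m) G0 (2 ^+ m) w0 (m`!%:R) f0 => g g0 w w0 f f0.
by field; rewrite !gt_eqF.
Qed.

Lemma sphere_volume_gt0 : 0 < volume M.
Proof.
rewrite sphere_volume_value divr_gt0 ?ltr0n ?fact_gt0// Gamma_half_fact//.
by rewrite !mulr_gt0 ?exprn_gt0 ?sqrtr_gt0 ?pi_gt0// half_fact_gt0.
Qed.

Lemma sphere_main_volume t : 0 < t ->
  sphere_main t = (volume M)^-1 * t `^ (- (n%:R / 2)) * heat_sum t.
Proof.
move=> t0; rewrite sphere_volume_value /sphere_main powR_4pi// powR_half ?(ltW t0)//.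
have -> : Num.sqrt t ^+ n = t ^+ m * Num.sqrt t by rewrite exprSr exprM sqr_sqrtr// ltW.
rewrite /heat_sum /bb big_mkord !mulr_sumr; apply: eq_bigr => k _.
have q0 : 0 < t ^+ m * Num.sqrt t by rewrite mulr_gt0 ?exprn_gt0 ?sqrtr_gt0.
have g0 : 0 < Gamma (m%:R + 2^-1 : R) by rewrite Gamma_half_fact// mulr_gt0 ?sqrtr_gt0 ?pi_gt0// half_fact_gt0.
have w0 : 0 < 2 ^+ m :> R by rewrite exprn_gt0.
have f0 : 0 < (2 * m)`!%:R :> R by rewrite ltr0n fact_gt0.
have A0 : 0 < Num.sqrt pi ^+ n :> R by rewrite exprn_gt0 ?sqrtr_gt0 ?pi_gt0.
move: (t ^+ m * Num.sqrt t) q0 (Gamma (m%:R + 2^-1)) g0 (2 ^+ m) w0 => T T0 g g0 w w0.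
move: ((2 * m)`!%:R) f0 (Num.sqrt pi ^+ n) A0 (Gamma (m%:R - k%:R + 2^-1)) => f f0 A A0 g1.
by field; rewrite !gt_eqF.
Qed.

(** The sum of the [|a_k|] is finite, being at most the same combination of exponentials at [t = 1]
    with absolute values; for [t <= 1] the tail from [N] is then at most that sum times [t^N]. *)
Lemma heat_sum_partial N : exists2 B : R, 0 <= B & forall t, 0 < t <= 1 ->
  `|heat_sum t - \sum_(0 <= k < N) a_coef R m k * t ^+ k| <= B * t ^+ N.
Proof.
pose B : R := \sum_(l < m) `|bb l| * expR (m%:R ^+ 2).
have B0 : 0 <= B by apply: sumr_ge0 => l _; rewrite mulr_ge0 ?expR_ge0.
have absB K : \sum_(0 <= k < K) `|a_coef R m k| <= B.
  apply: (@le_trans _ _ (\sum_(l < m) `|bb l| * exp_shift l K (m%:R ^+ 2))); last first.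
    by apply: ler_sum => l _; rewrite ler_wpM2l// exp_shift_le// sqr_ge0.
  apply: (@le_trans _ _ (\sum_(0 <= k < K) \sum_(l < m) `|bb l| *
      (if (l <= k)%N then (m%:R ^+ 2) ^+ (k - l) / (k - l)`!%:R else 0))).
    apply: ler_sum => k _; rewrite a_coefE (le_trans (ler_norm_sum _ _ _))//.
    apply: ler_sum => l _; rewrite normrM ler_wpM2l//; case: ifP => _; last by rewrite normr0.
    by rewrite ger0_norm// divr_ge0 ?exprn_ge0 ?sqr_ge0.
  rewrite exchange_big /=; apply: ler_sum => l _; rewrite /exp_shift mulr_sumr //.
exists B => // t /andP[t0 t1].
pose s K := \sum_(0 <= k < K) a_coef R m k * t ^+ k.
have bound K : (N <= K)%N -> `|s K - s N| <= B * t ^+ N.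
  move=> NK; have -> : s K - s N = \sum_(N <= k < K) a_coef R m k * t ^+ k.
    by rewrite /s (@big_cat_nat _ _ _ N 0 K)//= addrAC subrr add0r.
  apply: (@le_trans _ _ (\sum_(N <= k < K) `|a_coef R m k| * t ^+ N)).
    rewrite (le_trans (ler_norm_sum _ _ _))//; rewrite big_seq [leRHS]big_seq.
    apply: ler_sum => k; rewrite mem_index_iota => /andP[Nk _].
    rewrite normrM ler_wpM2l// ger0_norm ?exprn_ge0 ?(ltW t0)//.
    by rewrite ler_wiXn2l// ?ltW.
  rewrite -mulr_suml ler_wpM2r ?exprn_ge0 ?(ltW t0)//.
  apply: le_trans (absB K); rewrite [leRHS](big_cat_nat (n := N))//= lerDr.
  by apply: sumr_ge0.
have lim : `|s K - s N| @[K --> \oo] --> `|heat_sum t - s N|.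
  by apply: cvg_norm; apply: cvgB; [exact: a_series_cvg|exact: cvg_cst].
suff nB : \forall K \near \oo, `|s K - s N| <= B * t ^+ N by exact: (cvgr_to_le lim nB).
by near=> K; apply: bound; near: K; exact: nbhs_infty_ge.
Unshelve. all: by end_near. Qed.

Lemma sphere_heat_trace kappa : radial_heat_kernel M kappa ->
  is_heat_trace_coefficients M kappa (a_coef R m).
Proof.
move=> rk N; have [C C0 HC] := sphere_kernel_bound rk N; have [B B0 HB] := heat_sum_partial N.
have V0 := sphere_volume_gt0.
apply/eqOP; near=> k; near=> t => /=.
have t0 : 0 < t by near: t; exact: nbhs_right_gt.
have t1 : t <= 1 by near: t; exact: nbhs_right_le.
have t01 : 0 < t <= 1 by rewrite t0.
have pE : t `^ (N%:R - n%:R / 2) = t ^+ N * t `^ (- (n%:R / 2)).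
  have := @powRD R t N%:R (- (n%:R / 2)); rewrite (gt_eqF t0) /= implybT => /(_ isT) ->.
  by rewrite powR_mulrn// ltW.
have p0 : 0 <= t `^ (- (n%:R / 2)) by exact: powR_ge0.
(* An error [O(t^N)] on the kernel is therefore also [O(t^(N - n/2))], the order required of the
   trace. *)
have p1 : 1 <= t `^ (- (n%:R / 2)).
  rewrite powR_half ?(ltW t0)// invf_ge1 ?exprn_gt0 ?sqrtr_gt0// exprn_ile1 ?sqrtr_ge0//.
  by rewrite -sqrtr1 ler_sqrt.
have tN : 0 <= t ^+ N by rewrite exprn_ge0// ltW.
have -> : volume M * kappa t 0 - t `^ (- (n%:R / 2)) * (\sum_(0 <= k0 < N) a_coef R m k0 * t ^+ k0) =
  volume M * (kappa t 0 - sphere_main t) +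
  t `^ (- (n%:R / 2)) * (heat_sum t - \sum_(0 <= k0 < N) a_coef R m k0 * t ^+ k0).
  by rewrite sphere_main_volume//; field; rewrite gt_eqF.
rewrite pE [leRHS](_ : _ = k * (t ^+ N * t `^ (- (n%:R / 2)))); last first.
  by rewrite ger0_norm// mulr_ge0.
apply: (@le_trans _ _ ((volume M * C + B) * (t ^+ N * t `^ (- (n%:R / 2))))); last first.
  rewrite ler_wpM2r ?mulr_ge0//; near: k; apply: nbhs_pinfty_ge; exact: num_real.
rewrite (le_trans (ler_normD _ _))// !normrM (gtr0_norm V0) (ger0_norm p0) mulrDl; apply: lerD.
  rewrite -mulrA ler_pM2l//; apply: (le_trans (HC t t01)).
  by rewrite mulrA ler_peMr// mulr_ge0.
have := HB t t01; set h := `|_| => hB.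
by rewrite mulrA [leLHS]mulrC ler_wpM2r.
Unshelve. all: by end_near. Qed.

End SphereExpansion.

Theorem theorem1p2 (R : realType) (m : nat) (m_gt0 : (0 < m)%N) :
  (forall K : R -> R -> R,
    radial_heat_kernel (hyperbolic_space R (2 * m).+1) K ->
    forall t : R, 0 < t ->
      K t 0 = (4 * pi * t) `^ (- ((2 * m).+1%:R / 2)) * expR (- (m%:R ^+ 2 * t))
              * \sum_(0 <= k < m)
                  Gamma (m%:R - k%:R + 2^-1) * c_coef R m k
                  / Gamma (m%:R + 2^-1) * t ^+ k)
  /\
  (forall kappa : R -> R -> R,
    radial_heat_kernel (sphere R (2 * m).+1) kappa ->
    let main (t : R) :=
      (4 * pi * t) `^ (- ((2 * m).+1%:R / 2)) * expR (m%:R ^+ 2 * t)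
      * \sum_(0 <= k < m)
          (-1) ^+ k * (Gamma (m%:R - k%:R + 2^-1) * c_coef R m k
          / Gamma (m%:R + 2^-1)) * t ^+ k in
    [/\ asymp_eq (kappa ^~ 0) main,
        (forall t : R, 0 < t ->
           cvgn (series (fun k => a_coef R m k * t ^+ k)) /\
           main t = (volume (sphere R (2 * m).+1))^-1
                    * t `^ (- ((2 * m).+1%:R / 2))
                    * limn (series (fun k => a_coef R m k * t ^+ k))) &
        is_heat_trace_coefficients (sphere R (2 * m).+1) kappa (a_coef R m)]).
Proof.
split=> [K rK t t0|kappa rk main]; first exact: hyperbolic_part.
split; first exact: (sphere_asymp m_gt0 rk).
  move=> t t0; have c := @a_series_cvg R m m_gt0 t; split; first by apply/cvg_ex; eexists; exact: c.
  by rewrite (cvg_lim (@Rhausdorff R) c); exact: (sphere_main_volume m_gt0 t0).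
exact: sphere_heat_trace.
Qed.
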